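(* Let $\chi:\mathfrak A\times\mathfrak A\to\mathbb K^\times$ be a bi-homomorphism such that $R^+=R^+(\chi,\pi)$ is finite and $\chi(\beta,\beta)\ne1$ for all $\beta\in R^+$. Let $\lambda\in\mathfrak A^+$ with $m_\lambda:=|\mathfrak P_\lambda|\,(=\dim U^+_\lambda)\ne0$, let $\alpha\in R^+$, $t\in\mathbb N$, $r:=|\mathfrak P_\lambda(\alpha;t)|$, and put $f:=-\hat\rho(\alpha)\chi(\alpha,\alpha)^{-t}K_\alpha+L_\alpha\in U^0$. Let $\hat X:\{1,\dots,m_\lambda\}\to U^+_\lambda$ and $\hat Y:\{1,\dots,m_\lambda\}\to U^-_{-\lambda}$ be maps with $d_{\hat X,\hat Y}:=\det[\vartheta(\hat X(x),\hat Y(y))]_{1\le x,y\le m_\lambda}\ne0$, and let $\mathcal S:=[\mathrm{Sh}(\hat X(x)\hat Y(y))]_{1\le x,y\le m_\lambda}\in\mathrm{Mat}(m_\lambda,U^0)$. Then there exist $h\in U^0\setminus U^0f$ and $P_1,P_2\in\mathrm{Mat}(m_\lambda,U^0)$ with $\det P_1,\det P_2\in U^0\setminus U^0f$ such that $$P_1\mathcal SP_2=h\Bigl(\sum_{x=1}^{m_\lambda-r}E_{x,x}+f\sum_{y=m_\lambda-r+1}^{m_\lambda}E_{y,y}\Bigr),$$ where $E_{x,y}$ denote matrix units.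
   Context: Setting. $\mathbb K$ is an algebraically closed field, $\mathbb K^\times=\mathbb K\setminus\{0\}$; $I$ is a finite nonempty set, $\mathcal V$ is a real vector space of dimension $|I|$, $\pi:I\to\mathcal V$ is a map with $\pi(I)$ an $\mathbb R$-basis of $\mathcal V$; $\mathfrak A=\bigoplus_{i\in I}\mathbb Z\pi(i)$, $\mathfrak A^+=\bigoplus_{i\in I}\mathbb Z_{\ge0}\pi(i)$. A bi-homomorphism is a map $\chi:\mathfrak A\times\mathfrak A\to\mathbb K^\times$ with $\chi(\lambda,\mu+\nu)=\chi(\lambda,\mu)\chi(\lambda,\nu)$ and $\chi(\lambda+\mu,\nu)=\chi(\lambda,\nu)\chi(\mu,\nu)$. For $n\in\mathbb Z_{\ge0}$, $x\in\mathbb K$: $(n)_x=\sum_{r=1}^n x^{r-1}$, $(n)_x!=\prod_{r=1}^n(r)_x$. Generalized quantum group. $U=U(\chi,\pi)$ is the (known to exist and be unique) unital associative $\mathbb K$-algebra such that: (1) $U$ is generated by $K_\lambda,L_\lambda$ ($\lambda\in\mathfrak A$), $E_i,F_i$ ($i\in I$). (2) $K_0=L_0=1$, $K_\lambda K_\mu=K_{\lambda+\mu}$, $L_\lambda L_\mu=L_{\lambda+\mu}$, $K_\lambda L_\mu=L_\mu K_\lambda$, $K_\lambda E_i=\chi(\lambda,\pi(i))E_iK_\lambda$, $L_\lambda E_i=\chi(-\pi(i),\lambda)E_iL_\lambda$, $K_\lambda F_i=\chi(\lambda,-\pi(i))F_iK_\lambda$, $L_\lambda F_i=\chi(\pi(i),\lambda)F_iL_\lambda$,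 $E_iF_j-F_jE_i=\delta_{ij}(-K_{\pi(i)}+L_{\pi(i)})$. (3) There is an algebra homomorphism $\Delta:U\to U\otimes U$ with $\Delta(K_\lambda)=K_\lambda\otimes K_\lambda$, $\Delta(L_\lambda)=L_\lambda\otimes L_\lambda$, $\Delta(E_i)=E_i\otimes1+K_{\pi(i)}\otimes E_i$, $\Delta(F_i)=F_i\otimes L_{\pi(i)}+1\otimes F_i$. (4) Let $U^0$ be the subalgebra generated by all $K_\lambda L_\mu$, $U^+$ (resp. $U^-$) the unital subalgebra generated by the $E_i$ (resp. $F_i$), $U^{+,\flat}=\sum_\lambda U^+K_\lambda$, $U^{-,\flat}=\sum_\lambda U^-L_\lambda$. The $K_\lambda L_\mu$ ($\lambda,\mu\in\mathfrak A$) form a basis of $U^0$; multiplication $U^-\otimes U^0\otimes U^+\to U$ is a linear isomorphism; and there is a bilinear map $\vartheta:U^{+,\flat}\times U^{-,\flat}\to\mathbb K$, non-degenerate on $U^+\times U^-$, with $\vartheta(K_\lambda,L_\mu)=\chi(\lambda,\mu)$, $\vartheta(E_i,F_j)=\delta_{ij}$, $\vartheta(K_\lambda,F_j)=\vartheta(E_i,L_\lambda)=0$, $\vartheta(X_1X_2,Y)=\sum\vartheta(X_1,Y^{(2)})\vartheta(X_2,Y^{(1)})$, $\vartheta(X,Y_1Y_2)=\sum\vartheta(X^{(2)},Y_1)\vartheta(X^{(1)},Y_2)$ (Sweedler notation for $\Delta$). $U=\bigoplus_{\lambda\in\mathfrak A}U_\lambda$ is $\mathfrak A$-graded with $E_i\in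 U_{\pi(i)}$, $F_i\in U_{-\pi(i)}$, $U^0\subset U_0$; $U^\pm_\lambda=U^\pm\cap U_\lambda$; $\dim U^+_\lambda=\dim U^-_{-\lambda}$ for $\lambda\in\mathfrak A^+$. Roots. $R^+(\chi,\pi)$ is the unique subset of $\mathfrak A^+\setminus\{0\}$ for which there is a (unique) map $\varphi:R^+(\chi,\pi)\to\mathbb N$ such that for all $\lambda\in\mathfrak A^+$, $\dim U^+_\lambda$ is the number of functions $g:\{(\beta,k):\beta\in R^+(\chi,\pi),1\le k\le\varphi(\beta)\}\to\mathbb Z_{\ge0}$ with all $(g(\beta,k))_{\chi(\beta,\beta)}!\ne0$ and $\sum g(\beta,k)\beta=\lambda$ (Kharchenko). Further notation. $\mathfrak P_\lambda$ is the set of maps $p:R^+(\chi,\pi)\to\mathbb Z_{\ge0}$ with $(p(\beta))_{\chi(\beta,\beta)}!\ne0$ for all $\beta$ and $\sum_\beta p(\beta)\beta=\lambda$; $\mathfrak P_\lambda(\alpha;t)=\{p\in\mathfrak P_\lambda:p(\alpha)\ge t\}$. When $R^+(\chi,\pi)$ is finite, $|\mathfrak P_\lambda|=\dim U^+_\lambda$. $\hat\rho:\mathfrak A\to\mathbb K^\times$ is the group homomorphism with $\hat\rho(\pi(j))=\chi(\pi(j),\pi(j))$. $\mathrm{Sh}:U\to U^0$ is the linear map that is the identity on $U^0$ and zero on $U^-_{-\mu}U^0U^+_\lambda$ for $\lambda,\mu\in\mathfrak A^+$, $(\lambda,\mu)\ne(0,0)$.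
   Formalization: Second pairing rule corrected to ϑ(X,Y₁Y₂)=Σϑ(X⁽¹⁾,Y₁)ϑ(X⁽²⁾,Y₂) (the printed one forces χ(π(i),·)²=1); t≥1 is assumed to be the only s≥1 with 𝔓_λ(α;s) nonempty and χ(α,α)^s=χ(α,α)^t, if any (else false, e.g. rank one, q of order N, λ=α, t=N+1). *)

(* Defs.v *)
From HB Require Import structures.
From mathcomp Require Import all_boot all_order all_algebra.
From mathcomp Require Import boolp classical_sets functions cardinality fsbigop.
From mathcomp Require Import reals.

Set Implicit Arguments.
Unset Strict Implicit.
Unset Printing Implicit Defensive.
Import Order.TTheory GRing.Theory Num.Theory.

Local Open Scope classical_set_scope.
Local Open Scope card_scope.
Local Open Scope ring_scope.

(** * The lattice spanned by [pi] *)

Section RootLattice.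
Variables (R : realType) (V : vectType R) (I : finType) (pi : I -> V).

Definition int_span : {pred V} :=
  [pred v | `[< exists n : I -> int, v = \sum_i pi i *~ n i >]].

Lemma int_span_zmod : zmod_closed int_span.
Proof.
split=> [|x y].
  apply/asboolP; exists (fun=> 0).
  by rewrite big1 // => i _; rewrite mulr0z.
move=> /asboolP[n ->] /asboolP[k ->]; apply/asboolP.
exists (fun i => n i - k i); rewrite -sumrB.
by apply: eq_bigr => i _; rewrite mulrzBr.
Qed.

HB.instance Definition _ := GRing.isZmodClosed.Build V int_span int_span_zmod.

Record rootLattice := RootLattice {
  lattice_val :> V;
  _ : lattice_val \in int_span }.

HB.instance Definition _ := [isSub for lattice_val].
HB.instance Definition _ := [Choice of rootLattice by <:].
HB.instance Definition _ := [SubChoice_isSubZmodule of rootLattice by <:].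

Lemma int_span_gen i : pi i \in int_span.
Proof.
apply/asboolP; exists (fun j => (j == i)%:Z).
rewrite (bigD1 i) //= eqxx mulr1z big1 ?addr0 // => j /negPf ->.
by rewrite mulr0z.
Qed.

Definition sroot (i : I) : rootLattice := RootLattice (int_span_gen i).

End RootLattice.

(** The lattice is an abstract [A : zmodType] from here on, with [pi : I -> A]
    giving the simple roots. *)

Definition nonneg (I : finType) (A : zmodType) (pi : I -> A) : set A :=
  [set lam | exists n : I -> nat, lam = \sum_i pi i *+ n i].

Definition bihom (K : fieldType) (A : zmodType) (chi : A -> A -> K) : Prop :=
  [/\ forall a b, chi a b != 0,
      forall a b c, chi a (b + c) = chi a b * chi a c &
      forall a b c, chi (a + b) c = chi a c * chi b c].

Definition qnum (K : fieldType) (x : K) (n : nat) : K :=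
  \sum_(1 <= r < n.+1) x ^+ r.-1.

Definition qfact (K : fieldType) (x : K) (n : nat) : K :=
  \prod_(1 <= r < n.+1) qnum x r.

(** * Linear algebra in possibly infinite-dimensional spaces *)

Section LinearAlgebra.
Variable K : fieldType.

Definition subspace (M : lmodType K) (S : set M) : Prop :=
  S 0 /\ forall (c : K) x y, S x -> S y -> S (c *: x + y).

Definition lspan (M : lmodType K) (S : set M) : set M := smallest (@subspace M) S.

Definition basis_for (M : lmodType K) (J : choiceType) (S : set M)
    (e : J -> M) : Prop :=
  [/\ S = lspan (range e) &
      forall (s : seq J) (c : J -> K), uniq s ->
        \sum_(j <- s) c j *: e j = 0 -> forall j, j \in s -> c j = 0].

Definition has_dim (M : lmodType K) (S : set M) (n : nat) : Prop :=
  exists e : 'I_n -> M, basis_for S e.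

Definition linear_on (M W : lmodType K) (S : set M) (g : M -> W) : Prop :=
  forall (c : K) x y, S x -> S y -> g (c *: x + y) = c *: g x + g y.

Definition bilinear_on (M N W : lmodType K) (S : set M) (T : set N)
    (b : M -> N -> W) : Prop :=
  (forall y, T y -> linear_on S (b^~ y)) /\ (forall x, S x -> linear_on T (b x)).

Definition trilinear_on (M W : lmodType K) (S T Q : set M)
    (b : M -> M -> M -> W) : Prop :=
  [/\ forall y z, T y -> Q z -> linear_on S (fun x => b x y z),
      forall x z, S x -> Q z -> linear_on T (fun y => b x y z) &
      forall x y, S x -> T y -> linear_on Q (b x y)].

(** [M (x) N] is [T], with [t x y] in the role of [x (x) y]. *)
Definition is_tensor2 (M N T : lmodType K) (t : M -> N -> T) : Prop :=
  bilinear_on setT setT t /\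
  forall (W : lmodType K) (b : M -> N -> W), bilinear_on setT setT b ->
    exists g : {linear T -> W},
      (forall x y, g (t x y) = b x y) /\
      forall g' : {linear T -> W}, (forall x y, g' (t x y) = b x y) -> g' =1 g.

(** The linear map [S (x) T (x) Q -> P] induced by the trilinear map [t] is an
    isomorphism, i.e. [P] has the universal property of this tensor product of
    subspaces. *)
Definition is_tensor3 (M P : lmodType K) (S T Q : set M)
    (t : M -> M -> M -> P) : Prop :=
  trilinear_on S T Q t /\
  forall (W : lmodType K) (b : M -> M -> M -> W), trilinear_on S T Q b ->
    exists g : {linear P -> W},
      (forall x y z, S x -> T y -> Q z -> g (t x y z) = b x y z) /\
      forall g' : {linear P -> W},
        (forall x y z, S x -> T y -> Q z -> g' (t x y z) = b x y z) -> g' =1 g.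

Definition subalgebra (U : algType K) (S : set U) : Prop :=
  [/\ subspace S, S 1 & forall x y, S x -> S y -> S (x * y)].

Definition subalg (U : algType K) (S : set U) : set U :=
  smallest (@subalgebra U) S.

Definition is_grading (A : zmodType) (U : algType K) (gr : A -> set U) : Prop :=
  [/\ forall a, subspace (gr a),
      forall a b x y, gr a x -> gr b y -> gr (a + b) (x * y),
      forall u, exists (s : seq A) (c : A -> U),
        [/\ uniq s, forall a, gr a (c a) & u = \sum_(a <- s) c a] &
      forall (s : seq A) (c : A -> U), uniq s -> (forall a, gr a (c a)) ->
        \sum_(a <- s) c a = 0 -> forall a, a \in s -> c a = 0].

End LinearAlgebra.

(** * Generalized quantum groups *)

Record gqgData (K : fieldType) (I : finType) (A : zmodType) := GqgData {
  gqg_alg :> algType K;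
  qK : A -> gqg_alg;
  qL : A -> gqg_alg;
  qE : I -> gqg_alg;
  qF : I -> gqg_alg;
  gqg_tens : algType K;
  tens : gqg_alg -> gqg_alg -> gqg_tens;
  Delta : {lrmorphism gqg_alg -> gqg_tens};
  theta : gqg_alg -> gqg_alg -> K; (* meaningful on [Upflat] x [Umflat] only *)
  gr : A -> set gqg_alg }.

Arguments qK {K I A}.
Arguments qL {K I A}.
Arguments qE {K I A}.
Arguments qF {K I A}.
Arguments tens {K I A}.
Arguments Delta {K I A}.
Arguments theta {K I A}.
Arguments gr {K I A}.

Section Gqg.
Variables (K : fieldType) (I : finType) (A : zmodType) (pi : I -> A).
Variables (chi : A -> A -> K) (U : gqgData K I A).

Definition U0 : set U := subalg [set u | exists a b, u = qK U a * qL U b].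
Definition Up : set U := subalg (range (qE U)).
Definition Um : set U := subalg (range (qF U)).
Definition Upflat : set U :=
  lspan [set u | exists x a, Up x /\ u = x * qK U a].
Definition Umflat : set U :=
  lspan [set u | exists y a, Um y /\ u = y * qL U a].
Definition Upgr (a : A) : set U := Up `&` gr U a.
Definition Umgr (a : A) : set U := Um `&` gr U a.

Definition gqg_generated : Prop :=
  subalg (range (qK U) `|` range (qL U) `|` range (qE U) `|` range (qF U))
  = setT.

Definition gqg_cartan_rels : Prop :=
  [/\ qK U 0 = 1, qL U 0 = 1,
      forall a b, qK U a * qK U b = qK U (a + b),
      forall a b, qL U a * qL U b = qL U (a + b) &
      forall a b, qK U a * qL U b = qL U b * qK U a].

Definition gqg_root_rels : Prop :=
  [/\ forall a i, qK U a * qE U i = chi a (pi i) *: (qE U i * qK U a),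
      forall a i, qL U a * qE U i = chi (- pi i) a *: (qE U i * qL U a),
      forall a i, qK U a * qF U i = chi a (- pi i) *: (qF U i * qK U a),
      forall a i, qL U a * qF U i = chi (pi i) a *: (qF U i * qL U a) &
      forall i j, qE U i * qF U j - qF U j * qE U i
                  = (- qK U (pi i) + qL U (pi i)) *+ (i == j)].

Definition gqg_tensor_algebra : Prop :=
  [/\ is_tensor2 (tens U),
      tens U 1 1 = 1 &
      forall x y x' y', tens U x y * tens U x' y' = tens U (x * x') (y * y')].

Definition gqg_coproduct : Prop :=
  [/\ forall a, Delta U (qK U a) = tens U (qK U a) (qK U a),
      forall a, Delta U (qL U a) = tens U (qL U a) (qL U a),
      forall i, Delta U (qE U i)
                = tens U (qE U i) 1 + tens U (qK U (pi i)) (qE U i) &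
      forall i, Delta U (qF U i)
                = tens U (qF U i) (qL U (pi i)) + tens U 1 (qF U i)].

Definition gqg_triangular : Prop :=
  basis_for U0 (fun ab : A * A => qK U ab.1 * qL U ab.2) /\
  is_tensor3 Um U0 Up (fun y z x => (y * z * x : U)).

Definition gqg_pairing_gen : Prop :=
  [/\ @bilinear_on K U U K^o Upflat Umflat (theta U),
      forall a b, theta U (qK U a) (qL U b) = chi a b,
      forall i j, theta U (qE U i) (qF U j) = (i == j)%:R,
      forall a j, theta U (qK U a) (qF U j) = 0 &
      forall i a, theta U (qE U i) (qL U a) = 0].

Definition gqg_pairing_nondeg : Prop :=
  (forall x, Up x -> (forall y, Um y -> theta U x y = 0) -> x = 0) /\
  (forall y, Um y -> (forall x, Up x -> theta U x y = 0) -> y = 0).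

(** Sweedler sums range over the expressions of the coproduct as a sum of pure
    tensors of elements of the domain of [theta].  Only the first rule reverses
    the order of the tensor factors: reversing it in the second one as well
    yields [theta E_i (L_a F_i) = 1] and [theta E_i (F_i L_a) = chi (pi i) a],
    so that [L_a F_i = chi (pi i) a *: F_i L_a] forces [chi (pi i) a ^+ 2 = 1]. *)
Definition gqg_pairing_coprod : Prop :=
  (forall (x1 x2 y : U) (n : nat) (y1 y2 : 'I_n -> U),
     Upflat x1 -> Upflat x2 -> Umflat y ->
     (forall k, Umflat (y1 k)) -> (forall k, Umflat (y2 k)) ->
     Delta U y = \sum_k tens U (y1 k) (y2 k) ->
     theta U (x1 * x2) y = \sum_k theta U x1 (y2 k) * theta U x2 (y1 k)) /\
  (forall (x y1 y2 : U) (n : nat) (x1 x2 : 'I_n -> U),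
     Upflat x -> Umflat y1 -> Umflat y2 ->
     (forall k, Upflat (x1 k)) -> (forall k, Upflat (x2 k)) ->
     Delta U x = \sum_k tens U (x1 k) (x2 k) ->
     theta U x (y1 * y2) = \sum_k theta U (x1 k) y1 * theta U (x2 k) y2).

Definition gqg_graded : Prop :=
  [/\ is_grading (gr U),
      forall i, gr U (pi i) (qE U i),
      forall i, gr U (- pi i) (qF U i) &
      U0 `<=` gr U 0].

Record is_gqg : Prop := IsGqg {
  gqgP_generated : gqg_generated;
  gqgP_cartan : gqg_cartan_rels;
  gqgP_root : gqg_root_rels;
  gqgP_tensor : gqg_tensor_algebra;
  gqgP_coproduct : gqg_coproduct;
  gqgP_triangular : gqg_triangular;
  gqgP_pairing_gen : gqg_pairing_gen;
  gqgP_pairing_nondeg : gqg_pairing_nondeg;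
  gqgP_pairing_coprod : gqg_pairing_coprod;
  gqgP_graded : gqg_graded }.

Definition root_index (Rp : set A) (phi : A -> nat) : set (A * nat) :=
  [set bk | Rp bk.1 /\ (1 <= bk.2 <= phi bk.1)%N].

(** Functions on an index set are functions on the ambient type that vanish
    outside it.  Finiteness of the support is explicit because [fsbigop] sums
    with infinite support are [0] by convention. *)
Definition kostant_functions (Rp : set A) (phi : A -> nat) (lam : A) :
    set (A * nat -> nat) :=
  [set g | [/\ forall bk, ~ root_index Rp phi bk -> g bk = 0%N,
               finite_set [set bk | g bk != 0%N],
               forall bk, root_index Rp phi bk ->
                 qfact (chi bk.1 bk.1) (g bk) != 0 &
               \sum_(bk \in root_index Rp phi) bk.1 *+ g bk = lam]].

Definition is_posroots (Rp : set A) : Prop :=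
  (forall b, Rp b -> nonneg pi b /\ b != 0) /\
  exists phi : A -> nat,
    (forall b, Rp b -> (0 < phi b)%N) /\
    (forall lam, nonneg pi lam ->
       exists n : nat,
         has_dim (Upgr lam) n /\ kostant_functions Rp phi lam #= `I_n).

Definition PP (Rp : set A) (lam : A) : set (A -> nat) :=
  [set p | [/\ forall b, ~ Rp b -> p b = 0%N,
               finite_set [set b | p b != 0%N],
               forall b, Rp b -> qfact (chi b b) (p b) != 0 &
               \sum_(b \in Rp) b *+ p b = lam]].

Definition PPge (Rp : set A) (lam alpha : A) (t : nat) : set (A -> nat) :=
  PP Rp lam `&` [set p | (t <= p alpha)%N].

(** [t] is the only exponent [s] occurring at [alpha] in [PP Rp lam] that yields
    the same element [- rho alpha * chi alpha alpha ^- s K_alpha + L_alpha].  It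
    holds whenever [qfact (chi alpha alpha) t != 0] (as [chi alpha alpha != 1]),
    so also for all [t] if [chi alpha alpha] is not a root of unity.  When it
    fails, [t] exceeds the order of [chi alpha alpha], so [PPge Rp lam alpha t]
    is empty, whereas the Shapovalov matrix is singular modulo this element:
    e.g. for [I = {i}], [chi (pi i) (pi i)] of order [N], [lam = pi i] and
    [t = N + 1], the element is [- K + L = Sh (E_i * F_i)]. *)
Definition exponent_separated (Rp : set A) (lam alpha : A) (t : nat) : Prop :=
  forall s : nat, (0 < s)%N -> PPge Rp lam alpha s !=set0 ->
    chi alpha alpha ^+ s = chi alpha alpha ^+ t -> s = t.

Definition is_rhohat (rho : A -> K) : Prop :=
  [/\ forall a, rho a != 0,
      forall a b, rho (a + b) = rho a * rho b &
      forall j, rho (pi j) = chi (pi j) (pi j)].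

Definition is_Sh (Sh : {linear U -> U}) : Prop :=
  [/\ forall u, U0 (Sh u),
      forall u, U0 u -> Sh u = u &
      forall lam mu y z x, nonneg pi lam -> nonneg pi mu ->
        (lam, mu) != (0, 0) ->
        Umgr (- mu) y -> U0 z -> Upgr lam x -> Sh (y * z * x) = 0].

Definition U0_outside (f : U) : set U :=
  [set u | U0 u /\ ~ exists2 z, U0 z & u = z * f].

Definition U0_mx (m : nat) (P : 'M[U]_m) : Prop := forall x y, U0 (P x y).

End Gqg.

Arguments U0 {K I A}.
Arguments Up {K I A}.
Arguments Um {K I A}.
Arguments Upgr {K I A}.
Arguments Umgr {K I A}.

(* Main.v *)
From HB Require Import structures.
From mathcomp Require Import all_boot all_order all_algebra.
From mathcomp Require finmap.
From mathcomp Require Import boolp classical_sets functions cardinality fsbigop.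
From mathcomp Require Import reals ring zify.
Require Import Defs.

(** Fix [lam].  Reflecting the triangular decomposition at simple roots makes every
    root [b] simple for some other Borel subalgebra, where powers of a generator are
    singular vectors; transporting them back yields, for every character on the
    hyperplane [L_b = rho b * chi b b ^- s * K_b], a nonzero singular vector of degree
    [s b] in the Verma module.  It generates a submodule in the radical of the
    Shapovalov form, so by induction on the height the form of degree [lam] has corank
    at least #{p | p b >= s} there, and its determinant is divisible by the
    corresponding power of [L_b - c K_b].  Along the one-parameter family of characters
    (1, T^height) the determinant is a polynomial in T of degree at most
    [m * height lam] with nonzero constant term, which is exactly the degree of the
    product of these factors: the coranks and exponents are therefore exact.  A Schur
    complement at a generic point of the hyperplane gives the diagonal form. *)

Set Implicit Arguments.
Unset Strict Implicit.
Unset Printing Implicit Defensive.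
Import Order.TTheory GRing.Theory Num.Theory.
Local Open Scope ring_scope.

(** Reflections act only on the generators: the algebra, [chi] and the torus stay fixed, and what
    passes through a reflection is a list of properties ([borel]) together with a Hilbert series
    ([hil]). The pairing is not carried along; its trace is that an element of nonzero degree of one
    half commuting with the generators of the other half is zero. A singular vector is carried back
    only for characters in general position: when q = chi(i,i) has finite order h because F_i^h = 0,
    and otherwise because F_i^s v can be made singular for large s. The rest of the hyperplane is
    reached along a curve inside it, since a linear system with nontrivial solutions off every
    finite set of parameters has them everywhere. Two facts make the count exact. Reflections show
    that every root takes the value 1 under some integral functional, so that L_b - c K_b behaves as
    a prime element; and each p in P_lam satisfies sum p(b) height(b) = height(lam), so that the
    predicted factors use up the whole degree. The constant term at T = 0 involves only one of the
    two skew derivatives, and its nonvanishing is the nondegeneracy of that one alone. *)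

(** * Normal forms of noncommutative polynomials *)

Section NonCommutativePolynomials.
Variables (K : fieldType) (U : algType K).

Inductive ncexp :=
| NcAtom of nat | NcZero | NcOne | NcAdd of ncexp & ncexp | NcOpp of ncexp
| NcScale of K & ncexp | NcMul of ncexp & ncexp.

Fixpoint nc_eval (env : seq U) (e : ncexp) : U :=
  match e with
  | NcAtom n => nth 0 env n
  | NcZero => 0
  | NcOne => 1
  | NcAdd a b => nc_eval env a + nc_eval env b
  | NcOpp a => - nc_eval env a
  | NcScale c a => c *: nc_eval env a
  | NcMul a b => nc_eval env a * nc_eval env b
  end.

Definition nc_word (env : seq U) (w : seq nat) : U :=
  foldr (fun n x => nth 0 env n * x) 1 w.

Definition nc_sum (env : seq U) (l : seq (K * seq nat)) : U :=
  foldr (fun p x => p.1 *: nc_word env p.2 + x) 0 l.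

Fixpoint nc_norm (e : ncexp) : seq (K * seq nat) :=
  match e with
  | NcAtom n => [:: (1, [:: n])]
  | NcZero => [::]
  | NcOne => [:: (1, [::])]
  | NcAdd a b => cat (nc_norm a) (nc_norm b)
  | NcOpp a => map (fun p => (- p.1, p.2)) (nc_norm a)
  | NcScale c a => map (fun p => (c * p.1, p.2)) (nc_norm a)
  | NcMul a b =>
      foldr (fun p l => cat (map (fun r => (p.1 * r.1, cat p.2 r.2)) (nc_norm b)) l)
        [::] (nc_norm a)
  end.

Fixpoint nc_weq (u v : seq nat) : bool :=
  match u, v with
  | [::], [::] => true
  | a :: u', b :: v' => if eqn a b then nc_weq u' v' else false
  | _, _ => false
  end.

Fixpoint nc_insert (p : K * seq nat) (l : seq (K * seq nat)) :=
  match l with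
  | [::] => [:: p]
  | r :: l' => if nc_weq p.2 r.2 then (p.1 + r.1, r.2) :: l' else r :: nc_insert p l'
  end.

Definition nc_collect (l : seq (K * seq nat)) := foldr nc_insert [::] l.

(** A proposition, not a test: equality of scalars is not decided here but becomes one goal per
    word, left to [ring] or [field]. *)
Fixpoint nc_null (l : seq (K * seq nat)) : Prop :=
  match l with
  | [::] => True
  | p :: l' => p.1 = 0 /\ nc_null l'
  end.

Lemma nc_sum_cat env l1 l2 : nc_sum env (cat l1 l2) = nc_sum env l1 + nc_sum env l2.
Proof. by elim: l1 => [|p l1 IH] /=; rewrite ?add0r // IH addrA. Qed.

Lemma nc_word_cat env u v : nc_word env (cat u v) = nc_word env u * nc_word env v.
Proof. by elim: u => [|p u IH] /=; rewrite ?mul1r // IH mulrA. Qed.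

Lemma nc_norm_correct env e : nc_eval env e = nc_sum env (nc_norm e).
Proof.
elim: e => [n|||a IHa b IHb|a IHa|c a IHa|a IHa b IHb] //=.
- by rewrite mulr1 scale1r addr0.
- by rewrite scale1r addr0.
- by rewrite IHa IHb nc_sum_cat.
- rewrite IHa; elim: (nc_norm a) => [|p l IH] /=; first by rewrite oppr0.
  by rewrite opprD IH scaleNr.
- rewrite IHa; elim: (nc_norm a) => [|p l IH] /=; first by rewrite scaler0.
  by rewrite scalerDr IH scalerA.
rewrite IHa IHb; elim: (nc_norm a) => [|p l IH] /=; first by rewrite mul0r.
rewrite mulrDl IH nc_sum_cat; congr (_ + _).
elim: (nc_norm b) => [|r k IHk] /=; first by rewrite mulr0.
by rewrite mulrDr IHk nc_word_cat -scalerAl -scalerAr scalerA.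
Qed.

Lemma nc_weqP u v : nc_weq u v -> u = v.
Proof.
elim: u v => [|a u IH] [|b v] //=.
by case: eqnP => // -> /IH ->.
Qed.

Lemma nc_collect_correct env l : nc_sum env (nc_collect l) = nc_sum env l.
Proof.
elim: l => [|p l IH] //=; rewrite -IH; elim: (nc_collect l) => [|r k IHk] //=.
case: ifP => [/nc_weqP e|_] /=; last by rewrite IHk addrCA.
by rewrite -e scalerDl addrA.
Qed.

Lemma nc_eqP env e1 e2 :
  nc_null (nc_collect (nc_norm (NcAdd e1 (NcOpp e2)))) ->
  nc_eval env e1 = nc_eval env e2.
Proof.
move=> h; apply: subr0_eq; rewrite -[LHS]/(nc_eval env (NcAdd e1 (NcOpp e2))).
rewrite nc_norm_correct -nc_collect_correct.
by elim: (nc_collect _) h => [|p l IH] //= [-> /IH ->]; rewrite scale0r addr0.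
Qed.

End NonCommutativePolynomials.

Ltac nc_mem x env :=
  match env with
  | nil => constr:(false)
  | cons x _ => constr:(true)
  | cons _ ?l => nc_mem x l
  end.
Ltac nc_idx x env :=
  match env with
  | cons x _ => constr:(O)
  | cons _ ?l => let n := nc_idx x l in constr:(S n)
  end.
Ltac nc_atoms e env :=
  lazymatch e with
  | GRing.add ?a ?b => let env' := nc_atoms a env in nc_atoms b env'
  | GRing.mul ?a ?b => let env' := nc_atoms a env in nc_atoms b env'
  | GRing.opp ?a => nc_atoms a env
  | GRing.scale _ ?a => nc_atoms a env
  | 0%R => env
  | 1%R => env
  | _ => let b := nc_mem e env in
         lazymatch b with true => env | false => constr:(cons e env) end
  end.
Ltac nc_reify K e env :=
  lazymatch e with
  | GRing.add ?a ?b =>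
      let x := nc_reify K a env in let y := nc_reify K b env in constr:(@NcAdd K x y)
  | GRing.mul ?a ?b =>
      let x := nc_reify K a env in let y := nc_reify K b env in constr:(@NcMul K x y)
  | GRing.opp ?a => let x := nc_reify K a env in constr:(@NcOpp K x)
  | GRing.scale ?c ?a => let x := nc_reify K a env in constr:(@NcScale K c x)
  | 0%R => constr:(@NcZero K)
  | 1%R => constr:(@NcOne K)
  | _ => let n := nc_idx e env in constr:(@NcAtom K n)
  end.
(* Reduces an identity between noncommutative polynomial expressions of an
   algebra to the identities between the coefficients of its words. *)
Ltac nc_simp K U :=
  lazymatch goal with
  | |- ?l = ?r =>
      let env0 := nc_atoms l (@nil U) in let env := nc_atoms r env0 in
      let a := nc_reify K l env in let b := nc_reify K r env in
      change (@nc_eval K U env a = @nc_eval K U env b);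
      apply: nc_eqP;
      cbv [nc_collect nc_norm nc_null nc_insert nc_weq foldr map cat fst snd eqn];
      repeat split
  end.

(** For scalar identities that hold only modulo a relation such as (q - 1)(n)_q = q^n - 1: [z] is
    the multiplier of the relation, and the remaining premise is an identity of rational
    functions. *)
Lemma lin_comb1 (R : pzRingType) (z u v a b : R) :
  u = v -> a - b = z * (u - v) -> a = b.
Proof. by move=> ->; rewrite subrr mulr0 => /subr0_eq. Qed.

(** * Quantum integers and their factorials *)

Section QuantumIntegers.
Variables (K : fieldType) (q : K).

Lemma qnum0 : qnum q 0 = 0.
Proof. by rewrite /qnum big_nil. Qed.

Lemma qnumS n : qnum q n.+1 = qnum q n + q ^+ n.
Proof. by rewrite /qnum big_nat_recr. Qed.

Lemma qnumSl n : qnum q n.+1 = 1 + q * qnum q n.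
Proof.
elim: n => [|n IH]; first by rewrite qnumS qnum0 mulr0 expr0 addrC.
by rewrite qnumS {1}IH qnumS mulrDr exprS addrA.
Qed.

Lemma qnum1 : qnum q 1 = 1.
Proof. by rewrite qnumS qnum0 add0r. Qed.

Lemma qnum_sub1 n : (q - 1) * qnum q n = q ^+ n - 1.
Proof.
elim: n => [|n IH]; first by rewrite qnum0 mulr0 subrr.
by rewrite qnumS mulrDr IH exprS; ring.
Qed.

Lemma qfactS n : qfact q n.+1 = qfact q n * qnum q n.+1.
Proof. by rewrite /qfact big_nat_recr. Qed.

Lemma qfact0 : qfact q 0 = 1.
Proof. by rewrite /qfact big_nil. Qed.

Lemma qfact_le n k : (k <= n)%N -> qfact q n != 0 -> qfact q k != 0.
Proof.
elim: n => [|n IH]; first by rewrite leqn0 => /eqP ->.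
by rewrite leq_eqVlt => /orP[/eqP -> //|/IH h]; rewrite qfactS mulf_eq0 negb_or => /andP[/h].
Qed.

Lemma qnum_neq0 n k : qfact q n != 0 -> (0 < k <= n)%N -> qnum q k != 0.
Proof.
case: k => // k nz /andP[_ /qfact_le/(_ nz)].
by rewrite qfactS mulf_eq0 negb_or => /andP[].
Qed.

End QuantumIntegers.

(** * Subalgebras spanned by homogeneous words *)

Section GradedSubalgebras.
Variables (K : fieldType) (A : zmodType) (U : algType K).

(* [Gen dg g a x]: [x] is a linear combination of words of total degree [a] in
   the letters [g j] of degree [dg j]. *)
Inductive Gen (J : Type) (dg : J -> A) (g : J -> U) : A -> U -> Prop :=
| Gen1 : Gen dg g 0 1
| Gen0 a : Gen dg g a 0
| GenM j a x : Gen dg g a x -> Gen dg g (dg j + a) (g j * x)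
| GenD a c x y : Gen dg g a x -> Gen dg g a y -> Gen dg g a (c *: x + y).

Section Theory.
Variables (J : Type) (dg : J -> A) (g : J -> U).
Local Notation G := (Gen dg g).

Lemma Gen_eq a b x : G a x -> a = b -> G b x.
Proof. by move=> h <-. Qed.

Lemma GenA a x y : G a x -> G a y -> G a (x + y).
Proof. by move=> hx hy; rewrite -[x]scale1r; apply: GenD. Qed.

Lemma GenZ a c x : G a x -> G a (c *: x).
Proof. by move=> hx; rewrite -[_ *: _]addr0; apply: GenD => //; apply: Gen0. Qed.

Lemma GenN a x : G a x -> G a (- x).
Proof. by rewrite -scaleN1r; apply: GenZ. Qed.

Lemma GenB a x y : G a x -> G a y -> G a (x - y).
Proof. by move=> hx hy; apply/GenA/GenN. Qed.

Lemma Gen_sum (T : Type) (r : seq T) (P : pred T) a (f : T -> U) :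
  (forall s, P s -> G a (f s)) -> G a (\sum_(s <- r | P s) f s).
Proof. by move=> h; apply: big_ind => //; [apply: Gen0|move=> *; apply: GenA]. Qed.

Lemma Gen_gen j : G (dg j) (g j).
Proof. by rewrite -[dg j]addr0 -[g j]mulr1; apply/GenM/Gen1. Qed.

Lemma Gen_mul a b x y : G a x -> G b y -> G (a + b) (x * y).
Proof.
move=> hx hy; elim: hx => [|c|j c z _ IH|c e z w _ IHz _ IHw].
- by rewrite add0r mul1r.
- by rewrite mul0r; apply: Gen0.
- by rewrite -mulrA -addrA; apply: GenM.
- by rewrite mulrDl -scalerAl; apply: GenD.
Qed.

Lemma Gen_exp a x n : G a x -> G (a *+ n) (x ^+ n).
Proof.
move=> hx; elim: n => [|n IH]; first by rewrite mulr0n; apply: Gen1.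
by rewrite mulrS exprS; apply: Gen_mul.
Qed.

(** The constructor [GenM] prepends letters; to append them, the induction carries an arbitrary
    prefix [z] for which the property is known, and moves letters from [x] to its end. *)
Lemma Gen_rind (Q : A -> U -> Prop) :
  Q 0 1 -> (forall a, Q a 0) ->
  (forall j a x, G a x -> Q a x -> Q (a + dg j) (x * g j)) ->
  (forall a c x y, G a x -> G a y -> Q a x -> Q a y -> Q a (c *: x + y)) ->
  forall a x, G a x -> Q a x.
Proof.
move=> q1 q0 qM qD a x hx.
suff: forall b z, G b z -> Q b z -> Q (b + a) (z * x).
  by move=> /(_ 0 1 (Gen1 _ _) q1); rewrite add0r mul1r.
elim: hx => [|c|j c y hy IH|c e y w hy IHy hw IHw] b z hz qz.
- by rewrite addr0 mulr1.
- by rewrite mulr0.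
- rewrite mulrA addrA; apply: IH; last exact: qM.
  by apply: Gen_mul => //; apply: Gen_gen.
- rewrite mulrDr -scalerAr; apply: qD; try exact: Gen_mul; [exact: IHy|exact: IHw].
Qed.

End Theory.

Lemma Gen_sub (J J' : Type) dg (g : J -> U) dg' (g' : J' -> U) a x :
  (forall j, Gen dg' g' (dg j) (g j)) -> Gen dg g a x -> Gen dg' g' a x.
Proof.
move=> h; elim=> [|c|j c y _ IH|c e y w _ IHy _ IHw]; [exact: Gen1|exact: Gen0| |exact: GenD].
exact: Gen_mul.
Qed.

End GradedSubalgebras.

(** * Pairs of opposite Borel subalgebras *)

Section HalfBorel.
Variables (K : fieldType) (A : zmodType) (U : algType K) (I : finType).

(** [F i] is given degree [pi i], so that [Gen pi F mu] is the part of degree -mu of the negative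
    half. The last four axioms are what is kept of the triangular decomposition and of the pairing:
    they follow from both for the original generators, and they can be proved again for reflected
    ones without an adapted coproduct or pairing. *)
Record pborel (chi : A -> A -> K) (qk ql : A -> U) (pi : I -> A)
    (crd : I -> A -> int) (E F : I -> U) : Prop := PBorel {
  h_chi : bihom chi;
  h_crdD : forall i a b, crd i (a + b) = crd i a + crd i b;
  h_crdpi : forall i j, crd i (pi j) = (i == j)%:Z;
  h_crdE : forall a, a = \sum_i pi i *~ crd i a;
  h_one : (1 : U) != 0;
  h_K0 : qk 0 = 1;
  h_L0 : ql 0 = 1;
  h_KK : forall a b, qk a * qk b = qk (a + b);
  h_LL : forall a b, ql a * ql b = ql (a + b);
  h_KL : forall a b, qk a * ql b = ql b * qk a;
  h_KE : forall a i, qk a * E i = chi a (pi i) *: (E i * qk a);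
  h_LE : forall a i, ql a * E i = (chi (pi i) a)^-1 *: (E i * ql a);
  h_KF : forall a i, qk a * F i = (chi a (pi i))^-1 *: (F i * qk a);
  h_LF : forall a i, ql a * F i = chi (pi i) a *: (F i * ql a);
  h_EF : forall i j, E i * F j = F j * E i + (ql (pi i) - qk (pi i)) *+ (i == j);
  h_indF : forall j mu y1 y2, Gen pi F mu y1 -> Gen pi F mu y2 ->
    y1 * qk (pi j) + y2 * ql (pi j) = 0 -> y1 = 0 /\ y2 = 0;
  h_indE : forall j mu y1 y2, Gen pi E mu y1 -> Gen pi E mu y2 ->
    y1 * qk (pi j) + y2 * ql (pi j) = 0 -> y1 = 0 /\ y2 = 0;
  h_ndF : forall mu y, Gen pi F mu y -> mu != 0 ->
    (forall j, E j * y = y * E j) -> y = 0;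
  h_ndE : forall mu y, Gen pi E mu y -> mu != 0 ->
    (forall j, F j * y = y * F j) -> y = 0 }.

(* The algebra is unchanged; this symmetry halves the work below. *)
Lemma pborel_swap chi qk ql pi crd E F :
  pborel chi qk ql pi crd E F -> pborel (fun a b => chi b a) ql qk pi crd F E.
Proof.
case=> -[c0 cr cl] cD cp cE o1 k0 l0 kk ll kl ke le kf lf ef iF iE nF nE.
split=> //.
- move=> i j; rewrite ef eq_sym; case: eqVneq => [->|_]; rewrite ?mulr0n ?addr0 // !mulr1n.
  by nc_simp K U; ring.
- by move=> j mu y1 y2 h1 h2 h; have [] := iE j mu y2 y1 h2 h1 _; rewrite 1?addrC.
- by move=> j mu y1 y2 h1 h2 h; have [] := iF j mu y2 y1 h2 h1 _; rewrite 1?addrC.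
Qed.

End HalfBorel.

(** * Skew derivatives of the negative half *)

Section HalfTheory.
Variables (K : fieldType) (A : zmodType) (U : algType K) (I : finType).
Variables (chi : A -> A -> K) (qk ql : A -> U) (pi : I -> A).
Variables (crd : I -> A -> int) (E F : I -> U).
Hypothesis H : pborel chi qk ql pi crd E F.
Local Notation Nm := (Gen pi F).

Lemma chi_nz a b : chi a b != 0.
Proof. by case: (h_chi H). Qed.
Lemma chiDr a b c : chi a (b + c) = chi a b * chi a c.
Proof. by case: (h_chi H). Qed.
Lemma chiDl a b c : chi (a + b) c = chi a c * chi b c.
Proof. by case: (h_chi H). Qed.
Lemma chi0r a : chi a 0 = 1.
Proof. by apply: (mulfI (chi_nz a 0)); rewrite -chiDr addr0 mulr1. Qed.
Lemma chi0l a : chi 0 a = 1.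
Proof. by apply: (mulfI (chi_nz 0 a)); rewrite -chiDl addr0 mulr1. Qed.
Lemma chiNr a b : chi a (- b) = (chi a b)^-1.
Proof. by apply: (mulIf (chi_nz a b)); rewrite -chiDr addNr chi0r mulVf ?chi_nz. Qed.
Lemma chiNl a b : chi (- a) b = (chi a b)^-1.
Proof. by apply: (mulIf (chi_nz a b)); rewrite -chiDl addNr chi0l mulVf ?chi_nz. Qed.
Lemma chiMnr a b n : chi a (b *+ n) = chi a b ^+ n.
Proof. by elim: n => [|n IH]; rewrite ?mulr0n ?chi0r // mulrS chiDr IH exprS. Qed.
Lemma chiMnl a b n : chi (a *+ n) b = chi a b ^+ n.
Proof. by elim: n => [|n IH]; rewrite ?mulr0n ?chi0l // mulrS chiDl IH exprS. Qed.

Lemma crd0 i : crd i 0 = 0.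
Proof. by have := h_crdD H i 0 0; rewrite addr0 => /(congr1 (fun x => x - crd i 0)); rewrite addrK subrr. Qed.
Lemma crdN i a : crd i (- a) = - crd i a.
Proof. by apply/eqP; rewrite -addr_eq0 -(h_crdD H) addNr crd0. Qed.
Lemma crdB i a b : crd i (a - b) = crd i a - crd i b.
Proof. by rewrite (h_crdD H) crdN. Qed.
Lemma crdMn i a n : crd i (a *+ n) = crd i a *+ n.
Proof. by elim: n => [|n IH]; rewrite ?mulr0n ?crd0 // !mulrS (h_crdD H) IH. Qed.
Lemma crd_inj a b : (forall i, crd i a = crd i b) -> a = b.
Proof.
move=> h; rewrite (h_crdE H a) (h_crdE H b).
by apply: eq_bigr => i _; rewrite h.
Qed.
Lemma pi_neq0 i : pi i != 0.
Proof. by apply/eqP => h; have := h_crdpi H i i; rewrite h crd0 eqxx. Qed.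

Definition hgt a := \sum_i crd i a.
Lemma hgtD a b : hgt (a + b) = hgt a + hgt b.
Proof. by rewrite /hgt -big_split; apply: eq_bigr => i _; rewrite (h_crdD H). Qed.
Lemma hgtN a : hgt (- a) = - hgt a.
Proof. by rewrite /hgt -sumrN; apply: eq_bigr => i _; rewrite crdN. Qed.
Lemma hgtB a b : hgt (a - b) = hgt a - hgt b.
Proof. by rewrite hgtD hgtN. Qed.
Lemma hgt_pi k : hgt (pi k) = 1.
Proof.
rewrite /hgt (bigD1 k) //= (h_crdpi H) eqxx big1 ?addr0 // => i /negbTE ni.
by rewrite (h_crdpi H) ni.
Qed.

Lemma KKN a : qk a * qk (- a) = 1.
Proof. by rewrite (h_KK H) subrr (h_K0 H). Qed.
Lemma KNK a : qk (- a) * qk a = 1.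
Proof. by rewrite (h_KK H) addNr (h_K0 H). Qed.
Lemma LLN a : ql a * ql (- a) = 1.
Proof. by rewrite (h_LL H) subrr (h_L0 H). Qed.
Lemma LNL a : ql (- a) * ql a = 1.
Proof. by rewrite (h_LL H) addNr (h_L0 H). Qed.
Lemma mulKI a : injective (fun y => y * qk a).
Proof. by move=> x y /(congr1 (fun z => z * qk (- a))); rewrite -!mulrA KKN !mulr1. Qed.
Lemma mulLI a : injective (fun y => y * ql a).
Proof. by move=> x y /(congr1 (fun z => z * ql (- a))); rewrite -!mulrA LLN !mulr1. Qed.

Lemma GK mu y a : Nm mu y -> qk a * y = (chi a mu)^-1 *: (y * qk a).
Proof.
elim=> [|c|j c z _ IH|c e z w _ IHz _ IHw].
- by rewrite chi0r invr1 scale1r mul1r mulr1.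
- by rewrite mulr0 mul0r scaler0.
- by rewrite mulrA (h_KF H) -scalerAl -[_ * _ * z]mulrA IH -scalerAr scalerA mulrA chiDr invfM.
- by rewrite mulrDr -scalerAr IHz IHw mulrDl scalerDr -scalerAl !scalerA mulrC.
Qed.

Lemma GL mu y a : Nm mu y -> ql a * y = chi mu a *: (y * ql a).
Proof.
elim=> [|c|j c z _ IH|c e z w _ IHz _ IHw].
- by rewrite chi0l scale1r mul1r mulr1.
- by rewrite mulr0 mul0r scaler0.
- by rewrite mulrA (h_LF H) -scalerAl -[_ * _ * z]mulrA IH -scalerAr scalerA mulrA chiDl.
- by rewrite mulrDr -scalerAr IHz IHw mulrDl scalerDr -scalerAl !scalerA mulrC.
Qed.

Lemma Nm_cone mu y : Nm mu y -> y != 0 -> forall i, 0 <= crd i mu.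
Proof.
elim=> [|c|j c z _ IH|c e z w _ IHz _ IHw] nz i.
- by rewrite crd0.
- by rewrite eqxx in nz.
- have nz' : z != 0 by apply: contraNneq nz => ->; rewrite mulr0.
  by rewrite (h_crdD H) addr_ge0 ?IH // (h_crdpi H).
- case: (eqVneq z 0) nz => [->|nz _]; last exact: IHz.
  by rewrite scaler0 add0r => /IHw.
Qed.

Lemma Nm_out mu y i : Nm mu y -> crd i mu < 0 -> y = 0.
Proof.
move=> h lt; apply/eqP; apply: contraTT lt => nz.
by rewrite -leNgt (Nm_cone h nz).
Qed.

Lemma Nm_deg0 mu y : Nm mu y -> mu = 0 -> exists c, y = c *: 1.
Proof.
elim=> [|c|j c z hz IH|c e z w _ IHz _ IHw] e0.
- by exists 1; rewrite scale1r.
- by exists 0; rewrite scale0r.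
- exists 0; rewrite scale0r (@Nm_out c z j hz) ?mulr0 //.
  by move/eqP: e0; rewrite addrC addr_eq0 => /eqP ->; rewrite crdN (h_crdpi H) eqxx.
- have [a ->] := IHz e0; have [b ->] := IHw e0.
  by exists (e * a + b); rewrite scalerDl scalerA.
Qed.

Lemma Nm_simple k y : Nm (pi k) y -> exists v, y = v *: F k.
Proof.
have [mu e0] : exists mu, mu = pi k by exists (pi k).
rewrite -e0 => h; elim: h e0 => [|c|j c z hz IH|c e z w _ IHz _ IHw] e0.
- by move: (pi_neq0 k); rewrite -e0 eqxx.
- by exists 0; rewrite scale0r.
- have ec : c = pi k - pi j by rewrite -e0 addrAC subrr add0r.
  case: (eqVneq j k) => [ejk|njk].
    have c0 : c = 0 by rewrite ec ejk subrr.
    have [v ->] := Nm_deg0 hz c0.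
    by exists v; rewrite ejk -scalerAr mulr1.
  exists 0; rewrite scale0r (@Nm_out c z j hz) ?mulr0 //.
  by rewrite ec crdB !(h_crdpi H) (negbTE njk) eqxx.
- have [a ->] := IHz e0; have [b ->] := IHw e0.
  by exists (e * a + b); rewrite scalerDl scalerA.
Qed.

(* [y1] and [y2] are the two skew derivatives of [y] with respect to [E j]. *)
Definition der j mu y y1 y2 :=
  [/\ Nm (mu - pi j) y1, Nm (mu - pi j) y2 &
      E j * y = y * E j + (y1 * qk (pi j) + y2 * ql (pi j))].

Lemma der_lin j mu c y z y1 y2 z1 z2 :
  der j mu y y1 y2 -> der j mu z z1 z2 ->
  der j mu (c *: y + z) (c *: y1 + z1) (c *: y2 + z2).
Proof.
move=> [h1 h2 e] [k1 k2 f]; split; try exact: GenD.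
rewrite mulrDr -scalerAr e f; nc_simp K U; ring.
Qed.

Lemma der0 j mu : der j mu 0 0 0.
Proof. by split; try exact: Gen0; rewrite mulr0 !mul0r !addr0. Qed.

Lemma der_mul j mu nu y z y1 y2 z1 z2 :
  Nm mu y -> Nm nu z -> der j mu y y1 y2 -> der j nu z z1 z2 ->
  der j (mu + nu) (y * z) ((chi (pi j) nu)^-1 *: (y1 * z) + y * z1)
                          (chi nu (pi j) *: (y2 * z) + y * z2).
Proof.
move=> hy hz [h1 h2 e] [k1 k2 f]; split.
- apply: GenD; first by apply: Gen_eq (Gen_mul h1 hz) _; rewrite addrAC.
  by apply: Gen_eq (Gen_mul hy k1) _; rewrite addrA.
- apply: GenD; first by apply: Gen_eq (Gen_mul h2 hz) _; rewrite addrAC.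
  by apply: Gen_eq (Gen_mul hy k2) _; rewrite addrA.
rewrite mulrA e.
have -> : (y * E j + (y1 * qk (pi j) + y2 * ql (pi j))) * z =
  y * (E j * z) + (y1 * (qk (pi j) * z) + y2 * (ql (pi j) * z)).
  nc_simp K U; ring.
rewrite f (GK _ hz) (GL _ hz); nc_simp K U; ring.
Qed.

Lemma der_F j i : der j (pi i) (F i) (- ((i == j)%:R *: 1)) ((i == j)%:R *: 1).
Proof.
have g1 : Nm (pi i - pi j) ((i == j)%:R *: 1).
  case: eqVneq => [->|_]; first by rewrite subrr scale1r; exact: Gen1.
  by rewrite scale0r; exact: Gen0.
split=> //; first exact: GenN.
rewrite (h_EF H) [j == i]eq_sym; congr (_ + _); case: (i == j).
  by rewrite mulr1n scale1r mulN1r mul1r addrC.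
by rewrite mulr0n scale0r oppr0 !mul0r addr0.
Qed.

Lemma der_ex j mu y : Nm mu y -> exists y1 y2, der j mu y y1 y2.
Proof.
elim=> [|c|i c z hz [z1 [z2 hd]]|c e z w _ [z1 [z2 hz]] _ [w1 [w2 hw]]].
- exists 0, 0; split; try exact: Gen0.
  by rewrite mulr1 !mul0r !addr0 mul1r.
- by exists 0, 0; exact: der0.
- do 2 eexists; apply: der_mul hz (der_F _ _) hd; exact: Gen_gen.
- by do 2 eexists; apply: der_lin hz hw.
Qed.

Lemma der_uniq j mu y y1 y2 z1 z2 :
  der j mu y y1 y2 -> der j mu y z1 z2 -> y1 = z1 /\ y2 = z2.
Proof.
move=> [h1 h2 e] [k1 k2 f].
have [|||a b] := @h_indF _ _ _ _ _ _ _ _ _ _ _ H j (mu - pi j) (y1 - z1) (y2 - z2).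
- exact: GenB.
- exact: GenB.
- have : E j * y - E j * y = 0 by rewrite subrr.
  rewrite {1}e f => d; rewrite -[RHS]d; nc_simp K U; ring.
by split; apply: subr0_eq.
Qed.

Lemma der_comm j k mu y : Nm mu y ->
  exists a1 a2 b1 b2 c1 c2 d1 d2,
    [/\ der j mu y a1 a2, der k mu y b1 b2, der j (mu - pi k) b2 c1 c2,
        der k (mu - pi j) a1 d1 d2 & c1 = chi (pi j) (pi k) *: d2].
Proof.
elim=> [|a|i a z hz [a1 [a2 [b1 [b2 [c1 [c2 [d1 [d2 [hj hk hjk hkj e]]]]]]]]]
  |a r z w _ [a1 [a2 [b1 [b2 [c1 [c2 [d1 [d2 [hj hk hjk hkj e]]]]]]]]] _
    [a1' [a2' [b1' [b2' [c1' [c2' [d1' [d2' [hj' hk' hjk' hkj' e']]]]]]]]]].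
- have d1 l : der l 0 1 0 0.
    by split; try exact: Gen0; rewrite !mul0r !addr0 mulr1 mul1r.
  by do 8 exists 0; split; try exact: d1; try exact: der0; rewrite scaler0.
- by do 8 exists 0; split; try exact: der0; rewrite scaler0.
- have Fd l := der_mul (Gen_gen pi F i) hz (der_F l i).
  have [hb1 hb2 _] := hk; have [ha1 ha2 _] := hj.
  set A1 := (chi (pi j) a)^-1 *: (- ((i == j)%:R *: 1) * z) + F i * a1.
  set B2 := chi a (pi k) *: ((i == k)%:R *: 1 * z) + F i * b2.
  have eA1 : A1 = (- ((chi (pi j) a)^-1 * (i == j)%:R)) *: z + F i * a1.
    by rewrite /A1; move: (_ ^-1) (_ %:R) => c d; nc_simp K U; ring.
  have eB2 : B2 = (chi a (pi k) * (i == k)%:R) *: z + F i * b2.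
    by rewrite /B2; move: (_ %:R) => d; nc_simp K U; ring.
  have dA1 := der_mul (Gen_gen pi F i) ha1 (der_F k i) hkj.
  have dB2 := der_mul (Gen_gen pi F i) hb2 (der_F j i) hjk.
  have zk : der k (pi i + a - pi j) ((- ((chi (pi j) a)^-1 * (i == j)%:R)) *: z)
      ((- ((chi (pi j) a)^-1 * (i == j)%:R)) *: b1) ((- ((chi (pi j) a)^-1 * (i == j)%:R)) *: b2).
    case: eqVneq => [->|_]; last by rewrite mulr0 oppr0 !scale0r; exact: der0.
    rewrite addrAC subrr add0r -[_ *: z]addr0 -[_ *: b1]addr0 -[_ *: b2]addr0.
    by apply: der_lin hk _; exact: der0.
  have zj : der j (pi i + a - pi k) ((chi a (pi k) * (i == k)%:R) *: z)
      ((chi a (pi k) * (i == k)%:R) *: a1) ((chi a (pi k) * (i == k)%:R) *: a2).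
    case: eqVneq => [->|_]; last by rewrite mulr0 !scale0r; exact: der0.
    rewrite addrAC subrr add0r -[_ *: z]addr0 -[_ *: a1]addr0 -[_ *: a2]addr0.
    by apply: der_lin hj _; exact: der0.
  rewrite addrA in dA1; rewrite addrA in dB2.
  have DA := der_lin 1 zk dA1; have DB := der_lin 1 zj dB2.
  rewrite scale1r -eA1 in DA; rewrite scale1r -eB2 in DB.
  exists A1; eexists; eexists; exists B2; do 4 eexists.
  split; [exact: Fd hj|exact: Fd hk|exact: DB|exact: DA|].
  rewrite e !(chiDr, chiDl, chiNr, chiNl) invfM invrK.
  nc_simp K U; case: (i == j); case: (i == k); by field; rewrite ?chi_nz.
do 8 eexists; split; [apply: der_lin hj hj'|apply: der_lin hk hk'|
  apply: der_lin hjk hjk'|apply: der_lin hkj hkj'|].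
by rewrite e e' scalerDr !scalerA mulrC.
Qed.

(* Both kinds of skew derivatives commute up to scalars, so an element killed by
   all derivatives of the first kind descends to one killed by all of them. *)
Lemma strong_ndF n mu y : \sum_i crd i mu <= n%:Z -> Nm mu y -> mu != 0 ->
  (forall j y1 y2, der j mu y y1 y2 -> y1 = 0) -> y = 0.
Proof.
elim: n mu y => [|n IH] mu y le hy nz hd.
  apply/eqP; apply: contraNT nz => ny; apply/eqP/crd_inj => i; rewrite crd0.
  have cone := Nm_cone hy ny; apply/eqP; rewrite eq_le cone andbT.
  by apply: le_trans le; rewrite (bigD1 i) //= lerDl sumr_ge0.
apply: (h_ndF H hy nz) => k; have [y1 [y2 dk]] := der_ex k hy.
have z1 := hd _ _ _ dk; have [h1 h2 ->] := dk; rewrite z1 mul0r add0r.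
suff -> : y2 = 0 by rewrite mul0r addr0.
(* Degree [pi k] is the end of the descent: there [y] is a multiple of [F k], whose two derivatives
   are opposite constants, so the second vanishes with the first. *)
case: (eqVneq (mu - pi k) 0) => [e0|nz'].
  have ek : mu = pi k by apply: subr0_eq.
  rewrite ek in dk hy; have [v ev] := Nm_simple hy.
  have dF := der_lin v (der_F k k) (der0 k (pi k)).
  rewrite !addr0 -ev eqxx in dF; have [e1 ->] := der_uniq dk dF.
  by move: e1; rewrite z1 scalerN => /esym/eqP; rewrite oppr_eq0 => /eqP.
apply: (IH (mu - pi k)) => //.
  by rewrite -/(hgt _) hgtB hgt_pi lerBlDr -PoszD addn1.
move=> j v1 v2 dv.
have [a1 [a2 [b1 [b2 [c1 [c2 [d1 [d2 [hj hk hjk hkj e]]]]]]]]] := der_comm j k hy.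
have [_ e2] := der_uniq dk hk; rewrite e2 in dv.
have [-> _] := der_uniq dv hjk; rewrite e.
have a0 := hd _ _ _ hj; rewrite a0 in hkj.
by have [_ ->] := der_uniq hkj (der0 _ _); rewrite scaler0.
Qed.

End HalfTheory.

Ltac lattice H := apply: (crd_inj H) => ?;
  rewrite ?(crdB H, h_crdD H, crdN H, crdMn H, crd0 H, mulr0n, mulr1n, mulrSr); ring.

(** * Rank one: powers of F_i and adjoint strings *)

Section RankOne.
Variables (K : fieldType) (A : zmodType) (U : algType K) (I : finType).
Variables (chi : A -> A -> K) (qk ql : A -> U) (pi : I -> A).
Variables (crd : I -> A -> int) (E F : I -> U).
Hypothesis H : pborel chi qk ql pi crd E F.
Variable i : I.
Local Notation Nm := (Gen pi F).
Local Notation al := (pi i).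
Local Notation q := (chi (pi i) (pi i)).
Local Notation Ka := (qk (pi i)).
Local Notation La := (ql (pi i)).

Let q0 : q != 0 := chi_nz H _ _.

Lemma Nm_Fn n : Nm (al *+ n) (F i ^+ n).
Proof. exact/Gen_exp/Gen_gen. Qed.

Lemma LFn a n : ql a * F i ^+ n = chi al a ^+ n *: (F i ^+ n * ql a).
Proof. by rewrite (GL H _ (Nm_Fn n)) (chiMnl H). Qed.

Lemma KFn a n : qk a * F i ^+ n = chi a al ^- n *: (F i ^+ n * qk a).
Proof. by rewrite (GK H _ (Nm_Fn n)) (chiMnr H). Qed.

Lemma EF1 : E i * F i = F i * E i + (La - Ka).
Proof. by rewrite (h_EF H) eqxx mulr1n. Qed.

Lemma EFn n : E i * F i ^+ n.+1 =
  F i ^+ n.+1 * E i + qnum q n.+1 *: (F i ^+ n * (La - q ^- n *: Ka)).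
Proof.
elim: n => [|n IH].
  by rewrite !expr1 expr0 EF1 qnum1 scale1r mul1r invr1 scale1r.
rewrite exprS mulrA EF1.
have -> : (F i * E i + (La - Ka)) * F i ^+ n.+1 =
  F i * (E i * F i ^+ n.+1) + La * F i ^+ n.+1 - Ka * F i ^+ n.+1.
  nc_simp K U; ring.
rewrite IH LFn KFn [qnum q n.+2]qnumS.
have rel := qnum_sub1 q n.+1.
rewrite !exprS in rel *; move: (qnum q _) (q ^+ n) rel (expf_neq0 n q0) => x p rel p0.
nc_simp K U; try ring.
by apply: (lin_comb1 (z := - (q * p)^-1) rel); field; rewrite q0 p0.
Qed.

Lemma EjFn j n : j != i -> E j * F i ^+ n = F i ^+ n * E j.
Proof.
move=> ji; elim: n => [|n IH]; first by rewrite expr0 mulr1 mul1r.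
by rewrite exprS mulrA (h_EF H) (negbTE ji) mulr0n addr0 -mulrA IH mulrA.
Qed.

Lemma al_mul_neq0 n : al *+ n.+1 != 0.
Proof.
apply/eqP => /(congr1 (crd i)); rewrite (crdMn H) (crd0 H) (h_crdpi H) eqxx.
by move/eqP; rewrite mulrn_eq0.
Qed.

(** At the first n with (n)_q = 0 the commutator with E_i vanishes, so F_i^n commutes with every E_j
    and nondegeneracy kills it; higher powers follow. *)
Lemma Fn_eq0 n : qfact q n = 0 -> F i ^+ n = 0.
Proof.
elim: n => [/eqP|n IH]; first by rewrite qfact0 oner_eq0.
rewrite qfactS => /eqP; rewrite mulf_eq0 => /orP[/eqP/IH e|/eqP e].
  by rewrite exprS e mulr0.
apply: (h_ndF H (Nm_Fn n.+1) (al_mul_neq0 n)) => j.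
case: (eqVneq j i) => [->|ji]; first by rewrite EFn e scale0r addr0.
exact: EjFn.
Qed.

Lemma Fn_neq0 n : qfact q n != 0 -> F i ^+ n != 0.
Proof.
elim: n => [_|n IH]; first by rewrite expr0 (h_one H).
rewrite qfactS mulf_eq0 negb_or => /andP[/IH nz qn]; apply: contraNneq nz => z.
have := EFn n; rewrite z mulr0 mul0r add0r => /esym/eqP.
rewrite scaler_eq0 (negbTE qn) /= => /eqP e.
have [|||e1 ->//] := @h_indF _ _ _ _ _ _ _ _ _ _ _ H i (al *+ n) (- q ^- n *: F i ^+ n) (F i ^+ n).
- exact/GenZ/Nm_Fn.
- exact: Nm_Fn.
- by rewrite -[RHS]e; nc_simp K U; ring.
Qed.

Lemma der_Fn n : der qk ql pi E F i (al *+ n.+1) (F i ^+ n.+1)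
  (- (qnum q n.+1 * q ^- n) *: F i ^+ n) (qnum q n.+1 *: F i ^+ n).
Proof.
have e : al *+ n.+1 - al = al *+ n by rewrite mulrSr addrK.
split; rewrite ?e; try exact/GenZ/Nm_Fn.
by rewrite EFn; nc_simp K U; ring.
Qed.

(* The iterated skew adjoint action of [F i] on [F j]; [E i] lowers it again. *)
Fixpoint Fm j m : U :=
  if m is n.+1 then F i * Fm j n - (chi al (pi j + al *+ n))^-1 *: (Fm j n * F i)
  else F j.

Definition braid j := chi al (pi j) * chi (pi j) al.

(** Scalar by which E_i lowers the string. Up to a unit it is (m+1)_q (q^m chi(pi i, pi j) chi(pi j,
    pi i) - 1), so that its first zero in [m] is minus the generalized Cartan entry at (i, j). *)
Definition bm j m := (chi al (pi j))^-1 * qnum q m.+1 * (braid j - q ^- m).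

Lemma Nm_Fm j m : Nm (pi j + al *+ m) (Fm j m).
Proof.
elim: m => [|m IH]; first by rewrite mulr0n addr0; exact: Gen_gen.
rewrite mulrS [al + _]addrC addrA; apply: GenB.
  by apply: Gen_eq (Gen_mul (Gen_gen pi F i) IH) _; rewrite addrC.
by apply/GenZ/Gen_mul/Gen_gen.
Qed.

Lemma bm0 j : bm j 0 = chi (pi j) al - (chi al (pi j))^-1.
Proof. by rewrite /bm qnum1 expr0 /braid; field; rewrite !(chi_nz H) //= oner_eq0. Qed.

Lemma bmS j m : bm j m.+1 =
  bm j m + chi (pi j + al *+ m.+1) al - (chi al (pi j + al *+ m.+1))^-1.
Proof.
rewrite /bm /braid (chiDl H) (chiDr H) (chiMnl H) (chiMnr H) [qnum q m.+2]qnumS.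
have rel := qnum_sub1 q m.+1; rewrite !exprS in rel *.
move: (qnum q _) (q ^+ m) rel (expf_neq0 m q0) => x p rel p0.
apply: (lin_comb1 (z := (chi al (pi j))^-1 * (q * p)^-1) rel).
by field; rewrite q0 p0 !(chi_nz H).
Qed.

Lemma E_Fm0 j : j != i -> E i * F j = F j * E i.
Proof. by move=> ji; rewrite (h_EF H) eq_sym (negbTE ji) mulr0n addr0. Qed.

Lemma E_Fm j m : j != i ->
  E i * Fm j m.+1 = Fm j m.+1 * E i + bm j m *: (Fm j m * La).
Proof.
move=> ji; elim: m => [|m IH].
  rewrite /= mulr0n addr0 bm0 mulrBr -scalerAr 2!mulrA EF1 E_Fm0 // -!mulrA EF1.
  have -> : (F i * E i + (La - Ka)) * F j = F i * (E i * F j) + La * F j - Ka * F j.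
    nc_simp K U; ring.
  by rewrite E_Fm0 // (h_LF H) (h_KF H); nc_simp K U; ring.
rewrite -/(Fm j m.+1); set x := Fm j m.+1 in IH *; set c := (chi al (pi j + al *+ m))^-1.
have ex : x = F i * Fm j m - c *: (Fm j m * F i) by [].
have -> : Fm j m.+2 = F i * x - (c * q^-1) *: (x * F i).
  rewrite /= -/(Fm j m) -ex mulrSr addrA (chiDr H) invfM //.
rewrite bmS; have hx := Nm_Fm j m.+1; rewrite -/x in hx.
have EKx := GK H al hx; have ELx := GL H al hx.
have cc : (chi al (pi j + al *+ m.+1))^-1 = c * q^-1.
  by rewrite mulrSr addrA (chiDr H) invfM.
rewrite cc in EKx *.
have -> : E i * (F i * x - (c * q^-1) *: (x * F i)) =
   (E i * F i) * x - (c * q^-1) *: ((E i * x) * F i) by nc_simp K U; ring.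
rewrite EF1 IH.
have -> : (F i * E i + (La - Ka)) * x - (c * q^-1) *: ((x * E i + bm j m *: (Fm j m * La)) * F i)
  = F i * (E i * x) + La * x - Ka * x - (c * q^-1) *: (x * (E i * F i))
    - (c * q^-1 * bm j m) *: (Fm j m * (La * F i)).
  nc_simp K U; ring.
rewrite IH EF1 EKx ELx (h_LF H).
have -> a b : (bm j m + a - b) *: (x * La) = (a - b) *: (x * La)
    + bm j m *: ((F i * Fm j m - c *: (Fm j m * F i)) * La).
  by rewrite -ex -scalerDl; congr (_ *: _); ring.
by nc_simp K U; try ring; field; rewrite q0.
Qed.

Lemma Ek_Fm k j m : k != i -> k != j -> E k * Fm j m = Fm j m * E k.
Proof.
move=> ki kj.
have eF l : k != l -> E k * F l = F l * E k.
  by move=> kl; rewrite (h_EF H) (negbTE kl) mulr0n addr0.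
elim: m => [|m IH] /=; first exact: eF.
by rewrite mulrBr mulrBl -scalerAr -scalerAl !mulrA eF // IH -!mulrA eF // IH.
Qed.

(** The value -1 is the coefficient of K_j in the commutator of E_j and F_j; the L_j part is already
    gone after one bracket with F_i, and every bracket contributes one factor to the K_j part. *)
Fixpoint am j m : K :=
  if m is n.+1 then am j n * (1 - (braid j * q ^+ n)^-1) else -1.

Lemma Ej_Fm j m : j != i ->
  E j * Fm j m.+1 = Fm j m.+1 * E j + am j m.+1 *: (F i ^+ m.+1 * qk (pi j)).
Proof.
move=> ji; have Eji : E j * F i = F i * E j by rewrite (h_EF H) (negbTE ji) mulr0n addr0.
have Ejj : E j * F j = F j * E j + (ql (pi j) - qk (pi j)) by rewrite (h_EF H) eqxx.
elim: m => [|m IH].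
  rewrite /= mulr0n addr0 mulrBr -scalerAr 2!mulrA Ejj Eji -!mulrA Ejj.
  have -> : (F j * E j + (ql (pi j) - qk (pi j))) * F i
    = F j * (E j * F i) + ql (pi j) * F i - qk (pi j) * F i by nc_simp K U; ring.
  rewrite Eji (h_LF H) (h_KF H) expr0 mulr1 /braid expr1.
  by nc_simp K U; try ring; field; rewrite !(chi_nz H).
set x := Fm j m.+1 in IH *; set c := (chi al (pi j + al *+ m.+1))^-1.
have -> : Fm j m.+2 = F i * x - c *: (x * F i) by [].
have -> : E j * (F i * x - c *: (x * F i)) = (E j * F i) * x - c *: ((E j * x) * F i).
  nc_simp K U; ring.
rewrite Eji IH -[F i * E j * x]mulrA IH.
have -> : am j m.+2 = am j m.+1 * (1 - (braid j * q ^+ m.+1)^-1) by [].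
have -> : (x * E j + am j m.+1 *: (F i ^+ m.+1 * qk (pi j))) * F i
  = x * (E j * F i) + am j m.+1 *: (F i ^+ m.+1 * (qk (pi j) * F i)) by nc_simp K U; ring.
rewrite Eji (h_KF H) -[F i ^+ m.+2]/(F i * F i ^+ m.+1).
have cF : F i ^+ m.+1 * (F i * qk (pi j)) = F i * F i ^+ m.+1 * qk (pi j).
  by rewrite mulrA -exprSr exprS.
have -> : c = (chi al (pi j))^-1 * q ^- m.+1 by rewrite /c (chiDr H) (chiMnr H) invfM.
rewrite -scalerAr cF /braid; move: (q ^+ m.+1) (expf_neq0 m.+1 q0) => p p0.
by nc_simp K U; try ring; field; rewrite p0 !(chi_nz H).
Qed.

Lemma Fm_deg_neq0 j m : j != i -> pi j + al *+ m != 0.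
Proof.
move=> ji; apply/eqP => /(congr1 (crd j)).
by rewrite (h_crdD H) (crdMn H) (crd0 H) !(h_crdpi H) eqxx (negbTE ji) mul0rn addr0.
Qed.

(** At a zero of [bm] the next string element commutes with E_i. It also commutes with E_j: either
    (m+1)_q = 0 and F_i^(m+1) = 0, or the last factor of [am] vanishes. Nondegeneracy then
    applies. *)
Lemma Fm_eq0 j m : j != i -> bm j m = 0 -> Fm j m.+1 = 0.
Proof.
move=> ji b0; apply: (h_ndF H (Nm_Fm j m.+1) (Fm_deg_neq0 _ ji)) => k.
case: (eqVneq k i) => [->|ki]; first by rewrite E_Fm // b0 scale0r addr0.
case: (eqVneq k j) => [->|kj]; last exact: Ek_Fm.
suff e : am j m.+1 *: F i ^+ m.+1 = 0 by rewrite Ej_Fm // scalerAl e mul0r addr0.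
move/eqP: b0; rewrite /bm mulf_eq0 mulf_eq0 invr_eq0 (negbTE (chi_nz H _ _)) /=.
case/orP=> [/eqP z|]; first by rewrite Fn_eq0 ?scaler0 // qfactS z mulr0.
rewrite subr_eq0 => /eqP z /=.
by rewrite z mulVf ?expf_neq0 // invr1 subrr mulr0 scale0r.
Qed.

Lemma F_neq0 j : F j != 0.
Proof.
apply/eqP => z; have := h_EF H j j; rewrite z mulr0 mul0r add0r eqxx mulr1n => e.
have [|||_ /eqP] := @h_indF _ _ _ _ _ _ _ _ _ _ _ H j 0 (- 1) 1.
- exact/GenN/Gen1.
- exact: Gen1.
- by rewrite mulN1r mul1r addrC -e.
by rewrite (negbTE (h_one H)).
Qed.

Lemma Fm_neq0 j m : j != i -> (forall k, (k < m)%N -> bm j k != 0) -> Fm j m != 0.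
Proof.
move=> ji; elim: m => [_|m IH hb]; first exact: F_neq0.
have nz : Fm j m != 0 by apply: IH => k /ltnW; exact: hb.
apply: contraNneq nz => z; have := E_Fm m ji; rewrite z mulr0 mul0r add0r.
move/esym/eqP; rewrite scaler_eq0 (negbTE (hb m (ltnSn m))) /= => /eqP e.
by have := mulLI H (a := al) (x1 := Fm j m) (x2 := 0); rewrite /= mul0r => /(_ e) ->.
Qed.

(** Together with [km_gen] this defines [Km], the algebra generated by the strings through the F_j,
    j != i. It lies in the kernel of the first skew derivative along E_i and survives the reflection
    at i: the old and the new negative half arise from it by adjoining powers of one further
    element. *)
Definition km_deg (x : {j : I | j != i} * nat) : A := pi (val x.1) + al *+ x.2.
Definition km_gen (x : {j : I | j != i} * nat) : U := Fm (val x.1) x.2.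
Local Notation Km := (Gen km_deg km_gen).

Lemma Km_Fm j m : j != i -> Km (pi j + al *+ m) (Fm j m).
Proof. by move=> ji; exact: (Gen_gen km_deg km_gen (exist _ j ji, m)). Qed.

Lemma Km_Nm mu k : Km mu k -> Nm mu k.
Proof. by apply: Gen_sub => x; exact: Nm_Fm. Qed.

Lemma Km_E mu k : Km mu k ->
  exists2 k1, Km (mu - al) k1 & E i * k = k * E i + k1 * La.
Proof.
elim=> [|c|[[j ji] m] c z hz [z1 h1 e1]|c e z w _ [z1 hz1 ez] _ [w1 hw1 ew]].
- by exists 0; [exact: Gen0|rewrite mulr1 mul1r mul0r addr0].
- by exists 0; [exact: Gen0|rewrite mulr0 !mul0r addr0].
- rewrite /km_deg /km_gen /=; case: m => [|m].
    exists (F j * z1).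
      apply: Gen_eq (Gen_mul (Km_Fm 0 ji) h1) _.
      by rewrite mulr0n addr0 addrA.
    by rewrite /= mulrA E_Fm0 // -mulrA e1 mulrDr !mulrA.
  exists (bm j m *: (chi c al *: (Fm j m * z)) + Fm j m.+1 * z1).
    apply: GenA.
      apply/GenZ/GenZ; apply: Gen_eq (Gen_mul (Km_Fm m ji) hz) _.
      by lattice H.
    by apply: Gen_eq (Gen_mul (Km_Fm m.+1 ji) h1) _; rewrite addrA.
  rewrite mulrA E_Fm //.
  have -> : (Fm j m.+1 * E i + bm j m *: (Fm j m * La)) * z
    = Fm j m.+1 * (E i * z) + bm j m *: (Fm j m * (La * z)).
    nc_simp K U; ring.
  by rewrite e1 (GL H _ (Km_Nm hz)); nc_simp K U; ring.
- exists (e *: z1 + w1); first exact: GenD.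
  by rewrite mulrDr -scalerAr ez ew; nc_simp K U; ring.
Qed.

Lemma Km_ad mu k : Km mu k -> Km (mu + al) (F i * k - (chi al mu)^-1 *: (k * F i)).
Proof.
elim=> [|c|[[j ji] m] c z hz IH|c e z w _ IHz _ IHw].
- by rewrite (chi0r H) invr1 scale1r mulr1 mul1r subrr; exact: Gen0.
- by rewrite mulr0 mul0r scaler0 subrr; exact: Gen0.
- rewrite /km_deg /km_gen /= (chiDr H) invfM.
  set x := Fm j m; set d := (chi al (pi j + al *+ m))^-1.
  have -> : F i * (x * z) - (d * (chi al c)^-1) *: (x * z * F i) =
     (F i * x - d *: (x * F i)) * z + d *: (x * (F i * z - (chi al c)^-1 *: (z * F i))).
    by move: (chi al c)^-1 => c1; nc_simp K U; ring.
  apply: GenA.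
    apply: Gen_eq (Gen_mul (Km_Fm m.+1 ji) hz) _.
    by lattice H.
  by apply/GenZ; apply: Gen_eq (Gen_mul (Km_Fm m ji) IH) _; rewrite addrA.
- have -> : F i * (e *: z + w) - (chi al c)^-1 *: ((e *: z + w) * F i) =
    e *: (F i * z - (chi al c)^-1 *: (z * F i)) + (F i * w - (chi al c)^-1 *: (w * F i)).
    by move: (chi al c)^-1 => c1; nc_simp K U; ring.
  exact: GenD.
Qed.

Lemma der_Km mu k : Km mu k -> exists k1, der qk ql pi E F i mu k 0 k1.
Proof.
move=> hk; have [k1 h1 e] := Km_E hk; exists k1; split; rewrite ?mul0r ?add0r //.
  exact: Gen0.
exact: Km_Nm.
Qed.

(* Every element of [U^-] expands in the powers of [F i] with coefficients in
   [Km], on either side; the expansion is made unique by dropping the powers of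
   [F i] that vanish. *)
Definition expR mu y (s : nat) (k : nat -> U) :=
  [/\ forall r, Km (mu - al *+ r) (k r), forall r, qfact q r = 0 -> k r = 0,
      forall r, (s <= r)%N -> k r = 0 & y = \sum_(r < s) k r * F i ^+ r].

Definition expL mu y (s : nat) (k : nat -> U) :=
  [/\ forall r, Km (mu - al *+ r) (k r), forall r, qfact q r = 0 -> k r = 0,
      forall r, (s <= r)%N -> k r = 0 & y = \sum_(r < s) F i ^+ r * k r].

Lemma exp_shift mu (k : nat -> U) n : (forall r, Km (mu - al *+ r) (k r)) ->
  Km (mu - al - al *+ n) (k n.+1).
Proof. by move=> h; apply: Gen_eq (h n.+1) _; rewrite mulrS opprD addrA. Qed.

Lemma der_sum j mu n (y y1 y2 : 'I_n -> U) :
  (forall r, der qk ql pi E F j mu (y r) (y1 r) (y2 r)) ->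
  der qk ql pi E F j mu (\sum_r y r) (\sum_r y1 r) (\sum_r y2 r).
Proof.
move=> h; elim: n y y1 y2 h => [|n IH] y y1 y2 h; first by rewrite !big_ord0; exact: der0.
rewrite !big_ord_recl -[y _]scale1r -[y1 _]scale1r -[y2 _]scale1r.
by apply: der_lin => //; apply: IH.
Qed.

(** The first skew derivative along E_i kills the coefficients and sends F_i^(n+1) to a multiple of
    F_i^n that is nonzero unless the power was dropped; the relation obtained is shorter. *)
Lemma expR_indep mu s k : expR mu 0 s k -> forall r, k r = 0.
Proof.
elim: s mu k => [|s IH] mu k [hK hq hs e] r; first exact: hs.
have kS n : k n.+1 = 0.
  pose k' n := - (qnum q n.+1 * q ^- n) *: k n.+1.
  suff : k' n = 0.
    rewrite /k' => /eqP; rewrite scaler_eq0 oppr_eq0 mulf_eq0 invr_eq0 expf_eq0 (negbTE q0) andbF orbF.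
    by case/orP=> /eqP // z; rewrite hq // qfactS z mulr0.
  apply: (IH (mu - al) k'); split.
  - by move=> m; apply/GenZ/exp_shift.
  - by move=> m z; rewrite /k' hq ?scaler0 // qfactS z mul0r.
  - by move=> m sm; rewrite /k' hs ?scaler0.
  have d0 := der0 qk ql pi E F i mu.
  have dk r' : exists y2, der qk ql pi E F i mu (k r' * F i ^+ r')
      (if r' is n'.+1 then k' n' * F i ^+ n' else 0) y2.
    have hk := hK r'; have [k1 dk1] := der_Km hk; case: r' hk dk1 => [|n'] hk dk1.
      by exists k1; rewrite expr0 mulr1; move: dk1; rewrite mulr0n subr0.
    have := der_mul H (Km_Nm hk) (Nm_Fn n'.+1) dk1 (der_Fn n').
    rewrite subrK mul0r scaler0 add0r -scalerAr /k' -scalerAl => d.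
    by eexists; exact: d.
  have [y2 hy2] := choice dk.
  have := der_sum (fun r' : 'I_s.+1 => hy2 r'); rewrite -e => d.
  have [e1 _] := der_uniq H d d0.
  by rewrite -[LHS]e1 big_ord_recl /= add0r.
case: r => [|r //]; move: e; rewrite big_ord_recl expr0 mulr1 big1 => [|n _].
  by rewrite addr0 => <-.
by rewrite kS mul0r.
Qed.

Lemma expL_indep mu s k : expL mu 0 s k -> forall r, k r = 0.
Proof.
elim: s mu k => [|s IH] mu k [hK hq hs e] r; first exact: hs.
have kS n : k n.+1 = 0.
  pose c n := (chi al (mu - al *+ n.+1))^-1 * - (qnum q n.+1 * q ^- n).
  pose k' n := c n *: k n.+1.
  suff : k' n = 0.
    rewrite /k' => /eqP; rewrite scaler_eq0 mulf_eq0 invr_eq0 (negbTE (chi_nz H _ _)) oppr_eq0.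
    rewrite mulf_eq0 invr_eq0 expf_eq0 (negbTE q0) andbF orbF.
    by case/orP=> /eqP // z; rewrite hq // qfactS z mulr0.
  apply: (IH (mu - al) k'); split.
  - by move=> m; apply/GenZ/exp_shift.
  - by move=> m z; rewrite /k' hq ?scaler0 // qfactS z mul0r.
  - by move=> m sm; rewrite /k' hs ?scaler0.
  have d0 := der0 qk ql pi E F i mu.
  have dk r' : exists y2, der qk ql pi E F i mu (F i ^+ r' * k r')
      (if r' is n'.+1 then F i ^+ n' * k' n' else 0) y2.
    have hk := hK r'; have [k1 dk1] := der_Km hk; case: r' hk dk1 => [|n'] hk dk1.
      by exists k1; rewrite expr0 mul1r; move: dk1; rewrite mulr0n subr0.
    have := der_mul H (Nm_Fn n'.+1) (Km_Nm hk) (der_Fn n') dk1.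
    rewrite [al *+ _ + _]addrC subrK mulr0 addr0 -scalerAl scalerA scalerAr => d.
    by eexists; exact: d.
  have [y2 hy2] := choice dk.
  have := der_sum (fun r' : 'I_s.+1 => hy2 r'); rewrite -e => d.
  have [e1 _] := der_uniq H d d0.
  by rewrite -[LHS]e1 big_ord_recl /= add0r.
case: r => [|r //]; move: e; rewrite big_ord_recl expr0 mul1r big1 => [|n _].
  by rewrite addr0 => <-.
by rewrite kS mulr0.
Qed.

(** Unnormalised expansions: repeated exponents and vanishing powers are allowed, which makes
    stability under multiplication by the generators easy to prove. [left] tells on which side the
    powers of F_i stand. *)
Inductive KR (left : bool) : A -> U -> Prop :=
| KR0 mu : KR left mu 0
| KRc mu r k y : Km (mu - al *+ r) k -> KR left mu y ->
    KR left mu ((if left then F i ^+ r * k else k * F i ^+ r) + y).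

Lemma KR_term left mu r k : Km (mu - al *+ r) k ->
  KR left mu (if left then F i ^+ r * k else k * F i ^+ r).
Proof. by move=> h; rewrite -[X in KR _ _ X]addr0; apply: KRc => //; exact: KR0. Qed.

Lemma KR_lin left mu c x y : KR left mu x -> KR left mu y -> KR left mu (c *: x + y).
Proof.
move=> hx hy; elim: hx => {mu x} [mu|mu r k x hk _ IH] in hy *; first by rewrite scaler0 add0r.
rewrite scalerDr -addrA.
have -> : c *: (if left then F i ^+ r * k else k * F i ^+ r) =
  if left then F i ^+ r * (c *: k) else (c *: k) * F i ^+ r.
  by case: left {IH hy}; rewrite -?scalerAr -?scalerAl.
by apply: KRc; [exact: GenZ|exact: IH].
Qed.

Lemma KR_lin_map left a b (f : U -> U) x : (forall c x y, f (c *: x + y) = c *: f x + f y) ->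
  (forall r k, Km (a - al *+ r) k ->
     KR left b (f (if left then F i ^+ r * k else k * F i ^+ r))) ->
  KR left a x -> KR left b (f x).
Proof.
move=> fl fk hx; elim: hx fk => {a x} [mu|mu r k x hk _ IH] fk.
  have -> : f 0 = 0 by have := fl (-1) 0 0; rewrite scaler0 addr0 scaleN1r addNr.
  exact: KR0.
rewrite -[X in f (X + _)]scale1r fl; apply: KR_lin; [exact: fk|exact: IH].
Qed.

Lemma Nm_KRr mu y : Nm mu y -> KR false mu y.
Proof.
elim=> [|c|j c z hz IH|c e z w _ IHz _ IHw]; last exact: KR_lin.
- rewrite -[1]mulr1 -[X in _ * X](expr0 (F i)); apply: (KR_term false).
  by rewrite mulr0n subr0; exact: Gen1.
- exact: KR0.
apply: (KR_lin_map _ _ IH) => [e x w|r k hk]; first by rewrite mulrDr -scalerAr.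
rewrite mulrA; case: (eqVneq j i) => [->|ji]; last first.
  apply: (KR_term false); apply: Gen_eq (Gen_mul (Km_Fm 0 ji) hk) _.
  by rewrite mulr0n addr0 addrA.
set d := (chi al (c - al *+ r))^-1.
(* F_i is moved past [k] at the cost of the adjoint term, which stays in [Km] by [Km_ad]. *)
have -> : F i * k * F i ^+ r = 1 *: ((F i * k - d *: (k * F i)) * F i ^+ r)
    + (d *: k) * F i ^+ r.+1.
  by rewrite exprS; nc_simp K U; ring.
apply: KR_lin; apply: (KR_term false).
  by apply: Gen_eq (Km_ad hk) _; lattice H.
by apply: GenZ; apply: Gen_eq hk _; lattice H.
Qed.

Lemma Nm_KRl mu y : Nm mu y -> KR true mu y.
Proof.
apply: (Gen_rind (Q := KR true)) => [|c|j c z hz IH|c e z w _ _ hz hw]; last exact: KR_lin.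
- rewrite -[1]mulr1 -[X in X * _](expr0 (F i)); apply: (KR_term true).
  by rewrite mulr0n subr0; exact: Gen1.
- exact: KR0.
apply: (KR_lin_map (f := fun x => x * F j) _ _ IH) => [e x w|r k hk].
  by rewrite mulrDl -scalerAl.
rewrite -mulrA; case: (eqVneq j i) => [->|ji]; last first.
  apply: (KR_term true); apply: Gen_eq (Gen_mul hk (Km_Fm 0 ji)) _.
  by rewrite mulr0n addr0 addrAC.
set d := chi al (c - al *+ r).
have d0 : d != 0 by exact: chi_nz H _ _.
have -> : F i ^+ r * (k * F i) = (- d) *: (F i ^+ r * (F i * k - d^-1 *: (k * F i)))
    + F i ^+ r.+1 * (d *: k).
  by rewrite exprSr; nc_simp K U; field.
apply: KR_lin; apply: (KR_term true).
  by apply: Gen_eq (Km_ad hk) _; lattice H.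
by apply: GenZ; apply: Gen_eq hk _; lattice H.
Qed.

Lemma sum_ord_widen (f : nat -> U) s t : (s <= t)%N -> (forall r, (s <= r)%N -> f r = 0) ->
  \sum_(r < t) f r = \sum_(r < s) f r.
Proof.
move=> st f0; rewrite (big_ord_widen _ f st) [LHS](bigID (fun r : 'I_t => (r < s)%N)) /=.
by rewrite [X in _ + X]big1 ?addr0 // => r; rewrite -leqNgt => /f0.
Qed.

(** Merging equal exponents and dropping vanishing powers turns [KR] into the normalised expansions,
    the form in which coefficients are unique. *)
Lemma KR_exp left mu y : KR left mu y ->
  exists s k, [/\ forall r, Km (mu - al *+ r) (k r),
    forall r, qfact q r = 0 -> k r = 0, forall r, (s <= r)%N -> k r = 0
    & y = \sum_(r < s) if left then F i ^+ r * k r else k r * F i ^+ r].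
Proof.
pose T k r := if left then F i ^+ r * k else k * F i ^+ r.
have T0 r : T 0 r = 0 by rewrite /T; case: (left); rewrite ?mulr0 ?mul0r.
move=> h; elim: h => {mu y} [mu|mu r k y hk _ [s [k1 [hK hq hs ->]]]].
  by exists 0%N, (fun=> 0); split=> //; [move=> r; exact: Gen0|rewrite big_ord0].
case: (eqVneq (qfact q r) 0) => [z|nz].
  exists s, k1; split=> //.
  by rewrite Fn_eq0 //; case: (left); rewrite ?mul0r ?mulr0 add0r.
exists (maxn s r.+1), (fun p => k1 p + if p == r then k else 0); split.
- by move=> p; apply: GenA => //; case: eqVneq => [->|_] //; exact: Gen0.
- by move=> p z; rewrite hq // add0r; case: eqVneq => // e; rewrite -e z eqxx in nz.
- move=> p; rewrite geq_max => /andP[sp rp].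
  by rewrite hs // add0r gtn_eqF.
have TD a b p : T (a + b) p = T a p + T b p.
  by rewrite /T; case: (left); rewrite ?mulrDr ?mulrDl.
rewrite -[X in X + _ = _]/(T k r) [RHS](eq_bigr (fun p : 'I_(maxn s r.+1) =>
  T (k1 p) p + T (if val p == r then k else 0) p)) => [|p _]; last by rewrite -TD.
rewrite big_split /= addrC; congr (_ + _); last first.
  apply: esym; apply: (@sum_ord_widen (fun p => T (k1 p) p)) => [|p sp]; first exact: leq_maxl.
  by rewrite hs // T0.
have rl : (r < maxn s r.+1)%N by rewrite leq_max ltnSn orbT.
rewrite (bigD1 (Ordinal rl)) //= eqxx big1 ?addr0 // => p pr.
by rewrite ifF ?T0 //; apply: contraNF pr => /eqP e; apply/eqP/val_inj.
Qed.

Lemma expR_ex mu y : Nm mu y -> exists s k, expR mu y s k.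
Proof. by move/Nm_KRr/KR_exp. Qed.

Lemma expL_ex mu y : Nm mu y -> exists s k, expL mu y s k.
Proof. by move/Nm_KRl/KR_exp. Qed.

End RankOne.

(** * Commutators of E-strings and F-strings *)

Section ReflectedGenerators.
Variables (K : fieldType) (A : zmodType) (U : algType K) (I : finType).
Variables (chi : A -> A -> K) (qk ql : A -> U) (pi : I -> A).
Variables (crd : I -> A -> int) (E F : I -> U).
Hypothesis H : pborel chi qk ql pi crd E F.
Variable i : I.
Local Notation Nm := (Gen pi F).
Local Notation Np := (Gen pi E).
Local Notation al := (pi i).
Local Notation q := (chi (pi i) (pi i)).
Local Notation Ka := (qk (pi i)).
Local Notation La := (ql (pi i)).
Local Notation Em := (Fm (fun a b => chi b a) pi E i).
Local Notation Fm := (Fm chi pi F i).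
Local Notation bm := (bm chi pi i).
Local Notation am := (am chi pi i).
Let H' := pborel_swap H.
Let q0 : q != 0 := chi_nz H _ _.

Lemma GKE mu x a : Np mu x -> qk a * x = chi a mu *: (x * qk a).
Proof. exact: (GL H'). Qed.
Lemma GLE mu x a : Np mu x -> ql a * x = (chi mu a)^-1 *: (x * ql a).
Proof. exact: (GK H'). Qed.
Lemma Np_Em j m : Np (pi j + al *+ m) (Em j m).
Proof. exact: Nm_Fm. Qed.

(** Induction on the E-string. The correction [bm] from E_i acting on the F-string occurs twice with
    opposite signs, since passing L_i through [Em j m] costs exactly the scalar of the adjoint
    action. *)
Lemma Em_Fm_comm j k m n : j != k -> j != i -> k != i ->
  Em j m * Fm k n = Fm k n * Em j m.
Proof.
move=> jk ji ki; elim: m n => [|m IH] n; first exact: (Ek_Fm H).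
set e := Em j m; set d := (chi (pi j + al *+ m) al)^-1.
have {}IH p : e * Fm k p = Fm k p * e := IH p.
have -> : Em j m.+1 = E i * e - d *: (e * E i) by [].
have eL : La * e = d *: (e * La) by exact/GLE/Np_Em.
case: n => [|n].
  have c0 : E i * F k = F k * E i by exact: (E_Fm0 H).
  have := IH 0%N; rewrite -/e /= => c1.
  by rewrite mulrBl mulrBr -scalerAl -scalerAr -!mulrA c1 c0 !mulrA c0 c1.
have -> : (E i * e - d *: (e * E i)) * Fm k n.+1 = E i * (e * Fm k n.+1) - d *: (e * (E i * Fm k n.+1)).
  by nc_simp K U; ring.
rewrite (E_Fm H) // IH.
have -> : E i * (Fm k n.+1 * e) - d *: (e * (Fm k n.+1 * E i + bm k n *: (Fm k n * La)))
  = (E i * Fm k n.+1) * e - d *: (e * Fm k n.+1 * E i) - (d * bm k n) *: (e * Fm k n * La).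
  by nc_simp K U; ring.
rewrite (E_Fm H) // !IH.
have -> : (Fm k n.+1 * E i + bm k n *: (Fm k n * La)) * e
  = Fm k n.+1 * E i * e + bm k n *: (Fm k n * (La * e)) by nc_simp K U; ring.
by rewrite eL; nc_simp K U; ring.
Qed.

(** Coefficient of F_i^d times a torus element in the commutator of [Em j m] with [Fm j (m + d)]. At
    [d = 0] and m = M_j it becomes, up to sign and inversion, the normalising constant of the
    reflected F_j. *)
Fixpoint ac j m d : K :=
  if m is n.+1 then - (ac j n d.+1 * qnum q d.+1 * q ^- d) else am j d.

(** The identity by which the terms containing L_i cancel in the inductive step of [Em_Fm]. *)
Lemma ac_rel j m d : ac j m d.+1 * qnum q d.+1 =
  bm j (m + d) * (chi (pi j + al *+ m) al)^-1 * ac j m d.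
Proof.
elim: m d => [|m IH] d.
  rewrite /= add0n mulr0n addr0 /bm /braid.
  by field; rewrite expf_neq0 // !(chi_nz H).
have e : ac j m.+1 d.+1 = - (ac j m d.+2 * qnum q d.+2 * q ^- d.+1) by [].
have f : ac j m.+1 d = - (ac j m d.+1 * qnum q d.+1 * q ^- d) by [].
rewrite e f (IH d.+1) addSnnS mulrSr addrA !(chiDl H) exprS.
by field; rewrite q0 expf_neq0 // !(chi_nz H).
Qed.

Lemma acS0 j m : ac j m.+1 0 = - (bm j m * (chi (pi j + al *+ m) al)^-1 * ac j m 0).
Proof. by have := ac_rel j m 0; rewrite addn0 => <- /=; rewrite expr0 invr1 mulr1. Qed.

Lemma Em_Fm j m : j != i ->
  (forall d, Em j m * Fm j (m + d.+1) = Fm j (m + d.+1) * Em j m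
     + ac j m d.+1 *: (F i ^+ d.+1 * qk (pi j + al *+ m))) /\
  Em j m * Fm j m = Fm j m * Em j m
     + ac j m 0 *: (qk (pi j + al *+ m) - ql (pi j + al *+ m)).
Proof.
move=> ji; elim: m => [|m [IHd IH0]].
  split=> [d|]; first by rewrite add0n mulr0n addr0; exact: (Ej_Fm H).
  by rewrite mulr0n addr0 /= (h_EF H) eqxx mulr1n scaleN1r opprB.
set e := Em j m; set dm := (chi (pi j + al *+ m) al)^-1.
set Km := qk (pi j + al *+ m); set Lm := ql (pi j + al *+ m).
have eE : Em j m.+1 = E i * e - dm *: (e * E i) by [].
have eL : La * e = dm *: (e * La) by exact/GLE/Np_Em.
have KmS : qk (pi j + al *+ m.+1) = Ka * Km.
  by rewrite (h_KK H); congr qk; lattice H.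
have LmS : ql (pi j + al *+ m.+1) = Lm * La.
  by rewrite (h_LL H); congr ql; lattice H.
have KmE : Km * E i = dm^-1 *: (E i * Km) by rewrite /Km (h_KE H) /dm invrK.
have dm0 : dm != 0 by rewrite invr_eq0 (chi_nz H).
(* The commutator [C] is left arbitrary because it has two shapes: a multiple of K - L for [d = 0],
   and of F_i^d K otherwise. *)
have main d C : e * Fm j (m + d) = Fm j (m + d) * e + C ->
  Em j m.+1 * Fm j (m + d.+1) = Fm j (m + d.+1) * Em j m.+1 +
   (ac j m d.+1 * qnum q d.+1) *: (F i ^+ d * (La - q ^- d *: Ka) * Km)
   - (dm * bm j (m + d)) *: (C * La).
  move=> eC; have ed := IHd d; rewrite -/e -/Km in ed; rewrite eE.
  set f := Fm j (m + d.+1) in ed *.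
  have Ef : E i * f = f * E i + bm j (m + d) *: (Fm j (m + d) * La).
    by rewrite /f addnS (E_Fm H).
  have -> : (E i * e - dm *: (e * E i)) * f = E i * (e * f) - dm *: (e * (E i * f)).
    by nc_simp K U; ring.
  rewrite Ef ed.
  have -> : E i * (f * e + ac j m d.+1 *: (F i ^+ d.+1 * Km))
      - dm *: (e * (f * E i + bm j (m + d) *: (Fm j (m + d) * La)))
    = (E i * f) * e + ac j m d.+1 *: ((E i * F i ^+ d.+1) * Km)
      - dm *: ((e * f) * E i) - (dm * bm j (m + d)) *: ((e * Fm j (m + d)) * La).
    by nc_simp K U; ring.
  rewrite Ef ed eC (EFn H).
  have -> : (f * E i + bm j (m + d) *: (Fm j (m + d) * La)) * e
     = f * E i * e + bm j (m + d) *: (Fm j (m + d) * (La * e)) by nc_simp K U; ring.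
  have -> : (f * e + ac j m d.+1 *: (F i ^+ d.+1 * Km)) * E i
     = f * e * E i + ac j m d.+1 *: (F i ^+ d.+1 * (Km * E i)) by nc_simp K U; ring.
  rewrite eL KmE; move: (q ^- d) => x.
  by nc_simp K U; try ring; field.
have com : Km * La = La * Km by rewrite /Km (h_KL H).
split=> [d|]; last first.
  have := main 0%N _; rewrite addn0 addn1 => /(_ _ IH0) ->.
  have r := ac_rel j m 0; rewrite addn0 qnum1 mulr1 -/dm in r.
  rewrite qnum1 mulr1 acS0 -/dm r expr0 mul1r invr1 scale1r KmS LmS -/Km -/Lm.
  have -> : (ac j m 0 *: (Km - Lm)) * La = ac j m 0 *: (La * Km - Lm * La).
    by rewrite -com; nc_simp K U; ring.
  by nc_simp K U; ring.
rewrite addSnnS (main d.+1 _ (IHd d)) -/Km.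
have e2 : ac j m.+1 d.+1 = - (ac j m d.+2 * qnum q d.+2 * q ^- d.+1) by [].
have r := ac_rel j m d.+1; rewrite -/dm in r.
rewrite e2 KmS r.
have -> : (ac j m d.+1 *: (F i ^+ d.+1 * Km)) * La = ac j m d.+1 *: (F i ^+ d.+1 * (La * Km)).
  by rewrite -com; nc_simp K U; ring.
by move: (q ^- d.+1) => x; nc_simp K U; ring.
Qed.

End ReflectedGenerators.

(** * Linear functionals on arbitrary vector spaces *)

Section SeparatingFunctional.
Variables (K : fieldType) (M : lmodType K).
Local Open Scope classical_set_scope.

(** A subspace maximal among those that avoid [x] (Zorn) is a complement of the line through [x];
    [phi] is the coordinate along that line. *)
Lemma separating_functional (x : M) : x != 0 ->
  exists phi : M -> K, (forall c u v, phi (c *: u + v) = c * phi u + phi v) /\ phi x = 1.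
Proof.
move=> x0.
pose P : set (set M) := [set W | ~ W x /\ forall c u v, W u -> W v -> W (c *: u + v)].
have [|W [[Wx Wl] Wmax]] := @Zorn_bigcup _ P.
  move=> F FP Ft; split=> [[W FW]|c u v [W1 FW1 W1u] [W2 FW2 W2v]]; first by case: (FP _ FW).
  case: (Ft _ _ FW1 FW2) => s.
    by exists W2 => //; case: (FP _ FW2) => _; apply=> //; apply: s.
  by exists W1 => //; case: (FP _ FW1) => _; apply=> //; apply: s.
(* The empty set also satisfies [P], so that nonemptiness of [W] has to come from maximality. *)
have W0 : W 0.
  case: (pselect (exists w, W w)) => [[w Ww]|nW].
    by rewrite -[0](addNr w) -scaleN1r; apply: Wl.
  exfalso; apply: (Wmax [set 0]).
    split=> [w Ww|s]; first by case: nW; exists w.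
    by case: nW; exists 0; apply: s.
  by split=> [e|c u v -> ->]; [move: x0; rewrite e eqxx|rewrite /= scaler0 addr0].
have ex v : exists c, W (v - c *: x).
  case: (pselect (W v)) => [Wv|nWv]; first by exists 0; rewrite scale0r subr0.
  pose W' := [set y | exists w a, W w /\ y = a *: v + w].
  have nP : ~ P W'.
    apply: Wmax; split=> [w Ww|s]; first by exists w, 0; rewrite scale0r add0r.
    by apply/nWv/s; exists 0, 1; rewrite scale1r addr0.
  have [w [a [Ww e]]] : W' x.
    apply: contrapT => nx; apply: nP; split=> // c u w [u' [a [Wu ->]]] [w' [b [Ww ->]]].
    exists (c *: u' + w'), (c * a + b); split; first exact: Wl.
    by rewrite scalerDr scalerDl scalerA addrACA.
  have a0 : a != 0.
    by apply/eqP => z; apply: Wx; rewrite e z scale0r add0r.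
  exists a^-1; rewrite e scalerDr scalerA mulVf // scale1r opprD addrA subrr add0r.
  by rewrite -scaleNr -[_ *: w]addr0; apply: Wl.
have uq v c d : W (v - c *: x) -> W (v - d *: x) -> c = d.
  move=> Wc Wd; apply: contrapT => /eqP cd; apply: Wx.
  have dc : d - c != 0 by rewrite subr_eq0 eq_sym.
  have -> : x = (d - c)^-1 *: (-1 *: (v - d *: x) + (v - c *: x)) + 0.
    rewrite scaleN1r opprB -[d *: x - v + _]addrA [- v + _]addrA addNr add0r -scalerBl.
    by rewrite scalerA mulVf // scale1r addr0.
  by apply: (Wl) => //; apply: Wl.
have [phi hphi] := choice ex.
exists phi; split=> [c u v|].
  apply: (uq (c *: u + v)) => //.
  have -> : c *: u + v - (c * phi u + phi v) *: x = c *: (u - phi u *: x) + (v - phi v *: x).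
    by rewrite scalerDl opprD addrACA scalerBr scalerA.
  exact: Wl.
by apply: (uq x) => //; rewrite scale1r subrr.
Qed.

End SeparatingFunctional.

(** * The triangular decomposition in terms of functionals *)

Section Borel.
Variables (K : fieldType) (A : zmodType) (U : algType K) (I : finType).

Definition linon (S : U -> Prop) (f : U -> K) :=
  forall c x y, S x -> S y -> f (c *: x + y) = c * f x + f y.

Lemma linon_lin (f : U -> K) (S : U -> Prop) :
  (forall c u v, f (c *: u + v) = c * f u + f v) -> linon S f.
Proof. by move=> h c x y _ _. Qed.

Lemma linon0 S f : S 0 -> linon S f -> f 0 = 0.
Proof. by move=> s0 /(_ (-1) 0 0 s0 s0); rewrite scaler0 addr0 mulN1r addNr. Qed.

Lemma linonZ S f c x : S 0 -> linon S f -> S x -> f (c *: x) = c * f x.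
Proof. by move=> s0 hf sx; have := hf c x 0 sx s0; rewrite !addr0 (linon0 s0 hf) addr0. Qed.

(* The graph of the functional [y K_a L_b x |-> phi y * gam a b * psi x] on the
   triangular decomposition. *)
Inductive tgraph (qk ql : A -> U) (Nm Np : A -> U -> Prop) (phi psi : A -> U -> K)
    (gam : A -> A -> K) : U -> K -> Prop :=
| tg0 : tgraph qk ql Nm Np phi psi gam 0 0
| tgD mu a b nu y x u c : Nm mu y -> Np nu x -> tgraph qk ql Nm Np phi psi gam u c ->
    tgraph qk ql Nm Np phi psi gam
      (y * (qk a * ql b) * x + u) (phi mu y * gam a b * psi nu x + c).

(** Injectivity of the multiplication from the tensor product of the three subalgebras, with
    independence of the torus monomials: a tensor functional takes one value on all expressions of
    an element. In this form no tensor product has to be built for the reflected halves. *)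
Definition tri (qk ql : A -> U) (Nm Np : A -> U -> Prop) := forall phi psi gam,
  (forall mu, linon (Nm mu) (phi mu)) -> (forall nu, linon (Np nu) (psi nu)) ->
  forall c, tgraph qk ql Nm Np phi psi gam 0 c -> c = 0.

(** With arbitrary [phi], [psi] and [gam] this says only that [u] is a sum of triangular
    products. *)
Definition tspan (qk ql : A -> U) (Nm Np : A -> U -> Prop) :=
  forall u phi psi gam, exists c, tgraph qk ql Nm Np phi psi gam u c.

Record borel chi (qk ql : A -> U) (pi : I -> A) crd (E F : I -> U) : Prop := Borel {
  b_pb : pborel chi qk ql pi crd E F;
  b_tri : tri qk ql (Gen pi F) (Gen pi E);
  b_span : tspan qk ql (Gen pi F) (Gen pi E) }.

Section Tgraph.
Variables (qk ql : A -> U) (Nm Np : A -> U -> Prop) (phi psi : A -> U -> K).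
Variable gam : A -> A -> K.
Hypothesis Nm0 : forall mu, Nm mu 0.
Hypothesis NmD : forall mu c x y, Nm mu x -> Nm mu y -> Nm mu (c *: x + y).
Hypothesis phil : forall mu, linon (Nm mu) (phi mu).
Local Notation G := (tgraph qk ql Nm Np phi psi gam).

Lemma tg_lin k u c v d : G u c -> G v d -> G (k *: u + v) (k * c + d).
Proof.
move=> hu hv; elim: hu => [|mu a b nu y x w e hy hx _ IH].
  by rewrite scaler0 mulr0 !add0r.
have -> : k *: (y * (qk a * ql b) * x + w) + v = (k *: y) * (qk a * ql b) * x + (k *: w + v).
  by nc_simp K U; ring.
have -> : k * (phi mu y * gam a b * psi nu x + e) + d =
  phi mu (k *: y) * gam a b * psi nu x + (k * e + d).
  by rewrite (linonZ k (Nm0 _) (@phil mu) hy) //; ring.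
apply: tgD => //.
by rewrite -[_ *: y]addr0; apply: NmD.
Qed.

Lemma tg_term mu a b nu y x : Nm mu y -> Np nu x ->
  G (y * (qk a * ql b) * x) (phi mu y * gam a b * psi nu x).
Proof. by move=> hy hx; rewrite -[X in G X _]addr0 -[X in G _ X]addr0; apply: tgD => //; exact: tg0. Qed.

Lemma tg_sum (T : Type) (r : seq T) (P : pred T) (u : T -> U) (c : T -> K) :
  (forall t, P t -> G (u t) (c t)) -> G (\sum_(t <- r | P t) u t) (\sum_(t <- r | P t) c t).
Proof.
move=> h; apply: (big_ind2 G) => //; first exact: tg0.
move=> x1 x2 y1 y2 g1 g2; rewrite -[x1]scale1r -[x2]mul1r.
exact: tg_lin.
Qed.

End Tgraph.

(** [gam] is a delta function of one torus exponent, which tells K_j from L_j because pi j is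
    nonzero. In the positive half the torus elements are moved to the left of [y1] and [y2] before a
    functional is applied, whence the two characters. *)
Lemma tri_inj (qk ql : A -> U) (pi : I -> A) (crd : I -> A -> int) (chi : A -> A -> K) (E F : I -> U) : (1 : U) != 0 ->
  (forall i j, crd i (pi j) = (i == j)%:Z) -> (forall i, crd i 0 = 0) ->
  qk 0 = 1 -> ql 0 = 1 -> bihom chi ->
  (forall mu x a, Gen pi E mu x -> qk a * x = chi a mu *: (x * qk a)) ->
  (forall mu x a, Gen pi E mu x -> ql a * x = (chi mu a)^-1 *: (x * ql a)) ->
  tri qk ql (Gen pi F) (Gen pi E) ->
  (forall j mu y1 y2, Gen pi F mu y1 -> Gen pi F mu y2 ->
    y1 * qk (pi j) + y2 * ql (pi j) = 0 -> y1 = 0 /\ y2 = 0) /\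
  (forall j mu y1 y2, Gen pi E mu y1 -> Gen pi E mu y2 ->
    y1 * qk (pi j) + y2 * ql (pi j) = 0 -> y1 = 0 /\ y2 = 0).
Proof.
move=> o1 cp c0 k0 l0 [ch0 _ _] gk gl T.
have pn j : pi j != 0 by apply/eqP => e; have := cp j j; rewrite e c0 eqxx.
have [one [onel one1]] := separating_functional o1.
have sep (x : U) : (forall phi : U -> K, (forall c u v, phi (c *: u + v) = c * phi u + phi v) ->
    phi x = 0) -> x = 0.
  move=> h; apply/eqP; apply: contraT => /separating_functional[phi [pl p1]].
  by have := h _ pl; rewrite p1 => /eqP; rewrite oner_eq0.
split=> j mu y1 y2 h1 h2 e.
  have tg phi gam : tgraph qk ql (Gen pi F) (Gen pi E) (fun=> phi) (fun=> one) gam 0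
      (phi y1 * gam (pi j) 0 * 1 + (phi y2 * gam 0 (pi j) * 1 + 0)).
    have -> : 0 = y1 * (qk (pi j) * ql 0) * 1 + (y2 * (qk 0 * ql (pi j)) * 1 + 0) :> U.
      by rewrite l0 k0 !mulr1 mul1r addr0 e.
    have t phi' gam' : tgraph qk ql (Gen pi F) (Gen pi E) (fun=> phi') (fun=> one) gam'
        (y1 * (qk (pi j) * ql 0) * 1 + (y2 * (qk 0 * ql (pi j)) * 1 + 0))
        (phi' y1 * gam' (pi j) 0 * one 1 + (phi' y2 * gam' 0 (pi j) * one 1 + 0)).
      apply: (tgD _ _ h1 (Gen1 pi E)).
      by apply: (tgD _ _ h2 (Gen1 pi E)); exact: tg0.
    by have := t phi gam; rewrite one1.
  have T' phi gam (pl : forall c u v, phi (c *: u + v) = c * phi u + phi v) :=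
    T _ _ gam (fun mu => linon_lin (S := Gen pi F mu) pl)
      (fun nu => linon_lin (S := Gen pi E nu) onel) _ (tg phi gam).
  split; apply: sep => phi pl.
    have := T' phi (fun a b => (b == 0)%:R) pl; rewrite eqxx (negbTE (pn j)).
    by rewrite ?(mul0r, mulr0, mulr1, mul1r, addr0, add0r).
  have := T' phi (fun a b => (a == 0)%:R) pl; rewrite eqxx (negbTE (pn j)).
  by rewrite ?(mul0r, mulr0, mulr1, mul1r, addr0, add0r).
have ck : chi (pi j) mu != 0 by exact: ch0.
have cl : chi mu (pi j) != 0 by exact: ch0.
have t psi gam : tgraph qk ql (Gen pi F) (Gen pi E) (fun=> one) (fun=> psi) gam 0
    (1 * gam (pi j) 0 * psi ((chi (pi j) mu)^-1 *: y1)
     + (1 * gam 0 (pi j) * psi (chi mu (pi j) *: y2) + 0)).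
  have -> : 0 = 1 * (qk (pi j) * ql 0) * ((chi (pi j) mu)^-1 *: y1)
      + (1 * (qk 0 * ql (pi j)) * (chi mu (pi j) *: y2) + 0) :> U.
    rewrite l0 k0 !mulr1 !mul1r -!scalerAr (gk _ _ _ h1) (gl _ _ _ h2) !scalerA.
    by rewrite mulVf // mulfV // !scale1r addr0 e.
  have -> : 1 = one 1 by [].
  apply: (tgD _ _ (Gen1 pi F) (GenZ _ h1)).
  by apply: (tgD _ _ (Gen1 pi F) (GenZ _ h2)); exact: tg0.
have T' psi gam (pl : forall c u v, psi (c *: u + v) = c * psi u + psi v) :=
  T _ _ gam (fun mu => linon_lin (S := Gen pi F mu) onel)
    (fun nu => linon_lin (S := Gen pi E nu) pl) _ (t psi gam).
suff [z1 z2] : (chi (pi j) mu)^-1 *: y1 = 0 /\ chi mu (pi j) *: y2 = 0.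
  move/eqP: z1; rewrite scaler_eq0 invr_eq0 (negbTE ck) => /eqP ->.
  by move/eqP: z2; rewrite scaler_eq0 (negbTE cl) => /eqP ->.
split; apply: sep => phi pl.
  have := T' phi (fun a b => (b == 0)%:R) pl; rewrite eqxx (negbTE (pn j)).
  by rewrite ?(mul0r, mulr0, mulr1, mul1r, addr0, add0r).
have := T' phi (fun a b => (a == 0)%:R) pl; rewrite eqxx (negbTE (pn j)).
by rewrite ?(mul0r, mulr0, mulr1, mul1r, addr0, add0r).
Qed.

End Borel.

(** * Commutation with torus elements and rescaling *)

Section GenScalars.
Variables (K : fieldType) (A : zmodType) (U : algType K) (J : Type).
Variables (dg : J -> A) (g : J -> U).

Lemma Gen_scal (z : U) (c : A -> K) mu x :
  c 0 = 1 -> (forall a b, c (a + b) = c a * c b) ->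
  (forall j, z * g j = c (dg j) *: (g j * z)) ->
  Gen dg g mu x -> z * x = c mu *: (x * z).
Proof.
move=> c0 cD h; elim=> [|a|j a y _ IH|a e y w _ IHy _ IHw].
- by rewrite c0 scale1r mul1r mulr1.
- by rewrite mulr0 mul0r scaler0.
- by rewrite mulrA h -scalerAl -[_ * _ * y]mulrA IH -scalerAr scalerA mulrA cD.
- by rewrite mulrDr -scalerAr IHy IHw mulrDl scalerDr -scalerAl !scalerA mulrC.
Qed.

Lemma Gen_rescale (s : J -> K) mu x : (forall j, s j != 0) ->
  Gen dg (fun j => s j *: g j) mu x <-> Gen dg g mu x.
Proof.
move=> s0; split; apply: Gen_sub => j; first exact/GenZ/Gen_gen.
rewrite -[g j]scale1r -(mulVf (s0 j)) -scalerA.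
exact/GenZ/(Gen_gen dg (fun j => s j *: g j)).
Qed.

End GenScalars.

(** * The negative half after reflection at i *)

Section ReflectedHalf.
Variables (K : fieldType) (A : zmodType) (U : algType K) (I : finType).
Variables (chi : A -> A -> K) (qk ql : A -> U) (pi : I -> A).
Variables (crd : I -> A -> int) (E F : I -> U).
Hypothesis H : pborel chi qk ql pi crd E F.
Variables (i : I) (M : I -> nat).
Local Notation al := (pi i).
Local Notation q := (chi (pi i) (pi i)).
Local Notation La := (ql (pi i)).
Local Notation Fm := (Fm chi pi F i).
Local Notation bm := (bm chi pi i).
Local Notation Km := (Gen (@km_deg A I pi i) (@km_gen K A U I chi pi F i)).
Hypothesis hM : forall j, j != i -> bm j (M j) = 0 /\ forall k, (k < M j)%N -> bm j k != 0.

Let q0 : q != 0 := chi_nz H _ _.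

Definition rpi j := if j == i then - al else pi j + al *+ M j.
(** Up to scalars the images of the F_j under an isomorphism of Lusztig's type: L_i^-1 E_i takes the
    place of F_i, the end of the string that of F_j. The reflected E_j are obtained by the same
    formula from the swapped data. *)
Definition rf j := if j == i then ql (- al) * E i else Fm j (M j).
Local Notation eh := (ql (- al) * E i).
Local Notation N' := (Gen rpi rf).

Lemma N'_eh : N' (- al) eh.
Proof. by have := Gen_gen rpi rf i; rewrite /rpi /rf eqxx. Qed.

Lemma Fm_gtM j m : j != i -> (M j < m)%N -> Fm j m = 0.
Proof.
move=> ji; elim: m => // m IH; rewrite ltnS leq_eqVlt => /orP[/eqP <-|/IH z].
  by apply: (Fm_eq0 H) => //; case: (hM ji).
by rewrite /= z mulr0 mul0r scaler0 subrr.
Qed.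

(** Downward along the string: the skew bracket with L_i^-1 E_i lowers [Fm j n.+1] to a multiple of
    [Fm j n], and the scalar [bm j n] is nonzero below [M j]; beyond [M j] the string vanishes. *)
Lemma N'_Fm j m : j != i -> N' (pi j + al *+ m) (Fm j m).
Proof.
move=> ji; case: (ltnP (M j) m) => [lt|le]; first by rewrite Fm_gtM //; exact: Gen0.
rewrite -(subKn le); elim: (M j - m)%N (leq_subr m (M j)) => [|d IH] ld.
  by rewrite subn0; have := Gen_gen rpi rf j; rewrite /rpi /rf (negbTE ji).
have {IH} := IH (ltnW ld); set n := (M j - d.+1)%N.
have -> : (M j - d)%N = n.+1 by rewrite /n subnSK.
move=> hf; set f := Fm j n.+1 in hf.
have b0 : bm j n != 0 by case: (hM ji) => _; apply; rewrite /n; lia.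
have e := E_Fm H n ji; rewrite -/f in e.
have Lf := GL H (- al) (Nm_Fm chi pi F i j n.+1); rewrite -/f in Lf.
have Lg := GL H (- al) (Nm_Fm chi pi F i j n).
have -> : Fm j n = ((bm j n)^-1 * chi (pi j + al *+ n) al) *:
    (eh * f - chi (pi j + al *+ n.+1) (- al) *: (f * eh)).
  have -> : eh * f = ql (- al) * (E i * f) by rewrite mulrA.
  rewrite e; have -> : ql (- al) * (f * E i + bm j n *: (Fm j n * La)) =
    ql (- al) * f * E i + bm j n *: (ql (- al) * Fm j n * La) by nc_simp K U; ring.
  rewrite Lf Lg (chiNr H (pi j + al *+ n)) -[_ *: (_ * _) * La]scalerAl -[Fm j n * _ * La]mulrA (LNL H) mulr1.
  move: (chi_nz H (pi j + al *+ n) al) b0; move: (chi _ al) (bm j n) (chi _ (- al)) => x y z x0 y0.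
  by nc_simp K U; field; rewrite ?x0 ?y0.
apply/GenZ/GenB.
  by apply: Gen_eq (Gen_mul N'_eh hf) _; lattice H.
by apply/GenZ; apply: Gen_eq (Gen_mul hf N'_eh) _; lattice H.
Qed.

Lemma Km_N' mu k : Km mu k -> N' mu k.
Proof. by apply: Gen_sub => -[[j ji] m]; exact: N'_Fm. Qed.

Lemma eh_Km mu k : Km mu k -> exists2 k1, Km (mu - al) k1 &
  eh * k = (chi mu al)^-1 *: (k * eh) + k1.
Proof.
move=> hk; have [k1 h1 e] := Km_E H hk.
exists (chi (mu - al) (- al) *: k1); first exact: GenZ.
rewrite -mulrA e mulrDr 2!mulrA (GL H _ (Km_Nm hk)) (GL H _ (Km_Nm h1)).
by rewrite -!scalerAl -[k1 * _ * La]mulrA (LNL H) mulr1 (chiNr H mu) -mulrA.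
Qed.

(** Counterpart of [KR] for the reflected half, with L_i^-1 E_i in the role of F_i. *)
Inductive KE (left : bool) : A -> U -> Prop :=
| KE0 mu : KE left mu 0
| KEc mu p k y : Km (mu + al *+ p) k -> KE left mu y ->
    KE left mu ((if left then eh ^+ p * k else k * eh ^+ p) + y).

Lemma KE_term left mu p k : Km (mu + al *+ p) k ->
  KE left mu (if left then eh ^+ p * k else k * eh ^+ p).
Proof. by move=> h; rewrite -[X in KE _ _ X]addr0; apply: KEc => //; exact: KE0. Qed.

Lemma KE_lin left mu c x y : KE left mu x -> KE left mu y -> KE left mu (c *: x + y).
Proof.
move=> hx hy; elim: hx => {mu x} [mu|mu r k x hk _ IH] in hy *; first by rewrite scaler0 add0r.
rewrite scalerDr -addrA.
have -> : c *: (if left then eh ^+ r * k else k * eh ^+ r) =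
  if left then eh ^+ r * (c *: k) else (c *: k) * eh ^+ r.
  by case: left {IH hy}; rewrite -?scalerAr -?scalerAl.
by apply: KEc; [exact: GenZ|exact: IH].
Qed.

Lemma KE_lin_map left a b (f : U -> U) x : (forall c x y, f (c *: x + y) = c *: f x + f y) ->
  (forall r k, Km (a + al *+ r) k ->
     KE left b (f (if left then eh ^+ r * k else k * eh ^+ r))) ->
  KE left a x -> KE left b (f x).
Proof.
move=> fl fk hx; elim: hx fk => {a x} [mu|mu r k x hk _ IH] fk.
  have -> : f 0 = 0 by have := fl (-1) 0 0; rewrite scaler0 addr0 scaleN1r addNr.
  exact: KE0.
rewrite -[X in f (X + _)]scale1r fl; apply: KE_lin; [exact: fk|exact: IH].
Qed.

Lemma N'_KEr mu y : N' mu y -> KE false mu y.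
Proof.
elim=> [|c|j c z hz IH|c e z w _ IHz _ IHw]; last exact: KE_lin.
- rewrite -[1]mulr1 -[X in _ * X](expr0 eh); apply: (KE_term false).
  by rewrite mulr0n addr0; exact: Gen1.
- exact: KE0.
apply: (KE_lin_map _ _ IH) => [e x w|r k hk]; first by rewrite mulrDr -scalerAr.
rewrite mulrA /rpi /rf; case: (eqVneq j i) => [_|ji]; last first.
  apply: (KE_term false); apply: Gen_eq (Gen_mul (Km_Fm chi pi F _ ji) hk) _.
  by rewrite addrA.
have [k1 h1 ->] := eh_Km hk.
have -> : ((chi (c + al *+ r) al)^-1 *: (k * eh) + k1) * eh ^+ r =
  1 *: (((chi (c + al *+ r) al)^-1 *: k) * eh ^+ r.+1) + k1 * eh ^+ r.
  by rewrite exprS; move: eh (_ ^-1) => x d; nc_simp K U; ring.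
apply: KE_lin; apply: (KE_term false).
  by apply: GenZ; apply: Gen_eq hk _; lattice H.
by apply: Gen_eq h1 _; lattice H.
Qed.

Lemma N'_KEl mu y : N' mu y -> KE true mu y.
Proof.
apply: (Gen_rind (Q := KE true)) => [|c|j c z hz IH|c e z w _ _ hz hw]; last exact: KE_lin.
- rewrite -[1]mulr1 -[X in X * _](expr0 eh); apply: (KE_term true).
  by rewrite mulr0n addr0; exact: Gen1.
- exact: KE0.
apply: (KE_lin_map (f := fun x => x * rf j) _ _ IH) => [e x w|r k hk].
  by rewrite mulrDl -scalerAl.
rewrite -mulrA /rpi /rf; case: (eqVneq j i) => [_|ji]; last first.
  apply: (KE_term true); apply: Gen_eq (Gen_mul hk (Km_Fm chi pi F _ ji)) _.
  by lattice H.
have [k1 h1 e] := eh_Km hk; set d := chi (c + al *+ r) al in e.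
have d0 : d != 0 by exact: chi_nz H _ _.
have -> : eh ^+ r * (k * eh) = 1 *: (eh ^+ r.+1 * (d *: k)) + eh ^+ r * (- d *: k1).
  rewrite exprSr -[_ * eh * _]mulrA -[eh * (d *: k)]scalerAr e; move: eh => x.
  by nc_simp K U; field.
apply: KE_lin; apply: (KE_term true); apply: GenZ.
  by apply: Gen_eq hk _; lattice H.
by apply: Gen_eq h1 _; lattice H.
Qed.

Lemma KE_N' left mu y : KE left mu y -> N' mu y.
Proof.
have he p : N' (- (al *+ p)) (eh ^+ p).
  by rewrite -mulNrn; apply/Gen_exp/N'_eh.
elim=> {mu y} [mu|mu p k y hk _ IH]; first exact: Gen0.
apply: GenA => //; case: left {IH}.
  by apply: Gen_eq (Gen_mul (he p) (Km_N' hk)) _; lattice H.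
by apply: Gen_eq (Gen_mul (Km_N' hk) (he p)) _; lattice H.
Qed.

(* The coefficient of [F i ^+ r] in the expansions of elements of [U^-]. *)
Lemma coefR_ex : exists c : A -> U -> nat -> U, forall mu y, Gen pi F mu y ->
  exists s, expR chi pi F i mu y s (c mu y).
Proof.
have h (p : A * U) : exists k, Gen pi F p.1 p.2 -> exists s, expR chi pi F i p.1 p.2 s k.
  case: (pselect (Gen pi F p.1 p.2)) => [hy|n]; last by exists (fun=> 0).
  by have [s [k hk]] := expR_ex H i hy; exists k => _; exists s.
by have [f hf] := choice h; exists (fun mu y => f (mu, y)) => mu y /(hf (mu, y)).
Qed.

Lemma coefL_ex : exists c : A -> U -> nat -> U, forall mu y, Gen pi F mu y ->
  exists s, expL chi pi F i mu y s (c mu y).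
Proof.
have h (p : A * U) : exists k, Gen pi F p.1 p.2 -> exists s, expL chi pi F i p.1 p.2 s k.
  case: (pselect (Gen pi F p.1 p.2)) => [hy|n]; last by exists (fun=> 0).
  by have [s [k hk]] := expL_ex H i hy; exists k => _; exists s.
by have [f hf] := choice h; exists (fun mu y => f (mu, y)) => mu y /(hf (mu, y)).
Qed.

Lemma expR_lin mu c y z s t k l : expR chi pi F i mu y s k -> expR chi pi F i mu z t l ->
  expR chi pi F i mu (c *: y + z) (maxn s t) (fun r => c *: k r + l r).
Proof.
move=> [a1 b1 c1 ->] [a2 b2 c2 ->]; split.
- by move=> r; apply: GenD.
- by move=> r z0; rewrite b1 // b2 // scaler0 addr0.
- by move=> r; rewrite geq_max => /andP[h1 h2]; rewrite c1 // c2 // scaler0 addr0.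
have e1 := @sum_ord_widen _ U (fun r => k r * F i ^+ r) s (maxn s t) (leq_maxl _ _).
have e2 := @sum_ord_widen _ U (fun r => l r * F i ^+ r) t (maxn s t) (leq_maxr _ _).
rewrite -e1 => [|r h]; last by rewrite c1 // mul0r.
rewrite -e2 => [|r h]; last by rewrite c2 // mul0r.
rewrite scaler_sumr -big_split; apply: eq_bigr => r _.
by rewrite mulrDl -scalerAl.
Qed.

Lemma expL_lin mu c y z s t k l : expL chi pi F i mu y s k -> expL chi pi F i mu z t l ->
  expL chi pi F i mu (c *: y + z) (maxn s t) (fun r => c *: k r + l r).
Proof.
move=> [a1 b1 c1 ->] [a2 b2 c2 ->]; split.
- by move=> r; apply: GenD.
- by move=> r z0; rewrite b1 // b2 // scaler0 addr0.
- by move=> r; rewrite geq_max => /andP[h1 h2]; rewrite c1 // c2 // scaler0 addr0.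
have e1 := @sum_ord_widen _ U (fun r => F i ^+ r * k r) s (maxn s t) (leq_maxl _ _).
have e2 := @sum_ord_widen _ U (fun r => F i ^+ r * l r) t (maxn s t) (leq_maxr _ _).
rewrite -e1 => [|r h]; last by rewrite c1 // mulr0.
rewrite -e2 => [|r h]; last by rewrite c2 // mulr0.
rewrite scaler_sumr -big_split; apply: eq_bigr => r _.
by rewrite mulrDr -scalerAr.
Qed.

Lemma expR_uniq mu y s t k l : expR chi pi F i mu y s k -> expR chi pi F i mu y t l -> k =1 l.
Proof.
move=> h1 h2 r; have := expR_lin (-1) h2 h1; rewrite scaleN1r addNr.
by move/(expR_indep H)/(_ r); rewrite scaleN1r addrC => /subr0_eq.
Qed.

Lemma expL_uniq mu y s t k l : expL chi pi F i mu y s k -> expL chi pi F i mu y t l -> k =1 l.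
Proof.
move=> h1 h2 r; have := expL_lin (-1) h2 h1; rewrite scaleN1r addNr.
by move/(expL_indep H)/(_ r); rewrite scaleN1r addrC => /subr0_eq.
Qed.

Lemma expR_term mu r k : Km mu k -> qfact q r != 0 ->
  expR chi pi F i (mu + al *+ r) (k * F i ^+ r) r.+1 (fun p => if p == r then k else 0).
Proof.
move=> hk nz; split.
- by move=> p; case: eqVneq => [->|_]; [rewrite addrK|exact: Gen0].
- by move=> p z; case: eqVneq => // e; rewrite -e z eqxx in nz.
- by move=> p rp; rewrite gtn_eqF.
rewrite big_ord_recr /= eqxx big1 ?add0r // => p _.
by rewrite ltn_eqF ?mul0r.
Qed.

Lemma expL_term mu r k : Km mu k -> qfact q r != 0 ->
  expL chi pi F i (mu + al *+ r) (F i ^+ r * k) r.+1 (fun p => if p == r then k else 0).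
Proof.
move=> hk nz; split.
- by move=> p; case: eqVneq => [->|_]; [rewrite addrK|exact: Gen0].
- by move=> p z; case: eqVneq => // e; rewrite -e z eqxx in nz.
- by move=> p rp; rewrite gtn_eqF.
rewrite big_ord_recr /= eqxx big1 ?add0r // => p _.
by rewrite ltn_eqF ?mulr0.
Qed.

Lemma KNF_exp r : exists2 c : K, c != 0 & (qk (- al) * F i) ^+ r = c *: (F i ^+ r * qk (- (al *+ r))).
Proof.
elim: r => [|r [c c0 IH]].
  by exists 1; rewrite ?oner_eq0 // !expr0 mulr0n oppr0 (h_K0 H) mulr1 scale1r.
exists (c * q ^+ r.+1); first by rewrite mulf_neq0 // expf_neq0.
rewrite exprS IH -scalerAr -scalerA; congr (_ *: _).
rewrite -[qk (- al) * F i * _]mulrA [F i * (_ * _)]mulrA -exprS mulrA (KFn H) -scalerAl.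
rewrite (chiNl H) exprVn invrK -[_ * qk (- al) * _]mulrA (h_KK H).
by congr (_ *: (_ * qk _)); lattice H.
Qed.

End ReflectedHalf.

(** * The triangular decomposition survives the reflection *)

Section ReflectedTriangular.
Variables (K : fieldType) (A : zmodType) (U : algType K) (I : finType).
Variables (chi : A -> A -> K) (qk ql : A -> U) (pi : I -> A).
Variables (crd : I -> A -> int) (E F : I -> U).
Hypothesis B : borel chi qk ql pi crd E F.
Variables (i : I) (M : I -> nat).
Local Notation al := (pi i).
Local Notation q := (chi (pi i) (pi i)).
Local Notation Ka := (qk (pi i)).
Local Notation La := (ql (pi i)).
Local Notation chiT := (fun a b => chi b a).
Local Notation bmT := (bm chiT pi i).
Local Notation bm := (bm chi pi i).
Hypothesis hM : forall j, j != i -> bm j (M j) = 0 /\ forall k, (k < M j)%N -> bm j k != 0.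
Let H := b_pb B.
Let H' := pborel_swap H.
Let q0 : q != 0 := chi_nz H _ _.
Local Notation Nm := (Gen pi F).
Local Notation Np := (Gen pi E).
Local Notation Km := (Gen (@km_deg A I pi i) (@km_gen K A U I chi pi F i)).
Local Notation Kp := (Gen (@km_deg A I pi i) (@km_gen K A U I chiT pi E i)).
Local Notation pi' := (rpi pi i M).
Local Notation f := (rf chi ql pi E F i M).
Local Notation e := (rf chiT qk pi F E i M).
Local Notation eh := (ql (- pi i) * E i).
Local Notation fh := (qk (- pi i) * F i).

(** Hence the E-strings end where the F-strings do, and one function [M] describes the reflection of
    both halves. *)
Lemma bm_swap j m : bm j m = chi (pi j) al / chi al (pi j) * bmT j m.
Proof.
by rewrite [in LHS]/bm [in RHS]/bmT /braid; field; rewrite !(chi_nz H) expf_neq0.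
Qed.

Lemma hM' j : j != i -> bmT j (M j) = 0 /\
  forall k, (k < M j)%N -> bmT j k != 0.
Proof.
move=> /hM[b0 bk]; have u k : (bm j k == 0) = (bmT j k == 0).
  by rewrite bm_swap mulf_eq0 mulf_eq0 invr_eq0 !(negbTE (chi_nz H _ _)).
split=> [|k /bk]; last by rewrite u.
by apply/eqP; rewrite -u b0.
Qed.

Lemma EnL a n : ql a * E i ^+ n = chi al a ^- n *: (E i ^+ n * ql a).
Proof. exact: (KFn H'). Qed.

(* Families [u a b] of combinations of [F ^+ r * K_a L_b * E ^+ p] (up to a shift
   of [a] and [b]) of total length [r + p] less than [n]. *)
Inductive Ex (n : nat) : (A -> A -> U) -> Prop :=
| Ex0 : Ex n (fun _ _ => 0)
| ExD r p da db cf u : (r + p < n)%N -> Ex n u ->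
    Ex n (fun a b => cf a b *: (F i ^+ r * (qk (a + da) * ql (b + db)) * E i ^+ p) + u a b).

Lemma Ex_ext n u v : Ex n u -> (forall a b, u a b = v a b) -> Ex n v.
Proof. by move=> h e1; suff <- : u = v by []; apply/funext => a; apply/funext. Qed.

Lemma Ex_term n r p da db cf : (r + p < n)%N ->
  Ex n (fun a b => cf a b *: (F i ^+ r * (qk (a + da) * ql (b + db)) * E i ^+ p)).
Proof. by move=> h; apply: Ex_ext (ExD da db cf h (Ex0 n)) _ => a b; rewrite addr0. Qed.

Lemma Ex_add n u v (c : A -> A -> K) : Ex n u -> Ex n v -> Ex n (fun a b => c a b *: u a b + v a b).
Proof.
move=> hu hv; elim: hu => [|r p da db cf w h _ IH].
  by apply: Ex_ext hv _ => a b; rewrite scaler0 add0r.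
apply: Ex_ext (ExD da db (fun a b => c a b * cf a b) h IH) _ => a b.
by rewrite scalerDr scalerA addrA.
Qed.

Lemma EFr r : E i * F i ^+ r = F i ^+ r * E i + qnum q r *: (F i ^+ r.-1 * (La - q ^- r.-1 *: Ka)).
Proof. by case: r => [|r]; rewrite ?(EFn H) // expr0 qnum0 scale0r addr0 mulr1 mul1r. Qed.

Lemma eh_term r p a b : eh * (F i ^+ r * (qk a * ql b) * E i ^+ p) =
  (q ^- r * (chi a al)^-1 * chi al b) *: (F i ^+ r * (qk a * ql (b - al)) * E i ^+ p.+1)
  + ((qnum q r * q ^- r.-1) *: (F i ^+ r.-1 * (qk a * ql b) * E i ^+ p)
  + (- (qnum q r * q ^- r.-1 * q ^- r.-1)) *:
      (F i ^+ r.-1 * (qk (a + al) * ql (b - al)) * E i ^+ p)).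
Proof.
have -> : eh * (F i ^+ r * (qk a * ql b) * E i ^+ p) =
  ql (- al) * (E i * F i ^+ r) * (qk a * ql b) * E i ^+ p by rewrite !mulrA.
rewrite EFr.
have -> : ql (- al) * (F i ^+ r * E i + qnum q r *: (F i ^+ r.-1 * (La - q ^- r.-1 *: Ka))) *
    (qk a * ql b) * E i ^+ p =
  (ql (- al) * F i ^+ r) * (E i * qk a * ql b) * E i ^+ p +
  qnum q r *: ((ql (- al) * F i ^+ r.-1) * (La * qk a * ql b) * E i ^+ p) +
  (- (qnum q r * q ^- r.-1)) *: ((ql (- al) * F i ^+ r.-1) * (Ka * qk a * ql b) * E i ^+ p).
  by move: (q ^- _) => x; nc_simp K U; ring.
rewrite !(LFn H) (chiNr H) !exprVn.
have e1 : E i * qk a * ql b = ((chi a al)^-1 * chi al b) *: (qk a * ql b * E i).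
  rewrite -[qk a * ql b * _]mulrA (h_LE H) -scalerAr mulrA (h_KE H) -!scalerAl !scalerA.
  by rewrite -[LHS]scale1r; congr (_ *: _); field; rewrite !(chi_nz H).
have e2 : ql (- al) * (qk a * ql b) = qk a * ql (b - al).
  by rewrite mulrA -(h_KL H) -mulrA (h_LL H) [- al + b]addrC.
have e3 : ql (- al) * (La * qk a * ql b) = qk a * ql b.
  by rewrite -!mulrA mulrA (LNL H) mul1r.
have e4 : ql (- al) * (Ka * qk a * ql b) = qk (a + al) * ql (b - al).
  by rewrite (h_KK H) mulrA -(h_KL H) -mulrA (h_LL H) [al + a]addrC [- al + b]addrC.
have -> : q ^- r *: (F i ^+ r * ql (- al)) * (E i * qk a * ql b) * E i ^+ p =
  (q ^- r * (chi a al)^-1 * chi al b) *: (F i ^+ r * (qk a * ql (b - al)) * E i ^+ p.+1).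
  rewrite e1 -e2 exprS; move: (q ^- r) (chi a al)^-1 => x y.
  by nc_simp K U; ring.
have -> : q ^- r.-1 *: (F i ^+ r.-1 * ql (- al)) * (La * qk a * ql b) * E i ^+ p =
  q ^- r.-1 *: (F i ^+ r.-1 * (qk a * ql b) * E i ^+ p).
  by rewrite -!scalerAl -[_ * ql (- al) * _]mulrA e3.
have -> : q ^- r.-1 *: (F i ^+ r.-1 * ql (- al)) * (Ka * qk a * ql b) * E i ^+ p =
  q ^- r.-1 *: (F i ^+ r.-1 * (qk (a + al) * ql (b - al)) * E i ^+ p).
  by rewrite -!scalerAl -[_ * ql (- al) * _]mulrA e4.
by rewrite !scalerA mulNr addrA.
Qed.

Lemma Ex_eh n u : Ex n u -> Ex n.+1 (fun a b => eh * u a b).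
Proof.
elim=> [|r p da db cf w h _ IH]; first by apply: Ex_ext (Ex0 _) _ => a b; rewrite mulr0.
have t1 := @Ex_term n.+1 r p.+1 da (db - al)
  (fun a b => cf a b * (q ^- r * (chi (a + da) al)^-1 * chi al (b + db))).
have t2 := @Ex_term n.+1 r.-1 p da db (fun a b => cf a b * (qnum q r * q ^- r.-1)).
have t3 := @Ex_term n.+1 r.-1 p (da + al) (db - al)
  (fun a b => cf a b * (- (qnum q r * q ^- r.-1 * q ^- r.-1))).
have l1 : (r + p.+1 < n.+1)%N by rewrite addnS.
have l2 : (r.-1 + p < n.+1)%N by apply: leq_ltn_trans (leqW h); rewrite leq_add2r leq_pred.
apply: Ex_ext (Ex_add (fun _ _ => 1) (t1 l1) (Ex_add (fun _ _ => 1) (t2 l2)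
  (Ex_add (fun _ _ => 1) (t3 l2) IH))) _ => a b.
rewrite mulrDr -scalerAr eh_term !scale1r !scalerDr !scalerA !addrA.
by rewrite -!addrA.
Qed.

Lemma fh_exp r : exists2 c : K, c != 0 & fh ^+ r = c *: (F i ^+ r * qk (- (al *+ r))).
Proof. exact: (KNF_exp H). Qed.

Lemma eh_exp p : exists2 c : K, c != 0 & eh ^+ p = c *: (E i ^+ p * ql (- (al *+ p))).
Proof. exact: (KNF_exp H'). Qed.

Lemma eh_eq0 p : qfact q p = 0 -> eh ^+ p = 0.
Proof. by move=> z; have [c _ ->] := eh_exp p; rewrite (Fn_eq0 H') // mul0r scaler0. Qed.

Lemma fh_eq0 p : qfact q p = 0 -> fh ^+ p = 0.
Proof. by move=> z; have [c _ ->] := fh_exp p; rewrite (Fn_eq0 H) // mul0r scaler0. Qed.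

(** Reordering trades a letter E_i and a letter F_i for torus elements, so all corrections are
    shorter than the main term; the coefficient of the latter is a product of character values,
    hence invertible. *)
Lemma exchange p r : exists cf u, [/\ forall a b, cf a b != 0, Ex (r + p) u &
  forall a b, eh ^+ p * (qk a * ql b) * fh ^+ r =
    cf a b *: (F i ^+ r * (qk (a + - (al *+ r)) * ql (b + - (al *+ p))) * E i ^+ p) + u a b].
Proof.
elim: p => [|p [cf [u [c0 hu IH]]]].
  have [c c0 ec] := fh_exp r.
  exists (fun a b => c * chi a al ^- r * chi al b ^+ r), (fun _ _ => 0); split.
  - by move=> a b; rewrite !mulf_neq0 ?invr_eq0 ?expf_neq0 ?(chi_nz H).
  - exact: Ex0.
  move=> a b; rewrite mulr0n oppr0 !expr0 mul1r mulr1 !addr0 ec.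
  have -> : qk a * ql b * (c *: (F i ^+ r * qk (- (al *+ r)))) =
    c *: (qk a * (ql b * F i ^+ r) * qk (- (al *+ r))) by nc_simp K U; ring.
  rewrite (LFn H); move: (chi al b ^+ r) => x.
  have -> : c *: (qk a * (x *: (F i ^+ r * ql b)) * qk (- (al *+ r))) =
    (c * x) *: (qk a * F i ^+ r * (ql b * qk (- (al *+ r)))) by nc_simp K U; ring.
  rewrite (KFn H) -(h_KL H) -(h_KK H); move: (chi a al ^- r) => y.
  by nc_simp K U; ring.
exists (fun a b => cf a b * (q ^- r * (chi (a + - (al *+ r)) al)^-1 * chi al (b + - (al *+ p)))).
exists (fun a b => (cf a b * (qnum q r * q ^- r.-1)) *:
    (F i ^+ r.-1 * (qk (a + - (al *+ r)) * ql (b + - (al *+ p))) * E i ^+ p)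
  + ((cf a b * - (qnum q r * q ^- r.-1 * q ^- r.-1)) *:
      (F i ^+ r.-1 * (qk (a + (- (al *+ r) + al)) * ql (b + (- (al *+ p) - al))) * E i ^+ p)
  + eh * u a b)); split.
- by move=> a b; rewrite !mulf_neq0 ?invr_eq0 ?expf_neq0 ?(chi_nz H).
- have l : (r.-1 + p < r + p.+1)%N by rewrite addnS ltnS leq_add2r leq_pred.
  apply: ExD => //; apply: ExD => //; rewrite addnS; exact: Ex_eh.
move=> a b.
have -> : eh ^+ p.+1 * (qk a * ql b) * fh ^+ r = eh * (eh ^+ p * (qk a * ql b) * fh ^+ r).
  by rewrite exprS -!mulrA.
rewrite IH mulrDr -scalerAr eh_term.
rewrite !scalerDr !scalerA -!addrA; congr (_ *: (_ * (_ * ql _) * _) + (_ + (_ *: (_ * (qk _ * ql _) * _) + _))).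
all: by lattice H.
Qed.

(** Summands of a product of the reflected halves around the torus. Vanishing powers are excluded,
    since only for the others does the corresponding power of F_i or E_i have a coefficient that can
    be read off. *)
Record term := Term {
  t_mu : A; t_k : U; t_p : nat; t_a : A; t_b : A; t_r : nat; t_nu : A; t_x : U;
  t_hk : Km t_mu t_k; t_hx : Kp t_nu t_x;
  t_hp : qfact q t_p != 0; t_hr : qfact q t_r != 0 }.

Definition tval t :=
  t_k t * eh ^+ t_p t * (qk (t_a t) * ql (t_b t)) * (fh ^+ t_r t * t_x t).

Lemma expand_terms phi psi gam u c :
  (forall mu, linon (Gen pi' f mu) (phi mu)) -> (forall nu, linon (Gen pi' e nu) (psi nu)) ->
  tgraph qk ql (Gen pi' f) (Gen pi' e) phi psi gam u c ->
  exists L : seq term, u = \sum_(t <- L) tval t /\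
    c = \sum_(t <- L) phi (t_mu t - al *+ t_p t) (t_k t * eh ^+ t_p t) * gam (t_a t) (t_b t)
          * psi (t_nu t - al *+ t_r t) (fh ^+ t_r t * t_x t).
Proof.
move=> phil psil; elim=> [|mu a b nu y x v d hy hx _ [L [-> ->]]].
  by exists [::]; rewrite !big_nil.
suff [L' [e1 e2]] : exists L' : seq term, y * (qk a * ql b) * x = \sum_(t <- L') tval t /\
    phi mu y * gam a b * psi nu x = \sum_(t <- L') phi (t_mu t - al *+ t_p t) (t_k t * eh ^+ t_p t)
      * gam (t_a t) (t_b t) * psi (t_nu t - al *+ t_r t) (fh ^+ t_r t * t_x t).
  by exists (L' ++ L); rewrite !big_cat /= e1 e2.
have phi0 m : phi m 0 = 0 by apply: linon0 (@phil m); exact: Gen0.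
have psi0 m : psi m 0 = 0 by apply: linon0 (@psil m); exact: Gen0.
have phiD m y1 y2 : Gen pi' f m y1 -> Gen pi' f m y2 -> phi m (y1 + y2) = phi m y1 + phi m y2.
  by move=> h1 h2; have := @phil m 1 y1 y2 h1 h2; rewrite scale1r mul1r.
have psiD m y1 y2 : Gen pi' e m y1 -> Gen pi' e m y2 -> psi m (y1 + y2) = psi m y1 + psi m y2.
  by move=> h1 h2; have := @psil m 1 y1 y2 h1 h2; rewrite scale1r mul1r.
have := N'_KEr H hy; elim=> {mu y hy} [mu|mu p k y hk hy [L1 [e1 e2]]].
  by exists [::]; rewrite !big_nil phi0 !mul0r.
rewrite !mulrDl phiD; last 2 first.
- exact: (KE_N' H hM (KE_term ql E false hk)).
- exact: (KE_N' H hM hy).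
rewrite !mulrDl.
suff [L2 [f1 f2]] : exists L2 : seq term, k * eh ^+ p * (qk a * ql b) * x = \sum_(t <- L2) tval t /\
    phi mu (k * eh ^+ p) * gam a b * psi nu x = \sum_(t <- L2) phi (t_mu t - al *+ t_p t) (t_k t * eh ^+ t_p t)
      * gam (t_a t) (t_b t) * psi (t_nu t - al *+ t_r t) (fh ^+ t_r t * t_x t).
  by exists (L2 ++ L1); rewrite !big_cat /= e1 e2 f1 f2.
case: (eqVneq (qfact q p) 0) => [z|nzp].
  by exists [::]; rewrite !big_nil eh_eq0 // mulr0 phi0 !mul0r.
have := N'_KEl H' hx; elim=> {nu x hx e1 e2} [nu|nu r x w hx hw [L2 [e1 e2]]].
  by exists [::]; rewrite !big_nil psi0 !mulr0.
rewrite !mulrDr psiD; last 2 first.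
- exact: (KE_N' H' hM' (KE_term qk F true hx)).
- exact: (KE_N' H' hM' hw).
rewrite !mulrDr e1 e2; case: (eqVneq (qfact q r) 0) => [z|nzr].
  by exists L2; rewrite fh_eq0 // mul0r psi0 !mulr0 !add0r.
exists (Term a b hk hx nzp nzr :: L2); rewrite !big_cons /tval /= !addrK.
by split.
Qed.

Section Claim.
Variables (n : nat) (t : 'I_n -> term).
Hypothesis t0 : \sum_s tval (t s) = 0.

Definition claim p r := forall (Phi Psi : A -> U -> K) (gam : A -> A -> K),
  (forall mu, linon (Km mu) (Phi mu)) -> (forall nu, linon (Kp nu) (Psi nu)) ->
  \sum_(s < n | (t_p (t s) == p) && (t_r (t s) == r))
     Phi (t_mu (t s)) (t_k (t s)) * gam (t_a (t s)) (t_b (t s)) * Psi (t_nu (t s)) (t_x (t s)) = 0.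

(** The relation is rewritten in the original triangular order and tested on the coefficient of
    F_i^r0 and E_i^p0. Only the class (p0, r0) has its main term there; corrections of classes that
    are not longer are too short, and those of longer classes vanish by the hypothesis applied to
    composite functionals. *)
Lemma claim_step p0 r0 : (forall p r, (p0 + r0 < p + r)%N -> claim p r) -> claim p0 r0.
Proof.
move=> IH Phi Psi gam Phil Psil.
have [cR hR] := coefR_ex H i; have [cL hL] := coefL_ex H' i.
have [cf0 [u0 [cf00 hu0 ex0]]] := exchange p0 r0.
pose phi mu y := Phi (mu - al *+ r0) (cR mu y r0).
pose psi nu x := Psi (nu - al *+ p0) (cL nu x p0).
(* Undoes the torus shift and the leading coefficient of [exchange] for the class (p0, r0). *)
pose g a b := gam (a + al *+ r0) (b + al *+ p0) / cf0 (a + al *+ r0) (b + al *+ p0).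
have phil mu : linon (Nm mu) (phi mu).
  move=> c x y hx hy; have [s1 ex] := hR _ _ hx; have [s2 ey] := hR _ _ hy.
  have [s3 exy] := hR _ _ (GenD c hx hy).
  rewrite /phi (expR_uniq H exy (expR_lin c ex ey)) Phil //.
    by case: ex => h _ _ _; exact: h.
  by case: ey => h _ _ _; exact: h.
have psil nu : linon (Np nu) (psi nu).
  move=> c x y hx hy; have [s1 ex] := hL _ _ hx; have [s2 ey] := hL _ _ hy.
  have [s3 exy] := hL _ _ (GenD c hx hy).
  rewrite /psi (expL_uniq H' exy (expL_lin c ex ey)) Psil //.
    by case: ex => h _ _ _; exact: h.
  by case: ey => h _ _ _; exact: h.
have Phi0 m : Phi m 0 = 0 by apply: linon0 (@Phil m); exact: Gen0.
have Psi0 m : Psi m 0 = 0 by apply: linon0 (@Psil m); exact: Gen0.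
have phi0 m : phi m 0 = 0 by apply: linon0 (@phil m); exact: Gen0.
have psi0 m : psi m 0 = 0 by apply: linon0 (@psil m); exact: Gen0.
have Nk mu k r : Km mu k -> Nm (mu + al *+ r) (k * F i ^+ r).
  by move=> hk; apply: Gen_mul (Km_Nm hk) (Nm_Fn pi F i r).
have Nx nu x p : Kp nu x -> Np (nu + al *+ p) (E i ^+ p * x).
  by move=> hx; rewrite addrC; apply: Gen_mul (Nm_Fn pi E i p) (Km_Nm hx).
have phiF mu k r : Km mu k -> phi (mu + al *+ r) (k * F i ^+ r) =
    if (r == r0) && (qfact q r != 0) then Phi mu k else 0.
  move=> hk; case: (eqVneq (qfact q r) 0) => [z|nz].
    by rewrite (Fn_eq0 H) // mulr0 phi0 andbF.
  rewrite andbT; have [s es] := hR _ _ (Nk _ _ r hk).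
  rewrite /phi (expR_uniq H es (expR_term hk nz)) eq_sym.
  by case: eqVneq => [->|_]; rewrite ?addrK.
have psiE nu x p : Kp nu x -> psi (nu + al *+ p) (E i ^+ p * x) =
    if (p == p0) && (qfact q p != 0) then Psi nu x else 0.
  move=> hx; case: (eqVneq (qfact q p) 0) => [z|nz].
    by rewrite (Fn_eq0 H') // mul0r psi0 andbF.
  rewrite andbT; have [s es] := hL _ _ (Nx _ _ p hx).
  rewrite /psi (expL_uniq H' es (expL_term hx nz)) eq_sym.
  by case: eqVneq => [->|_]; rewrite ?addrK.
pose G := tgraph qk ql Nm Np phi psi g.
have Glin := tg_lin (fun mu => Gen0 pi F mu) (fun mu c x y => @GenD _ _ _ _ pi F mu c x y) phil.
have Gsum := tg_sum (fun mu => Gen0 pi F mu) (fun mu c x y => @GenD _ _ _ _ pi F mu c x y) phil.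
pose vterm (cf : A -> A -> K) r p da db s := cf (t_a (t s)) (t_b (t s)) *
  (phi (t_mu (t s) + al *+ r) (t_k (t s) * F i ^+ r) * g (t_a (t s) + da) (t_b (t s) + db)
   * psi (t_nu (t s) + al *+ p) (E i ^+ p * t_x (t s))).
have Gterm cf r p da db s : G (t_k (t s) * (cf (t_a (t s)) (t_b (t s)) *:
     (F i ^+ r * (qk (t_a (t s) + da) * ql (t_b (t s) + db)) * E i ^+ p)) * t_x (t s))
    (vterm cf r p da db s).
  have -> : t_k (t s) * (cf (t_a (t s)) (t_b (t s)) *:
     (F i ^+ r * (qk (t_a (t s) + da) * ql (t_b (t s) + db)) * E i ^+ p)) * t_x (t s) =
    cf (t_a (t s)) (t_b (t s)) *: ((t_k (t s) * F i ^+ r) *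
     (qk (t_a (t s) + da) * ql (t_b (t s) + db)) * (E i ^+ p * t_x (t s))) + 0.
    by rewrite addr0 -scalerAr -scalerAl !mulrA.
  rewrite /vterm -[X in G _ X]addr0; apply: Glin; last exact: tg0.
  by apply: tg_term; [exact/Nk/t_hk|exact/Nx/t_hx].
have Gex m u (Q : pred 'I_n) : Ex m u ->
    (forall cf r p da db, (r + p < m)%N -> \sum_(s < n | Q s) vterm cf r p da db s = 0) ->
    G (\sum_(s < n | Q s) t_k (t s) * u (t_a (t s)) (t_b (t s)) * t_x (t s)) 0.
  move=> hu hz; elim: hu => [|r p da db cf v lt _ IHu].
    by rewrite big1 => [|s _]; [exact: tg0|rewrite mulr0 mul0r].
  under eq_bigr => s _ do rewrite mulrDr mulrDl.
  rewrite big_split /= -[X in G (X + _) _]scale1r -[X in G _ X](_ : 1 * 0 + 0 = 0); last by ring.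
  apply: Glin => //; rewrite -(hz cf r p da db lt).
  by apply: Gsum => s _; apply: Gterm.
have Gclass p r : G (\sum_(s < n | (t_p (t s) == p) && (t_r (t s) == r)) tval (t s))
   (if (p == p0) && (r == r0) then \sum_(s < n | (t_p (t s) == p) && (t_r (t s) == r))
     Phi (t_mu (t s)) (t_k (t s)) * gam (t_a (t s)) (t_b (t s)) * Psi (t_nu (t s)) (t_x (t s))
    else 0).
  have [cf [u [cfn hu ex]]] : exists cf u, [/\ (p == p0) && (r == r0) -> cf = cf0, Ex (r + p) u &
      forall a b, eh ^+ p * (qk a * ql b) * fh ^+ r =
      cf a b *: (F i ^+ r * (qk (a + - (al *+ r)) * ql (b + - (al *+ p))) * E i ^+ p) + u a b].
    case: (boolP ((p == p0) && (r == r0))) => [/andP[/eqP -> /eqP ->]|_]; first by exists cf0, u0.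
    by have [cf [u [_ hu ex]]] := exchange p r; exists cf, u.
  have etv : \sum_(s < n | (t_p (t s) == p) && (t_r (t s) == r)) tval (t s) =
     1 *: (\sum_(s < n | (t_p (t s) == p) && (t_r (t s) == r)) t_k (t s) * (cf (t_a (t s)) (t_b (t s)) *:
     (F i ^+ r * (qk (t_a (t s) + - (al *+ r)) * ql (t_b (t s) + - (al *+ p))) * E i ^+ p)) * t_x (t s))
     + \sum_(s < n | (t_p (t s) == p) && (t_r (t s) == r)) t_k (t s) * u (t_a (t s)) (t_b (t s)) * t_x (t s).
    rewrite scale1r -big_split; apply: eq_bigr => s /andP[/eqP ep /eqP er].
    by rewrite /= /tval ep er -mulrDl -mulrDr -ex !mulrA.
  pose v := \sum_(s < n | (t_p (t s) == p) && (t_r (t s) == r)) vterm cf r p (- (al *+ r)) (- (al *+ p)) s.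
  have zero cf' r' p' da db : ~~ ((p' == p0) && (r' == r0)) ->
      forall s, vterm cf' r' p' da db s = 0.
    move=> nn s; rewrite /vterm phiF; last exact: t_hk.
    rewrite psiE; last exact: t_hx.
    by move: nn; case: (p' == p0); case: (r' == r0) => //= _; rewrite ?mulr0 ?mul0r ?mulr0.
  have small cf' r' p' da db : (r' + p' < r + p)%N -> \sum_(s < n | (t_p (t s) == p) && (t_r (t s) == r))
      vterm cf' r' p' da db s = 0.
    move=> lt; case: (ltnP (p0 + r0) (p + r)) => [gt|le].
      have := IH p r gt (fun mu k => phi (mu + al *+ r') (k * F i ^+ r'))
        (fun nu x => psi (nu + al *+ p') (E i ^+ p' * x)) (fun a b => cf' a b * g (a + da) (b + db)).
      move=> h; rewrite -[RHS]h; first by apply: eq_bigr => s _; rewrite /vterm; ring.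
        move=> mu c x y hx hy; rewrite mulrDl -scalerAl; apply: phil; exact: Nk.
      move=> nu c x y hx hy; rewrite mulrDr -scalerAr; apply: psil; exact: Nx.
    apply: big1 => s _; apply: zero; apply/negP => /andP[/eqP ep /eqP er].
    by move: (leq_trans lt (leq_trans (eq_leq (addnC r p)) le)); rewrite ep er addnC ltnn.
  have Gv : G (\sum_(s < n | (t_p (t s) == p) && (t_r (t s) == r)) tval (t s)) v.
    rewrite etv -[v](_ : 1 * v + 0 = v); last by ring.
    by apply: Glin (Gex _ _ _ hu small); apply: Gsum => s _; apply: Gterm.
  suff <- : v = (if (p == p0) && (r == r0) then \sum_(s < n | (t_p (t s) == p) && (t_r (t s) == r))
     Phi (t_mu (t s)) (t_k (t s)) * gam (t_a (t s)) (t_b (t s)) * Psi (t_nu (t s)) (t_x (t s))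
    else 0) by [].
  rewrite /v; case: ifPn => [c0|nc]; last by apply: big1 => s _; exact: zero.
  apply: eq_bigr => s /andP[/eqP ep /eqP er]; rewrite /vterm (cfn c0).
  case/andP: c0 => /eqP ep0 /eqP er0.
  rewrite phiF; last exact: t_hk.
  rewrite psiE; last exact: t_hx.
  rewrite ep0 er0 !eqxx /= -ep0 -er0 -ep -er t_hp t_hr /g ep er ep0 er0 !subrK.
  by field; exact: cf00.
pose N := (\max_(s < n) (t_p (t s) + t_r (t s)) + (p0 + r0)).+1.
pose cls (s : 'I_n) : 'I_N * 'I_N := (inord (t_p (t s)), inord (t_r (t s))).
have bnd s : (t_p (t s) < N)%N /\ (t_r (t s) < N)%N.
  have h : (t_p (t s) + t_r (t s) <= \max_(s < n) (t_p (t s) + t_r (t s)))%N by exact: leq_bigmax.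
  by rewrite /N; lia.
have cE s (x : 'I_N * 'I_N) : (cls s == x) = (t_p (t s) == x.1) && (t_r (t s) == x.2).
  by case: x => x1 x2; rewrite xpair_eqE -!val_eqE /= !inordK; case: (bnd s).
have tot : G 0 (\sum_(x : 'I_N * 'I_N) if (x.1 == p0 :> nat) && (x.2 == r0 :> nat) then
    \sum_(s < n | (t_p (t s) == x.1) && (t_r (t s) == x.2))
     Phi (t_mu (t s)) (t_k (t s)) * gam (t_a (t s)) (t_b (t s)) * Psi (t_nu (t s)) (t_x (t s)) else 0).
  rewrite -[X in G X _]t0 (partition_big cls predT) //=.
  apply: Gsum => x _; rewrite (eq_bigl _ _ (cE^~ x)); exact: Gclass.
have := b_tri B phil psil tot.
have lp : (p0 < N)%N by rewrite /N; lia.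
have lr : (r0 < N)%N by rewrite /N; lia.
rewrite (bigD1 (Ordinal lp, Ordinal lr)) //= !eqxx /=.
rewrite [X in _ + X = 0]big1 ?addr0 // => -[x1 x2].
by rewrite xpair_eqE -!val_eqE /= => /negbTE ->.
Qed.

(** Downward induction on p + r, starting above the longest class, where the sum is empty. *)
Lemma claim_all p r : claim p r.
Proof.
pose N := (\max_(s < n) (t_p (t s) + t_r (t s))).+1.
have [m hm] : exists m, (N <= p + r + m)%N by exists N; exact: leq_addl.
elim: m p r hm => [|m IH] p r hm.
  move=> Phi Psi gam _ _; rewrite big_pred0 // => s; apply/negP => /andP[/eqP ep /eqP er].
  have h : (t_p (t s) + t_r (t s) <= \max_(s < n) (t_p (t s) + t_r (t s)))%N by exact: leq_bigmax.
  by move: hm h; rewrite addn0 ep er => /leq_trans h /h; rewrite ltnn.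
by apply: claim_step => p' r' lt; apply: IH; lia.
Qed.

End Claim.

Lemma refl_tri : tri qk ql (Gen pi' f) (Gen pi' e).
Proof.
move=> phi psi gam phil psil c /(expand_terms phil psil)[L [e0 ->]].
rewrite big_tnth in e0; rewrite big_tnth.
set t := tnth (in_tuple L) in e0 *; move/esym in e0.
pose N := (\max_(s < size L) (t_p (t s) + t_r (t s))).+1.
pose cls s : 'I_N * 'I_N := (inord (t_p (t s)), inord (t_r (t s))).
have bnd s : (t_p (t s) < N)%N /\ (t_r (t s) < N)%N.
  have h : (t_p (t s) + t_r (t s) <= \max_(s < size L) (t_p (t s) + t_r (t s)))%N by exact: leq_bigmax.
  by rewrite /N; lia.
have cE s (x : 'I_N * 'I_N) : (cls s == x) = (t_p (t s) == x.1) && (t_r (t s) == x.2).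
  by case: x => x1 x2; rewrite xpair_eqE -!val_eqE /= !inordK; case: (bnd s).
rewrite (partition_big cls predT) //= big1 // => -[p r] _.
rewrite (eq_bigl _ _ (cE^~ (p, r))) /=.
have he p' : Gen pi' f (- (al *+ p')) (eh ^+ p') by rewrite -mulNrn; apply/Gen_exp/N'_eh.
have hf p' : Gen pi' e (- (al *+ p')) (fh ^+ p') by rewrite -mulNrn; apply/Gen_exp/N'_eh.
have := @claim_all _ t e0 p r (fun mu k => phi (mu - al *+ p) (k * eh ^+ p))
  (fun nu x => psi (nu - al *+ r) (fh ^+ r * x)) gam => h; rewrite -[RHS]h.
- by apply: eq_bigr => s /andP[/eqP -> /eqP ->].
- move=> mu k x y hx hy; rewrite mulrDl -scalerAl; apply: phil.
    exact: Gen_mul (Km_N' H hM hx) (he p).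
  exact: Gen_mul (Km_N' H hM hy) (he p).
- move=> nu k x y hx hy; rewrite mulrDr -scalerAr; apply: psil; rewrite addrC.
    exact: Gen_mul (hf r) (Km_N' H' hM' hx).
  exact: Gen_mul (hf r) (Km_N' H' hM' hy).
Qed.

End ReflectedTriangular.

(** * Relations between the reflected generators *)

Section ReflectedRelations.
Variables (K : fieldType) (A : zmodType) (U : algType K) (I : finType).
Variables (chi : A -> A -> K) (qk ql : A -> U) (pi : I -> A).
Variables (crd : I -> A -> int) (E F : I -> U).
Hypothesis H : pborel chi qk ql pi crd E F.
Variables (i : I) (M : I -> nat).
Local Notation al := (pi i).
Local Notation q := (chi (pi i) (pi i)).
Local Notation Ka := (qk (pi i)).
Local Notation La := (ql (pi i)).
Local Notation chiT := (fun a b => chi b a).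
Local Notation Em := (Fm chiT pi E i).
Local Notation Fm := (Fm chi pi F i).
Local Notation bmT := (bm chiT pi i).
Local Notation bm := (bm chi pi i).
Hypothesis hM : forall j, j != i -> bm j (M j) = 0 /\ forall k, (k < M j)%N -> bm j k != 0.
Hypothesis hMT : forall j, j != i -> bmT j (M j) = 0 /\ forall k, (k < M j)%N -> bmT j k != 0.
Let H' := pborel_swap H.
Let q0 : q != 0 := chi_nz H _ _.
Local Notation Nm := (Gen pi F).
Local Notation Km := (Gen (@km_deg A I pi i) (@km_gen K A U I chi pi F i)).
Local Notation pi' := (rpi pi i M).
Local Notation f := (rf chi ql pi E F i M).
Local Notation eh := (ql (- pi i) * E i).
Local Notation fh := (qk (- pi i) * F i).

Lemma rf_K a j : qk a * f j = (chi a (pi' j))^-1 *: (f j * qk a).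
Proof.
rewrite /rf /rpi; case: eqP => _; last exact: (GK H _ (Nm_Fm chi pi F i j (M j))).
by rewrite mulrA (h_KL H) -mulrA (h_KE H) -scalerAr mulrA (chiNr H) invrK.
Qed.

Lemma rf_L a j : ql a * f j = chi (pi' j) a *: (f j * ql a).
Proof.
rewrite /rf /rpi; case: eqP => _; last exact: (GL H _ (Nm_Fm chi pi F i j (M j))).
by rewrite mulrA (h_LL H) addrC -(h_LL H) -mulrA (h_LE H) -scalerAr mulrA (chiNl H).
Qed.

(** The factor [q] is the reason for the scalar q^-1 in the normalisation of the reflected F_i. *)
Lemma fh_eh : fh * eh = eh * fh + q *: (ql (- al) - qk (- al)).
Proof.
have e1 : fh * eh = qk (- al) * (F i * ql (- al)) * E i by rewrite !mulrA.
have e2 : eh * fh = ql (- al) * (E i * qk (- al)) * F i by rewrite !mulrA.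
have c1 : F i * ql (- al) = q *: (ql (- al) * F i).
  by rewrite (h_LF H) scalerA (chiNr H) mulfV // scale1r.
have c2 : E i * qk (- al) = q *: (qk (- al) * E i).
  by rewrite (h_KE H) scalerA (chiNl H) mulfV // scale1r.
rewrite e1 e2 c1 c2.
have -> : qk (- al) * (q *: (ql (- al) * F i)) * E i = q *: (qk (- al) * ql (- al) * (F i * E i)).
  by nc_simp K U; ring.
have -> : ql (- al) * (q *: (qk (- al) * E i)) * F i = q *: (ql (- al) * qk (- al) * (E i * F i)).
  by nc_simp K U; ring.
rewrite -(h_KL H) (EF1 H) mulrDr -scalerDr -addrA; congr (_ *: _).
have -> : qk (- al) * ql (- al) * (La - Ka) = qk (- al) * (ql (- al) * La) - qk (- al) * (ql (- al) * Ka).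
  by nc_simp K U; ring.
have -> : qk (- al) * (ql (- al) * Ka) = ql (- al).
  by rewrite -(h_KL H) mulrA (KNK H) mul1r.
by rewrite (LNL H) mulr1; nc_simp K U; ring.
Qed.

(** The vanishing of the string beyond its end says that F_i commutes with [Fm k (M k)] up to a
    scalar, which K_i^-1 absorbs. *)
Lemma fh_Fm k : k != i -> fh * Fm k (M k) = Fm k (M k) * fh.
Proof.
move=> ki; have [b0 _] := hM ki.
have /subr0_eq e := Fm_eq0 H ki b0.
have g := GK H (- al) (Nm_Fm chi pi F i k (M k)).
move: e g; set y := Fm k (M k); set c := (chi al _)^-1 => e g.
rewrite (chiNl H) invrK in g; rewrite -mulrA e -scalerAr [qk _ * (y * _)]mulrA g -scalerAl scalerA.
by rewrite /c mulVf ?(chi_nz H) // scale1r mulrA.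
Qed.

(** Bracketing with F_i, which commutes with [k] up to a scalar, lowers [Em j m.+1] to [Em j m]
    times K_i, with a scalar that is nonzero below the end of the string. *)
Lemma Km_comm_descend mu k j m : Km mu k -> j != i -> (m < M j)%N ->
  F i * k = (chi al mu)^-1 *: (k * F i) ->
  k * Em j m.+1 = Em j m.+1 * k -> k * Em j m = Em j m * k.
Proof.
move=> hk ji lt ek c1; set c := (chi al mu)^-1 in ek.
have c0 : c != 0 by rewrite invr_eq0 (chi_nz H).
have b0 : bmT j m != 0 by case: (hMT ji) => _; apply.
have eF : F i * Em j m.+1 = Em j m.+1 * F i + bmT j m *: (Em j m * Ka) by exact: (E_Fm H').
have eK : Ka * k = c *: (k * Ka) by exact: (GK H _ (Km_Nm hk)).
have z : F i * (k * Em j m.+1 - Em j m.+1 * k) = 0 by rewrite c1 subrr mulr0.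
have e2 : (bmT j m * c) *: ((k * Em j m - Em j m * k) * Ka) = 0.
  have e1 : F i * (k * Em j m.+1 - Em j m.+1 * k) = c *: ((k * Em j m.+1 - Em j m.+1 * k) * F i)
    + (bmT j m * c) *: ((k * Em j m - Em j m * k) * Ka).
    rewrite mulrBr 2!mulrA ek eF.
    have -> : c *: (k * F i) * Em j m.+1 = c *: (k * (F i * Em j m.+1)) by nc_simp K U; ring.
    have -> : (Em j m.+1 * F i + bmT j m *: (Em j m * Ka)) * k =
      Em j m.+1 * (F i * k) + bmT j m *: (Em j m * (Ka * k)) by nc_simp K U; ring.
    by rewrite eF ek eK; nc_simp K U; ring.
  by move: z; rewrite e1 c1 subrr mul0r scaler0 add0r.
move/eqP: e2; rewrite scaler_eq0 mulf_eq0 (negbTE b0) (negbTE c0) /= => /eqP e2.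
by apply: subr0_eq; apply: (mulKI H (a := al)); rewrite mul0r.
Qed.

(** E_i raises [Em j m] to [Em j m.+1], so the derivative [k1] of [k] along E_i satisfies the same
    hypothesis in lower degree and vanishes by induction. Then [k] commutes with E_i as well, and
    [h_ndF] applies. *)
Lemma Km_central n mu k : Km mu k -> mu != 0 -> hgt crd mu <= n%:Z ->
  (forall j m, j != i -> k * Em j m = Em j m * k) -> k = 0.
Proof.
elim: n mu k => [|n IH] mu k hk mu0 hn hc.
  apply/eqP; apply: contraNT mu0 => nz; apply/eqP/(crd_inj H) => j; rewrite (crd0 H).
  have cone := Nm_cone H (Km_Nm hk) nz; apply/eqP; rewrite eq_le cone andbT.
  by apply: le_trans hn; rewrite /hgt (bigD1 j) //= lerDl sumr_ge0.
have [k1 h1 e1] := Km_E H hk.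
have hc1 j m : j != i -> k1 * Em j m = Em j m * k1.
  move=> ji; set d := (chi (pi j + al *+ m) al)^-1.
  have d0 : d != 0 by rewrite invr_eq0 (chi_nz H).
  have eL : La * Em j m = d *: (Em j m * La) by exact: (GLE H _ (Np_Em chi pi E i j m)).
  have eE : E i * Em j m = Em j m.+1 + d *: (Em j m * E i) by rewrite /= subrK.
  have z : E i * (k * Em j m - Em j m * k) = 0 by rewrite hc // subrr mulr0.
  have e2 : E i * (k * Em j m - Em j m * k) = (k * Em j m.+1 - Em j m.+1 * k)
    + d *: ((k * Em j m - Em j m * k) * E i) + d *: ((k1 * Em j m - Em j m * k1) * La).
    rewrite mulrBr 2!mulrA e1 eE.
    have -> : (k * E i + k1 * La) * Em j m = k * (E i * Em j m) + k1 * (La * Em j m).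
      by nc_simp K U; ring.
    have -> : (Em j m.+1 + d *: (Em j m * E i)) * k = Em j m.+1 * k + d *: (Em j m * (E i * k)).
      by nc_simp K U; ring.
    by rewrite eE eL e1; nc_simp K U; ring.
  move: z; rewrite e2 !hc // !subrr mul0r scaler0 !add0r => /eqP.
  rewrite scaler_eq0 (negbTE d0) /= => /eqP e3.
  by apply: subr0_eq; apply: (mulLI H (a := al)); rewrite mul0r.
suff z1 : k1 = 0.
  apply: (h_ndF H (Km_Nm hk) mu0) => j; case: (eqVneq j i) => [->|ji].
    by rewrite e1 z1 mul0r addr0.
  by have := hc j 0%N ji; rewrite /= => ->.
case: (eqVneq (mu - al) 0) => [/subr0_eq emu|nz].
  have [v ev] : exists v, k = v *: F i by apply: (Nm_simple H); rewrite -emu; exact: (Km_Nm hk).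
  have hk1 : Gen pi F 0 k1 by move: (Km_Nm h1); rewrite emu subrr.
  have [|||a1 a2] := @h_indF _ _ _ _ _ _ _ _ _ _ _ H i 0 (v *: 1) (k1 - v *: 1).
  - exact/GenZ/Gen1.
  - by apply: GenB => //; apply/GenZ/Gen1.
  - move: e1; rewrite ev -scalerAr (EF1 H) -scalerAl => e1.
    have {}e1 : k1 * La = v *: (La - Ka).
      by apply: (addrI (v *: (F i * E i))); rewrite -e1 scalerDr.
    by rewrite mulrBl e1; nc_simp K U; ring.
  by move: a2; rewrite a1 subr0.
apply: (IH (mu - al)) => //.
by rewrite (hgtB H) (hgt_pi H) lerBlDr -PoszD addn1.
Qed.

(* A nondegeneracy statement for the part common to both Borel subalgebras. *)
Lemma Km_nd mu k : Km mu k -> mu != 0 -> fh * k = k * fh ->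
  (forall j, j != i -> Em j (M j) * k = k * Em j (M j)) -> k = 0.
Proof.
move=> hk mu0 ef ee.
have [n hn] : exists n : nat, hgt crd mu <= n%:Z.
  by exists `|hgt crd mu|%N; apply: lez_abs.
apply: (Km_central hk mu0 hn) => j m ji.
have eF : F i * k = (chi al mu)^-1 *: (k * F i).
  have g := GK H (- al) (Km_Nm hk); rewrite (chiNl H) invrK in g.
  have g' : k * qk (- al) = (chi al mu)^-1 *: (qk (- al) * k).
    by rewrite g scalerA mulVf ?(chi_nz H) // scale1r.
  have : qk al * (fh * k) = qk al * (k * fh) by rewrite ef.
  have -> : qk al * (fh * k) = F i * k by rewrite !mulrA (KKN H) mul1r.
  have -> : k * fh = (k * qk (- al)) * F i by rewrite mulrA.
  by rewrite g' -!scalerAl -scalerAr !mulrA (KKN H) mul1r.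
case: (ltnP (M j) m) => [lt|le].
  by rewrite (Fm_gtM H' hMT ji lt) mulr0 mul0r.
rewrite -(subKn le); elim: (M j - m)%N (leq_subr m (M j)) => [|d IH] ld.
  by rewrite subn0 ee.
apply: (Km_comm_descend hk ji _ eF); first by lia.
by rewrite subnSK //; apply: IH; exact: ltnW.
Qed.

(** From pi_i = - pi'_i and pi_j = pi'_j + M_j pi'_i, with pi' the reflected basis. *)
Definition rcrd j a := if j == i then - crd i a + \sum_(k | k != i) (M k)%:Z * crd k a else crd j a.

Lemma rcrdD j a b : rcrd j (a + b) = rcrd j a + rcrd j b.
Proof.
rewrite /rcrd; case: eqP => _; last by rewrite (h_crdD H).
rewrite (h_crdD H) opprD addrACA -big_split; congr (_ + _).
by apply: eq_bigr => k _; rewrite (h_crdD H) mulrDr.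
Qed.

Lemma rcrd_pi j k : rcrd j (pi' k) = (j == k)%:Z.
Proof.
rewrite /rcrd /rpi.
case: (eqVneq k i) => [ki|ki]; case: (eqVneq j i) => [ji|ji].
- rewrite ki ji eqxx !(crdN H) (h_crdpi H) eqxx opprK big1 ?addr0 // => l li.
  by rewrite (crdN H) (h_crdpi H) (negbTE li) oppr0 mulr0.
- by rewrite ki (crdN H) (h_crdpi H) (negbTE ji) oppr0.
- rewrite ji eq_sym (negbTE ki) (h_crdD H) (crdMn H) !(h_crdpi H) eqxx eq_sym (negbTE ki) add0r.
  rewrite (bigD1 k) //= (h_crdD H) (crdMn H) !(h_crdpi H) eqxx (negbTE ki) mul0rn addr0 mulr1.
  rewrite big1 ?addr0; first by rewrite -[1%:Z *+ _]mulr_natr mul1r natz addNr.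
  move=> l /andP[li lk]; rewrite (h_crdD H) (crdMn H) !(h_crdpi H) (negbTE li) (negbTE lk).
  by rewrite mul0rn addr0 mulr0.
- by rewrite (h_crdD H) (crdMn H) !(h_crdpi H) (negbTE ji) mul0rn addr0.
Qed.

Lemma rcrdE a : a = \sum_j pi' j *~ rcrd j a.
Proof.
rewrite (bigD1 i) //= /rpi /rcrd eqxx.
rewrite (eq_bigr (fun j => pi j *~ crd j a + al *~ ((M j)%:Z * crd j a))) => [|j /negbTE ->]; last first.
  by rewrite mulrzDl pmulrn mulrzA.
rewrite big_split /= -mulrz_sumr mulrzDr [in LHS](h_crdE H a) (bigD1 i) //=.
rewrite mulNrz mulrNz opprK mulNrz; set x := al *~ crd i a; set y := \sum_(_ | _) pi _ *~ _.
by set z := al *~ _; rewrite addrACA addNr addr0.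
Qed.

End ReflectedRelations.

(** * Nondegeneracy after reflection *)

Section ReflectedNondegeneracy.
Variables (K : fieldType) (A : zmodType) (U : algType K) (I : finType).
Variables (chi : A -> A -> K) (qk ql : A -> U) (pi : I -> A).
Variables (crd : I -> A -> int) (E F : I -> U).
Hypothesis H : pborel chi qk ql pi crd E F.
Variables (i : I) (M : I -> nat).
Local Notation al := (pi i).
Local Notation q := (chi (pi i) (pi i)).
Local Notation chiT := (fun a b => chi b a).
Local Notation Em := (Fm chiT pi E i).
Local Notation bmT := (bm chiT pi i).
Local Notation bm := (bm chi pi i).
Hypothesis hM : forall j, j != i -> bm j (M j) = 0 /\ forall k, (k < M j)%N -> bm j k != 0.
Hypothesis hMT : forall j, j != i -> bmT j (M j) = 0 /\ forall k, (k < M j)%N -> bmT j k != 0.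
Let H' := pborel_swap H.
Let q0 : q != 0 := chi_nz H _ _.
Local Notation Km := (Gen (@km_deg A I pi i) (@km_gen K A U I chi pi F i)).
Local Notation pi' := (rpi pi i M).
Local Notation f := (rf chi ql pi E F i M).
Local Notation eh := (ql (- pi i) * E i).
Local Notation fh := (qk (- pi i) * F i).
Local Notation KE := (KE chi ql pi E F i).

(** Both orders occur: the triangular decomposition gives independence of the products k eh^s in the
    negative half and, after the swap, of the products fh^s k in the positive one. *)
Definition keterm (left : bool) s k := if left then eh ^+ s * k else k * eh ^+ s.

Lemma eh_eq0' p : qfact q p = 0 -> eh ^+ p = 0.
Proof.
have [c c0 ->] := KNF_exp H' i p => z.
by rewrite (Fn_eq0 H' z) mul0r scaler0.
Qed.

Lemma ketermD left s c x y : keterm left s (c *: x + y) = c *: keterm left s x + keterm left s y.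
Proof. by case: left; rewrite /keterm ?mulrDr ?mulrDl -?scalerAr -?scalerAl. Qed.

Lemma keterm0 left s : keterm left s 0 = 0.
Proof. by case: left; rewrite /keterm ?mulr0 ?mul0r. Qed.

Lemma KE_exp left mu y : KE left mu y ->
  exists s k, [/\ forall r, Km (mu + al *+ r) (k r),
    forall r, qfact q r = 0 -> k r = 0, forall r, (s <= r)%N -> k r = 0
    & y = \sum_(r < s) keterm left r (k r)].
Proof.
elim=> {mu y} [mu|mu p k y hk _ [s [l [l1 l2 l3 ->]]]].
  by exists 0%N, (fun=> 0); split=> // [r|]; [exact: Gen0 | rewrite big_ord0].
have [z|nz] := eqVneq (qfact q p) 0.
  by exists s, l; split=> //; rewrite (eh_eq0' z); case: left; rewrite ?mulr0 ?mul0r add0r.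
exists (maxn s p.+1), (fun r => (r == p)%:R *: k + l r); split.
- move=> r; case: eqP => [->|_]; first by rewrite scale1r; apply: GenA.
  by rewrite scale0r add0r.
- by move=> r z; case: eqP => [e|_]; [rewrite -e z eqxx in nz | rewrite scale0r add0r l2].
- move=> r; rewrite geq_max => /andP[h1 h2]; rewrite l3 // addr0.
  by rewrite gtn_eqF // scale0r.
rewrite [RHS](eq_bigr (fun r : 'I__ => (r == p :> nat)%:R *: keterm left r k + keterm left r (l r))).
  rewrite big_split /= ; congr (_ + _); last first.
    rewrite [RHS](@sum_ord_widen _ _ (fun r => keterm left r (l r)) s) ?leq_maxl // => r hr.
    by rewrite l3 // keterm0.
  have lt : (p < maxn s p.+1)%N by rewrite leq_maxr.
  rewrite (bigD1 (Ordinal lt)) //= eqxx scale1r big1 ?addr0 // => r /negbTE.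
  by rewrite -val_eqE /= => ->; rewrite scale0r.
by move=> r _; rewrite ketermD.
Qed.

Lemma fh_ehn s : fh * eh ^+ s = eh ^+ s * fh +
  eh ^+ s.-1 * ((q * qnum q s) *: ql (- al) - (q * qnum q^-1 s) *: qk (- al)).
Proof.
elim: s => [|s IH]; first by rewrite !expr0 !qnum0 !mulr0 !scale0r subrr mulr0 addr0 mul1r mulr1.
have cL : ql (- al) * eh = q *: (eh * ql (- al)).
  rewrite [in LHS](h_LE H) (chiNr H) invrK -scalerAr; congr (_ *: _).
  by rewrite !mulrA.
have cK : qk (- al) * eh = q^-1 *: (eh * qk (- al)).
  by rewrite [LHS]mulrA (h_KL H) -[LHS]mulrA [in LHS](h_KE H) (chiNl H) -scalerAr mulrA.
rewrite exprSr [LHS]mulrA IH mulrDl -[eh ^+ s * fh * eh]mulrA (fh_eh H) /=.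
set L := ql (- al) in cL *; set G := qk (- al) in cK *.
move: cL cK; set e := L * E i; set g := G * F i => cL cK.
have -> : e ^+ s.-1 * ((q * qnum q s) *: L - (q * qnum q^-1 s) *: G) * e =
  e ^+ s.-1 * e * ((q * q * qnum q s) *: L - qnum q^-1 s *: G).
  rewrite -mulrA mulrBl -!scalerAl cL cK !scalerA.
  have -> : q * qnum q^-1 s * q^-1 = qnum q^-1 s by rewrite mulrAC mulfV // mul1r.
  by generalize (qnum q^-1 s) => v; nc_simp K U; ring.
have -> : e ^+ s.-1 * e * ((q * q * qnum q s) *: L - qnum q^-1 s *: G) =
  e ^+ s * ((q * q * qnum q s) *: L - qnum q^-1 s *: G).
  by case: s {IH} => [|s]; [rewrite !qnum0 mulr0 !scale0r subrr !mulr0 | rewrite -exprSr].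
rewrite !qnumSl.
have -> : q * (1 + q^-1 * qnum q^-1 s) = q + qnum q^-1 s by rewrite mulrDr mulr1 mulrA mulfV // mul1r.
by generalize (qnum q^-1 s) => v; nc_simp K U; ring.
Qed.

Lemma fh_Km mu k : Km mu k -> exists2 k1, Km (mu + al) k1 & fh * k = k * fh + k1 * qk (- al).
Proof.
move=> hk; have h1 := Km_ad H hk; move: h1.
set w := F i * k - _ => h1; exists (chi al (mu + al) *: w); first exact: GenZ.
have e1 : F i * k = (chi al mu)^-1 *: (k * F i) + w by rewrite addrC subrK.
have gk := GK H (- al) (Km_Nm hk); have gw := GK H (- al) (Km_Nm h1).
rewrite -mulrA e1 mulrDr gw -scalerAr [qk _ * (k * _)]mulrA gk -scalerAl scalerA !(chiNl H) !invrK.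
by rewrite mulVf ?(chi_nz H) // scale1r mulrA scalerAl.
Qed.

Hypothesis indF : forall mu y1 y2, Gen pi' f mu y1 -> Gen pi' f mu y2 ->
    y1 * qk (- al) + y2 * ql (- al) = 0 -> y1 = 0 /\ y2 = 0.

(** Only the L-part of the commutator is computed; of the K-part [y1] nothing but its degree is
    used, since [indF] separates the two. *)
Lemma fh_keterm left mu s k : Km (mu + al *+ s) k -> exists c : K, exists2 y1,
  Gen pi' f (mu + al) y1 & c != 0 /\ fh * keterm left s k = keterm left s k * fh +
   (y1 * qk (- al) + (c * qnum q s) *: (keterm left s.-1 k * ql (- al))).
Proof.
move=> hk; have [k1 h1 e1] := fh_Km hk; have hs := fh_ehn s.
have gk := GK H (- al) (Km_Nm hk); have gl := GL H (- al) (Km_Nm hk).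
have N'e r : Gen pi' f (- al *+ r) (eh ^+ r) by apply/Gen_exp/N'_eh.
have cK n : qk (- al) * eh ^+ n = q ^- n *: (eh ^+ n * qk (- al)).
  elim: n => [|n IHn]; first by rewrite expr0 invr1 scale1r mulr1 mul1r.
  have c1 : qk (- al) * eh = q^-1 *: (eh * qk (- al)).
    by rewrite [LHS]mulrA (h_KL H) -[LHS]mulrA [in LHS](h_KE H) (chiNl H) -scalerAr mulrA.
  by rewrite [eh ^+ n.+1]exprS mulrA c1 -scalerAl -[eh * qk _ * _]mulrA IHn -scalerAr scalerA [eh * (_ * qk _)]mulrA -[eh * eh ^+ n]exprS [q ^+ n.+1]exprS invfM.
have cs (s0 : s = 0%N) : qnum q s = 0 by rewrite s0 qnum0.
set G := qk (- al) in e1 hs gk cK *; set L := ql (- al) in hs gl *.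
case: left; rewrite /keterm.
  exists (q * chi (mu + al *+ s) (- al)).
  exists (eh ^+ s * k1 - (q * qnum q^-1 s * (chi (- al) (mu + al *+ s))^-1) *: (eh ^+ s.-1 * k)).
    apply: GenB.
      apply: Gen_eq (Gen_mul (N'e s) (Km_N' H hM h1)) _.
      by rewrite mulNrn; lattice H.
    case: s hk {h1 e1 hs gk gl cs} => [|s] hk.
      rewrite qnum0 mulr0 mul0r scale0r; exact: Gen0.
    apply/GenZ; apply: Gen_eq (Gen_mul (N'e s) (Km_N' H hM hk)) _.
    by rewrite mulNrn mulrS /=; lattice H.
  split; first by rewrite mulf_neq0 ?(chi_nz H).
  rewrite mulrA hs; move: e1 gk gl; set e := L * E i; set g := G * F i => e1 gk gl.
  set d := (chi (- al) _)^-1 in gk *; set d' := chi (_ + _) _ in gl *.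
  set v := qnum q^-1 s; set w := qnum q s.
  have -> : (e ^+ s * g + e ^+ s.-1 * ((q * w) *: L - (q * v) *: G)) * k =
    e ^+ s * (g * k) + e ^+ s.-1 * ((q * w) *: (L * k) - (q * v) *: (G * k)) by nc_simp K U; ring.
  by rewrite e1 gk gl; nc_simp K U; ring.
exists q.
exists (q ^- s *: (k1 * eh ^+ s) - (q * qnum q^-1 s) *: (k * eh ^+ s.-1)).
  apply: GenB.
    apply: GenZ; apply: Gen_eq (Gen_mul (Km_N' H hM h1) (N'e s)) _.
    by rewrite mulNrn; lattice H.
  case: s hk {h1 e1 hs gk gl cs} => [|s] hk.
    rewrite qnum0 mulr0 scale0r; exact: Gen0.
  apply/GenZ; apply: Gen_eq (Gen_mul (Km_N' H hM hk) (N'e s)) _.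
  by rewrite mulNrn mulrS /=; lattice H.
split; first by [].
move: (cK s) hs => {}cK hs; move: e1 cK hs; set e := L * E i; set g := G * F i => e1 cK hs.
set v := qnum q^-1 s in hs *; set w := qnum q s in hs *; set x := q ^- s in cK *.
rewrite [LHS]mulrA e1 mulrDl -[k * g * _]mulrA hs -[k1 * G * _]mulrA cK.
by nc_simp K U; ring.
Qed.

(** [fh] lowers the powers of [eh] like a derivation. The L-part of its commutator with [y]
    vanishes, which kills the coefficients of all positive powers; what remains lies in [Km], where
    [Km_nd] applies. *)
Lemma refl_ndF left mu y :
  (forall mu s (k : nat -> U), (forall r, Km (mu + al *+ r) (k r)) ->
    (forall r, qfact q r = 0 -> k r = 0) ->
    \sum_(r < s) keterm left r (k r) = 0 -> forall r, (r < s)%N -> k r = 0) ->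
  Gen pi' f mu y -> mu != 0 -> fh * y = y * fh ->
  (forall j, j != i -> Em j (M j) * y = y * Em j (M j)) -> y = 0.
Proof.
move=> ind hy mu0 cf ce.
have ke : KE left mu y.
  by case: (left); [exact: (N'_KEl H hy) | exact: (N'_KEr H hy)].
have [s [k [hk k0 kb ey]]] := KE_exp ke.
have /choice[c hc] r := fh_keterm left (hk r).
have /choice[y1 {}hc] : forall r, exists y1, Gen pi' f (mu + al) y1 /\ (c r != 0 /\ fh * keterm left r (k r) =
  keterm left r (k r) * fh + (y1 * qk (- al) + (c r * qnum q r) *: (keterm left r.-1 (k r) * ql (- al)))).
  by move=> r; have [z z1 z2] := hc r; exists z.
have N'e r : Gen pi' f (- al *+ r) (eh ^+ r) by apply/Gen_exp/N'_eh.
pose Y1 := \sum_(r < s) y1 r.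
pose Y2 := \sum_(r < s) (c r * qnum q r) *: keterm left r.-1 (k r).
have g1 : Gen pi' f (mu + al) Y1 by apply: Gen_sum => r _; case: (hc r).
have g2 : Gen pi' f (mu + al) Y2.
  apply: Gen_sum => -[[|r] hr] _ /=; first by rewrite qnum0 mulr0 scale0r; exact: Gen0.
  apply: GenZ; rewrite /keterm; case: (left).
    apply: Gen_eq (Gen_mul (N'e r) (Km_N' H hM (hk r.+1))) _.
    by rewrite mulNrn mulrS /=; lattice H.
  apply: Gen_eq (Gen_mul (Km_N' H hM (hk r.+1)) (N'e r)) _.
  by rewrite mulNrn mulrS /=; lattice H.
have e12 : Y1 * qk (- al) + Y2 * ql (- al) = 0.
  apply: (addrI (y * fh)); rewrite addr0 -[RHS]cf [in RHS]ey mulr_sumr.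
  rewrite [RHS](eq_bigr _ (fun (r : 'I_s) _ => proj2 (proj2 (hc r)))) big_split /= -mulr_suml -ey big_split /=.
  rewrite -[X in _ = _ + (X + _)]mulr_suml; congr (_ + (_ + _)).
  by rewrite /Y2 mulr_suml; apply: eq_bigr => r _; rewrite scalerAl.
have [_] := indF g1 g2 e12; rewrite /Y2 => z2 {Y1 Y2 g1 g2 e12}.
have kS r : k r.+1 = 0.
  have [le|lt] := leqP s r.+1; first exact: kb.
  have [qz|qnz] := eqVneq (qfact q r.+1) 0; first exact: k0.
  case: s lt kb ey z2 => // s lt kb ey z2.
  have := ind (mu + al) s (fun r => (c r.+1 * qnum q r.+1) *: k r.+1) _ _ _ r lt.
  rewrite /=; set v := c r.+1 * _ => h.
  have v0 : v != 0.
    by rewrite mulf_neq0 //; [case: (hc r.+1) => _ [] | rewrite (qnum_neq0 qnz) //=].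
  suff /eqP : v *: k r.+1 = 0 by rewrite scaler_eq0 (negbTE v0) => /eqP.
  apply: h.
  - move=> p; apply: GenZ; apply: Gen_eq (hk p.+1) _; rewrite mulrS; lattice H.
  - move=> p pz; rewrite k0 ?scaler0 // qfactS pz mul0r //.
  - rewrite -[RHS]z2 big_ord_recl /= qnum0 mulr0 scale0r add0r.
    apply: eq_bigr => p _; rewrite /bump /= add1n /= /keterm.
    by case: (left); rewrite -?scalerAr -?scalerAl.
have ek : y = k 0%N.
  rewrite ey; case: s {z2 ey} kb => [|s] kb; first by rewrite big_ord0 kb.
  rewrite big_ord_recl big1 => [|r _]; last by rewrite /= kS keterm0.
  by rewrite addr0 /keterm; case: (left); rewrite /= expr0 ?mul1r ?mulr1.
have hk0 : Km mu (k 0%N) by have := hk 0%N; rewrite mulr0n addr0.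
by rewrite ek in cf ce *; apply: (Km_nd H hMT hk0).
Qed.

End ReflectedNondegeneracy.

(** * Spanning by triangular products and generation *)

Section Generation.
Variables (K : fieldType) (A : zmodType) (U : algType K) (I : finType).
Variables (chi : A -> A -> K) (qk ql : A -> U) (pi : I -> A).
Variables (crd : I -> A -> int) (E F : I -> U).

(** Serves to express generation in a form that passes easily through reflections: a subspace
    containing 1 and stable under left multiplication by all generators is everything. *)
Definition left_closed (T : U -> Prop) :=
  [/\ T 0, forall c u v, T u -> T v -> T (c *: u + v),
      (forall a u, T u -> T (qk a * u)) /\ (forall a u, T u -> T (ql a * u)),
      forall j u, T u -> T (E j * u) & forall j u, T u -> T (F j * u)].

Lemma left_closed_Gen T (J : Type) (dg : J -> A) (g : J -> U) mu y u :
  left_closed T -> (forall j u, T u -> T (g j * u)) ->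
  Gen dg g mu y -> T u -> T (y * u).
Proof.
case=> T0 TD _ _ _ Tg h Tu; elim: h => [|a|j a x _ IH|a c x z _ IHx _ IHz].
- by rewrite mul1r.
- by rewrite mul0r.
- by rewrite -mulrA; apply: Tg.
- by rewrite mulrDl -scalerAl; apply: TD.
Qed.

Lemma tspan_generates T u : tspan qk ql (Gen pi F) (Gen pi E) -> left_closed T -> T 1 -> T u.
Proof.
move=> sp hT T1; have [T0 TD [TK TL] TE TF] := hT.
have [c hc] := sp u (fun _ _ => 0) (fun _ _ => 0) (fun _ _ => 0).
elim: hc => // mu a b nu y x v d hy hx _ IH.
rewrite -[_ * _ * x]scale1r; apply: TD => //.
rewrite -!mulrA; apply: (left_closed_Gen hT TF hy); apply: TK; apply: TL.
by rewrite -[x]mulr1; apply: (left_closed_Gen hT TE hx).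
Qed.

Hypothesis H : pborel chi qk ql pi crd E F.

(** The span of the triangular products is stable under left multiplication by the generators: E_j
    is moved through the negative half by [der_ex] and through the torus by characters. *)
Lemma tspan_of_generation : (forall T u, left_closed T -> T 1 -> T u) ->
  tspan qk ql (Gen pi F) (Gen pi E).
Proof.
move=> gen u phi psi gam.
pose T u := exists c, tgraph qk ql (Gen pi F) (Gen pi E) phi psi gam u c.
have TD c v w : T v -> T w -> T (c *: v + w).
  move=> [d hd] hw; elim: hd => [|mu a b nu y x z e hy hx _ [e' IH]]; first by rewrite scaler0 add0r.
  have -> : c *: (y * (qk a * ql b) * x + z) + w = (c *: y) * (qk a * ql b) * x + (c *: z + w).
    by nc_simp K U; ring.
  by exists (phi mu (c *: y) * gam a b * psi nu x + e'); apply: tgD => //; exact: GenZ.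
have T0 : T 0 by exists 0; exact: tg0.
have Tt mu nu y x a b c : Gen pi F mu y -> Gen pi E nu x -> T (c *: (y * (qk a * ql b) * x)).
  move=> hy hx; rewrite -[_ *: _]addr0; apply: TD => //.
  by exists (phi mu y * gam a b * psi nu x + 0); rewrite -[X in tgraph _ _ _ _ _ _ _ X _]addr0; apply: tgD => //; exact: tg0.
have Tm g : (forall mu nu y x a b, Gen pi F mu y -> Gen pi E nu x ->
    T (g * (y * (qk a * ql b) * x))) -> forall v, T v -> T (g * v).
  move=> hg v [d]; elim=> [|mu a b nu y x z e hy hx _ IH]; first by rewrite mulr0.
  by rewrite mulrDr -[g * (_ * x)]scale1r; apply: TD => //; apply: (hg mu nu).
have TA v w : T v -> T w -> T (v + w) by move=> hv hw; rewrite -[v]scale1r; exact: TD.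
apply: (gen T); last first.
  have := Tt 0 0 1 1 0 0 1 (Gen1 _ _) (Gen1 _ _).
  by rewrite scale1r (h_K0 H) (h_L0 H) !mulr1.
split=> //.
- split=> a; apply: Tm => mu nu y x c d hy hx.
    rewrite !mulrA (GK H a hy) -!scalerAl -[y * _ * _]mulrA (h_KK H) -[y * _ * _]mulrA.
    exact: (Tt mu nu).
  rewrite !mulrA (GL H a hy) -!scalerAl -[y * _ * _]mulrA -(h_KL H) mulrA -[y * _ * _ * _]mulrA (h_LL H).
  by rewrite -[y * _ * _]mulrA; exact: (Tt mu nu).
- move=> j; apply: Tm => mu nu y x a b hy hx.
  have [y1 [y2 [h1 h2 e]]] := der_ex H j hy.
  have eL : ql b * E j = (chi (pi j) b)^-1 *: (E j * ql b) by exact: (h_LE H).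
  have eK : qk a * E j = chi a (pi j) *: (E j * qk a) by exact: (h_KE H).
  have -> : E j * (y * (qk a * ql b) * x) =
    (chi (pi j) b / chi a (pi j)) *: (y * (qk a * ql b) * (E j * x))
    + 1 *: (y1 * (qk (pi j + a) * ql b) * x) + 1 *: (y2 * (qk a * ql (pi j + b)) * x).
    have -> : E j * (y * (qk a * ql b) * x) = (E j * y) * (qk a * ql b) * x by rewrite !mulrA.
    rewrite e -(h_KK H) -(h_LL H) !scale1r !mulrDl -addrA; congr (_ + (_ + _)).
    - have e2 : qk a * ql b * E j = ((chi (pi j) b)^-1 * chi a (pi j)) *: (E j * (qk a * ql b)).
        by rewrite -mulrA eL -scalerAr [qk a * (E j * _)]mulrA eK -scalerAl scalerA mulrA.
      have -> : y * (qk a * ql b) * (E j * x) = y * (qk a * ql b * E j) * x by rewrite !mulrA.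
      rewrite e2 -scalerAr -scalerAl scalerA.
      have -> : chi (pi j) b / chi a (pi j) * ((chi (pi j) b)^-1 * chi a (pi j)) = 1.
        by field; rewrite !(chi_nz H).
      by rewrite scale1r !mulrA.
    - by rewrite !mulrA.
    - by rewrite !mulrA -[y2 * ql _ * qk _]mulrA -(h_KL H) !mulrA.
  apply: (TA); first apply: (TA).
  - by apply: (Tt mu (pi j + nu)) => //; exact: GenM.
  - exact: (Tt (mu - pi j) nu).
  - exact: (Tt (mu - pi j) nu).
- move=> j; apply: Tm => mu nu y x a b hy hx.
  rewrite !mulrA -[_ * qk a * ql b]mulrA -[X in T X]scale1r.
  by apply: (Tt (pi j + mu) nu) => //; exact: GenM.
Qed.

End Generation.

(** * The reflected data form a Borel pair *)

Section ReflectedBorel.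
Variables (K : fieldType) (A : zmodType) (U : algType K) (I : finType).
Variables (chi : A -> A -> K) (qk ql : A -> U) (pi : I -> A).
Variables (crd : I -> A -> int) (E F : I -> U).
Hypothesis B : borel chi qk ql pi crd E F.
Variables (i : I) (M : I -> nat).
Local Notation al := (pi i).
Local Notation q := (chi (pi i) (pi i)).
Local Notation chiT := (fun a b => chi b a).
Local Notation bm := (bm chi pi i).
Hypothesis hM : forall j, j != i -> bm j (M j) = 0 /\ forall k, (k < M j)%N -> bm j k != 0.
Let H := b_pb B.
Let H' := pborel_swap H.
Let q0 : q != 0 := chi_nz H _ _.
Let hMT := hM' B hM.
Local Notation Fm' := (Fm chi pi F i).
Local Notation Em := (Fm chiT pi E i).
Local Notation Km := (Gen (@km_deg A I pi i) (@km_gen K A U I chi pi F i)).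
Local Notation Kp := (Gen (@km_deg A I pi i) (@km_gen K A U I chiT pi E i)).
Local Notation pi' := (rpi pi i M).
Local Notation f := (rf chi ql pi E F i M).
Local Notation e := (rf chiT qk pi F E i M).
Local Notation eh := (ql (- pi i) * E i).
Local Notation fh := (qk (- pi i) * F i).

(** Inverse to the constants of [fh_eh] and [Em_Fm], so that the reflected commutators are exactly L
    - K; the reflected E_j are left unscaled. *)
Definition rsc j := if j == i then q^-1 else (- ac chi pi i j (M j) 0)^-1.
Definition rF j := rsc j *: f j.

Lemma rsc_neq0 j : rsc j != 0.
Proof.
rewrite /rsc; case: (eqVneq j i) => [_|ji]; rewrite /= invr_eq0 // oppr_eq0.
have [_] := hM ji; elim: (M j) => [|m IH] hb; first by rewrite /= oppr_eq0 oner_eq0.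
rewrite (acS0 H) oppr_eq0; apply: mulf_neq0; last by apply: IH => k hk; apply/hb/ltnW.
by rewrite mulf_neq0 ?invr_eq0 ?(chi_nz H) ?hb.
Qed.

Lemma Gen_rF : Gen pi' rF = Gen pi' f.
Proof.
apply/funext => mu; apply/funext => x; apply/propext.
exact: (Gen_rescale _ _ _ _ rsc_neq0).
Qed.

Lemma al_mul_inj r s : al *+ r = al *+ s -> r = s.
Proof.
move=> /(congr1 (crd i)); rewrite !(crdMn H) (h_crdpi H) eqxx => e.
by apply/eqP; rewrite -(eqr_nat int); apply/eqP.
Qed.

(** eh^r is a multiple of L_(-r al) E_i^r, so distinct powers differ in their torus exponent, and
    [gam] singles out the one for [r0]. *)
Lemma keterm_indepR mu s (k : nat -> U) : (forall r, Km (mu + al *+ r) (k r)) ->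
  (forall r, qfact q r = 0 -> k r = 0) ->
  \sum_(r < s) keterm ql pi E i false r (k r) = 0 -> forall r, (r < s)%N -> k r = 0.
Proof.
move=> hk k0 sum0 r0 lt; apply/eqP; apply/negPn/negP => nz.
have qn : qfact q r0 != 0 by apply/eqP => z; rewrite k0 ?eqxx in nz.
have [phi [phil phi1]] := separating_functional nz.
have [psi [psil psi1]] := separating_functional (Fn_neq0 H' qn).
have /choice[c hc] p : exists c : K, c != 0 /\ eh ^+ p = c *: (ql (- (al *+ p)) * E i ^+ p).
  have [c c0 ->] := eh_exp B i p; exists (c * chi al (- (al *+ p)) ^+ p).
  rewrite (EnL B) scalerA -mulrA mulfV ?mulr1 ?mulf_neq0 ?expf_neq0 ?(chi_nz H) //.
pose gam (a b : A) : K := (b == - (al *+ r0))%:R.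
suff : \sum_(r < s) c r * (phi (k r) * gam 0 (- (al *+ r)) * psi (E i ^+ r)) = 0.
  rewrite (bigD1 (Ordinal lt)) //= phi1 psi1 /gam eqxx !mulr1 big1 ?addr0 => [|r /negbTE ne].
    by move/eqP; rewrite (negbTE (hc r0).1).
  case: eqP => [/oppr_inj/al_mul_inj er|_]; last by rewrite mulr0 mul0r mulr0.
  by move: ne; rewrite -val_eqE /= er eqxx.
apply: (b_tri B (phi := fun=> phi) (psi := fun=> psi) (gam := gam)).
- by move=> ?; exact: linon_lin.
- by move=> ?; exact: linon_lin.
rewrite -sum0; apply: tg_sum.
- by move=> ?; exact: Gen0.
- by move=> mu0 c0 x y; exact: GenD.
- by move=> ?; exact: linon_lin.
move=> r _; rewrite /keterm (hc r).2 -scalerAr.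
have -> : k r * (ql (- (al *+ r)) * E i ^+ r) = k r * (qk 0 * ql (- (al *+ r))) * E i ^+ r.
  by rewrite (h_K0 H) mul1r mulrA.
rewrite -[_ *: _]addr0 -[c r * _]addr0; apply: tg_lin.
- by move=> ?; exact: Gen0.
- by move=> mu0 c0 x y; exact: GenD.
- by move=> ?; exact: linon_lin.
- by apply: (tg_term _ _ (fun=> phi) (fun=> psi) gam _ _ (Km_Nm (hk r)) (Nm_Fn pi E i r)).
- exact: tg0.
Qed.

Lemma keterm_indepL mu s (k : nat -> U) : (forall r, Kp (mu + al *+ r) (k r)) ->
  (forall r, qfact q r = 0 -> k r = 0) ->
  \sum_(r < s) keterm qk pi F i true r (k r) = 0 -> forall r, (r < s)%N -> k r = 0.
Proof.
move=> hk k0 sum0 r0 lt; apply/eqP; apply/negPn/negP => nz.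
have qn : qfact q r0 != 0 by apply/eqP => z; rewrite k0 ?eqxx in nz.
have [psi [psil psi1]] := separating_functional nz.
have [phi [phil phi1]] := separating_functional (Fn_neq0 H qn).
have /choice[c hc] p : exists c : K, c != 0 /\ fh ^+ p = c *: (F i ^+ p * qk (- (al *+ p))).
  by have [c c0 ->] := fh_exp B i p; exists c.
pose gam (a b : A) : K := (a == - (al *+ r0))%:R.
suff : \sum_(r < s) c r * (phi (F i ^+ r) * gam (- (al *+ r)) 0 * psi (k r)) = 0.
  rewrite (bigD1 (Ordinal lt)) //= phi1 psi1 /gam eqxx !mulr1 big1 ?addr0 => [|r /negbTE ne].
    by move/eqP; rewrite (negbTE (hc r0).1).
  case: eqP => [/oppr_inj/al_mul_inj er|_]; last by rewrite mulr0 mul0r mulr0.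
  by move: ne; rewrite -val_eqE /= er eqxx.
apply: (b_tri B (phi := fun=> phi) (psi := fun=> psi) (gam := gam)).
- by move=> ?; exact: linon_lin.
- by move=> ?; exact: linon_lin.
rewrite -sum0; apply: tg_sum.
- by move=> ?; exact: Gen0.
- by move=> mu0 c0 x y; exact: GenD.
- by move=> ?; exact: linon_lin.
move=> r _; rewrite /keterm (hc r).2 -scalerAl.
have -> : F i ^+ r * qk (- (al *+ r)) * k r = F i ^+ r * (qk (- (al *+ r)) * ql 0) * k r.
  by rewrite (h_L0 H) mulr1.
rewrite -[_ *: _]addr0 -[c r * _]addr0; apply: tg_lin.
- by move=> ?; exact: Gen0.
- by move=> mu0 c0 x y; exact: GenD.
- by move=> ?; exact: linon_lin.
- by apply: (tg_term _ _ (fun=> phi) (fun=> psi) gam _ _ (Nm_Fn pi F i r) (Km_Nm (hk r))).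
- exact: tg0.
Qed.

Lemma refl_pborel : pborel chi qk ql pi' (rcrd crd i M) e rF.
Proof.
have triF : tri qk ql (Gen pi' rF) (Gen pi' e) by rewrite Gen_rF; exact: (refl_tri B hM).
have rK a j : qk a * e j = chi a (pi' j) *: (e j * qk a) by exact: (rf_L H').
have rL a j : ql a * e j = (chi (pi' j) a)^-1 *: (e j * ql a) by exact: (rf_K H').
have [iF iE] : (forall j mu y1 y2, Gen pi' rF mu y1 -> Gen pi' rF mu y2 ->
    y1 * qk (pi' j) + y2 * ql (pi' j) = 0 -> y1 = 0 /\ y2 = 0) /\
  (forall j mu y1 y2, Gen pi' e mu y1 -> Gen pi' e mu y2 ->
    y1 * qk (pi' j) + y2 * ql (pi' j) = 0 -> y1 = 0 /\ y2 = 0).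
  apply: (@tri_inj _ _ _ _ _ _ _ (rcrd crd i M) chi _ _ (h_one H) (rcrd_pi H i M) _ (h_K0 H) (h_L0 H) (h_chi H)) => //.
  - by move=> j; apply: (addrI (rcrd crd i M j 0)); rewrite -(rcrdD H) !addr0.
  - move=> mu x a; apply: (Gen_scal (c := chi a)); [exact: chi0r H a | exact: chiDr H a | exact: rK].
  - move=> mu x a; apply: (Gen_scal (c := fun m => (chi m a)^-1)).
    + by rewrite (chi0l H) invr1.
    + by move=> b c; rewrite (chiDl H) invfM.
    + exact: rL.
have pii : pi' i = - al by rewrite /rpi eqxx.
have ei : e i = fh by rewrite /rf eqxx.
have ej j : j != i -> e j = Em j (M j) by rewrite /rf => /negbTE ->.
split=> //; rewrite ?(h_K0 H) ?(h_L0 H) //.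
- exact: h_chi H.
- exact: (rcrdD H).
- exact: (rcrd_pi H).
- exact: (rcrdE H).
- exact: h_one H.
- exact: h_KK H.
- exact: h_LL H.
- exact: h_KL H.
- by move=> a j; rewrite /rF -scalerAr (rf_K H) -scalerAl !scalerA mulrC.
- by move=> a j; rewrite /rF -scalerAr (rf_L H) -scalerAl !scalerA mulrC.
- move=> j k; rewrite /rF /rf /rsc /rpi.
  case: (eqVneq j i) => [eji|ji]; case: (eqVneq k i) => [eki|ki].
  + rewrite eji eki eqxx mulr1n -scalerAr (fh_eh H) scalerDr scalerA mulVf // scale1r.
    by rewrite scalerAl.
  + by rewrite eji eq_sym (negbTE ki) mulr0n addr0 -scalerAr (fh_Fm H hM ki) scalerAl.
  + by rewrite eki (negbTE ji) mulr0n addr0 -scalerAr -scalerAl (fh_Fm H' hMT ji).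
  + case: (eqVneq j k) => [<-|jk]; last first.
      by rewrite mulr0n addr0 -scalerAr (Em_Fm_comm H) // scalerAl.
    have [_ e0] := Em_Fm H (M j) ji; have a0 := rsc_neq0 j.
    move: a0; rewrite /rsc (negbTE ji) invr_eq0 => a0.
    rewrite mulr1n -scalerAr e0 scalerDr scalerAl; congr (_ + _).
    rewrite scalerA invrN mulNr mulVf ?scaleN1r ?opprB //.
    by move: a0; rewrite oppr_eq0.
- move=> mu y hy mu0 hc; rewrite Gen_rF in hy.
  apply: (@refl_ndF _ _ _ _ _ _ _ _ _ _ _ H i M hM hMT _ false mu y) => //.
  + move=> nu y1 y2; rewrite -pii -Gen_rF; exact: iF.
  + exact: keterm_indepR.
  + by rewrite -ei.
  + by move=> j ji; rewrite -ej.
- move=> mu y hy mu0 hc.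
  apply: (@refl_ndF _ _ _ _ _ _ _ _ _ _ _ H' i M hMT hM _ true mu y) => //.
  + by move=> nu y1 y2 h1 h2 h; rewrite -pii addrC in h; case: (iE i nu y2 y1 h2 h1 h).
  + exact: keterm_indepL.
  + have := hc i; rewrite /rF /rsc eqxx -scalerAl -scalerAr => /(scalerI _) h.
    have := h (invr_neq0 q0); by rewrite /rf eqxx.
  + move=> j ji; have := hc j; rewrite /rF -scalerAl -scalerAr => /(scalerI (rsc_neq0 j)).
    by rewrite /rf (negbTE ji).
Qed.

Lemma refl_borel : borel chi qk ql pi' (rcrd crd i M) e rF.
Proof.
split; first exact: refl_pborel.
  by rewrite Gen_rF; exact: (refl_tri B hM).
apply: (tspan_of_generation refl_pborel) => T u [T0 TD [TK TL] TE TF] T1.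
have TZ c v : T v -> T (c *: v) by move=> h; rewrite -[_ *: v]addr0; exact: TD.
have TB v w : T v -> T w -> T (v - w) by move=> hv hw; rewrite addrC -scaleN1r; exact: TD.
have Tf j v : T v -> T (f j * v).
  move=> hv; rewrite -[f j * v](scalerK (rsc_neq0 j)) scalerAl; apply: TZ; exact: TF.
have Ti v : T v -> T (F i * v).
  move=> hv; have -> : F i * v = qk al * (e i * v) by rewrite /rf eqxx !mulrA (KKN H) mul1r.
  by apply: TK; exact: TE.
have Ti' v : T v -> T (E i * v).
  move=> hv; have -> : E i * v = ql al * (f i * v) by rewrite /rf eqxx !mulrA (LLN H) mul1r.
  by apply: TL; exact: Tf.
(* The old F_j come back from the ends of their strings by bracketing with E_i. *)
have TFm j d : j != i -> (d <= M j)%N -> forall v, T v -> T (Fm' j (M j - d) * v).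
  move=> ji; elim: d => [|d IH] hd v hv.
    by rewrite subn0; have := Tf j v hv; rewrite /rf (negbTE ji).
  have [_ hb] := hM ji; have := hb (M j - d.+1)%N; rewrite -subSn // subSS leq_subr.
  set b := (X in X != 0) => /(_ isT) b0.
  have eE : E i * Fm' j (M j - d.+1).+1 = Fm' j (M j - d.+1).+1 * E i + b *: (Fm' j (M j - d.+1) * ql al).
    exact: (E_Fm H).
  rewrite -subSn // subSS in eE.
  have -> : Fm' j (M j - d.+1) * v = b^-1 *: (E i * (Fm' j (M j - d) * (ql (- al) * v))
       - Fm' j (M j - d) * (E i * (ql (- al) * v))).
    rewrite !mulrA eE !mulrDl addrC addKr -!scalerAl scalerA mulVf // scale1r.
    by rewrite -[_ * ql al * _]mulrA (LLN H) mulr1.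
  by apply/TZ/TB; [apply/Ti'/IH/TL => //; exact: ltnW | apply: IH; [exact: ltnW | exact/Ti'/TL]].
have TEm j d : j != i -> (d <= M j)%N -> forall v, T v -> T (Em j (M j - d) * v).
  move=> ji; elim: d => [|d IH] hd v hv.
    by rewrite subn0; have := TE j v hv; rewrite /rf (negbTE ji).
  have [_ hb] := hMT ji; have := hb (M j - d.+1)%N; rewrite -subSn // subSS leq_subr.
  set b := (X in X != 0) => /(_ isT) b0.
  have eE : F i * Em j (M j - d.+1).+1 = Em j (M j - d.+1).+1 * F i + b *: (Em j (M j - d.+1) * qk al).
    exact: (E_Fm H').
  rewrite -subSn // subSS in eE.
  have -> : Em j (M j - d.+1) * v = b^-1 *: (F i * (Em j (M j - d) * (qk (- al) * v))
       - Em j (M j - d) * (F i * (qk (- al) * v))).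
    rewrite !mulrA eE !mulrDl addrC addKr -!scalerAl scalerA mulVf // scale1r.
    by rewrite -[_ * qk al * _]mulrA (KKN H) mulr1.
  by apply/TZ/TB; [apply/Ti/IH/TK => //; exact: ltnW | apply: IH; [exact: ltnW | exact/Ti/TK]].
apply: (tspan_generates u (b_span B)) => //; split=> //.
  move=> j v hv; case: (eqVneq j i) => [->|ji]; first exact: Ti'.
  by have := TEm j (M j) ji (leqnn _) v hv; rewrite subnn.
move=> j v hv; case: (eqVneq j i) => [->|ji]; first exact: Ti.
by have := TFm j (M j) ji (leqnn _) v hv; rewrite subnn.
Qed.

End ReflectedBorel.

(** * Finite dimension inside arbitrary vector spaces *)

Section FiniteDimension.
Variables (K : fieldType) (M : lmodType K).
Implicit Types (S T : M -> Prop).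

(** Bases are indexed by arbitrary finite types, so that direct sums can use a sigma type. *)
Definition fbasis S (J : finType) (b : J -> M) :=
  [/\ forall j, S (b j),
      forall c : J -> K, \sum_j c j *: b j = 0 -> forall j, c j = 0
    & forall x, S x -> exists c : J -> K, x = \sum_j c j *: b j].

Definition fdim S n := exists (J : finType) (b : J -> M), fbasis S b /\ #|J| = n.

Definition subsp S := S 0 /\ forall c x y, S x -> S y -> S (c *: x + y).

Lemma subsp_sum S (T : Type) (r : seq T) (P : pred T) (f : T -> M) :
  subsp S -> (forall t, P t -> S (f t)) -> S (\sum_(t <- r | P t) f t).
Proof.
case=> S0 SD h; elim/big_rec: _ => // t x Pt Sx.
by rewrite -[f t]scale1r; apply: SD => //; exact: h.
Qed.

Lemma fbasis_free_le S (J L : finType) (b : J -> M) (v : L -> M) :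
  fbasis S b -> (forall l, S (v l)) ->
  (forall c : L -> K, \sum_l c l *: v l = 0 -> forall l, c l = 0) -> (#|L| <= #|J|)%N.
Proof.
move=> [_ _ sp] vS vf.
have /choice[A hA] l := sp _ (vS l).
pose Am : 'M[K]_(#|L|, #|J|) := \matrix_(l, j) A (enum_val l) (enum_val j).
suff : row_free Am by rewrite /row_free => /eqP <-; exact: rank_leq_col.
apply: inj_row_free => x e.
suff h : \sum_l x 0 (enum_rank l) *: v l = 0.
  by apply/rowP => l; rewrite mxE -(enum_valK l); exact: (vf _ h).
rewrite (eq_bigr (fun l => \sum_j (x 0 (enum_rank l) * A l j) *: b j)); last first.
  by move=> l _; rewrite {1}(hA l) scaler_sumr; apply: eq_bigr => j _; rewrite scalerA.
rewrite exchange_big /= big1 // => j _; rewrite -scaler_suml.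
have := congr1 (fun y : 'rV_ _ => y 0 (enum_rank j)) e; rewrite !mxE => e1.
rewrite (reindex _ (onW_bij _ (enum_val_bij L))) /=.
rewrite (eq_bigr (fun l => x 0 l * Am l (enum_rank j))) ?e1 ?scale0r // => l _.
by rewrite mxE enum_valK enum_rankK.
Qed.

Lemma fdim_uniq S n m : fdim S n -> fdim S m -> n = m.
Proof.
move=> [J [b [hb <-]]] [L [d [hd <-]]]; apply/eqP; rewrite eqn_leq.
have [b1 b2 _] := hb; have [d1 d2 _] := hd.
by rewrite (fbasis_free_le hd b1 b2) (fbasis_free_le hb d1 d2).
Qed.

Lemma fdim_eq S T n : (forall x, S x <-> T x) -> fdim S n -> fdim T n.
Proof.
move=> h [J [b [[b1 b2 b3] e]]]; exists J, b; split=> //; split=> // [j|x /h]; last exact: b3.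
exact/h.
Qed.

Lemma fdim0 S : (forall x, S x -> x = 0) -> fdim S 0.
Proof.
move=> h; exists void, (fun=> 0); split; last exact: card_void.
split; [by case | by move=> c _ [] | move=> x /h ->].
by exists (fun=> 0); rewrite big1 // => -[].
Qed.

Lemma fdim_eq0 S x : fdim S 0 -> S x -> x = 0.
Proof.
move=> [J [b [[_ _ b3] J0]]] /b3[c ->]; rewrite big1 // => j.
by have := card0_eq J0 j.
Qed.

Lemma fdim1 S v : (forall c, S (c *: v)) -> (forall x, S x -> exists c, x = c *: v) ->
  v != 0 -> fdim S 1.
Proof.
move=> h1 h2 v0; exists unit, (fun=> v); split; last exact: card_unit.
have e (c : unit -> K) : \sum_j c j *: v = c tt *: v.
  by rewrite (bigD1 tt) //= big1 ?addr0 // => -[].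
split=> [_|c|x /h2[c ->]]; first by rewrite -[v]scale1r.
  by rewrite e => /eqP; rewrite scaler_eq0 (negbTE v0) orbF => /eqP h [].
by exists (fun=> c); rewrite e.
Qed.

Lemma fdim_sub_ex S T n : subsp S -> (forall x, S x -> T x) -> fdim T n -> exists m, fdim S m.
Proof.
move=> Ssub ST [J [b [hb _]]].
pose Q m := `[< exists v : 'I_m -> M, (forall l, S (v l)) /\
  forall c : 'I_m -> K, \sum_l c l *: v l = 0 -> forall l, c l = 0 >].
have exQ : exists m, Q m by exists 0%N; apply/asboolP; exists (fun=> 0); split=> [[]|c _ []].
have bQ m : Q m -> (m <= #|J|)%N.
  by move=> /asboolP[v [v1 v2]]; have := fbasis_free_le hb (fun l => ST _ (v1 l)) v2; rewrite card_ord.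
case: (ex_maxnP exQ bQ) => m /asboolP[v [v1 v2]] mx; exists m.
exists 'I_m, v; split; last exact: card_ord.
split=> // x Sx; apply: contrapT => nx; suff : Q m.+1 by move/mx; rewrite ltnn.
apply/asboolP; exists (fun l => if unlift ord_max l is Some l' then v l' else x); split.
  by move=> l; case: unliftP.
move=> c; rewrite big_ord_recr /= unlift_none.
rewrite (eq_bigr (fun l => c (widen_ord (leqnSn m) l) *: v l)) => [e|l _]; last first.
  have -> : widen_ord (leqnSn m) l = lift ord_max l by apply: val_inj; rewrite /= /bump leqNgt ltn_ord.
  by rewrite liftK.
have c0 : c ord_max = 0.
  apply/eqP; apply/negPn/negP => nz; apply: nx.
  exists (fun l => - (c ord_max)^-1 * c (widen_ord (leqnSn m) l)).
  rewrite (eq_bigr (fun l => - (c ord_max)^-1 *: (c (widen_ord (leqnSn m) l) *: v l))); last first.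
    by move=> l _; rewrite scalerA.
  rewrite -scaler_sumr; move/eqP: e; rewrite addr_eq0 => /eqP ->.
  by rewrite scalerN scaleNr opprK scalerA mulVf // scale1r.
rewrite c0 scale0r addr0 in e.
move=> l; case: (unliftP ord_max l) => [l' ->|->] //.
have := v2 _ e l'; congr (c _ = 0).
by apply: val_inj; rewrite /= /bump leqNgt ltn_ord.
Qed.

Lemma fdim_sum S (N : nat) (T : 'I_N -> M -> Prop) (g : 'I_N -> M -> M) (n : 'I_N -> nat) :
  (forall r, subsp (T r)) -> (forall r c x y, g r (c *: x + y) = c *: g r x + g r y) ->
  (forall r, fdim (T r) (n r)) -> subsp S ->
  (forall r x, T r x -> S (g r x)) ->
  (forall x, S x -> exists y : 'I_N -> M, (forall r, T r (y r)) /\ x = \sum_r g r (y r)) ->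
  (forall y : 'I_N -> M, (forall r, T r (y r)) -> \sum_r g r (y r) = 0 -> forall r, y r = 0) ->
  fdim S (\sum_r n r).
Proof.
move=> Tsub glin /choice[J hJ] Ssub gS gspan gind.
have {}hJ r : exists b : J r -> M, fbasis (T r) b /\ #|J r| = n r by exact: hJ.
have [b hb] : exists b : forall r, J r -> M, forall r, fbasis (T r) (b r) /\ #|J r| = n r.
  have h r := cid (hJ r); exists (fun r => sval (h r)) => r; exact: svalP (h r).
have g0 r : g r 0 = 0 by have := glin r (-1) 0 0; rewrite scaler0 addr0 scaleN1r addNr.
have gsum r (L : finType) (c : L -> K) (v : L -> M) : g r (\sum_l c l *: v l) = \sum_l c l *: g r (v l).
  by elim/big_rec2: _ => // l x y _ <-; rewrite glin.
exists {r : 'I_N & J r}, (fun t => g (tag t) (b (tag t) (tagged t))); split; last first.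
  by rewrite card_tagged sumnE big_map big_enum /=; apply: eq_bigr => r _; case: (hb r).
split.
- by move=> t; apply: gS; case: (hb (tag t)) => -[].
- move=> c e [r j].
  have es : \sum_r g r (\sum_(j : J r) c (Tagged J j) *: b r j) = 0.
    rewrite -[RHS]e (eq_bigr _ (fun r _ => gsum r _ _ _)).
    rewrite (sig_big_dep predT (fun=> predT) (fun r (j : J r) => c (Tagged J j) *: g r (b r j))) /=.
    by apply: eq_bigr => -[].
  have [[b1 b2 b3] _] := hb r.
  apply: (b2 (fun j => c (Tagged J j))); apply: (gind _ _ es) => r' .
  by apply: subsp_sum => // l _; have [[d1 _ _] _] := hb r'; have [t0 td] := Tsub r';
    rewrite -[_ *: _]addr0; exact: td.
- move=> x /gspan[y [yT ->]].
  have /choice[c hc] : forall r, exists c : {r : 'I_N & J r} -> K, y r = \sum_(j : J r) c (Tagged J j) *: b r j.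
    move=> r; have [[_ _ /(_ _ (yT r))[c ec]] _] := hb r.
    exists (fun t => untag 0 c t); rewrite ec; apply: eq_bigr => j _.
    by rewrite (untagE 0 c (erefl : tag (Tagged J j) = r)).
  exists (fun t => c (tag t) t).
  rewrite (eq_bigr (fun r => \sum_(j : J r) c r (Tagged J j) *: g r (b r j))); last first.
    by move=> r _; rewrite hc gsum.
  rewrite (sig_big_dep predT (fun=> predT) (fun r (j : J r) => c r (Tagged J j) *: g r (b r j))) /=.
  by apply: eq_bigr => -[].
Qed.

End FiniteDimension.

(** * Counting exponents of PBW monomials *)

Section Count.
Variables (K : fieldType) (A : zmodType) (chi : A -> A -> K).

(** Coefficient of [lam] in the product over [rs] of the series in x^b, cut off where the quantum
    factorial vanishes and at the exponent [N]. By [cnt_stable] the value of [N] is immaterial once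
    it exceeds the height of [lam]; repetitions in [rs] are multiplicities. *)
Fixpoint cnt (N : nat) (rs : seq A) (lam : A) : nat :=
  if rs is b :: l then \sum_(s < N | qfact (chi b b) s != 0) cnt N l (lam - b *+ s)
  else lam == 0.

Lemma cnt_front N rs b lam : b \in rs -> cnt N rs lam = cnt N (b :: rem b rs) lam.
Proof.
elim: rs lam => //= c l IH lam; rewrite inE eq_sym; case: eqP => [->|_] //= bl.
rewrite (eq_bigr _ (fun s _ => IH _ bl)) /= exchange_big /=.
by apply: eq_bigr => s _; apply: eq_bigr => r _; rewrite -!addrA [- _ - _]addrC.
Qed.

Section Functional.
Variable f : A -> int.
Hypothesis fD : forall a b, f (a + b) = f a + f b.

Lemma addf0 : f 0 = 0.
Proof. by apply: (addrI (f 0)); rewrite -fD !addr0. Qed.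
Lemma addfN a : f (- a) = - f a.
Proof. by apply: (addrI (f a)); rewrite -fD !subrr addf0. Qed.
Lemma addfMn a n : f (a *+ n) = f a *+ n.
Proof. by elim: n => [|n IH]; rewrite ?addf0 // !mulrS fD IH. Qed.
Lemma addf_sub a b n : f (a - b *+ n) = f a - f b *+ n.
Proof. by rewrite fD addfN addfMn. Qed.

Lemma cnt_cone N rs lam : (forall b, b \in rs -> 0 <= f b) ->
  cnt N rs lam != 0%N -> 0 <= f lam.
Proof.
elim: rs lam => [|b l IH] lam hb /=.
  by case: (eqVneq lam 0) => // -> _; rewrite addf0.
rewrite sum_nat_eq0 negb_forall => /existsP[s]; rewrite negb_imply => /andP[_ /IH h].
have {}h : 0 <= f (lam - b *+ s) by apply: h => c cl; apply: hb; rewrite inE cl orbT.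
move: h; rewrite addf_sub subr_ge0; apply: le_trans.
by apply: mulrn_wge0; apply: hb; rewrite inE eqxx.
Qed.

Lemma cnt_out N rs lam : (forall b, b \in rs -> 0 <= f b) -> f lam < 0 -> cnt N rs lam = 0%N.
Proof.
move=> hb lt; apply/eqP; apply: contraTT lt => /cnt_cone h.
by rewrite -leNgt; apply: h.
Qed.

Lemma cnt_stable N N' rs lam : (forall b, b \in rs -> 0 < f b) -> f lam < N%:Z -> (N <= N')%N ->
  cnt N' rs lam = cnt N rs lam.
Proof.
move=> hb + le; elim: rs lam hb => //= b l IH lam hb lt.
have hb0 : 0 < f b by apply: hb; rewrite inE eqxx.
have hl c : c \in l -> 0 < f c by move=> cl; apply: hb; rewrite inE cl orbT.
rewrite -(subnKC le) big_split_ord /= [X in (_ + X)%N]big1 ?addn0; last first.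
  move=> s _; rewrite (@cnt_out _ l) //; first by move=> c /hl/ltW.
  by rewrite addf_sub subr_lt0 -[_ *+ _]mulr_natr natz /=; nia.
apply: eq_bigr => s _; rewrite (subnKC le) IH //.
by apply: le_lt_trans lt; rewrite addf_sub gerBl mulrn_wge0 // ltW.
Qed.

End Functional.

Lemma cnt_tail N b l lam : (0 < N)%N -> (cnt N l lam <= cnt N (b :: l) lam)%N.
Proof.
case: N => // N _ /=; rewrite (bigD1 ord0) /=; last by rewrite qfact0 oner_eq0.
by rewrite mulr0n subr0 leq_addr.
Qed.

Lemma cnt0_gt0 N l : (0 < N)%N -> (0 < cnt N l 0)%N.
Proof.
move=> N0; elim: l => [|b l IH] /=; first by rewrite eqxx.
exact: leq_trans IH (cnt_tail b l 0 N0).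
Qed.

Lemma qfact1 (q : K) : qfact q 1 = 1.
Proof. by rewrite qfactS qfact0 qnum1 mulr1. Qed.

Lemma cnt_mem_gt0 N b l : (1 < N)%N -> b \in l -> (0 < cnt N l b)%N.
Proof.
case: N => // -[] // N _ /(cnt_front N.+2) ->; rewrite /=.
rewrite (bigD1 (lift ord0 ord0)) /=; last by rewrite qfact1 oner_eq0.
by rewrite mulr1n subrr addn_gt0 cnt0_gt0.
Qed.

End Count.

Lemma hgt_gt0 (K : fieldType) (A : zmodType) (U : algType K) (I : finType)
    (chi : A -> A -> K) (qk ql : A -> U) (pi : I -> A) (crd : I -> A -> int) (E F : I -> U)
    (H : pborel chi qk ql pi crd E F) b :
  (forall j, 0 <= crd j b) -> b != 0 -> 0 < hgt crd b.
Proof.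
move=> h nz; rewrite lt_neqAle sumr_ge0 // andbT; apply: contraNneq nz => e.
apply/eqP/(crd_inj H) => j; rewrite (crd0 H); move/esym/eqP: e.
by rewrite psumr_eq0 // => /allP/(_ j); rewrite mem_index_enum => /(_ isT)/eqP.
Qed.

(** * The Hilbert series and its reflection *)

Section Hilbert.
Variables (K : fieldType) (A : zmodType) (U : algType K) (I : finType).
Implicit Types (chi : A -> A -> K) (pi : I -> A) (crd : I -> A -> int) (F : I -> U).

(** [rs] lists the roots of the current Borel pair with multiplicity: [hil_dim] states that the
    negative half has the Hilbert series of a PBW basis with these roots. *)
Record hil chi pi crd F (rs : seq A) : Prop := Hil {
  hil_cone : forall b, b \in rs -> forall j, 0 <= crd j b;
  hil_nz : forall b, b \in rs -> b != 0;
  hil_neq1 : forall b, b \in rs -> chi b b != 1;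
  hil_dim : forall lam N, hgt crd lam < N%:Z -> fdim (Gen pi F lam) (cnt chi N rs lam) }.

Lemma Gen_subsp (J : Type) (dg : J -> A) (g : J -> U) mu : subsp (Gen dg g mu).
Proof. by split; [exact: Gen0 | move=> c x y; exact: GenD]. Qed.

Variables (chi : A -> A -> K) (qk ql : A -> U) (pi : I -> A).
Variables (crd : I -> A -> int) (E F : I -> U).
Hypothesis B : borel chi qk ql pi crd E F.
Let H := b_pb B.

Variables (rs : seq A) (i : I).
Hypothesis Hl : hil chi pi crd F rs.
Local Notation al := (pi i).
Local Notation q := (chi (pi i) (pi i)).
Local Notation l := (rem (pi i) rs).

Lemma rs_hgt b : b \in rs -> 0 < hgt crd b.
Proof. by move=> h; apply: (hgt_gt0 H); [exact: (hil_cone Hl h) | exact: (hil_nz Hl h)]. Qed.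

Lemma Nm_power k y : Gen pi F (al *+ k) y -> exists c, y = c *: F i ^+ k.
Proof.
have [mu e0] : exists mu, mu = al *+ k by exists (al *+ k).
rewrite -e0 => h; elim: h k e0 => [|c|j c z hz IH|c e z w _ IHz _ IHw] k e0.
- have [k0|k0] := posnP k; first by exists 1; rewrite k0 scale1r expr0.
  by case/eqP: (al_mul_neq0 H i k.-1); rewrite prednK.
- by exists 0; rewrite scale0r.
- case: (eqVneq j i) => [ji|ji].
    case: k e0 => [|k] e0.
      exists 0; rewrite scale0r (Nm_out H (i := i) hz) ?mulr0 //.
      have -> : c = - al by apply: (addrI al); rewrite subrr -{1}ji e0.
      by rewrite (crdN H) (h_crdpi H) eqxx oppr_lt0.
    have ec : c = al *+ k by apply: (addrI al); rewrite -mulrS -e0 ji.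
    by have [v ->] := IH k ec; exists v; rewrite ji exprS scalerAr.
  exists 0; rewrite scale0r (Nm_out H (i := j) hz) ?mulr0 //.
  have -> : c = al *+ k - pi j by rewrite -e0 addrC addKr.
  by rewrite (crdB H) (crdMn H) !(h_crdpi H) eqxx (negbTE ji) mul0rn sub0r oppr_lt0.
- by have [u ->] := IHz k e0; have [v ->] := IHw k e0; exists (e * u + v); rewrite scalerA scalerDl.
Qed.

Lemma fdim_power k : fdim (Gen pi F (al *+ k)) (qfact q k != 0).
Proof.
have [z|nz] /= := eqVneq (qfact q k) 0.
  by apply: fdim0 => x /Nm_power[c ->]; rewrite (Fn_eq0 H z) scaler0.
apply: (fdim1 (v := F i ^+ k)); last exact: (Fn_neq0 H).
  by move=> c; apply/GenZ/Nm_Fn.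
exact: Nm_power.
Qed.

Lemma al_hgt k : hgt crd (al *+ k) = k%:Z.
Proof. by rewrite (addfMn (hgtD H)) (hgt_pi H) natz. Qed.

Lemma l_sub b : b \in l -> b \in rs.
Proof. exact: mem_rem. Qed.

(** Degree [al] has dimension one, so some combination of roots equals [al]; as all roots lie in the
    positive cone, one of them is [al] itself. *)
Lemma simple_in : al \in rs.
Proof.
have h1 : fdim (Gen pi F (al *+ 1)) (cnt chi 2 rs (al *+ 1)).
  by apply: (hil_dim Hl); rewrite al_hgt.
have := fdim_uniq h1 (fdim_power 1); rewrite qfact1 oner_eq0 mulr1n => c1.
apply: contraT => nin; suff : cnt chi 2 rs al = 0%N by rewrite c1.
have h b : b \in rs -> (forall j, 0 <= crd j b) /\ b != 0 /\ b != al.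
  by move=> hb; split; [exact: (hil_cone Hl hb) | split; [exact: (hil_nz Hl hb) | apply: contraNneq nin => <-]].
elim: rs h {h1 c1 nin} => [|b m IH] h /=; first by rewrite (negbTE (pi_neq0 H i)).
have [hb [b0 bal]] := h b (mem_head _ _).
rewrite big1 // => -[[|s] hs] _ /=.
  by rewrite subr0 IH // => c cm; apply: h; rewrite inE cm orbT.
apply/eqP/negPn/negP => nz.
have hc j : 0 <= crd j (al - b *+ s.+1).
  by apply: (cnt_cone (h_crdD H j) _ nz) => c cm; case: (h c); rewrite ?inE ?cm ?orbT.
case/eqP: bal; apply: (crd_inj H) => j.
have cj k : k != i -> crd k b = 0.
  move=> ki; have := hc k; rewrite (crdB H) (crdMn H) (h_crdpi H) (negbTE ki) sub0r oppr_ge0.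
  rewrite pmulrn_lle0 // => le; apply/eqP; rewrite eq_le le; exact: hb.
rewrite (h_crdpi H); case: (eqVneq j i) => [->|/cj //].
have := hc i; rewrite (crdB H) (crdMn H) (h_crdpi H) eqxx subr_ge0 => le.
have ge : 1 <= crd i b.
  rewrite -gtz0_ge1 lt_neqAle hb andbT; apply: contraNneq b0 => e.
  by apply/eqP/(crd_inj H) => k; rewrite (crd0 H); case: (eqVneq k i) => [->|/cj].
apply/eqP; rewrite eq_le ge andbT; apply: le_trans le.
by rewrite mulrS lerDl mulrn_wge0.
Qed.

(** In degree k al the negative half is spanned by F_i^k, and the exponents of [al] already account
    for its dimension; a second root on this line would be one too many. *)
Lemma simple_uniq k : al *+ k \notin l.
Proof.
case: k => [|k]; apply/negP => h; first by have := hil_nz Hl (l_sub h); rewrite eqxx.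
have h1 : fdim (Gen pi F (al *+ k.+1)) (cnt chi k.+2 rs (al *+ k.+1)).
  by apply: (hil_dim Hl); rewrite al_hgt ltz_nat.
have := fdim_uniq h1 (fdim_power k.+1).
rewrite (cnt_front _ _ _ simple_in) /= => e.
have g1 : (0 < cnt chi k.+2 l (al *+ k.+1))%N by apply: cnt_mem_gt0.
move: e; rewrite (bigD1 ord0) /=; last by rewrite qfact0 oner_eq0.
rewrite mulr0n subr0; case: (eqVneq (qfact q k.+1) 0) => [z|nz] /=; first by lia.
rewrite (bigD1 ord_max) /=; last by rewrite nz.
by rewrite subrr; have := cnt0_gt0 chi l (ltn0Sn k.+1); lia.
Qed.

Local Notation Km := (Gen (@km_deg A I pi i) (@km_gen K A U I chi pi F i)).

Lemma Nm_hgt mu y : Gen pi F mu y -> hgt crd mu < 0 -> y = 0.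
Proof.
move=> h lt; apply/eqP; apply: contraTT lt => nz; rewrite -leNgt sumr_ge0 // => j _.
exact: (Nm_cone H h nz).
Qed.

(** The negative half is the direct sum of the Km F_i^s over the nonzero powers. In the resulting
    identity of dimensions the terms with s > 0 agree with the count by induction on the i-th
    coordinate, so the remaining terms agree too. *)
Lemma Km_dim lam N : hgt crd lam < N%:Z -> fdim (Km lam) (cnt chi N l lam).
Proof.
have hl b : b \in l -> 0 <= hgt crd b by move/l_sub/rs_hgt/ltW.
have [n] : exists n : nat, crd i lam < n%:Z.
  exists `|crd i lam|.+1; have := lez_abs (crd i lam); lia.
elim: n lam => [|n IH] lam hn hN.
  rewrite (@cnt_out _ _ _ (crd i)) //; first by apply: fdim0 => x /Km_Nm h; exact: (Nm_out H h hn).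
    exact: h_crdD H i.
  by move=> b /l_sub h; exact: (hil_cone Hl h).
have [neg|pos] := ltP (hgt crd lam) 0.
  rewrite (@cnt_out _ _ _ (hgt crd)) //; last exact: hgtD H.
  by apply: fdim0 => x /Km_Nm h; exact: Nm_hgt h neg.
have N0 : (0 < N)%N by rewrite -ltz_nat; exact: le_lt_trans pos hN.
have [m hm] : exists m, fdim (Km lam) m.
  apply: (fdim_sub_ex (Gen_subsp _ _ _) _ (hil_dim Hl hN)) => x; exact: Km_Nm.
have hs s : fdim (if qfact q s != 0 then Km (lam - al *+ s) else fun x => x = 0)
   (if qfact q s != 0 then if s == 0%N then m else cnt chi N l (lam - al *+ s) else 0).
  case: (qfact q s != 0); last by apply: fdim0.
  case: s => [|s] /=; first by rewrite subr0.
  apply: IH; rewrite ?(addf_sub (hgtD H)) ?(addf_sub (h_crdD H i)) ?(hgt_pi H) ?(h_crdpi H) ?eqxx.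
    by rewrite natz ltrBlDr; apply: lt_le_trans hn _; rewrite -PoszD lez_nat; lia.
  by apply: le_lt_trans hN; rewrite gerBl ler0n.
have := fdim_sum (S := Gen pi F lam) (T := fun s : 'I_N => if qfact q s != 0 then Km (lam - al *+ s) else fun x => x = 0)
  (g := fun s x => x * F i ^+ s) _ _ (fun s : 'I_N => hs s) (Gen_subsp _ _ _) _ _ _.
set tot := (\sum_(r < N) _)%N => hdim.
have {hdim} /(fdim_uniq (hil_dim Hl hN)) : fdim (Gen pi F lam) tot.
  apply: hdim.
  - move=> s; case: ifP => _; first exact: Gen_subsp.
    by split=> // c x y -> ->; rewrite scaler0 addr0.
  - by move=> s c x y; rewrite mulrDl scalerAl.
  - move=> s x; case: ifP => _ => [/Km_Nm h|->]; last by rewrite mul0r; exact: Gen0.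
    by apply: Gen_eq (Gen_mul h (Nm_Fn pi F i s)) _; rewrite subrK.
  - move=> x /(expR_ex H i)[s [k [k1 k2 k3 ->]]].
    exists (fun r : 'I_N => k r); split.
      by move=> r; case: eqP => /= [/k2|_] //; exact: k1.
    have kN r : (N <= r)%N -> k r = 0.
      move=> le; apply: (Nm_hgt (Km_Nm (k1 r))); rewrite (addf_sub (hgtD H)) (hgt_pi H) natz subr_lt0.
      by apply: lt_le_trans hN _; rewrite lez_nat.
    rewrite -(@sum_ord_widen _ _ (fun r => k r * F i ^+ r) s (maxn s N)) ?leq_maxl //.
      by rewrite (@sum_ord_widen _ _ (fun r => k r * F i ^+ r) N) ?leq_maxr // => r /kN ->; rewrite mul0r.
    by move=> r /k3 ->; rewrite mul0r.
  - move=> y hy e0 r.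
    pose k r := if insub r is Some r' then y r' else 0 : U.
    have := @expR_indep _ _ _ _ _ _ _ _ _ _ _ H i lam N k _ r.
    rewrite /k valK; apply; split.
    + move=> p; case: insubP => [p' _ <-|_]; last exact: Gen0.
      have := hy p'; case: eqP => //= _ ->; exact: Gen0.
    + move=> p z; case: insubP => [p' _ ep|_] //.
      by have := hy p'; rewrite ep z eqxx.
    + by move=> p le; case: insubP => // p'; rewrite ltnNge le.
    + by rewrite -[LHS]e0; apply: eq_bigr => p _; rewrite valK.
rewrite (cnt_front _ _ _ simple_in) /= /tot -big_mkcond /=.
case: N N0 {hN hs tot IH} => // N _; rewrite (bigD1 ord0) /=; last by rewrite qfact0 oner_eq0.
rewrite [in RHS](bigD1 ord0) /=; last by rewrite qfact0 oner_eq0.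
rewrite mulr0n subr0 [in RHS](eq_bigr (fun s : 'I_N.+1 => cnt chi N.+1 l (lam - al *+ s))).
  by move/eqP; rewrite eqn_add2r => /eqP ->.
by move=> s /andP[_ /negbTE]; rewrite -val_eqE /= => ->.
Qed.

(** If no [bm] vanishes, the string of F_j never ends, and [Km] is nonzero in the degrees pi j + m
    al for all m. Finitely many roots off the line of [al] cannot reach all these degrees. *)
Lemma string_bounded : exists M : I -> nat, forall j, j != i ->
  bm chi pi i j (M j) = 0 /\ forall k, (k < M j)%N -> bm chi pi i j k != 0.
Proof.
suff h j : exists m, j != i -> bm chi pi i j m = 0 /\ forall k, (k < m)%N -> bm chi pi i j k != 0.
  by have [M hM] := choice h; exists M.
case: (eqVneq j i) => [_|ji]; first by exists 0%N.
have [[m bm0]|nb] := pselect (exists m, bm chi pi i j m == 0).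
  have ex : exists m, bm chi pi i j m == 0 by exists m.
  case: (ex_minnP ex) => p /eqP hp mn; exists p => _; split=> // k kp.
  by apply/negP => /mn; rewrite leqNgt kp.
have {}nb m : bm chi pi i j m != 0 by apply/negP => z; apply: nb; exists m.
(* The functional [g] below is nonnegative on the roots of [l], which all have a positive coordinate
   other than the i-th, and takes the value C - m at pi j + m al. *)
pose C : int := \sum_(b <- l) `|crd i b|.
pose g a : int := C * (\sum_(k | k != i) crd k a) - crd i a.
have gD a b : g (a + b) = g a + g b.
  rewrite /g (h_crdD H) (eq_bigr _ (fun k _ => h_crdD H k a b)) big_split /=; ring.
have hg b : b \in l -> 0 <= g b.
  move=> bl; have bC : crd i b <= C.
    apply: le_trans (ler_norm _) _; rewrite /C (big_rem b bl) /= lerDl sumr_ge0 //.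
  have cb := hil_cone Hl (l_sub bl).
  rewrite /g subr_ge0; apply: le_trans bC _; rewrite ler_peMr //; first exact: sumr_ge0.
  rewrite -gtz0_ge1 lt_neqAle sumr_ge0 // andbT; apply/eqP => e.
  have z k : k != i -> crd k b = 0.
    by move=> ki; move/esym/eqP: e; rewrite psumr_eq0 // => /allP/(_ k); rewrite mem_index_enum ki => /(_ isT)/eqP.
  have : b = al *+ `|crd i b|.
    apply: (crd_inj H) => k; rewrite (crdMn H) (h_crdpi H).
    case: (eqVneq k i) => [->|/z ->]; last by rewrite mul0rn.
    by rewrite natz gez0_abs.
  by move=> eb; have := simple_uniq `|crd i b|; rewrite -eb bl.
pose m := `|C|.+1; pose lam := pi j + al *+ m.
have hN : hgt crd lam < (m.+2)%:Z by rewrite (hgtD H) al_hgt (hgt_pi H); lia.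
have : cnt chi m.+2 l lam = 0%N.
  apply: (@cnt_out _ _ chi g gD _ l lam hg); rewrite /g /lam (h_crdD H) (crdMn H) !(h_crdpi H) eqxx eq_sym (negbTE ji) add0r natz.
  rewrite (bigD1 j) //= big1 => [|k /andP[ki kj]].
    by rewrite (h_crdD H) (crdMn H) !(h_crdpi H) eqxx (negbTE ji) mul0rn !addr0 mulr1 /m; have := lez_abs C; lia.
  by rewrite (h_crdD H) (crdMn H) !(h_crdpi H) (negbTE ki) (negbTE kj) mul0rn.
have := Km_dim hN => + e0; rewrite e0 => /fdim_eq0/(_ (Km_Fm chi pi F m ji)) e1.
by have := Fm_neq0 H ji (m := m) (fun k _ => nb k); rewrite e1 eqxx.
Qed.

Variable M : I -> nat.
Hypothesis hM : forall j, j != i -> bm chi pi i j (M j) = 0 /\ forall k, (k < M j)%N -> bm chi pi i j k != 0.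

(** [Km] has the roots other than [al] and is common to both halves, while powers of an element of
    degree -al replace those of F_i. A root of [l] is positive for the new basis because [Km] is
    nonzero in its degree and lies in the new half. *)
Lemma hil_refl : hil chi (rpi pi i M) (rcrd crd i M) (rF chi ql pi E F i M) (- al :: l).
Proof.
have B' := refl_borel B hM; have H1 := b_pb B'.
have GrF := Gen_rF B hM.
have cone' b : b \in - al :: l -> (forall j, 0 <= rcrd crd i M j b) /\ b != 0.
  rewrite inE => /orP[/eqP ->|bl].
    split=> [j|]; last by rewrite oppr_eq0 (pi_neq0 H).
    by have := rcrd_pi H i M j i; rewrite {1}/rpi eqxx => ->.
  split; last exact: (hil_nz Hl (l_sub bl)).
  have [N hN] : exists N, hgt crd b < N%:Z /\ (1 < N)%N.
    exists `|hgt crd b|.+2; have := lez_abs (hgt crd b); lia.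
  have d := Km_dim hN.1; have c := cnt_mem_gt0 chi hN.2 bl.
  have [k hk nz] : exists2 k, Km b k & k != 0.
    apply: contrapT => h; have d0 : fdim (Km b) 0.
      by apply: fdim0 => x hx; apply: contrapT => /eqP nz; apply: h; exists x.
    by move: c; rewrite (fdim_uniq d d0).
  by apply: (Nm_cone H1 _ nz); rewrite GrF; exact: (Km_N' H hM hk).
have ht' b : b \in - al :: l -> 0 < hgt (rcrd crd i M) b.
  by move=> /cone'[h nz]; apply: (hgt_gt0 H1).
split.
- by move=> b /cone'[].
- by move=> b /cone'[].
- move=> b; rewrite inE => /orP[/eqP ->|/l_sub h]; last exact: (hil_neq1 Hl h).
  by rewrite (chiNl H) (chiNr H) invrK; exact: (hil_neq1 Hl simple_in).
move=> lam N hN; rewrite GrF.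
(* From [N1] on, degree lam + p al has negative new i-th coordinate and [Km] vanishes there; [N2]
   also exceeds the old heights of the earlier degrees. *)
pose N1 := maxn N `|rcrd crd i M i lam|.+1; pose N2 := (N1 + `|hgt crd lam|.+1)%N.
have NN2 : (N <= N2)%N by rewrite /N2 /N1; lia.
rewrite -(cnt_stable chi (hgtD H1) ht' hN NN2) /=.
have rci p : rcrd crd i M i (lam + al *+ p) = rcrd crd i M i lam - p%:Z.
  rewrite (rcrdD H); congr (_ + _); have := rcrd_pi H i M i i; rewrite {1}/rpi !eqxx => e.
  have ea : rcrd crd i M i al = -1 by apply: oppr_inj; rewrite opprK -(addfN (rcrdD H i M i)).
  by rewrite (addfMn (rcrdD H i M i)) ea mulNrn natz.
have Kz p x : (N1 <= p)%N -> Km (lam + al *+ p) x -> x = 0.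
  move=> le /(Km_N' H hM); rewrite -GrF => h; apply: (Nm_out H1 (i := i) h); rewrite rci.
  by move: le; rewrite /N1; have := lez_abs (rcrd crd i M i lam); lia.
have hd p : fdim (if qfact q p != 0 then Km (lam + al *+ p) else fun x => x = 0)
   (if qfact q p != 0 then cnt chi N2 l (lam + al *+ p) else 0).
  case: (qfact q p != 0); last by apply: fdim0.
  have [lt|le] := ltnP p N1.
    apply: Km_dim; rewrite (hgtD H) al_hgt /N2; have := lez_abs (hgt crd lam); lia.
  rewrite (@cnt_out _ _ _ (rcrd crd i M i)); first by apply: fdim0 => x; exact: Kz.
  - exact: (rcrdD H).
  - by move=> b bl; have [h _] := cone' b (mem_behead (s := - al :: l) bl); exact: h.
  - by rewrite rci; move: le; rewrite /N1; have := lez_abs (rcrd crd i M i lam); lia.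
have := fdim_sum (S := Gen (rpi pi i M) (rf chi ql pi E F i M) lam)
  (T := fun s : 'I_N2 => if qfact q s != 0 then Km (lam + al *+ s) else fun x => x = 0)
  (g := fun s x => keterm ql pi E i false s x) _ _ (fun s : 'I_N2 => hd s) (Gen_subsp _ _ _) _ _ _.
set tot := (\sum_(r < N2) _)%N => hdim.
have -> : (\sum_(s < N2 | qfact (chi (- al) (- al)) s != 0%R) cnt chi N2 l (lam - (- al) *+ s)%R = tot)%N.
  rewrite /tot -big_mkcond /= (chiNl H) (chiNr H) invrK.
  by apply: eq_bigr => s _; rewrite mulNrn opprK.
have N'e r : Gen (rpi pi i M) (rf chi ql pi E F i M) (- al *+ r) ((ql (- al) * E i) ^+ r).
  by apply/Gen_exp/N'_eh.
apply: hdim.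
- move=> s; case: ifP => _; first exact: Gen_subsp.
  by split=> // c x y -> ->; rewrite scaler0 addr0.
- by move=> s c x y; rewrite ketermD.
- move=> s x; case: ifP => _ => [h|->]; last by rewrite keterm0; exact: Gen0.
  by apply: Gen_eq (Gen_mul (Km_N' H hM h) (N'e s)) _; rewrite mulNrn addrK.
- move=> x hx; have [s [k [k1 k2 k3 ->]]] := KE_exp H (N'_KEr H hx).
  exists (fun r : 'I_N2 => k r); split.
    by move=> r; case: eqP => /= [/k2|_] //; exact: k1.
  have kN r : (N2 <= r)%N -> k r = 0.
    by move=> le; apply: (Kz r) => //; apply: leq_trans le; rewrite /N2 leq_addr.
  rewrite -(@sum_ord_widen _ _ (fun r => keterm ql pi E i false r (k r)) s (maxn s N2)) ?leq_maxl //.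
    by rewrite (@sum_ord_widen _ _ (fun r => keterm ql pi E i false r (k r)) N2) ?leq_maxr // => r /kN ->; rewrite keterm0.
  by move=> r /k3 ->; rewrite keterm0.
- move=> y hy e0 r.
  pose k r := if insub r is Some r' then y r' else 0 : U.
  have := @keterm_indepR _ _ _ _ _ _ _ _ _ _ _ B i lam N2 k _ _ _ r (ltn_ord r).
  rewrite /k valK; apply.
  + move=> p; case: insubP => [p' _ <-|_]; last exact: Gen0.
    have := hy p'; case: eqP => //= _ ->; exact: Gen0.
  + move=> p z; case: insubP => [p' _ ep|_] //.
    by have := hy p'; rewrite ep z eqxx.
  + by rewrite -[RHS]e0; apply: eq_bigr => p _; rewrite valK.
Qed.

End Hilbert.

(** * Verma modules *)

Section Verma.
Variables (K : fieldType) (A : zmodType) (U : algType K) (I : finType).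
Variables (chi : A -> A -> K) (qk ql : A -> U) (pi : I -> A).
Variables (crd : I -> A -> int) (E F : I -> U).

Definition chrp (k : A -> K) := (forall a, k a != 0) /\ forall a b, k (a + b) = k a * k b.

Lemma chrp0 k : chrp k -> k 0 = 1.
Proof. by case=> k0 kD; apply: (mulfI (k0 0)); rewrite -kD addr0 mulr1. Qed.
Lemma chrpN k a : chrp k -> k (- a) = (k a)^-1.
Proof.
move=> ck; case: (ck) => k0 kD; apply: (mulfI (k0 a)).
by rewrite -kD subrr (chrp0 ck) mulfV.
Qed.
Lemma chrpMn k a n : chrp k -> k (a *+ n) = k a ^+ n.
Proof.
move=> ck; case: (ck) => k0 kD; elim: n => [|n IH]; first by rewrite (chrp0 ck).
by rewrite mulrS kD IH exprS.
Qed.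

Hypothesis B : borel chi qk ql pi crd E F.
Let H := b_pb B.
Variables kk ll : A -> K.
Hypothesis kkP : chrp kk.
Hypothesis llP : chrp ll.
Let kk0 := chrp0 kkP.
Let ll0 := chrp0 llP.

Local Notation sf := (cid (separating_functional (h_one H))).
(** The counit of the positive half: zero in nonzero degrees, and in degree zero the scalar, read
    off by a functional normalised at 1. *)
Definition veps (nu : A) x := if nu == 0 then sval sf x else 0.

Lemma veps_lin nu c x y : veps nu (c *: x + y) = c * veps nu x + veps nu y.
Proof. by rewrite /veps; case: eqP => _; [case: (svalP sf) => -> | rewrite mulr0 addr0]. Qed.
Lemma veps0 nu : veps nu 0 = 0.
Proof. by have := veps_lin nu (-1) 0 0; rewrite scaler0 addr0 mulN1r addNr. Qed.
Lemma veps1 : veps 0 1 = 1.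
Proof. by rewrite /veps eqxx; case: (svalP sf). Qed.

(** Graph of [u] acting on the highest weight vector, the Verma module being identified with the
    negative half as a space. That it is a function follows from [b_tri], that it is total from
    [b_span]. *)
Inductive vgraph : U -> U -> Prop :=
| vg0 : vgraph 0 0
| vgD mu a b nu y x u w : Gen pi F mu y -> Gen pi E nu x -> vgraph u w ->
    vgraph (y * (qk a * ql b) * x + u) ((kk a * ll b * veps nu x) *: y + w).

Lemma vg_lin c u w u' w' : vgraph u w -> vgraph u' w' -> vgraph (c *: u + u') (c *: w + w').
Proof.
move=> h h'; elim: h => [|mu a b nu y x v z hy hx _ IH]; first by rewrite !scaler0 !add0r.
have -> : c *: (y * (qk a * ql b) * x + v) + u' = (c *: y) * (qk a * ql b) * x + (c *: v + u').
  by nc_simp K U; ring.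
have -> : c *: ((kk a * ll b * veps nu x) *: y + z) + w' = (kk a * ll b * veps nu x) *: (c *: y) + (c *: z + w').
  by nc_simp K U; ring.
by apply: (@vgD mu a b nu) => //; exact: GenZ.
Qed.

Lemma vg_ex u : exists w, vgraph u w.
Proof.
have [c h] := b_span B u (fun _ _ => 0) (fun _ _ => 0) (fun _ _ => 0).
elim: h => [|mu a b nu y x v d hy hx _ [w IH]]; first by exists 0; exact: vg0.
by exists ((kk a * ll b * veps nu x) *: y + w); exact: (@vgD mu a b nu y x v w).
Qed.

Lemma vg_uniq u w w' : vgraph u w -> vgraph u w' -> w = w'.
Proof.
move=> h h'; apply/eqP; rewrite -subr_eq0; apply/negPn/negP => nz.
have [phi [phil phi1]] := separating_functional nz.
have : phi (w - w') = 0.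
  apply: (b_tri B (phi := fun=> phi) (psi := veps) (gam := fun a b => kk a * ll b)).
  - by move=> mu c x y _ _; exact: phil.
  - by move=> mu c x y _ _; exact: veps_lin.
  have : vgraph 0 (w - w').
    by have := vg_lin (-1) h' h; rewrite !scaleN1r addNr addrC.
  elim=> [|mu a b nu y x v z hy hx _ IH].
    by have := phil (-1) 0 0; rewrite scaler0 addr0 mulN1r addNr => ->; exact: tg0.
  rewrite phil [_ * phi y]mulrC [phi y * (_ * _)]mulrA; exact: (@tgD _ _ _ qk ql _ _ (fun=> phi) veps (fun a b => kk a * ll b) mu a b nu).
by rewrite phi1 => /eqP; rewrite oner_eq0.
Qed.

Definition V u := sval (cid (vg_ex u)).
Lemma VP u : vgraph u (V u). Proof. exact: svalP. Qed.
Lemma VE u w : vgraph u w -> V u = w. Proof. exact: vg_uniq (VP u). Qed.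

Lemma V_lin c u v : V (c *: u + v) = c *: V u + V v.
Proof. by apply: VE; apply: vg_lin; exact: VP. Qed.
Lemma V0 : V 0 = 0. Proof. by apply: VE; exact: vg0. Qed.
Lemma VD u v : V (u + v) = V u + V v.
Proof. by rewrite -[u]scale1r V_lin !scale1r. Qed.
Lemma VZ c u : V (c *: u) = c *: V u.
Proof. by rewrite -[c *: u]addr0 V_lin V0 addr0. Qed.
Lemma VB u v : V (u - v) = V u - V v.
Proof. by rewrite addrC -scaleN1r V_lin scaleN1r addrC. Qed.
Lemma V_sum (T : Type) (r : seq T) (P : pred T) (u : T -> U) :
  V (\sum_(t <- r | P t) u t) = \sum_(t <- r | P t) V (u t).
Proof. by elim/big_rec2: _ => [|t x y _ <-]; rewrite ?V0 ?VD. Qed.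

Lemma V_term mu a b nu y x : Gen pi F mu y -> Gen pi E nu x ->
  V (y * (qk a * ql b) * x) = (kk a * ll b * veps nu x) *: y.
Proof.
move=> hy hx; apply: VE; rewrite -[X in vgraph X _]addr0 -[X in vgraph _ X]addr0.
by apply: (@vgD mu a b nu) => //; exact: vg0.
Qed.

Lemma V_ind (Q : U -> Prop) : Q 0 -> (forall u v, Q u -> Q v -> Q (u + v)) ->
  (forall mu a b nu y x, Gen pi F mu y -> Gen pi E nu x -> Q (y * (qk a * ql b) * x)) ->
  forall u, Q u.
Proof.
move=> Q0 QD Qt u; have [w] := vg_ex u; elim=> // mu a b nu y x v z hy hx _ IH.
by apply: QD => //; exact: (Qt mu a b nu).
Qed.

Lemma V_Gen mu y : Gen pi F mu y -> V y = y.
Proof.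
move=> hy; have := V_term 0 0 hy (Gen1 pi E).
by rewrite (h_K0 H) (h_L0 H) !mulr1 kk0 ll0 veps1 !mulr1 scale1r.
Qed.

Lemma V_GenM mu y u : Gen pi F mu y -> V (y * u) = y * V u.
Proof.
move=> hy; elim/V_ind: u => [|u v IHu IHv|nu a b rho z x hz hx].
- by rewrite mulr0 V0 mulr0.
- by rewrite mulrDr !VD IHu IHv mulrDr.
- have -> : y * (z * (qk a * ql b) * x) = y * z * (qk a * ql b) * x by rewrite !mulrA.
  by rewrite (V_term _ _ hz hx) -scalerAr (V_term _ _ (Gen_mul hy hz) hx).
Qed.

Lemma V_E u j : V (u * E j) = 0.
Proof.
elim/V_ind: u => [|u v IHu IHv|nu a b rho z x hz hx].
- by rewrite mul0r V0.
- by rewrite mulrDl VD IHu IHv addr0.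
- rewrite -mulrA (V_term _ _ hz (Gen_mul hx (Gen_gen pi E j))) /veps.
  case: eqP => [e|_]; last by rewrite mulr0 scale0r.
  rewrite (Nm_out (pborel_swap H) (i := j) hx); first by rewrite mul0r (_ : sval sf 0 = 0) ?mulr0 ?scale0r //; have := veps0 0; rewrite /veps eqxx.
  have -> : rho = - pi j by apply/eqP; rewrite -addr_eq0 e.
  by rewrite (crdN H) (h_crdpi H) eqxx oppr_lt0.
Qed.

Lemma veps_chi nu x c : (nu = 0 -> c = 1) -> c * veps nu x = veps nu x.
Proof. by rewrite /veps; case: eqP => [-> /(_ erefl) ->|_ _]; rewrite ?mul1r ?mulr0. Qed.

Lemma V_K u c : V (u * qk c) = kk c *: V u.
Proof.
elim/V_ind: u => [|u v IHu IHv|nu a b rho z x hz hx].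
- by rewrite mul0r V0 scaler0.
- by rewrite mulrDl !VD IHu IHv scalerDr.
- have ex : x * qk c = (chi c rho)^-1 *: (qk c * x).
    by rewrite (GKE H c hx) scalerA mulVf ?(chi_nz H) // scale1r.
  have -> : z * (qk a * ql b) * x * qk c = (chi c rho)^-1 *: (z * (qk (a + c) * ql b) * x).
    rewrite -[LHS]mulrA ex -scalerAr -(h_KK H); congr (_ *: _).
    by rewrite -[qk a * qk c * _]mulrA (h_KL H c) !mulrA.
  rewrite VZ !(V_term _ _ hz hx) !scalerA (proj2 kkP); congr (_ *: _).
  have h := @veps_chi rho x (chi c rho)^-1.
  rewrite -[in RHS]h => [|->]; last by rewrite (chi0r H) invr1.
  ring.
Qed.

Lemma V_L u c : V (u * ql c) = ll c *: V u.
Proof.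
elim/V_ind: u => [|u v IHu IHv|nu a b rho z x hz hx].
- by rewrite mul0r V0 scaler0.
- by rewrite mulrDl !VD IHu IHv scalerDr.
- have ex : x * ql c = chi rho c *: (ql c * x).
    by rewrite (GLE H c hx) scalerA mulfV ?(chi_nz H) // scale1r.
  have -> : z * (qk a * ql b) * x * ql c = chi rho c *: (z * (qk a * ql (b + c)) * x).
    by rewrite -[LHS]mulrA ex -scalerAr -(h_LL H) !mulrA.
  rewrite VZ !(V_term _ _ hz hx) !scalerA (proj2 llP); congr (_ *: _).
  have h := @veps_chi rho x (chi rho c).
  rewrite -[in RHS]h => [|->]; last by rewrite (chi0l H).
  ring.
Qed.

Lemma V_Gen_E nu x v : Gen pi E nu x -> nu != 0 -> V (v * x) = 0.
Proof.
move=> h; elim/(@Gen_rind K A U): h v => [v|a v _|j a y hy _ v _|a c y z _ _ IHy IHz v nz].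
- by rewrite eqxx.
- by rewrite mulr0 V0.
- by rewrite mulrA V_E.
- by rewrite mulrDr -scalerAr V_lin IHy // IHz // scaler0 addr0.
Qed.

(** The kernel of [V] is a left ideal, so [V (v * w)] is the action of [v] on the vector [w] of the
    Verma module. *)
Lemma V_V v u : V (v * V u) = V (v * u).
Proof.
elim/V_ind: u => [|u w IHu IHw|nu a b rho z x hz hx].
- by rewrite V0.
- by rewrite VD !mulrDr !VD IHu IHw.
rewrite (V_term _ _ hz hx) -scalerAr VZ.
case: (eqVneq rho 0) => [e|nz].
  have [c ec] := Nm_deg0 (pborel_swap H) hx e.
  have -> : v * (z * (qk a * ql b) * x) = c *: (v * z * qk a * ql b).
    by rewrite ec -scalerAr mulr1 -scalerAr !mulrA.
  rewrite VZ V_L V_K !scalerA; congr (_ *: _).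
  have -> : veps rho x = c.
    by rewrite ec e -[c *: 1]addr0 veps_lin veps1 veps0 mulr1 addr0.
  ring.
have -> : veps rho x = 0 by rewrite /veps (negbTE nz).
by rewrite mulr0 scale0r [v * _]mulrA (V_Gen_E _ hx nz).
Qed.

Lemma V_der j mu y y1 y2 : der qk ql pi E F j mu y y1 y2 ->
  V (E j * y) = kk (pi j) *: y1 + ll (pi j) *: y2.
Proof.
by move=> [h1 h2 ->]; rewrite !VD V_E add0r V_K V_L (V_Gen h1) (V_Gen h2).
Qed.

Lemma V_Ej j mu y : Gen pi F mu y -> Gen pi F (mu - pi j) (V (E j * y)).
Proof.
move=> /(der_ex H j)[y1 [y2 h]]; rewrite (V_der h); case: h => h1 h2 _.
by apply: GenD => //; exact: GenZ.
Qed.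

(** Written with skew derivatives, which do not depend on the characters; the condition is then
    linear in the values of [kk] and [ll], as the density argument requires. *)
Definition sing mu y := Gen pi F mu y /\ forall j y1 y2, der qk ql pi E F j mu y y1 y2 ->
  kk (pi j) *: y1 + ll (pi j) *: y2 = 0.

Lemma singP mu y : Gen pi F mu y -> (sing mu y <-> forall j, V (E j * y) = 0).
Proof.
move=> hy; split=> [[_ h] j|h]; last by split=> // j y1 y2 /V_der <-.
by have [y1 [y2 d]] := der_ex H j hy; rewrite (V_der d) (h _ _ _ d).
Qed.

End Verma.

(** * Carrying a singular vector back through a reflection *)

Section Transfer.
Variables (K : fieldType) (A : zmodType) (U : algType K) (I : finType).
Variables (chi : A -> A -> K) (qk ql : A -> U) (pi : I -> A).
Variables (crd : I -> A -> int) (E F : I -> U).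
Hypothesis B : borel chi qk ql pi crd E F.
Variables (i : I) (M : I -> nat).
Hypothesis hM : forall j, j != i -> bm chi pi i j (M j) = 0 /\ forall k, (k < M j)%N -> bm chi pi i j k != 0.
Variables kk ll : A -> K.
Hypothesis kkP : chrp kk.
Hypothesis llP : chrp ll.
Let H := b_pb B.
Let H' := pborel_swap H.
Let B' := refl_borel B hM.
Let H1 := b_pb B'.
Let hMT := hM' B hM.
Local Notation al := (pi i).
Local Notation q := (chi (pi i) (pi i)).
Let q0 : q != 0 := chi_nz H _ _.
Local Notation chiT := (fun a b => chi b a).
Local Notation Nm := (Gen pi F).
Local Notation Np := (Gen pi E).
Local Notation Em := (Fm chiT pi E i).
Local Notation Km := (Gen (@km_deg A I pi i) (@km_gen K A U I chi pi F i)).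
Local Notation pi' := (rpi pi i M).
Local Notation f := (rf chi ql pi E F i M).
Local Notation e := (rf chiT qk pi F E i M).
Local Notation rF := (rF chi ql pi E F i M).
Local Notation eh := (ql (- pi i) * E i).
Local Notation fh := (qk (- pi i) * F i).
Local Notation V := (V B kk ll).

Variable s : nat.
Hypothesis s_gt0 : (0 < s)%N.
Hypothesis hs : F i ^+ s = 0 \/ ll al = q ^- s.-1 * kk al.
Hypothesis he : forall r, (0 < r < s)%N -> qnum q r * (ll al - q ^- r.-1 * kk al) != 0.

(** Says that [z] sends the highest weight vector v into U^- F_i^s v, which is a submodule because
    F_i^s v is zero or singular. The degree is part of the predicate. *)
Definition JF mu z := exists2 y, Nm (mu - al *+ s) y & V z = y * F i ^+ s.

Lemma JF_eq mu nu z : JF mu z -> mu = nu -> JF nu z. Proof. by move=> h <-. Qed.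
Lemma JF_V0 mu z : V z = 0 -> JF mu z.
Proof. by move=> z0; exists 0; [exact: Gen0 | rewrite mul0r]. Qed.
Lemma JF_lin mu c z w : JF mu z -> JF mu w -> JF mu (c *: z + w).
Proof.
move=> [y hy ey] [x hx ex]; exists (c *: y + x); first exact: GenD.
by rewrite V_lin // ey ex mulrDl scalerAl.
Qed.
Lemma JF_Z mu c z : JF mu z -> JF mu (c *: z).
Proof. by move=> h; rewrite -[_ *: z]addr0; apply: JF_lin => //; apply: JF_V0; rewrite V0. Qed.
Lemma JF_B mu z w : JF mu z -> JF mu w -> JF mu (z - w).
Proof. by move=> hz hw; rewrite addrC -scaleN1r; apply: JF_lin. Qed.
Lemma JF_same mu z w c : V z = c *: V w -> JF mu w -> JF mu z.
Proof. by move=> eV [y hy ey]; exists (c *: y); [exact: GenZ | rewrite eV ey scalerAl]. Qed.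

Lemma JF_Gen mu nu x z : Nm nu x -> JF mu z -> JF (mu + nu) (x * z).
Proof.
move=> hx [y hy ey]; exists (x * y); last by rewrite (V_GenM _ _ _ _ hx) // ey mulrA.
by apply: Gen_eq (Gen_mul hx hy) _; lattice H.
Qed.

Lemma V_Kn a n x : V (x * (qk a * F i ^+ n)) = (chi a al ^- n * kk a) *: V (x * F i ^+ n).
Proof. by rewrite (KFn H) -scalerAr mulrA VZ // V_K // scalerA. Qed.
Lemma V_Ln a n x : V (x * (ql a * F i ^+ n)) = (chi al a ^+ n * ll a) *: V (x * F i ^+ n).
Proof. by rewrite (LFn H) -scalerAr mulrA VZ // V_L // scalerA. Qed.

Lemma V_EFs j : V (E j * F i ^+ s) = 0.
Proof.
case: (eqVneq j i) => [->|ji]; last by rewrite (EjFn H) // V_E.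
case: hs => [->|z]; first by rewrite mulr0 V0.
case: s s_gt0 z => // n _ z; rewrite (EFn H) VD // V_E // add0r VZ // mulrBr VB // -scalerAr VZ //.
by rewrite V_K // V_L // z scalerA subrr scaler0.
Qed.

Lemma JF_E j mu z : JF mu z -> JF (mu - pi j) (E j * z).
Proof.
move=> [y hy ey]; have [y1 [y2 [h1 h2 eE]]] := der_ex H j hy.
exists ((chi (pi j) al ^- s * kk (pi j)) *: y1 + (chi al (pi j) ^+ s * ll (pi j)) *: y2).
  by apply: Gen_eq (GenD _ h1 (GenZ _ h2)) _; lattice H.
rewrite -(V_V _ kkP llP) ey mulrA eE !mulrDl !VD // -[y * E j * _]mulrA (V_GenM _ _ _ _ hy) //.
rewrite V_EFs mulr0 add0r -2!mulrA V_Kn V_Ln -!scalerAl.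
have hF n := Nm_Fn pi F i n.
by rewrite !(V_GenM _ _ _ _ h1) // !(V_GenM _ _ _ _ h2) // (V_Gen _ kkP llP (hF s)).
Qed.

Lemma JF_K a mu z : JF mu z -> JF mu (qk a * z).
Proof.
move=> [y hy ey]; exists ((chi a (mu - al *+ s))^-1 *: ((chi a al ^- s * kk a) *: y)); first by do 2!apply: GenZ.
rewrite -(V_V _ kkP llP) ey mulrA (GK H a hy) -scalerAl -mulrA VZ // V_Kn -!scalerAl (V_GenM _ _ _ _ hy) //.
by rewrite (V_Gen _ kkP llP (Nm_Fn pi F i s)).
Qed.
Lemma JF_L a mu z : JF mu z -> JF mu (ql a * z).
Proof.
move=> [y hy ey]; exists (chi (mu - al *+ s) a *: ((chi al a ^+ s * ll a) *: y)); first by do 2!apply: GenZ.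
rewrite -(V_V _ kkP llP) ey mulrA (GL H a hy) -scalerAl -mulrA VZ // V_Ln -!scalerAl (V_GenM _ _ _ _ hy) //.
by rewrite (V_Gen _ kkP llP (Nm_Fn pi F i s)).
Qed.

Lemma JF_Np mu nu x z : Np nu x -> JF mu z -> JF (mu - nu) (x * z).
Proof.
move=> hx hz; elim: hx => [|a|j a x' _ IH|a c x1 x2 _ IH1 _ IH2].
- by rewrite subr0 mul1r.
- by rewrite mul0r; apply: JF_V0; rewrite V0.
- by rewrite -mulrA; apply: JF_eq (JF_E j IH) _; lattice H.
- by rewrite mulrDl -scalerAl; apply: JF_lin.
Qed.

Lemma JF_N' mu nu x z : Gen pi' f nu x -> JF mu z -> JF (mu + nu) (x * z).
Proof.
move=> hx hz; elim: hx => [|a|j a x' _ IH|a c x1 x2 _ IH1 _ IH2].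
- by rewrite addr0 mul1r.
- by rewrite mul0r; apply: JF_V0; rewrite V0.
- rewrite -mulrA /rpi /rf; case: (eqVneq j i) => [_|ji].
    by rewrite -mulrA; apply: JF_eq (JF_L _ (JF_E i IH)) _; lattice H.
  by apply: JF_eq (JF_Gen (Nm_Fm chi pi F i j (M j)) IH) _; lattice H.
- by rewrite mulrDl -scalerAl; apply: JF_lin.
Qed.

(** Since F_i F_i^(s-1) v lies in the submodule of [JF], this makes F_i^(s-1) v a highest weight
    vector for the reflected pair modulo that submodule. *)
Lemma V_EmF j m n : j != i -> V (Em j m * F i ^+ n) = 0.
Proof.
move=> ji; elim: n m => [|n IH] m.
  by rewrite expr0 mulr1 -[Em j m]mul1r (V_Gen_E _ _ _ _ (Np_Em chi pi E i j m)) // (Fm_deg_neq0 H).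
case: m => [|m].
  have -> : Em j 0 * F i ^+ n.+1 = F i * (Em j 0 * F i ^+ n).
    by rewrite exprS mulrA -(E_Fm0 H' ji) mulrA.
  by rewrite (V_GenM _ _ _ _ (Gen_gen pi F i)) // IH mulr0.
have eF : Em j m.+1 * F i = F i * Em j m.+1 - bm chiT pi i j m *: (Em j m * qk al).
  by rewrite (E_Fm H' m ji) addrK.
rewrite exprS mulrA eF mulrBl VB // -mulrA (V_GenM _ _ _ _ (Gen_gen pi F i)) // IH mulr0.
by rewrite -scalerAl VZ // -mulrA V_Kn IH !scaler0 subr0.
Qed.

Variables (nu : A) (y' : U).
(** With [ll'], the weight of F_i^(s-1) v. *)
Definition kk' a := kk a * chi a al ^- s.-1.
Definition ll' a := ll a * chi al a ^+ s.-1.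
Hypothesis y'_sing : sing qk ql pi' e rF kk' ll' nu y'.
Hypothesis y'_neq0 : y' != 0.
Hypothesis hp : forall p k, Km (nu + al *+ p) k -> k != 0 -> qfact q p != 0 -> (p < s)%N.

Local Notation u' := (y' * F i ^+ s.-1).
Local Notation mu' := (nu + al *+ s.-1).

Lemma y'_Gen : Gen pi' f nu y'.
Proof. by have [h _] := y'_sing; rewrite -(Gen_rF B hM). Qed.

(** The reflected Verma module with highest weight vector F_i^(s-1) v maps to the quotient by [JF],
    and [y'] is singular in it. *)
Lemma J_e j : JF (mu' - pi' j) (e j * u').
Proof.
have [hG hder] := y'_sing.
have [y1 [y2 d]] := der_ex H1 j hG; have z := hder _ _ _ d; have [_ _ eE] := d.
have eV : V (e j * u') = V (y' * (e j * F i ^+ s.-1)).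
  rewrite mulrA eE !mulrDl !VD // -!mulrA -[RHS]addr0; congr (_ + _).
  rewrite V_Kn V_Ln -!VZ // -VD // !scalerAl -mulrDl.
  have -> : (chi (pi' j) al ^- s.-1 * kk (pi' j)) *: y1 + (chi al (pi' j) ^+ s.-1 * ll (pi' j)) *: y2 = 0.
    by rewrite -[RHS]z /kk' /ll'; congr (_ *: _ + _ *: _); rewrite mulrC.
  by rewrite mul0r V0.
apply: (JF_same (c := 1) (w := y' * (e j * F i ^+ s.-1))); first by rewrite scale1r.
have : JF (al *+ s.-1 - pi' j) (e j * F i ^+ s.-1).
  rewrite /rf /rpi; case: (eqVneq j i) => [_|ji]; last by apply: JF_V0; rewrite V_EmF.
  rewrite -mulrA -exprS prednK //; apply: JF_K.
  exists 1; last by rewrite mul1r (V_Gen _ kkP llP (Nm_Fn pi F i s)).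
  apply: Gen_eq (Gen1 _ _) _; rewrite -{2}(prednK s_gt0) mulrSr; lattice H.
move=> h; apply: JF_eq (JF_N' y'_Gen h) _; lattice H.
Qed.

Lemma V_Ku a x : V (x * (qk a * u')) = ((chi a mu')^-1 * kk a) *: V (x * u').
Proof.
have g := Gen_scal (c := fun m => (chi a m)^-1) (z := qk a) _ _ (rf_K H i M a) y'_Gen.
have {}g : qk a * y' = (chi a nu)^-1 *: (y' * qk a).
  by apply: g => [|b c]; rewrite ?(chi0r H) ?invr1 // (chiDr H) invfM.
have -> : x * (qk a * u') = x * (qk a * y') * F i ^+ s.-1 by rewrite !mulrA.
rewrite g -scalerAr -scalerAl VZ //.
have -> : x * (y' * qk a) * F i ^+ s.-1 = x * y' * (qk a * F i ^+ s.-1) by rewrite !mulrA.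
rewrite V_Kn !scalerA -[x * y' * _]mulrA.
by rewrite (chiDr H) (chiMnr H) invfM mulrA mulrA.
Qed.
Lemma V_Lu a x : V (x * (ql a * u')) = (chi mu' a * ll a) *: V (x * u').
Proof.
have g := Gen_scal (c := fun m => chi m a) (z := ql a) _ _ (rf_L H i M a) y'_Gen.
have {}g : ql a * y' = chi nu a *: (y' * ql a).
  by apply: g => [|b c]; rewrite ?(chi0l H) // (chiDl H).
have -> : x * (ql a * u') = x * (ql a * y') * F i ^+ s.-1 by rewrite !mulrA.
rewrite g -scalerAr -scalerAl VZ //.
have -> : x * (y' * ql a) * F i ^+ s.-1 = x * y' * (ql a * F i ^+ s.-1) by rewrite !mulrA.
rewrite V_Ln !scalerA -[x * y' * _]mulrA.
by rewrite (chiDl H) (chiMnl H) mulrA mulrA.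
Qed.

Lemma J_Fu : JF (mu' + al) (F i * u').
Proof.
have := JF_K al (J_e i); rewrite /rpi /rf eqxx !mulrA (KKN H) mul1r => h.
by apply: JF_eq h _; rewrite opprK.
Qed.

(** The end of the E-string is a reflected generator, and bracketing with F_i, which sends [u'] into
    [JF], leads down the string. *)
Lemma J_Em j m : j != i -> JF (mu' - (pi j + al *+ m)) (Em j m * u').
Proof.
move=> ji; have [lt|le] := ltnP (M j) m.
  by rewrite (Fm_gtM H' hMT ji lt) mul0r; apply: JF_V0; rewrite V0.
rewrite -(subKn le); elim: (M j - m)%N (leq_subr m (M j)) => [|d IH] ld.
  by have := J_e j; rewrite /rpi /rf (negbTE ji) subn0.
have {IH} := IH (ltnW ld); set p := (M j - d.+1)%N; have -> : (M j - d)%N = p.+1 by rewrite /p; lia.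
move=> IH; have [_ hb] := hMT ji; have b0 : bm chiT pi i j p != 0 by apply: hb; rewrite /p; lia.
set b := bm _ _ _ _ _ in b0.
have eF : F i * Em j p.+1 = Em j p.+1 * F i + b *: (Em j p * qk al) by exact: (E_Fm H' p ji).
have : JF (mu' - (pi j + al *+ p)) (b *: (Em j p * (qk al * u'))).
  have -> : b *: (Em j p * (qk al * u')) = F i * (Em j p.+1 * u') - Em j p.+1 * (F i * u').
    by rewrite [F i * (Em _ _ * _)]mulrA eF mulrDl -[Em j p.+1 * _ * _]mulrA addrC addKr -scalerAl mulrA.
  apply: JF_B; first by apply: JF_eq (JF_Gen (Gen_gen pi F i) IH) _; lattice H.
  by apply: JF_eq (JF_Np (Np_Em chi pi E i j p.+1) J_Fu) _; lattice H.
set c := (chi al mu')^-1 * kk al.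
have c0 : c != 0 by rewrite mulf_neq0 ?invr_eq0 ?(chi_nz H) //; case: kkP.
apply: (JF_same (c := (b * c)^-1)); rewrite VZ // V_Ku -/c !scalerA -mulrA mulVf ?scale1r //.
by rewrite mulf_neq0.
Qed.

Lemma J_EmEn j m n : j != i ->
  JF (mu' - al *+ n - (pi j + al *+ m)) (Em j m * (E i ^+ n * u')).
Proof.
move=> ji; elim: n m => [|n IH] m; first by rewrite mul1r subr0; exact: J_Em.
set d := (chi (pi j + al *+ m) al)^-1; have d0 : d != 0 by rewrite invr_eq0 (chi_nz H).
have eE : E i * Em j m = Em j m.+1 + d *: (Em j m * E i) by rewrite /= subrK.
have -> : Em j m * (E i ^+ n.+1 * u') = d^-1 *: (E i * (Em j m * (E i ^+ n * u')) - Em j m.+1 * (E i ^+ n * u')).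
  rewrite mulrA [E i * (_ * _)]mulrA eE mulrDl addrC addKr -scalerAl scalerA mulVf // scale1r.
  by rewrite exprS !mulrA.
apply/JF_Z/JF_B; last by apply: JF_eq (IH m.+1) _; lattice H.
by apply: JF_eq (JF_E i (IH m)) _; lattice H.
Qed.

(** The scalar of the rank one relation between F_i and E_i^(n+1) on a vector of the weight of
    [u']. *)
Definition cN n := qnum q n.+1 * ((chi al mu')^-1 * kk al - q ^- n * (chi mu' al * ll al)).

Lemma V_FEn n : V (F i * (E i ^+ n.+1 * u')) = V (E i ^+ n.+1 * (F i * u')) + cN n *: V (E i ^+ n * u').
Proof.
have -> : F i * (E i ^+ n.+1 * u') = E i ^+ n.+1 * (F i * u') +
   qnum q n.+1 *: (E i ^+ n * (qk al * u') - q ^- n *: (E i ^+ n * (ql al * u'))).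
  rewrite mulrA (EFn H' i n) mulrDl -[E i ^+ _ * F i * _]mulrA -scalerAl; congr (_ + _ *: _).
  by rewrite -mulrA mulrBl mulrBr -scalerAl -scalerAr.
by rewrite VD // VZ // VB // VZ // V_Ku V_Lu scalerA -scalerBl scalerA.
Qed.

Lemma J_FnEn n : JF (mu' + al) (F i ^+ n.+1 * (E i ^+ n * u')).
Proof.
elim: n => [|n IH]; first by rewrite mul1r expr1; exact: J_Fu.
have -> : F i ^+ n.+2 * (E i ^+ n.+1 * u') = F i ^+ n.+1 * (F i * (E i ^+ n.+1 * u')) by rewrite exprSr !mulrA.
have hF := Nm_Fn pi F i n.+1.
apply: (JF_same (c := 1) (w := cN n *: (F i ^+ n.+1 * (E i ^+ n * u')) + F i ^+ n.+1 * (E i ^+ n.+1 * (F i * u')))).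
  by rewrite scale1r (V_GenM _ _ _ _ hF) // V_FEn V_lin // !(V_GenM _ _ _ _ hF) // mulrDr addrC -scalerAr.
apply: JF_lin => //.
by apply: JF_eq (JF_Gen hF (JF_Np (Nm_Fn pi E i n.+1) J_Fu)) _; lattice H.
Qed.

Lemma qfact_lt_s r : (r < s)%N -> qfact q r != 0.
Proof.
elim: r => [|r IH] lt; first by rewrite qfact0 oner_eq0.
rewrite qfactS mulf_neq0 ?IH //; first exact: ltnW.
by have := he (r := r.+1) lt; rewrite mulf_eq0 negb_or => /andP[].
Qed.

(** Each factor removes one F_i with the scalar of [EFn], nonzero by [he]. *)
Lemma V_ehF p : (p < s)%N -> exists2 c, c != 0 & V (eh ^+ p * F i ^+ s.-1) = c *: F i ^+ (s.-1 - p).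
Proof.
elim: p => [|p IH] lt.
  by exists 1; rewrite ?oner_eq0 // mul1r subn0 scale1r (V_Gen _ kkP llP (Nm_Fn pi F i _)).
have [c c0 e1] := IH (ltnW lt).
have -> : eh ^+ p.+1 * F i ^+ s.-1 = eh * (eh ^+ p * F i ^+ s.-1) by rewrite exprS -mulrA.
rewrite -(V_V _ kkP llP) e1 -scalerAr VZ //.
have [r er] : exists r, (s.-1 - p)%N = r.+1 by exists (s.-1 - p.+1)%N; lia.
have -> : (s.-1 - p.+1)%N = r by lia.
rewrite er -mulrA (EFn H) mulrDr VD // [ql _ * (_ * E i)]mulrA V_E // add0r.
have hr : (0 < r.+1 < s)%N by lia.
have h := he hr; exists (c * (chi al (- al) ^+ r * ll (- al) * (qnum q r.+1 * (ll al - q ^- r * kk al)))).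
  apply: mulf_neq0 => //; apply: mulf_neq0 => //; apply: mulf_neq0; last by case: llP.
  by rewrite expf_neq0 ?(chi_nz H).
rewrite -scalerAr VZ // mulrBr mulrBr VB // -!scalerAr VZ //.
have eL x : ql (- al) * x = x * ql (- al) ->
    V (ql (- al) * (F i ^+ r * x)) = (chi al (- al) ^+ r * ll (- al)) *: V (F i ^+ r * x).
  by move=> cx; rewrite mulrA (LFn H) -scalerAl -mulrA cx mulrA VZ // V_L // scalerA.
rewrite !eL ?(h_KL H) //; last by rewrite !(h_LL H) addrC.
rewrite V_L // V_K // (V_Gen _ kkP llP (Nm_Fn pi F i _)) !scalerA -scalerBl !scalerA; congr (_ *: _).
by rewrite /=; ring.
Qed.

Lemma V_u : exists k : nat -> U, [/\ forall r, (r < s)%N -> Km (mu' - al *+ r) (k r),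
  V u' = \sum_(r < s) k r * F i ^+ r & (forall r, (r < s)%N -> k r = 0) -> y' = 0].
Proof.
have [n [k [k1 k2 k3 ey]]] := KE_exp H (N'_KEr H y'_Gen).
have /choice[c hc] p : exists c, (p < s)%N -> c != 0 /\ V (eh ^+ p * F i ^+ s.-1) = c *: F i ^+ (s.-1 - p).
  have [lt|_] := ltnP p s; last by exists 0.
  by have [c c0 ec] := V_ehF lt; exists c.
have ks p : (s <= p)%N -> k p = 0.
  move=> le; apply/eqP; apply/negPn/negP => nz.
  have qn : qfact q p != 0 by apply/eqP => z; rewrite k2 ?eqxx in nz.
  by have := hp (k1 p) nz qn; rewrite ltnNge le.
have {}ey : y' = \sum_(p < s) k p * eh ^+ p.
  rewrite {1}ey -(@sum_ord_widen _ _ (fun r => keterm ql pi E i false r (k r)) n (maxn n s)) ?leq_maxl //.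
    by rewrite (@sum_ord_widen _ _ (fun r => keterm ql pi E i false r (k r)) s) ?leq_maxr // => r /ks ->; rewrite keterm0.
  by move=> r /k3 ->; rewrite keterm0.
exists (fun r => c (s.-1 - r)%N *: k (s.-1 - r)%N); split.
- move=> r lt; apply: GenZ; apply: Gen_eq (k1 _) _.
  have -> : s.-1 = (s.-1 - r + r)%N by lia.
  by rewrite mulrnDr addrA !addrK addnK.
- rewrite {1}ey mulr_suml V_sum // (reindex_inj rev_ord_inj) /=.
  apply: eq_bigr => r _; have es : (s - r.+1 = s.-1 - r)%N by have := ltn_ord r; lia.
  rewrite es -mulrA (V_GenM _ _ _ _ (Km_Nm (k1 _))) //.
  have [|_ ->] := hc (s.-1 - r)%N; first by have := ltn_ord r; lia.
  have -> : (s.-1 - (s.-1 - r) = r)%N by have := ltn_ord r; lia.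
  by rewrite -scalerAr scalerAl.
- move=> z; rewrite ey big1 // => p _.
  have := z (s.-1 - p)%N; have -> : (s.-1 - (s.-1 - p) = p)%N by have := ltn_ord p; lia.
  have [c0 _] := hc p (ltn_ord p).
  have lt : (s.-1 - p < s)%N by have := ltn_ord p; lia.
  by move=> /(_ lt)/eqP; rewrite scaler_eq0 (negbTE c0) => /eqP ->; rewrite mul0r.
Qed.

Lemma V_u_Gen : Nm mu' (V u').
Proof.
have [k [k1 -> _]] := V_u; apply: Gen_sum => r _.
by apply: Gen_eq (Gen_mul (Km_Nm (k1 r (ltn_ord r))) (Nm_Fn pi F i r)) _; rewrite subrK.
Qed.

(** By [V_u] the vector of [u'] involves only F_i^r with r < s, and not trivially, whereas vectors
    in [JF] involve only r >= s; the expansion in powers of F_i is unique. *)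
Lemma u'_notJ : ~ JF mu' u'.
Proof.
move=> [y hy eV]; have [k [k1 ek k0]] := V_u; case/eqP: y'_neq0; apply: k0.
have [n [y_ [h1 h2 h3 ey]]] := expR_ex H i hy.
pose g r := if (r < s)%N then k r else if qfact q r == 0 then 0 else - y_ (r - s)%N.
suff hg : expR chi pi F i mu' 0 (s + n) g.
  by move=> r lt; have := expR_indep H hg r; rewrite /g lt.
split.
- move=> r; rewrite /g; case: ltnP => [lt|le]; first exact: k1.
  case: eqP => _; first exact: Gen0.
  apply: GenN; apply: Gen_eq (h1 _) _.
  by rewrite -{2}(subnKC le) mulrnDr opprD addrA.
- move=> r z; rewrite /g z eqxx; case: ltnP => // lt.
  by have := qfact_lt_s lt; rewrite z eqxx.
- move=> r le; rewrite /g ltnNge (leq_trans _ le) ?leq_addr //=; case: eqP => // _.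
  by rewrite h3 ?oppr0 //; lia.
- rewrite big_split_ord /= (eq_bigr (fun r : 'I_s => k r * F i ^+ r)); last by move=> r _; rewrite /g ltn_ord.
  rewrite -ek eV {1}ey mulr_suml -big_split /= big1 // => r _.
  rewrite /g ltnNge leq_addr /= addKn; case: eqP => [z|_].
    by rewrite -mulrA -exprD addnC (Fn_eq0 H z) mulr0 mul0r addr0.
  by rewrite mulNr exprD [F i ^+ s * _]commrX ?mulrA ?subrr //; exact/commr_sym/commrX.
Qed.

Lemma V_En n : Nm (mu' - al *+ n) (V (E i ^+ n * u')).
Proof.
elim: n => [|n IH]; first by rewrite mul1r subr0; exact: V_u_Gen.
rewrite exprS -mulrA -(V_V _ kkP llP); apply: Gen_eq (V_Ej _ kkP llP i IH) _.
by lattice H.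
Qed.

(** [n] is the last exponent before E_i^n u' enters [JF], and the vector there is singular modulo
    [JF] for the original pair. As F_i E_i^(n+1) u' and E_i^(n+1) F_i u' lie in [JF], so does [cN n]
    times E_i^n u', whence [cN n = 0]. *)
Lemma transfer_core : exists n z, [/\ cN n = 0 /\ (E i ^+ n = 0 -> z = 0),
  Nm (mu' - al *+ n) z, ~ JF (mu' - al *+ n) z,
  forall j, JF (mu' - al *+ n - pi j) (E j * z) & JF (mu' + al) (F i ^+ n.+1 * z)].
Proof.
pose Q n := `[< JF (mu' - al *+ n) (E i ^+ n * u') >].
have ex : exists n, Q n.
  exists `|crd i mu'|.+1; apply/asboolP/JF_V0; apply: (Nm_out H (i := i) (V_En _)).
  rewrite (crdB H) (crdMn H) (h_crdpi H) eqxx natz.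
  by have := lez_abs (crd i mu'); lia.
case: (ex_minnP ex) => -[|n] /asboolP hn mn.
  by case: u'_notJ; move: hn; rewrite mul1r subr0.
have nJ : ~ JF (mu' - al *+ n) (E i ^+ n * u').
  by move=> h; have := mn n; rewrite ltnn; move=> h'; have := h' (introT (asboolP _) h).
have same z w mu : V z = V w -> JF mu w -> JF mu z.
  by move=> ezw; apply: (JF_same (c := 1)); rewrite scale1r.
exists n, (V (E i ^+ n * u')); split.
- split; last by move=> ->; rewrite mul0r V0.
  apply: contrapT => /eqP cn; apply: nJ.
  apply: (JF_same (c := (cN n)^-1) (w := F i * (E i ^+ n.+1 * u') - E i ^+ n.+1 * (F i * u'))).
    by rewrite VB // V_FEn addrC addKr scalerA mulVf // scale1r.
  apply: JF_B.
    by apply: JF_eq (JF_Gen (Gen_gen pi F i) hn) _; lattice H.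
  by apply: JF_eq (JF_Np (Nm_Fn pi E i n.+1) J_Fu) _; lattice H.
- exact: V_En.
- by move=> h; apply: nJ; apply: same h; rewrite (V_Gen _ kkP llP (V_En n)).
- move=> j; apply: (same _ (E j * (E i ^+ n * u'))); first by rewrite V_V.
  case: (eqVneq j i) => [->|ji].
    by rewrite mulrA -exprS; apply: JF_eq hn _; lattice H.
  by have := J_EmEn 0 n ji; rewrite mulr0n addr0.
- by apply: (same _ (F i ^+ n.+1 * (E i ^+ n * u'))); [rewrite V_V | exact: J_FnEn].
Qed.

End Transfer.

(** * Transfer for q of finite and of infinite order *)

Section TransferCases.
Variables (K : fieldType) (A : zmodType) (U : algType K) (I : finType).
Variables (chi : A -> A -> K) (qk ql : A -> U) (pi : I -> A).
Variables (crd : I -> A -> int) (E F : I -> U).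
Hypothesis B : borel chi qk ql pi crd E F.
Variables (i : I) (M : I -> nat).
Hypothesis hM : forall j, j != i -> bm chi pi i j (M j) = 0 /\ forall k, (k < M j)%N -> bm chi pi i j k != 0.
Let H := b_pb B.
Let H1 := b_pb (refl_borel B hM).
Local Notation al := (pi i).
Local Notation q := (chi (pi i) (pi i)).
Let q0 : q != 0 := chi_nz H _ _.
Local Notation Nm := (Gen pi F).
Local Notation pi' := (rpi pi i M).
Local Notation e := (rf (fun a b => chi b a) qk pi F E i M).
Local Notation rF := (rF chi ql pi E F i M).
Local Notation Km := (Gen (@km_deg A I pi i) (@km_gen K A U I chi pi F i)).
Hypothesis q1 : q != 1.

Lemma qnum_eq0 n : (qnum q n == 0) = (q ^+ n == 1).
Proof.
rewrite -[RHS]subr_eq0 -qnum_sub1 mulf_eq0 subr_eq0 (negbTE q1).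
by rewrite orFb.
Qed.

Section Finite.
Variables kk ll : A -> K.
Hypothesis kkP : chrp kk.
Hypothesis llP : chrp ll.
Variables (h : nat) (nu : A).
Hypothesis h_gt0 : (0 < h)%N.
Hypothesis qh : q ^+ h = 1.
Hypothesis hmin : forall r, (0 < r < h)%N -> q ^+ r != 1.
Hypothesis gen1 : forall r, ll al != q ^- r * kk al.
Hypothesis gen2 : forall n, (chi al (nu + al *+ h.-1))^-1 * kk al !=
   q ^- n * (chi (nu + al *+ h.-1) al * ll al).

(** Here F_i^h = 0, so that lying in [JF] means acting by zero. By [gen2] the scalar [cN n] vanishes
    only through (n+1)_q, which forces n = h - 1, and the degree returns to [nu]. *)
Lemma transfer_finite y' : sing qk ql pi' e rF (kk' chi pi i kk h) (ll' chi pi i ll h) nu y' ->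
  y' != 0 -> exists2 y, y != 0 & sing qk ql pi E F kk ll nu y.
Proof.
move=> sy y0.
have qfh n : (h <= n)%N -> qfact q n = 0.
  move=> le; apply/eqP; apply/negPn/negP => nz.
  by have := qnum_neq0 nz (k := h); rewrite h_gt0 le qnum_eq0 qh eqxx => /(_ isT).
have Fh : F i ^+ h = 0 by rewrite (Fn_eq0 H) // qfh.
have he r : (0 < r < h)%N -> qnum q r * (ll al - q ^- r.-1 * kk al) != 0.
  by move=> hr; rewrite mulf_neq0 ?qnum_eq0 ?hmin ?subr_eq0.
have hp p k : Km (nu + al *+ p) k -> k != 0 -> qfact q p != 0 -> (p < h)%N.
  by move=> _ _; apply: contraNT; rewrite -leqNgt => /qfh ->.
have [n [z [[cn ez] hz nJ jE _]]] := transfer_core B hM kkP llP h_gt0 (or_introl Fh) he sy y0 hp.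
have nlt : (n < h)%N.
  rewrite ltnNge; apply/negP => le; apply: nJ; apply: JF_V0.
  by rewrite ez ?V0 // (Fn_eq0 (pborel_swap H)) // qfh.
have en : n = h.-1.
  move/eqP: cn; rewrite /cN mulf_eq0 subr_eq0 (negbTE (gen2 n)) orbF qnum_eq0 => qn.
  suff : (h <= n.+1)%N by lia.
  by rewrite leqNgt; apply/negP => lt; have := hmin (r := n.+1); rewrite lt qn => /(_ isT).
have end_ : nu + al *+ h.-1 - al *+ n = nu by rewrite en addrK.
rewrite end_ in hz nJ jE; exists z.
  by apply/eqP => z0; apply: nJ; apply: JF_V0; rewrite z0 V0.
apply/(singP B kkP llP hz) => j; have [y _ ->] := jE j.
by rewrite Fh mulr0.
Qed.

End Finite.

Section Infinite.
Hypothesis qinf : forall r, (0 < r)%N -> q ^+ r != 1.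

Lemma qfact_inf n : qfact q n != 0.
Proof.
elim: n => [|n IH]; first by rewrite qfact0 oner_eq0.
by rewrite qfactS mulf_neq0 // qnum_eq0 qinf.
Qed.

Lemma qX_inj a b : q ^+ a = q ^+ b -> a = b.
Proof.
wlog le : a b / (a <= b)%N.
  by move=> W; case: (leqP a b) => [/W //|/ltnW /W h /esym /h].
move=> eq1; apply/eqP; rewrite eqn_leq le leqNgt; apply/negP => lt.
have := qinf (r := (b - a)%N); rewrite subn_gt0 lt => /(_ isT) /eqP; apply.
by apply: (mulfI (expf_neq0 a q0)); rewrite -exprD subnKC // mulr1.
Qed.

Lemma mulFr_inj mu z n : Nm mu z -> z * F i ^+ n = 0 -> z = 0.
Proof.
move=> /(expR_ex H i)[t [k [k1 k2 k3 ->]]] z0; rewrite big1 // => r _.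
pose g p := if (p < n)%N then 0 else k (p - n)%N.
have hg : expR chi pi F i (mu + al *+ n) 0 (n + t) g.
  split.
  - move=> p; rewrite /g; case: ltnP => [_|le]; first exact: Gen0.
    by apply: Gen_eq (k1 _) _; rewrite -{2}(subnKC le) mulrnDr opprD addrA addrK.
  - by move=> p pz; have := qfact_inf p; rewrite pz eqxx.
  - by move=> p le; rewrite /g ltnNge (leq_trans (leq_addr t n) le) /= k3 //; lia.
  - rewrite big_split_ord /= [X in _ = X + _]big1 => [|p _]; last by rewrite /g ltn_ord mul0r.
    rewrite add0r -[LHS]z0 mulr_suml; apply: eq_bigr => p _.
    by rewrite /g ltnNge leq_addr /= addKn -mulrA -exprD addnC.
by have := expR_indep H hg (n + r)%N; rewrite /g ltnNge leq_addr /= addKn => ->; rewrite mul0r.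
Qed.

Lemma mulFl_inj mu z n : Nm mu z -> F i ^+ n * z = 0 -> z = 0.
Proof.
move=> /(expL_ex H i)[t [k [k1 k2 k3 ->]]] z0; rewrite big1 // => r _.
pose g p := if (p < n)%N then 0 else k (p - n)%N.
have hg : expL chi pi F i (mu + al *+ n) 0 (n + t) g.
  split.
  - move=> p; rewrite /g; case: ltnP => [_|le]; first exact: Gen0.
    by apply: Gen_eq (k1 _) _; rewrite -{2}(subnKC le) mulrnDr opprD addrA addrK.
  - by move=> p pz; have := qfact_inf p; rewrite pz eqxx.
  - by move=> p le; rewrite /g ltnNge (leq_trans (leq_addr t n) le) /= k3 //; lia.
  - rewrite big_split_ord /= [X in _ = X + _]big1 => [|p _]; last by rewrite /g ltn_ord mulr0.
    rewrite add0r -[LHS]z0 mulr_sumr; apply: eq_bigr => p _.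
    by rewrite /g ltnNge leq_addr /= addKn mulrA -exprD.
by have := expL_indep H hg (n + r)%N; rewrite /g ltnNge leq_addr /= addKn => ->; rewrite mulr0.
Qed.

Variables kk ll : A -> K.
Hypothesis kkP : chrp kk.
Hypothesis llP : chrp ll.
Variables (s : nat) (nu : A) (n1 : nat).
Hypothesis s_gt0 : (0 < s)%N.
Hypothesis hs : ll al = q ^- s.-1 * kk al.
Hypothesis hn1 : forall n, (chi al (nu + al *+ s.-1))^-1 * kk al =
   q ^- n * (chi (nu + al *+ s.-1) al * ll al) -> n.+1 = n1.
Hypothesis n1_big : crd i nu < n1%:Z.
Hypothesis s_big : rcrd crd i M i nu < s%:Z.

(** [n] is so large that, by degree, the vector [z] is singular on the nose and not only modulo
    [JF]. The rank one relation makes F_i^(n+1) z singular as well; it has the form y F_i^s, and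
    cancelling F_i^s on the right shows that [y] is singular for the weight of F_i^s v. *)
Lemma transfer_inf y' : sing qk ql pi' e rF (kk' chi pi i kk s) (ll' chi pi i ll s) nu y' ->
  y' != 0 -> exists2 y, y != 0 &
  sing qk ql pi E F (fun a => kk a * chi a al ^- s) (fun a => ll a * chi al a ^+ s) nu y.
Proof.
move=> sy y0; have kal0 : kk al != 0 by case: kkP.
have he r : (0 < r < s)%N -> qnum q r * (ll al - q ^- r.-1 * kk al) != 0.
  move=> hr; rewrite mulf_neq0 ?qnum_eq0 ?qinf //; first by case/andP: hr.
  rewrite hs -mulrBl mulf_neq0 // subr_eq0; apply/eqP => /invr_inj/qX_inj; lia.
have hp p k : Km (nu + al *+ p) k -> k != 0 -> qfact q p != 0 -> (p < s)%N.
  move=> /(Km_N' H hM); rewrite -(Gen_rF B hM) => hk nz _.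
  have := Nm_cone H1 hk nz i; rewrite (rcrdD H) (addfMn (rcrdD H i M i)).
  have ea : rcrd crd i M i al = -1.
    apply: oppr_inj; rewrite opprK -(addfN (rcrdD H i M i)).
    by have := rcrd_pi H i M i i; rewrite {1}/rpi !eqxx.
  rewrite ea mulNrn natz; lia.
have [n [z [[cn _] hz nJ jE jF]]] := transfer_core B hM kkP llP s_gt0 (or_intror hs) he sy y0 hp.
have {}cn : (chi al (nu + al *+ s.-1))^-1 * kk al = q ^- n * (chi (nu + al *+ s.-1) al * ll al).
  move/eqP: cn; rewrite /cN mulf_eq0 subr_eq0 qnum_eq0 (negbTE (qinf _)) //=.
  by move/eqP.
have en := hn1 cn.
have z0 : z != 0 by apply/eqP => zz; apply: nJ; apply: JF_V0; rewrite zz V0.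
have Ez j : V B kk ll (E j * z) = 0.
  have [y hy ->] := jE j; rewrite (Nm_out H (i := i) hy) ?mul0r //.
  rewrite !(crdB H) (h_crdD H) !(crdMn H) !(h_crdpi H) eqxx !natz.
  by case: (i == j) => /=; lia.
have hF m := Nm_Fn pi F i m.
have hw : Nm (nu + al *+ s) (F i ^+ n.+1 * z).
  apply: Gen_eq (Gen_mul (hF n.+1) hz) _; rewrite -{2}(prednK s_gt0) !mulrSr; lattice H.
have Ew j : V B kk ll (E j * (F i ^+ n.+1 * z)) = 0.
  case: (eqVneq j i) => [->|ji]; last first.
    by rewrite mulrA (EjFn H) // -mulrA (V_GenM _ _ _ _ (hF n.+1)) // Ez mulr0.
  set ze := nu + _ - _ in hz.
  have gk := GK H al hz; have gl := GL H al hz.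
  have -> : E i * (F i ^+ n.+1 * z) = F i ^+ n.+1 * (E i * z)
      + qnum q n.+1 *: (F i ^+ n * (ql al * z - q ^- n *: (qk al * z))).
    by rewrite mulrA (EFn H) mulrDl -mulrA -scalerAl -mulrA mulrBl -[_ *: _ * z]scalerAl.
  rewrite VD // (V_GenM _ _ _ _ (hF _)) // Ez mulr0 add0r VZ // (V_GenM _ _ _ _ (hF _)) //.
  rewrite gk gl VB // !VZ // V_K // V_L // !scalerA -scalerBl.
  have -> : chi ze al * ll al - q ^- n / chi al ze * kk al = 0.
    rewrite /ze; move: cn; set mu := nu + _ => cn.
    have -> : chi (mu - al *+ n) al = chi mu al * q ^- n by rewrite (chiDl H) (chiNl H) (chiMnl H).
    have -> : chi al (mu - al *+ n) = chi al mu * q ^- n by rewrite (chiDr H) (chiNr H) (chiMnr H).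
    have qn := expf_neq0 n q0.
    have -> : q ^- n / (chi al mu * q ^- n) * kk al = (chi al mu)^-1 * kk al.
      by rewrite invfM invrK [_^-1 * q ^+ n]mulrC mulrA mulVf // mul1r.
    by rewrite cn; ring.
  by rewrite scale0r mulr0 scaler0.
have [y hy ey] := jF; rewrite (V_Gen _ kkP llP hw) in ey.
have {}hy : Nm nu y.
  by apply: Gen_eq hy _; rewrite -{2}(prednK s_gt0) !mulrSr; lattice H.
exists y.
  apply: contraNneq z0 => yz; apply/eqP/(mulFl_inj (n := n.+1) hz).
  by rewrite ey yz mul0r.
split=> // j y1 y2 [h1 h2 eE].
have := Ew j; rewrite ey mulrA eE !mulrDl !VD // -[y * E j * _]mulrA (V_GenM _ _ _ _ hy) //.
rewrite (V_EFs B kkP llP s_gt0 (or_intror hs)) mulr0 add0r -2!mulrA (V_Kn B i ll kkP) // (V_Ln B i kk llP) //.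
rewrite (V_GenM _ _ _ _ h1) // (V_GenM _ _ _ _ h2) // (V_Gen _ kkP llP (hF s)) !scalerAl -mulrDl => e0.
by rewrite [kk _ * _]mulrC [ll _ * _]mulrC; exact: (mulFr_inj (GenD _ h1 (GenZ _ h2)) e0).
Qed.

End Infinite.
End TransferCases.

(** * Generic points and limits of singular vectors *)

(** A root of p X - 1 satisfies p(x) x = 1, so neither factor vanishes. *)
Lemma generic_point (K : closedFieldType) (p : {poly K}) : p != 0 ->
  exists2 x, x != 0 & p.[x] != 0.
Proof.
move=> p0; have [x] : exists x, root (p * 'X - 1) x.
  apply: closed_rootP; rewrite size_polyDl ?size_mulX //.
    by rewrite eqSS size_poly_eq0.
  by rewrite size_polyN size_poly1 ltnS lt0n size_poly_eq0.
rewrite /root !hornerE subr_eq0 => /eqP e; exists x.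
  by apply: contraTneq isT => x0; move/eqP: e; rewrite x0 mulr0 eq_sym oner_eq0.
by apply: contraTneq isT => x0; move/eqP: e; rewrite x0 mul0r eq_sym oner_eq0.
Qed.

Lemma generic_point_seq (K : closedFieldType) (p : {poly K}) (bad : seq K) : p != 0 ->
  exists x, [/\ x != 0, x \notin bad & p.[x] != 0].
Proof.
move=> p0; have [|x x0] := generic_point (p := p * \prod_(b <- bad) ('X - b%:P)).
  by rewrite mulf_neq0 // monic_neq0 // monic_prod_XsubC.
rewrite hornerM mulf_eq0 negb_or => /andP[px bx]; exists x; split=> //.
by move: bx; rewrite -[_ == 0]/(root _ x) root_prod_XsubC.
Qed.

Lemma fdim_ord (K : fieldType) (M : lmodType K) (S : M -> Prop) n : fdim S n ->
  exists b : 'I_n -> M, fbasis S b.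
Proof.
move=> [J [b [[b1 b2 b3] <-]]]; exists (fun l => b (enum_val l)).
have rx (G : J -> M) : \sum_j G j = \sum_(l < #|J|) G (enum_val l).
  by rewrite (reindex _ (onW_bij _ (enum_val_bij J))).
split=> // [c e l|x /b3[c ->]].
  have := b2 (fun j => c (enum_rank j)); rewrite rx.
  rewrite (eq_bigr (fun l => c l *: b (enum_val l))) => [/(_ e (enum_val l))|k _]; by rewrite enum_valK.
by exists (fun l => c (enum_val l)); rewrite rx.
Qed.

Section Density.
Variables (K : closedFieldType) (A : zmodType) (U : algType K) (I : finType).
Variables (chi : A -> A -> K) (qk ql : A -> U) (pi : I -> A).
Variables (crd : I -> A -> int) (E F : I -> U).
Hypothesis H : pborel chi qk ql pi crd E F.
Local Notation Nm := (Gen pi F).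

Lemma der_sumZ j mu n (c : 'I_n -> K) (y y1 y2 : 'I_n -> U) :
  (forall r, der qk ql pi E F j mu (y r) (y1 r) (y2 r)) ->
  der qk ql pi E F j mu (\sum_r c r *: y r) (\sum_r c r *: y1 r) (\sum_r c r *: y2 r).
Proof.
move=> h; elim/big_ind3: _ => [|a b d a' b' d' h1 h2|r _].
- exact: der0.
- by have := der_lin 1 h1 h2; rewrite !scale1r.
- by have := der_lin (c r) (h r) (der0 qk ql pi E F j mu); rewrite !addr0.
Qed.

(** In coordinates singular vectors form the kernel of a matrix with Laurent polynomial entries in
    x. Were it zero at x = 1, a right inverse there would give a determinant [P] that is a nonzero
    polynomial, and the kernel would be zero off the roots of [P]. *)
Lemma sing_closed mu n0 (kk ll : A -> K) (th : I -> int) : fdim (Nm mu) n0 ->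
  (forall j, exists n, fdim (Nm (mu - pi j)) n) ->
  (forall bad : seq K, exists x, [/\ x != 0, x \notin bad & exists2 y, y != 0 &
    Nm mu y /\ forall j y1 y2, der qk ql pi E F j mu y y1 y2 ->
      (kk (pi j) * x ^ th j) *: y1 + ll (pi j) *: y2 = 0]) ->
  exists2 y, y != 0 & sing qk ql pi E F kk ll mu y.
Proof.
move=> /fdim_ord[b [b1 b2 b3]] /choice[m hm] dense; apply: contrapT => nosing.
have {hm} /choice[d hd] j : exists d : nat -> U, fbasis (Nm (mu - pi j)) (fun c : 'I_(m j) => d c).
  have [d hd] := fdim_ord (hm j); exists (fun c => if insub c is Some c' then d c' else 0).
  rewrite (_ : (fun c : 'I_(m j) => _) = d) //; apply/funext => c.
  by rewrite valK.
have /choice[D hD] (jp : I * 'I_n0) : exists y, der qk ql pi E F jp.1 mu (b jp.2) y.1 y.2.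
  by have [y1 [y2 h]] := der_ex H jp.1 (b1 jp.2); exists (y1, y2).
have /choice[C hC] (jp : I * 'I_n0) : exists c : (nat -> K) * (nat -> K),
  (D jp).1 = \sum_(r < m jp.1) c.1 r *: d jp.1 r /\ (D jp).2 = \sum_(r < m jp.1) c.2 r *: d jp.1 r.
  have [g1 g2 _] := hD jp; have [_ _ sp] := hd jp.1.
  have [c1 e1] := sp _ g1; have [c2 e2] := sp _ g2.
  exists (fun r => if insub r is Some r' then c1 r' else 0, fun r => if insub r is Some r' then c2 r' else 0).
  by rewrite e1 e2; split; apply: eq_bigr => r _; rewrite /= valK.
(* Multiplication by x^N clears the negative powers of x. *)
pose N := (\sum_j `|th j|)%N.
pose T := {j : I & 'I_(m j)}.
pose c1 p (t : T) := (C (tag t, p)).1 (tagged t); pose c2 p (t : T) := (C (tag t, p)).2 (tagged t).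
pose Mx : 'M[{poly K}]_(n0, #|{: T}|) := \matrix_(p, t)
  ((kk (pi (tag (enum_val t))) * c1 p (enum_val t)) *: 'X^(`|(N%:Z + th (tag (enum_val t)))%R|)
   + (ll (pi (tag (enum_val t))) * c2 p (enum_val t)) *: 'X^N).
pose Me x := map_mx (horner_eval x) Mx.
have hMe x p t : x != 0 -> Me x p t = x ^+ N * (kk (pi (tag (enum_val t))) * x ^ th (tag (enum_val t)) * c1 p (enum_val t)
    + ll (pi (tag (enum_val t))) * c2 p (enum_val t)).
  move=> x0; rewrite !mxE /horner_eval !hornerE.
  set j := tag _; have le : 0 <= N%:Z + th j.
    have : (`|th j| <= N)%N by rewrite /N (bigD1 j) //= leq_addr.
    by have := lez_abs (- th j); rewrite abszN; lia.
  have -> : x ^+ `|N%:Z + th j| = x ^+ N * x ^ th j.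
    by rewrite exprnP gez0_abs // expfzDr // -exprnP.
  ring.
have key x (z : 'rV[K]_n0) : x != 0 ->
    (forall j y1 y2, der qk ql pi E F j mu (\sum_p z 0 p *: b p) y1 y2 ->
      (kk (pi j) * x ^ th j) *: y1 + ll (pi j) *: y2 = 0) <-> z *m Me x = 0.
  move=> x0; have hder j := der_sumZ (fun p => z 0 p) (fun p => hD (j, p)).
  have eL j : (kk (pi j) * x ^ th j) *: (\sum_p z 0 p *: (D (j, p)).1) + ll (pi j) *: (\sum_p z 0 p *: (D (j, p)).2)
    = \sum_(r < m j) (\sum_p z 0 p * (kk (pi j) * x ^ th j * (C (j, p)).1 r + ll (pi j) * (C (j, p)).2 r)) *: d j r.
    rewrite !scaler_sumr -big_split /=.
    rewrite (eq_bigr (fun p => \sum_(r < m j) (z 0 p * (kk (pi j) * x ^ th j * (C (j, p)).1 r + ll (pi j) * (C (j, p)).2 r)) *: d j r)).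
      by rewrite exchange_big /=; apply: eq_bigr => r _; rewrite scaler_suml.
    move=> p _; have [-> ->] := hC (j, p); rewrite /= !scaler_sumr -big_split /=.
    by apply: eq_bigr => r _; rewrite !scalerA -scalerDl; congr (_ *: _); ring.
  split=> [h|h].
    apply/rowP => t; rewrite !mxE; set j := tag (enum_val t).
    have := h j _ _ (hder j); rewrite eL => e0; have [_ fr _] := hd j.
    have := fr _ e0 (tagged (enum_val t)) => /= e1.
    rewrite (eq_bigr _ (fun p _ => congr1 (fun v => z 0 p * v) (hMe x p t x0))).
    rewrite (eq_bigr (fun p => x ^+ N * (z 0 p * (kk (pi j) * x ^ th j * c1 p (enum_val t)
       + ll (pi j) * c2 p (enum_val t))))); last by move=> p _; rewrite mulrCA.
    by rewrite -mulr_sumr e1 mulr0.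
  move=> j y1 y2 hd'; have [-> ->] := der_uniq H hd' (hder j); rewrite eL big1 // => r _.
  have := congr1 (fun w : 'rV_ _ => w 0 (enum_rank (Tagged (fun j => 'I_(m j)) r))) h; rewrite !mxE.
  rewrite (eq_bigr _ (fun p _ => congr1 (fun v => z 0 p * v) (hMe x p _ x0))) enum_rankK /=.
  rewrite (eq_bigr (fun p => x ^+ N * (z 0 p * (kk (pi j) * x ^ th j * (C (j, p)).1 r
       + ll (pi j) * (C (j, p)).2 r)))); last by move=> p _; rewrite mulrCA.
  rewrite -mulr_sumr => /eqP; rewrite mulf_eq0 expf_eq0 (negbTE x0) andbF /= => /eqP ->.
  by rewrite scale0r.
have rf1 : row_free (Me 1).
  apply: inj_row_free => z hz; apply/rowP => p; rewrite mxE.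
  have nz := proj2 (key 1 z (oner_neq0 _)) hz.
  apply: (b2 (fun p => z 0 p)); apply: contrapT => /eqP ynz; apply: nosing.
  exists (\sum_p z 0 p *: b p) => //; split; first by apply: Gen_sum => p' _; exact: GenZ.
  by move=> j y1 y2 /nz; rewrite exp1rz mulr1.
have [Ni hNi] := row_freeP rf1.
pose P := \det (Mx *m map_mx polyC Ni).
have PE x : P.[x] = \det (Me x *m Ni).
  rewrite -[P.[x]]/(horner_eval x P) /P -det_map_mx map_mxM; congr (\det (_ *m _)).
  by apply/matrixP => a c; rewrite !mxE; exact: hornerC.
have P0 : P != 0.
  by apply: contraTneq isT => z; have := PE 1; rewrite hNi det1 z horner0 => /eqP; rewrite eq_sym oner_eq0.
have [rs Ps] := closed_field_poly_normal P.
have [x [x0 xb [y y0 [hy sy]]]] := dense rs.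
have [c ec] := b3 _ hy; pose z : 'rV[K]_n0 := \row_p c p.
have ez : y = \sum_p z 0 p *: b p by rewrite ec; apply: eq_bigr => p _; rewrite mxE.
have /(congr1 (fun w => w *m Ni)) : z *m Me x = 0 by apply/(key x z x0); rewrite -ez.
rewrite mul0mx -mulmxA => z0.
have uM : Me x *m Ni \in unitmx.
  rewrite unitmxE -PE unitfE Ps hornerZ mulf_neq0 ?lead_coef_eq0 //.
  by rewrite -[_ == 0]/(root _ x) root_prod_XsubC.
have := congr1 (fun w => w *m invmx (Me x *m Ni)) z0; rewrite mul0mx mulmxK // => zz.
by case/eqP: y0; rewrite ez zz big1 // => p _; rewrite mxE scale0r.
Qed.

End Density.

(** * Singular vectors on the hyperplanes of a root *)

Section SingularVectors.
Variables (K : closedFieldType) (A : zmodType) (U : algType K) (I : finType).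
Variables (chi : A -> A -> K) (qk ql : A -> U).

Definition is_rho (pi : I -> A) (rho : A -> K) :=
  chrp rho /\ forall j, rho (pi j) = chi (pi j) (pi j).

(** [rho] is quantified inside because a reflection changes the basis on which its values are
    prescribed. *)
Definition PS (pi : I -> A) (E F : I -> U) b t := forall rho kk ll,
  is_rho pi rho -> chrp kk -> chrp ll -> ll b = rho b * chi b b ^- t * kk b ->
  exists2 y, y != 0 & sing qk ql pi E F kk ll (b *+ t) y.

Variables (pi : I -> A) (crd : I -> A -> int) (E F : I -> U).
Hypothesis B : borel chi qk ql pi crd E F.
Let H := b_pb B.

Lemma PS_simple i t : (0 < t)%N -> qfact (chi (pi i) (pi i)) t != 0 -> PS pi E F (pi i) t.
Proof.
move=> t0 qt rho kk ll [_ hr] kkP llP e; exists (F i ^+ t); first exact: (Fn_neq0 H).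
apply/(singP B kkP llP (Nm_Fn pi F i t)) => j.
apply: (V_EFs B kkP llP t0); right.
have et : chi (pi i) (pi i) ^+ t = chi (pi i) (pi i) * chi (pi i) (pi i) ^+ t.-1 by rewrite -exprS prednK.
by rewrite e hr et; field; rewrite expf_neq0 ?(chi_nz H).
Qed.

Definition brd i a := chi (pi i) a * chi a (pi i).
Lemma brdP i : chrp (brd i).
Proof.
split=> [a|a b]; first by rewrite mulf_neq0 ?(chi_nz H).
by rewrite /brd (chiDr H) (chiDl H) mulrACA.
Qed.
Lemma chrpM k l : chrp k -> chrp l -> chrp (fun a : A => k a * l a :> K).
Proof. by move=> [k0 kD] [l0 lD]; split=> [a|a b]; rewrite ?mulf_neq0 // kD lD mulrACA. Qed.
Lemma chrpV k : chrp k -> chrp (fun a : A => (k a)^-1 :> K).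
Proof. by move=> [k0 kD]; split=> [a|a b]; rewrite ?invr_eq0 // kD invfM. Qed.
Lemma chrpX k n : chrp k -> chrp (fun a : A => k a ^+ n :> K).
Proof. by move=> [k0 kD]; split=> [a|a b]; rewrite ?expf_neq0 // kD exprMn. Qed.
Lemma chrp_chir b : chrp (fun a => chi a b).
Proof. by split=> [a|a c]; [exact: (chi_nz H) | exact: (chiDl H)]. Qed.
Lemma chrp_chil b : chrp (chi b).
Proof. by split=> [a|a c]; [exact: (chi_nz H) | exact: (chiDr H)]. Qed.
Lemma chrpz (th : A -> int) (x : K) : (forall a b, th (a + b) = th a + th b) -> x != 0 ->
  chrp (fun a => x ^ th a).
Proof. by move=> thD x0; split=> [a|a b]; rewrite ?expfz_neq0 // thD expfzDr. Qed.

Section Transfer.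
Variables (rs : seq A) (i : I) (M : I -> nat) (b : A) (t : nat).
Hypothesis Hl : hil chi pi crd F rs.
Hypothesis hM : forall j, j != i -> bm chi pi i j (M j) = 0 /\ forall k, (k < M j)%N -> bm chi pi i j k != 0.
Local Notation al := (pi i).
Local Notation q := (chi (pi i) (pi i)).
Local Notation pi' := (rpi pi i M).
Local Notation e := (rf (fun a b => chi b a) qk pi F E i M).
Local Notation rF := (rF chi ql pi E F i M).
Hypothesis b_in : b \in rs.
Hypothesis b_al : b != al.
Hypothesis PS' : PS pi' e rF b t.
Let q0 : q != 0 := chi_nz H _ _.
Let q1 : q != 1 := hil_neq1 Hl (simple_in B i Hl).

Lemma qn_eq0 n : (qnum q n == 0) = (q ^+ n == 1).
Proof. exact: (qnum_eq0 (chi := chi) (pi := pi) q1). Qed.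

Lemma bm_root j : j != i -> q ^+ (M j).+1 = 1 \/ brd i (pi j) = q ^- M j.
Proof.
move=> ji; have [/eqP + _] := hM ji; rewrite /bm !mulf_eq0 invr_eq0 (negbTE (chi_nz H _ _)) /=.
by rewrite qn_eq0 subr_eq0 => /orP[/eqP h|/eqP h]; [left | right].
Qed.

Lemma brd_al : brd i al = q ^+ 2. Proof. by rewrite /brd expr2. Qed.

Lemma chi_rpi j : j != i -> chi (pi' j) (pi' j) =
  chi (pi j) (pi j) * brd i (pi j) ^+ M j * q ^+ (M j * M j).
Proof.
move=> ji; rewrite /rpi (negbTE ji) (chiDl H) !(chiDr H) !(chiMnl H) !(chiMnr H) exprM.
by rewrite /brd exprMn; ring.
Qed.

(** A root on the line of [al] other than [al] is excluded by [simple_uniq]. *)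
Lemma other_coord : exists2 j, j != i & 0 < crd j b.
Proof.
apply: contrapT => nex; have cb := hil_cone Hl b_in.
have z j : j != i -> crd j b = 0.
  move=> ji; apply/eqP; rewrite eq_le cb andbT leNgt; apply/negP => lt; apply: nex; by exists j.
have eb : b = al *+ `|crd i b|.
  apply: (crd_inj H) => k; rewrite (crdMn H) (h_crdpi H).
  case: (eqVneq k i) => [->|/z ->]; last by rewrite mul0rn.
  by rewrite natz gez0_abs.
have := simple_uniq B i Hl `|crd i b|; rewrite -eb => /negP; apply.
have : b \in al :: rem al rs by rewrite -(perm_mem (perm_to_rem (simple_in B i Hl))).
by rewrite inE (negbTE b_al).
Qed.

Section Chars.
Variables (rho kk ll : A -> K).
Hypothesis rhoP : is_rho pi rho.
Hypothesis kkP : chrp kk.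
Hypothesis llP : chrp ll.
Hypothesis hb : ll b = rho b * chi b b ^- t * kk b.

(** Passing from (kk, ll) to (kk', ll') multiplies ll/kk by brd^(h-1), so rho must change by the
    same factor for [b] to stay on its hyperplane; the values on the reflected basis confirm that
    this is the new rho. *)
Lemma is_rho_finite h : (0 < h)%N -> q ^+ h = 1 -> (forall r, (0 < r < h)%N -> q ^+ r != 1) ->
  is_rho pi' (fun a => rho a * brd i a ^+ h.-1).
Proof.
move=> h0 qh hmin; have [rc rj] := rhoP; split; first exact: chrpM rc (chrpX _ (brdP i)).
have qh1 : q ^+ h.-1 = q^-1 by apply: (mulfI q0); rewrite -exprS prednK // qh mulfV.
move=> j; case: (eqVneq j i) => [->|ji].
  rewrite /rpi eqxx (chiNl H) (chiNr H) invrK (chrpN _ rc) (chrpN _ (brdP i)) rj brd_al.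
  by rewrite exprVn exprAC qh1 exprVn invrK expr2 mulKf.
rewrite (chi_rpi ji) {1 2}/rpi (negbTE ji) (proj2 rc) (proj2 (brdP i)) (chrpMn _ _ rc) (chrpMn _ _ (brdP i)) !rj.
rewrite brd_al exprMn -[(q ^+ 2) ^+ M j]exprM -[(q ^+ _) ^+ h.-1]exprM mulnC exprM qh1 exprVn mulnC.
have -> : q ^- (M j * 2) = (q ^+ M j * q ^+ M j)^-1 by rewrite muln2 -addnn exprD.
have qm := expf_neq0 (M j) q0.
(* Either q^(M_j + 1) = 1, which forces M_j = h - 1, or brd(pi j) = q^(-M_j); in both cases the
   powers of q match. *)
have key : brd i (pi j) ^+ h.-1 = brd i (pi j) ^+ M j * q ^+ (M j * M j) * q ^+ M j.
  rewrite -mulrA -exprD -mulnSr; case: (bm_root ji) => [qM|->].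
    have le : (M j < h)%N.
      have [_ hb'] := hM ji; rewrite ltnNge; apply/negP => le.
      have := hb' h.-1; rewrite prednK // => /(_ le); rewrite /bm prednK //.
      by have /eqP -> : qnum q h == 0; [rewrite qn_eq0 qh | rewrite mulr0 mul0r eqxx].
    have -> : M j = h.-1.
      have : ~~ ((M j).+1 < h)%N by apply/negP => lt; have := hmin (M j).+1; rewrite lt qM eqxx => /(_ isT).
      by lia.
    by rewrite prednK // mulnC exprM qh expr1n mulr1.
  rewrite -!exprVn -!exprM exprVn [(M j * h.-1)%N]mulnC exprM qh1 -exprVn invrK.
  by rewrite exprVn mulnSr exprD mulrA mulVf ?mul1r // expf_neq0.
by rewrite key; field.
Qed.

(** The characters are twisted back by the weight of F_i^s and then forward by that of F_i^(s-1),
    which leaves one inverse factor of [brd]. *)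
Lemma is_rho_inf : (forall r, (0 < r)%N -> q ^+ r != 1) -> is_rho pi' (fun a => rho a * (brd i a)^-1).
Proof.
move=> qinf; have [rc rj] := rhoP; split; first exact: chrpM rc (chrpV (brdP i)).
move=> j; case: (eqVneq j i) => [->|ji].
  rewrite /rpi eqxx (chiNl H) (chiNr H) invrK (chrpN _ rc) (chrpN _ (brdP i)) rj brd_al invrK.
  by rewrite expr2 mulKf.
rewrite (chi_rpi ji) {1 2}/rpi (negbTE ji) (proj2 rc) (proj2 (brdP i)) (chrpMn _ _ rc) (chrpMn _ _ (brdP i)) !rj.
have -> : brd i (pi j) = q ^- M j by case: (bm_root ji) => // /eqP; rewrite (negbTE (qinf _ _)).
rewrite brd_al -exprM mulnC muln2 -addnn exprD exprVn -exprM.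
by have := expf_neq0 (M j) q0; have := expf_neq0 (M j * M j) q0 => h1 h2; field; rewrite h1 h2.
Qed.

End Chars.

Lemma PS_transfer : PS pi E F b t.
Proof.
move=> rho kk ll rhoP kkP llP hb.
have [j0 j0i bj0] := other_coord.
(* [th] vanishes at [b] and not at [al]: twisting by x^th stays on the hyperplane of [b] and moves
   the weight along [al] freely. *)
pose th a : int := crd j0 b * crd i a - crd i b * crd j0 a.
have thD x y : th (x + y) = th x + th y by rewrite /th !(h_crdD H); ring.
have thb : th b = 0 by rewrite /th mulrC subrr.
pose n := `|crd j0 b|%N; have n0 : (0 < n)%N by rewrite /n; lia.
have thal : th al = n%:Z by rewrite /th !(h_crdpi H) eqxx (negbTE j0i) mulr1 mulr0 subr0 /n; lia.
have hdim mu : exists m, fdim (Gen pi F mu) m.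
  exists (cnt chi `|hgt crd mu|.+1 rs mu); apply: (hil_dim Hl); have := lez_abs (hgt crd mu); lia.
have [m0 hm0] := hdim (b *+ t).
apply: (sing_closed H (th := fun j => th (pi j)) hm0 (fun j => hdim _)) => bad.
have ksP x : x != 0 -> chrp (fun a => kk a * x ^ th a) by move=> x0; exact: chrpM kkP (chrpz thD x0).
have kal : kk al != 0 by case: kkP.
have lal : ll al != 0 by case: llP.
have ksal x : kk al * x ^ th al = kk al * x ^+ n by rewrite thal.
have [[h0 [h00 qh0]]|nex] := pselect (exists h, (0 < h)%N /\ q ^+ h = 1); last first.
  have qinf r : (0 < r)%N -> q ^+ r != 1 by move=> r0; apply/eqP => qr; apply: nex; exists r.
  (* In infinite order the braiding of [al] with every simple root, hence with [b], is an integral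
     power of q; [a0] and [b0] record the exponent for t b. *)
  have [a0 [b0 hX]] : exists a0 b0, brd i b ^+ t * q ^+ a0 = q ^+ b0.
    pose Q x := exists a0 b0 : nat, x * q ^+ a0 = q ^+ b0.
    have QM x y : Q x -> Q y -> Q (x * y).
      move=> [a1 [b1 h1]] [a2 [b2 h2]]; exists (a1 + a2)%N, (b1 + b2)%N.
      by rewrite !exprD -h1 -h2; ring.
    have Q1 : Q 1 by exists 0%N, 0%N; rewrite mulr1.
    have QX x k : Q x -> Q (x ^+ k) by move=> hx; elim: k => [|k IH]; rewrite ?expr0 // exprS; exact: QM.
    have QV x : x != 0 -> Q x -> Q x^-1.
      move=> x0 [a1 [b1 h1]]; exists b1, a1; rewrite -h1 mulKf //.
    have Qpi j : Q (brd i (pi j)).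
      case: (eqVneq j i) => [->|ji]; first by exists 0%N, 2%N; rewrite brd_al mulr1.
      have -> : brd i (pi j) = q ^- M j by case: (bm_root ji) => // /eqP; rewrite (negbTE (qinf _ _)).
      by exists (M j), 0%N; rewrite mulVf ?expf_neq0.
    have [X0 XD] := brdP i.
    apply: (QX); rewrite (h_crdE H b); elim/big_ind: _ => [|x y|j _]; first by rewrite (chrp0 (brdP i)).
      by rewrite XD; exact: QM.
    case: (crd j b) => k; rewrite ?NegzE -?pmulrn ?mulrNz ?(chrpN _ (brdP i)) -?pmulrn (chrpMn _ _ (brdP i)).
      exact: QX.
    by apply: QV; [rewrite expf_neq0 // X0 | exact: QX].
  pose S0 := (`|crd i (b *+ t)| + `|rcrd crd i M i (b *+ t)| + a0 + 2)%N.
  (* The parameter is chosen so that ll(al) = q^(s+1) ks(al); after the twist to [kp] and [lp] this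
     becomes the condition for F_i^s v to be singular. *)
  have /choice[sg hsg] s : exists x : K, x ^+ n = ll al / kk al / q ^+ s.+1.
    have [x] : exists x, root ('X^n - (ll al / kk al / q ^+ s.+1)%:P) x.
      by apply: closed_rootP; rewrite size_XnsubC // eqSS -lt0n.
    by rewrite /root !hornerE subr_eq0 => /eqP; exists x.
  (* Different s give different parameters since q has infinite order, so some large s avoids
     [bad]. *)
  have [s [sS sb]] : exists s, (S0 <= s)%N /\ sg s \notin bad.
    apply: contrapT => nex'; pose l := [seq sg (S0 + k)%N | k <- iota 0 (size bad).+1].
    have : (size l <= size bad)%N.
      apply: uniq_leq_size.
        rewrite map_inj_uniq ?iota_uniq // => k1 k2 /(congr1 (fun x => x ^+ n)); rewrite !hsg.
        move=> /mulfI; rewrite mulf_neq0 ?invr_eq0 // => /(_ isT)/invr_inj/(qX_inj B qinf); lia.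
      move=> x /mapP[k _ ->]; apply: contrapT => /negP nb; apply: nex'.
      by exists (S0 + k)%N; rewrite leq_addr.
    by rewrite size_map size_iota ltnn.
  have x0 : sg s != 0.
    apply/eqP => z; have := hsg s; rewrite z expr0n gtn_eqF // => /esym/eqP.
    by rewrite !mulf_eq0 !invr_eq0 (negbTE lal) (negbTE kal) expf_eq0 (negbTE q0).
  exists (sg s); split=> //.
  pose ks a := kk a * sg s ^ th a; have ksc : chrp ks by exact: ksP.
  have zal : ll al = q ^+ s.+1 * ks al.
    rewrite /ks ksal hsg; have := expf_neq0 s.+1 q0 => qs; by field; rewrite kal qs.
  have ksb : ks b = kk b by rewrite /ks thb expr0z mulr1.
  pose kp a := ks a * chi a al ^+ s; pose lp a := ll a * (chi al a ^+ s)^-1.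
  have kpP : chrp kp by exact: chrpM ksc (chrpX _ (chrp_chir _)).
  have lpP : chrp lp by exact: chrpM llP (chrpV (chrpX _ (chrp_chil _))).
  have s0 : (0 < s)%N by move: sS; rewrite /S0; lia.
  have hk' a : kk' chi pi i kp s a = ks a * chi a al.
    rewrite /kk' /kp -{1}(prednK s0) exprS.
    by have := expf_neq0 s.-1 (chi_nz H a al) => c0; field.
  have hl' a : ll' chi pi i lp s a = ll a * (chi al a)^-1.
    rewrite /ll' /lp -{1}(prednK s0) exprS.
    by have := expf_neq0 s.-1 (chi_nz H al a) => c0; field; rewrite c0 (chi_nz H).
  have [y' y0 sy] : exists2 y, y != 0 & sing qk ql pi' e rF (kk' chi pi i kp s) (ll' chi pi i lp s) (b *+ t) y.
    apply: (PS' (is_rho_inf rhoP qinf)).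
    - rewrite (_ : kk' _ _ _ _ _ = (fun a => ks a * chi a al)); last exact/funext.
      exact: chrpM ksc (chrp_chir _).
    - rewrite (_ : ll' _ _ _ _ _ = (fun a => ll a * (chi al a)^-1)); last exact/funext.
      exact: chrpM llP (chrpV (chrp_chil _)).
    rewrite hk' hl' ksb hb /brd.
    by field; rewrite !(chi_nz H) expf_neq0 ?(chi_nz H).
  have qs1 := expf_neq0 s.-1 q0; have qs2 := expf_neq0 s q0.
  have esq : q ^+ s = q * q ^+ s.-1 by rewrite -exprS prednK.
  have [||||y yn0 sy2] := @transfer_inf _ _ _ _ _ _ _ _ _ _ _ B i M hM q1 qinf kp lp kpP lpP s (b *+ t) (b0 + s - a0)%N s0 _ _ _ _ y' sy y0.
  - by rewrite /lp /kp zal exprS esq; field; rewrite qs1.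
  - move=> m; set mu := b *+ t + _ => em.
    have c1 : chi al mu != 0 := chi_nz H _ _.
    have c2 : q ^+ m * kp al = brd i mu * lp al.
      have := expf_neq0 m q0 => qm.
      apply: (mulfI (invr_neq0 qm)); rewrite mulKf // /brd -mulrA.
      by apply: (mulfI (invr_neq0 c1)); rewrite em; field; rewrite qm c1.
    have c3 : q ^+ (m + a0) = q ^+ (b0 + s.-1).
      have l1 : lp al = q ^- s.-1 * kp al by rewrite /lp /kp zal exprS esq; field; rewrite qs1.
      have kpal : kp al != 0 by case: kpP.
      apply: (mulIf kpal); rewrite !exprD -hX.
      have -> : q ^+ m * q ^+ a0 * kp al = q ^+ a0 * (q ^+ m * kp al) by ring.
      rewrite c2 l1 (proj2 (brdP i)) !(chrpMn _ _ (brdP i)) brd_al -exprM mulnC muln2 -addnn exprD.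
      by field.
    have := qX_inj B qinf c3; move: sS; rewrite /S0; lia.
  - by have := lez_abs (crd i (b *+ t)); move: sS; rewrite /S0; lia.
  - by have := lez_abs (rcrd crd i M i (b *+ t)); move: sS; rewrite /S0; lia.
  exists y => //; case: sy2 => hy hs; split=> // j y1 y2 /hs; congr (_ *: _ + _ *: _ = _).
    by rewrite /kp /ks mulfK // expf_neq0 ?(chi_nz H).
  by rewrite /lp mulfVK // expf_neq0 ?(chi_nz H).
have exh : exists h, (0 < h)%N && (q ^+ h == 1) by exists h0; rewrite h00 qh0 eqxx.
case: (ex_minnP exh) => h /andP[hgt0 /eqP qh] hm.
have hmin r : (0 < r < h)%N -> q ^+ r != 1.
  move=> /andP[r0 rh]; apply/negP => qr; have := hm r; rewrite r0 qr => /(_ isT); lia.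
pose mu := b *+ t + al *+ h.-1.
(* Infinitely many inequalities, one for each power of q, become two: in the h-th powers the factor
   q^r disappears. *)
pose p1 := (kk al ^+ h) *: 'X^(n * h) - (ll al ^+ h)%:P.
pose p2 := (((chi al mu)^-1 * kk al) ^+ h) *: 'X^(n * h) - ((chi mu al * ll al) ^+ h)%:P.
have pn0 (u v : K) : u != 0 -> u *: 'X^(n * h) - v%:P != 0.
  move=> u0; apply/eqP => /(congr1 (fun p : {poly K} => p`_(n * h))).
  rewrite coefB coefZ coefXn eqxx coefC coef0 mulr1 muln_eq0.
  by rewrite !eqn0Ngt n0 hgt0 /= subr0 => /eqP; rewrite (negbTE u0).
have p12 : p1 * p2 != 0.
  by rewrite mulf_neq0 // pn0 // expf_neq0 // mulf_neq0 // invr_eq0 (chi_nz H).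
have [x [x0 xb]] := generic_point_seq bad p12.
rewrite hornerM mulf_eq0 negb_or !hornerE => /andP[g1 g2]; exists x; split=> //.
pose ks a := kk a * x ^ th a; have ksc : chrp ks by exact: ksP.
have ksb : ks b = kk b by rewrite /ks thb expr0z mulr1.
have qhX r : (q ^- r) ^+ h = 1 by rewrite exprVn -exprM mulnC exprM qh expr1n invr1.
have [|||y' y0 sy] := PS' (is_rho_finite rhoP hgt0 qh hmin) (kk := kk' chi pi i ks h) (ll := ll' chi pi i ll h).
- exact: chrpM ksc (chrpV (chrpX _ (chrp_chir _))).
- exact: chrpM llP (chrpX _ (chrp_chil _)).
- rewrite /kk' /ll' ksb hb /brd exprMn.
  by field; rewrite !expf_neq0 ?(chi_nz H).
have [||y yn0 [hy hs]] := transfer_finite B hM q1 ksc llP hgt0 qh hmin _ _ sy y0.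
- move=> r; apply: contraNneq g1 => e1; rewrite subr_eq0; apply/eqP.
  by rewrite e1 exprMn qhX mul1r /ks ksal exprMn -exprM.
- move=> r; apply: contraNneq g2 => e1; rewrite subr_eq0; apply/eqP.
  rewrite -[RHS]mul1r -(qhX r) -exprMn -/mu -e1 /ks ksal.
  by rewrite exprM -exprMn mulrA.
by exists y.
Qed.

End Transfer.

End SingularVectors.

(** * Every positive root becomes simple *)

Lemma addf_mulz (A : zmodType) (f : A -> int) (fD : forall a b, f (a + b) = f a + f b) a z :
  f (a *~ z) = f a * z.
Proof.
case: z => k; first by rewrite -pmulrn (addfMn fD) -mulr_natr natz.
by rewrite NegzE mulrNz -pmulrn (addfN fD) (addfMn fD) -mulr_natr natz mulrN.
Qed.

Lemma addf_sum (A : zmodType) (f : A -> int) (fD : forall a b, f (a + b) = f a + f b)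
  (I : finType) (g : I -> A) : f (\sum_i g i) = \sum_i f (g i).
Proof. by elim/big_rec2: _ => [|j x y _ <-]; rewrite ?(addf0 fD) ?fD. Qed.

Section AllRoots.
Variables (K : closedFieldType) (A : zmodType) (U : algType K) (I : finType).
Variables (chi : A -> A -> K) (qk ql : A -> U).
Variable ht : A -> int.
Hypothesis htD : forall a b, ht (a + b) = ht a + ht b.

(* Reflecting at a simple root of positive height lowers the number of roots of
   positive height, so that every such root becomes simple eventually. *)
Lemma positive_roots n pi crd (E F : I -> U) rs : borel chi qk ql pi crd E F ->
  hil chi pi crd F rs -> (forall b, b \in rs -> ht b != 0) ->
  count (fun b => 0 < ht b) rs = n -> forall b, b \in rs -> 0 < ht b ->
  [/\ count_mem b rs = 1%N,
      exists2 w : A -> int, (forall a c, w (a + c) = w a + w c) & w b = 1 &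
      forall t, (0 < t)%N -> qfact (chi b b) t != 0 -> PS chi qk ql pi E F b t].
Proof.
elim: n pi crd E F rs => [|n IH] pi crd E F rs B Hl ht0 cn b b_in hb.
  have : has (fun b => 0 < ht b) rs by apply/hasP; exists b.
  by rewrite has_count cn.
have H := b_pb B.
have [[i ei]|nsimple] := pselect (exists i, b = pi i).
  rewrite ei; split.
  - rewrite (permP (perm_to_rem (simple_in B i Hl))) /= eqxx.
    by rewrite (count_memPn _) //; have := simple_uniq B i Hl 1.
  - by exists (crd i); [exact: (h_crdD H i) | rewrite (h_crdpi H) eqxx].
  - by move=> t t0 qt; exact: (PS_simple B).
have cb := hil_cone Hl b_in.
(* [ht b] is the sum of these products. As [crd i b] is not negative, both factors are positive. *)
have [i hi] : exists i, 0 < ht (pi i) * crd i b.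
  apply: contrapT => nex; move: hb; rewrite (h_crdE H b) (addf_sum htD) ltNge => /negP; apply.
  apply: sumr_le0 => j _; rewrite (addf_mulz htD) leNgt; apply/negP => lt; apply: nex; by exists j.
have hti : 0 < ht (pi i).
  by rewrite ltNge; apply/negP => le; move: hi; rewrite ltNge => /negP; apply; exact: mulr_le0_ge0.
have bi : b != pi i by apply/eqP => ebi; apply: nsimple; exists i.
have [M hM] := string_bounded B i Hl.
have B' := refl_borel B hM; have Hl' := hil_refl B Hl hM.
have al_in := simple_in B i Hl; have pm := perm_to_rem al_in.
have b_in' : b \in - pi i :: rem (pi i) rs.
  by move: b_in; rewrite (perm_mem pm) !inE (negbTE bi) /= => ->; rewrite orbT.
have [||c1 w hPS] := IH _ _ _ _ _ B' Hl' _ _ b b_in' hb.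
- move=> c; rewrite inE => /orP[/eqP ->|/mem_rem]; last exact: ht0.
  by rewrite (addfN htD) oppr_eq0 ht0.
- move: cn; rewrite (permP pm) /= hti add1n => -[<-].
  by rewrite (addfN htD) oppr_gt0 ltNge (ltW hti).
split=> //.
- move: c1; rewrite (permP pm) /= [pi i == b]eq_sym (negbTE bi).
  have -> // : (- pi i == b) = false.
  by apply/negbTE/eqP => eb; move: hb; rewrite -eb (addfN htD) oppr_gt0 ltNge (ltW hti).
- by move=> t t0 qt; apply: (PS_transfer B Hl hM b_in bi); exact: hPS.
Qed.

End AllRoots.

(** * Homogeneous components *)

Section Components.
Variables (K : fieldType) (M : lmodType K) (T : eqType) (G : T -> M -> Prop).
Hypothesis Gsub : forall t, subsp (G t).
Hypothesis Gind : forall (s : seq T) (c : T -> M), uniq s -> (forall t, G t (c t)) ->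
  \sum_(t <- s) c t = 0 -> forall t, t \in s -> c t = 0.

Definition decomp u (d : T -> M) := exists s : seq T,
  [/\ uniq s, forall t, G t (d t), forall t, t \notin s -> d t = 0 & u = \sum_(t <- s) d t].

Lemma decomp_widen (d : T -> M) (s s' : seq T) : uniq s -> uniq s' -> {subset s <= s'} ->
  (forall t, t \notin s -> d t = 0) -> \sum_(t <- s) d t = \sum_(t <- s') d t.
Proof.
move=> us us' sub d0; rewrite [RHS](bigID (mem s)) /= [X in _ = _ + X]big1 ?addr0 => [|t /d0 //].
rewrite -[RHS]big_filter; apply: perm_big; apply: uniq_perm => //; first exact: filter_uniq.
by move=> t; rewrite mem_filter /=; case: (boolP (t \in s)) => //= /sub.
Qed.

Lemma decomp_lin k u v d d' : decomp u d -> decomp v d' ->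
  decomp (k *: u + v) (fun t => k *: d t + d' t).
Proof.
move=> [s [us g d0 ->]] [s' [us' g' d0' ->]]; exists (undup (s ++ s')); split.
- exact: undup_uniq.
- by move=> t; have [_ h] := Gsub t; exact: h.
- by move=> t; rewrite mem_undup mem_cat negb_or => /andP[/d0 -> /d0' ->]; rewrite scaler0 addr0.
have s1 : {subset s <= undup (s ++ s')} by move=> t ts; rewrite mem_undup mem_cat ts.
have s2 : {subset s' <= undup (s ++ s')} by move=> t ts; rewrite mem_undup mem_cat ts orbT.
rewrite (decomp_widen us (undup_uniq _) s1 d0) (decomp_widen us' (undup_uniq _) s2 d0').
by rewrite big_split /= scaler_sumr.
Qed.

Lemma decomp_uniq u d d' : decomp u d -> decomp u d' -> d =1 d'.
Proof.
move=> h h'; have [s [us g d0 e]] := decomp_lin (-1) h' h => t.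
rewrite scaleN1r addNr in e; apply/eqP; rewrite -subr_eq0 addrC -scaleN1r; apply/eqP.
by have [ts|/d0 //] := boolP (t \in s); exact: (Gind us g (esym e)).
Qed.

Lemma decomp1 t u : G t u -> decomp u (fun t' => if t' == t then u else 0).
Proof.
move=> h; exists [:: t]; split=> //.
- by move=> t'; case: eqP => [->|_] //; case: (Gsub t').
- by move=> t'; rewrite inE => /negbTE ->.
- by rewrite big_seq1 eqxx.
Qed.

Lemma decomp_of (s : seq T) (c : T -> M) : uniq s -> (forall t, G t (c t)) ->
  decomp (\sum_(t <- s) c t) (fun t => if t \in s then c t else 0).
Proof.
move=> us g; exists s; split=> //.
- by move=> t; case: ifP => _ //; case: (Gsub t).
- by move=> t /negbTE ->.
- by rewrite [LHS]big_seq [RHS]big_seq; apply: eq_bigr => t ->.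
Qed.

Definition compo t u := if pselect (exists d, decomp u d) is left h then (sval (cid h)) t else 0.

Lemma cpE u d : decomp u d -> forall t, compo t u = d t.
Proof.
move=> h t; rewrite /compo; case: pselect => [h'|[]]; last by exists d.
exact: (decomp_uniq (svalP (cid h')) h t).
Qed.

Lemma cp_lin t k u v : (exists d, decomp u d) -> (exists d, decomp v d) ->
  compo t (k *: u + v) = k *: compo t u + compo t v.
Proof. by move=> [d h] [d' h']; rewrite (cpE (decomp_lin k h h')) (cpE h) (cpE h'). Qed.

Lemma cp1 t u t' : G t u -> compo t' u = if t' == t then u else 0.
Proof. by move/decomp1/cpE. Qed.

End Components.

(** * The generalized quantum group as a Borel pair *)

Section InitialBorel.
Variables (K : fieldType) (I : finType) (A : zmodType) (pi : I -> A) (chi : A -> A -> K).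
Variable U : gqgData K I A.
Variable crd : I -> A -> int.
Hypothesis crdD : forall i a b, crd i (a + b) = crd i a + crd i b.
Hypothesis crdpi : forall i j, crd i (pi j) = (i == j)%:Z.
Hypothesis crdE : forall a, a = \sum_i pi i *~ crd i a.
Hypothesis chiP : bihom chi.
Hypothesis gq : is_gqg pi chi U.
Local Notation qk := (qK U).
Local Notation ql := (qL U).
Local Notation E := (qE U).
Local Notation F := (qF U).
Local Notation Nm := (Gen pi F).
Local Notation Np := (Gen pi E).

Lemma gchi0r a : chi a 0 = 1.
Proof. by have [c0 cr _] := chiP; apply: (mulfI (c0 a 0)); rewrite -cr addr0 mulr1. Qed.
Lemma gchi0l a : chi 0 a = 1.
Proof. by have [c0 _ cl] := chiP; apply: (mulfI (c0 0 a)); rewrite -cl addr0 mulr1. Qed.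
Lemma gchiNr a b : chi a (- b) = (chi a b)^-1.
Proof. by have [c0 cr _] := chiP; apply: (mulfI (c0 a b)); rewrite -cr subrr gchi0r mulfV. Qed.
Lemma gchiNl a b : chi (- a) b = (chi a b)^-1.
Proof. by have [c0 _ cl] := chiP; apply: (mulfI (c0 a b)); rewrite -cl subrr gchi0l mulfV. Qed.

Lemma subalg_gen (S : set U) x : S x -> subalg S x.
Proof. by move=> h Q [_]; apply. Qed.
Lemma subalg_subalg (S : set U) : subalgebra (subalg S).
Proof.
split.
- split=> [Q [[[]]]|c x y hx hy Q hQ] //.
  by have [[[_ QD] _ _] _] := hQ; apply: QD; [exact: hx | exact: hy].
- by move=> Q [[]].
- by move=> x y hx hy Q hQ; have [[_ _ QM] _] := hQ; apply: QM; [exact: hx | exact: hy].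
Qed.
Lemma subalg_ind (S Q : set U) x : subalgebra Q -> (forall y, S y -> Q y) -> subalg S x -> Q x.
Proof. by move=> hQ hS; apply. Qed.

Inductive gsum (J : Type) (g : J -> U) (dg : J -> A) : U -> Prop :=
| gsum0 : gsum g dg 0
| gsumD mu y u : Gen dg g mu y -> gsum g dg u -> gsum g dg (y + u).

Lemma gsum_lin (J : Type) (g : J -> U) (dg : J -> A) c u v :
  gsum g dg u -> gsum g dg v -> gsum g dg (c *: u + v).
Proof.
move=> hu hv; elim: hu => [|mu y w hy _ IH]; first by rewrite scaler0 add0r.
by rewrite scalerDr -addrA; apply: (gsumD (mu := mu)) => //; exact: GenZ.
Qed.

Lemma gsum_Gen (J : Type) (g : J -> U) (dg : J -> A) mu y : Gen dg g mu y -> gsum g dg y.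
Proof. by move=> h; rewrite -[y]addr0; apply: (gsumD (mu := mu)) => //; exact: gsum0. Qed.

Lemma subalg_gsum (J : Type) (g : J -> U) (dg : J -> A) u : subalg (range g) u -> gsum g dg u.
Proof.
apply: subalg_ind; last by move=> _ [j _ <-]; exact: (gsum_Gen (Gen_gen dg g j)).
split.
- by split; [exact: gsum0 | move=> c x y; exact: gsum_lin].
- exact: (gsum_Gen (Gen1 dg g)).
- move=> x y hx hy; elim: hx => [|mu z w hz _ IH]; first by rewrite mul0r; exact: gsum0.
  rewrite mulrDl -[z * y]scale1r; apply: gsum_lin => //.
  elim: hy => [|nu z' w' hz' _ IH']; first by rewrite mulr0; exact: gsum0.
  by rewrite mulrDr; apply: gsumD (Gen_mul hz hz') IH'.
Qed.

Lemma Gen_subalg (J : Type) (g : J -> U) (dg : J -> A) mu y : Gen dg g mu y -> subalg (range g) y.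
Proof.
have [[S0 SD] S1 SM] := subalg_subalg (range g).
elim=> [|a|j a x _ IH|a c x z _ IHx _ IHz] //.
- by apply: SM => //; apply: subalg_gen; exists j.
- exact: SD.
Qed.

Let grP := gqgP_graded gq.
Lemma gr_subsp a : subsp (gr U a). Proof. by have [[h _ _ _] _ _ _] := grP; exact: (h a). Qed.
Lemma gr_ind (s : seq A) (c : A -> U) : uniq s -> (forall t, gr U t (c t)) ->
  \sum_(t <- s) c t = 0 -> forall t, t \in s -> c t = 0.
Proof. by have [[_ _ _ h] _ _ _] := grP; exact: h. Qed.

Lemma gr_Np mu x : Np mu x -> gr U mu x.
Proof.
have [[gs gm _ _] gE _ g0] := grP.
elim=> [|a|j a y _ IH|a c y z _ IHy _ IHz].
- by apply: g0; have [_ S1 _] := subalg_subalg [set u | exists a b, u = qk a * ql b].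
- by case: (gs a).
- exact: gm.
- by case: (gs a) => _; apply.
Qed.
Lemma gr_Nm mu y : Nm mu y -> gr U (- mu) y.
Proof.
have [[gs gm _ _] _ gF g0] := grP.
elim=> [|a|j a x _ IH|a c x z _ IHx _ IHz].
- by rewrite oppr0; apply: g0; have [_ S1 _] := subalg_subalg [set u | exists a b, u = qk a * ql b].
- by case: (gs (- a)).
- by rewrite opprD; exact: gm.
- by case: (gs (- a)) => _; apply.
Qed.

Local Notation cp := (compo (gr U)).
Lemma gr_dec u : exists d, decomp (gr U) u d.
Proof.
have [[_ _ h _] _ _ _] := grP; have [s [c [us g ->]]] := h u.
by exists (fun t => if t \in s then c t else 0); exact: (decomp_of gr_subsp us g).
Qed.
Lemma cpL t k u v : cp t (k *: u + v) = k *: cp t u + cp t v.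
Proof. by apply: (cp_lin gr_subsp gr_ind); exact: gr_dec. Qed.
Lemma cp0 t : cp t 0 = 0.
Proof. by have := cpL t (-1) 0 0; rewrite scaler0 addr0 scaleN1r addNr. Qed.
Lemma cpG t u t' : gr U t u -> cp t' u = if t' == t then u else 0.
Proof. exact: (cp1 gr_subsp gr_ind). Qed.

Lemma Um_cp u mu : Um U u -> Nm mu (cp (- mu) u).
Proof.
move=> /(subalg_gsum pi); elim=> [|nu y w hy _ IH]; first by rewrite cp0; exact: Gen0.
rewrite -[y]scale1r cpL scale1r; apply: GenA => //; rewrite (cpG _ (gr_Nm hy)).
by case: eqP => [/oppr_inj ->|_] //; exact: Gen0.
Qed.
Lemma Up_cp u mu : Up U u -> Np mu (cp mu u).
Proof.
move=> /(subalg_gsum pi); elim=> [|nu y w hy _ IH]; first by rewrite cp0; exact: Gen0.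
rewrite -[y]scale1r cpL scale1r; apply: GenA => //; rewrite (cpG _ (gr_Np hy)).
by case: eqP => [->|_] //; exact: Gen0.
Qed.

Lemma UpgrP lam x : Upgr U lam x <-> Np lam x.
Proof.
split=> [[hx hg]|h]; last by split; [exact: (Gen_subalg h) | exact: gr_Np].
by have := Up_cp lam hx; rewrite (cpG _ hg) eqxx.
Qed.
Lemma UmgrP lam y : Umgr U (- lam) y <-> Nm lam y.
Proof.
split=> [[hy hg]|h]; last by split; [exact: (Gen_subalg h) | exact: gr_Nm].
by have := Um_cp lam hy; rewrite (cpG _ hg) eqxx.
Qed.

Let cart := gqgP_cartan gq.
Let root := gqgP_root gq.
Local Notation e0 := (fun ab : A * A => qk ab.1 * ql ab.2).

Definition G0 (ab : A * A) u := exists c : K, u = c *: e0 ab.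
Lemma G0_subsp ab : subsp (G0 ab).
Proof.
split; first by exists 0; rewrite scale0r.
by move=> c x y [u ->] [v ->]; exists (c * u + v); rewrite scalerA scalerDl.
Qed.
Lemma G0_ind (s : seq (A * A)) (c : A * A -> U) : uniq s -> (forall t, G0 t (c t)) ->
  \sum_(t <- s) c t = 0 -> forall t, t \in s -> c t = 0.
Proof.
move=> us /choice[d hd] e t ts; have [[_ h] _] := gqgP_triangular gq.
rewrite hd (h s d us _ t ts) ?scale0r // -[RHS]e; apply: eq_bigr => ab _; exact/esym.
Qed.
Lemma e0_neq0 ab : e0 ab != 0.
Proof.
apply/eqP => z; have [[_ h] _] := gqgP_triangular gq.
have := h [:: ab] (fun=> 1) isT; rewrite big_seq1 scale1r => /(_ z ab (mem_head _ _))/eqP.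
by rewrite oner_eq0.
Qed.
Lemma U0_dec z : U0 U z -> exists d, decomp G0 z d.
Proof.
have [[-> _] _] := gqgP_triangular gq => h; apply: (h [set z | exists d, decomp G0 z d]%classic).
split=> [|_ [ab _ <-]]; last first.
  by exists (fun t => if t == ab then e0 ab else 0); apply: (decomp1 G0_subsp); exists 1; rewrite scale1r.
split; first by exists (fun=> 0), [::]; split=> // [t|]; [case: (G0_subsp t) | rewrite big_nil].
by move=> c x y [d hd] [d' hd']; exists (fun t => c *: d t + d' t); exact: (decomp_lin G0_subsp).
Qed.

(** The universal property of the tensor product yields a linear functional on the algebra, but only
    from maps linear on whole subalgebras, while [phi] and [psi] are given degree by degree. They
    are therefore summed over finite sets of degrees that contain all those occurring in the
    expression. *)
Lemma g_tri : tri qk ql Nm Np.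
Proof.
move=> phi psi gam phil psil c hc.
have phi0 mu : phi mu 0 = 0 by exact: linon0 (Gen0 _ _ _) (phil mu).
have psi0 nu : psi nu 0 = 0 by exact: linon0 (Gen0 _ _ _) (psil nu).
have /choice[fe hfe] ab := separating_functional (e0_neq0 ab).
pose Ph D1 y : K := \sum_(mu <- D1) phi mu (cp (- mu) y).
pose Ps D3 x : K := \sum_(nu <- D3) psi nu (cp nu x).
pose Ga (D2 : seq (A * A)) z : K := \sum_(ab <- D2) gam ab.1 ab.2 * fe ab (compo G0 ab z).
have PhL D c0 x y : Um U x -> Um U y -> Ph D (c0 *: x + y) = c0 * Ph D x + Ph D y.
  move=> hx hy; rewrite /Ph mulr_sumr -big_split; apply: eq_bigr => mu _.
  by rewrite cpL phil //; exact: Um_cp.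
have PsL D c0 x y : Up U x -> Up U y -> Ps D (c0 *: x + y) = c0 * Ps D x + Ps D y.
  move=> hx hy; rewrite /Ps mulr_sumr -big_split; apply: eq_bigr => mu _.
  by rewrite cpL psil //; exact: Up_cp.
have GaL D c0 x y : U0 U x -> U0 U y -> Ga D (c0 *: x + y) = c0 * Ga D x + Ga D y.
  move=> hx hy; rewrite /Ga mulr_sumr -big_split; apply: eq_bigr => ab _.
  have [fl _] := hfe ab; rewrite (cp_lin G0_subsp G0_ind _ _ (U0_dec hx) (U0_dec hy)) fl.
  by rewrite mulrDr mulrCA.
have [_ [_ tens3]] := gqgP_triangular gq.
have hg D1 D2 D3 : exists g : {linear U -> K^o}, forall y z x, Um U y -> U0 U z -> Up U x ->
    g (y * z * x) = Ph D1 y * Ga D2 z * Ps D3 x.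
  have [|g [hg _]] := tens3 K^o (fun y z x => Ph D1 y * Ga D2 z * Ps D3 x : K^o); last by exists g.
  split=> [z x hz hx|y x hy hx|y z hy hz] c0 u v hu hv; rewrite /= ?PhL ?GaL ?PsL //.
  - by rewrite -[c0 *: _]/(c0 * _); ring.
  - by rewrite -[c0 *: _]/(c0 * _); ring.
  - by rewrite -[c0 *: _]/(c0 * _); ring.
have PhE (D : seq A) mu y : uniq D -> mu \in D -> Nm mu y -> Ph D y = phi mu y.
  move=> uD mD hy; rewrite /Ph (bigD1_seq mu) //= (cpG _ (gr_Nm hy)) eqxx big1 ?addr0 // => nu ne.
  by rewrite (cpG _ (gr_Nm hy)) (inj_eq oppr_inj) (negbTE ne).
have PsE (D : seq A) mu y : uniq D -> mu \in D -> Np mu y -> Ps D y = psi mu y.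
  move=> uD mD hy; rewrite /Ps (bigD1_seq mu) //= (cpG _ (gr_Np hy)) eqxx big1 ?addr0 // => nu ne.
  by rewrite (cpG _ (gr_Np hy)) (negbTE ne).
have GaE (D : seq (A * A)) a b : uniq D -> (a, b) \in D -> Ga D (qk a * ql b) = gam a b.
  have h : G0 (a, b) (qk a * ql b) by exists 1; rewrite scale1r.
  move=> uD mD; rewrite /Ga (bigD1_seq (a, b)) //= (cp1 G0_subsp G0_ind _ h) eqxx.
  rewrite (proj2 (hfe (a, b))) mulr1 big1 ?addr0 // => ab ne.
  rewrite (cp1 G0_subsp G0_ind _ h) (negbTE ne).
  by have := proj1 (hfe ab) (-1) 0 0; rewrite scaler0 addr0 mulN1r addNr => ->; rewrite mulr0.
suff [D1 [D2 [D3 h]]] : exists (D1 : seq A) (D2 : seq (A * A)) (D3 : seq A),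
    forall D1' D2' D3' (g : {linear U -> K^o}), uniq D1' -> uniq D2' -> uniq D3' ->
    {subset D1 <= D1'} -> {subset D2 <= D2'} -> {subset D3 <= D3'} ->
    (forall y z x, Um U y -> U0 U z -> Up U x -> g (y * z * x) = Ph D1' y * Ga D2' z * Ps D3' x) ->
    g 0 = c.
  have [g hg'] := hg (undup D1) (undup D2) (undup D3).
  rewrite -(h _ _ _ g (undup_uniq _) (undup_uniq _) (undup_uniq _) _ _ _ hg') ?raddf0 //.
  - by move=> x; rewrite mem_undup.
  - by move=> x; rewrite mem_undup.
  - by move=> x; rewrite mem_undup.
elim: hc => [|mu a b nu y x u d hy hx _ [D1 [D2 [D3 IH]]]].
  by exists [::], [::], [::] => *; exact: raddf0.
exists (mu :: D1), ((a, b) :: D2), (nu :: D3) => D1' D2' D3' g u1 u2 u3 s1 s2 s3 hg'.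
rewrite raddfD /= (IH D1' D2' D3' g) //.
- rewrite hg' ?(PhE _ mu) ?(GaE) ?(PsE _ nu) //.
  + by apply: s3; rewrite mem_head.
  + by apply: s2; rewrite mem_head.
  + by apply: s1; rewrite mem_head.
  + exact: (Gen_subalg hy).
  + by apply: subalg_gen; exists a, b.
  + exact: (Gen_subalg hx).
- by move=> t ht; apply: s1; rewrite inE ht orbT.
- by move=> t ht; apply: s2; rewrite inE ht orbT.
- by move=> t ht; apply: s3; rewrite inE ht orbT.
Qed.

Lemma g_one : (1 : U) != 0.
Proof. by have := e0_neq0 (0, 0); have [-> -> _ _ _] := cart; rewrite /= mulr1. Qed.

Lemma gKE a j : qk a * E j = chi a (pi j) *: (E j * qk a).
Proof. by have [h _ _ _ _] := root. Qed.
Lemma gLE a j : ql a * E j = (chi (pi j) a)^-1 *: (E j * ql a).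
Proof. by have [_ h _ _ _] := root; rewrite h gchiNl. Qed.
Lemma gKF a j : qk a * F j = (chi a (pi j))^-1 *: (F j * qk a).
Proof. by have [_ _ h _ _] := root; rewrite h gchiNr. Qed.
Lemma gLF a j : ql a * F j = chi (pi j) a *: (F j * ql a).
Proof. by have [_ _ _ h _] := root. Qed.
Lemma gEF i j : E i * F j = F j * E i + (ql (pi i) - qk (pi i)) *+ (i == j).
Proof. by have [_ _ _ _ h] := root; rewrite [ql _ - _]addrC -h addrC subrK. Qed.

Lemma gNK mu x a : Np mu x -> qk a * x = chi a mu *: (x * qk a).
Proof. by have [_ cr _] := chiP; apply: (Gen_scal (c := chi a)); [exact: gchi0r | exact: cr | exact: gKE]. Qed.
Lemma gNL mu x a : Np mu x -> ql a * x = (chi mu a)^-1 *: (x * ql a).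
Proof.
have [_ _ cl] := chiP; apply: (Gen_scal (c := fun m => (chi m a)^-1)).
- by rewrite gchi0l invr1.
- by move=> b c; rewrite cl invfM.
- exact: gLE.
Qed.
Lemma gMK mu x a : Nm mu x -> qk a * x = (chi a mu)^-1 *: (x * qk a).
Proof.
have [_ cr _] := chiP; apply: (Gen_scal (c := fun m => (chi a m)^-1)).
- by rewrite gchi0r invr1.
- by move=> b c; rewrite cr invfM.
- exact: gKF.
Qed.
Lemma gML mu x a : Nm mu x -> ql a * x = chi mu a *: (x * ql a).
Proof. by have [_ _ cl] := chiP; apply: (Gen_scal (c := fun m => chi m a)); [exact: gchi0l | move=> b c; exact: cl | exact: gLF]. Qed.

Lemma g_ind :
  (forall j mu y1 y2, Nm mu y1 -> Nm mu y2 ->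
    y1 * qk (pi j) + y2 * ql (pi j) = 0 -> y1 = 0 /\ y2 = 0) /\
  (forall j mu y1 y2, Np mu y1 -> Np mu y2 ->
    y1 * qk (pi j) + y2 * ql (pi j) = 0 -> y1 = 0 /\ y2 = 0).
Proof.
have [k0 l0 _ _ _] := cart.
apply: (tri_inj g_one crdpi _ k0 l0 chiP gNK gNL g_tri).
by move=> i; apply: (addrI (crd i 0)); rewrite -crdD !addr0.
Qed.

Let tensP := gqgP_tensor gq.
Let copP := gqgP_coproduct gq.
Local Notation T := (tens U).
Local Notation th := (theta U).
Local Notation Upfl := (@Upflat K I A U).
Local Notation Umfl := (@Umflat K I A U).

Lemma tDl c x x' y : T (c *: x + x') y = c *: T x y + T x' y.
Proof. by have [[[h _] _] _ _] := tensP; exact: (h y Logic.I c x x' Logic.I Logic.I). Qed.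
Lemma tDr c x y y' : T x (c *: y + y') = c *: T x y + T x y'.
Proof. by have [[[_ h] _] _ _] := tensP; exact: (h x Logic.I c y y' Logic.I Logic.I). Qed.
Lemma t0l y : T 0 y = 0.
Proof. by have := tDl (-1) 0 0 y; rewrite scaler0 addr0 scaleN1r addNr. Qed.
Lemma t0r y : T y 0 = 0.
Proof. by have := tDr (-1) y 0 0; rewrite scaler0 addr0 scaleN1r addNr. Qed.
Lemma tZl c x y : T (c *: x) y = c *: T x y.
Proof. by rewrite -[c *: x]addr0 tDl t0l addr0. Qed.
Lemma tZr c x y : T x (c *: y) = c *: T x y.
Proof. by rewrite -[c *: y]addr0 tDr t0r addr0. Qed.
Lemma tM x y x' y' : T x y * T x' y' = T (x * x') (y * y').
Proof. by have [_ _ h] := tensP. Qed.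

Lemma lspan_in (S : set U) x : S x -> lspan S x.
Proof. by move=> h Q [_]; apply. Qed.
Lemma Upf_K x a : Up U x -> Upfl (x * qk a).
Proof. by move=> h; apply: lspan_in; exists x, a. Qed.
Lemma Umf_L y a : Um U y -> Umfl (y * ql a).
Proof. by move=> h; apply: lspan_in; exists y, a. Qed.
Lemma Upf x : Up U x -> Upfl x.
Proof. by move=> h; have := Upf_K 0 h; have [-> _ _ _ _] := cart; rewrite mulr1. Qed.
Lemma Umf y : Um U y -> Umfl y.
Proof. by move=> h; have := Umf_L 0 h; have [_ -> _ _ _] := cart; rewrite mulr1. Qed.
Lemma Up1 : Up U 1. Proof. exact: (Gen_subalg (Gen1 pi E)). Qed.
Lemma Um1 : Um U 1. Proof. exact: (Gen_subalg (Gen1 pi F)). Qed.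
Lemma Up_E j x : Up U x -> Up U (E j * x).
Proof. by have [_ _ h] := subalg_subalg (range E) => hx; apply: h => //; apply: subalg_gen; exists j. Qed.
Lemma Um_F j x : Um U x -> Um U (F j * x).
Proof. by have [_ _ h] := subalg_subalg (range F) => hx; apply: h => //; apply: subalg_gen; exists j. Qed.
Lemma Umf_qL a : Umfl (ql a).
Proof. by rewrite -[ql a]mul1r; apply: Umf_L; exact: Um1. Qed.

Let pg := gqgP_pairing_gen gq.
Lemma th_linl y c x x' : Umfl y -> Upfl x -> Upfl x' -> th (c *: x + x') y = c * th x y + th x' y.
Proof. by have [[h _] _ _ _ _] := pg => hy hx hx'; exact: (h y hy c x x' hx hx'). Qed.
Lemma th_linr x c y y' : Upfl x -> Umfl y -> Umfl y' -> th x (c *: y + y') = c * th x y + th x y'.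
Proof. by have [[_ h] _ _ _ _] := pg => hx hy hy'; exact: (h x hx c y y' hy hy'). Qed.
Lemma th_0r x : Upfl x -> th x 0 = 0.
Proof.
move=> hx; have h0 : Umfl 0 by apply: Umf; exact: (Gen_subalg (Gen0 pi F 0)).
by have := th_linr (-1) hx h0 h0; rewrite scaler0 addr0 mulN1r addNr.
Qed.
Lemma th_0l y : Umfl y -> th 0 y = 0.
Proof.
move=> hy; have h0 : Upfl 0 by apply: Upf; exact: (Gen_subalg (Gen0 pi E 0)).
by have := th_linl (-1) hy h0 h0; rewrite scaler0 addr0 mulN1r addNr.
Qed.

Lemma rule1 x1 x2 y (L : seq (U * U)) : Upfl x1 -> Upfl x2 -> Umfl y ->
  (forall p, p \in L -> Umfl p.1 /\ Umfl p.2) ->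
  Delta U y = \sum_(p <- L) T p.1 p.2 ->
  th (x1 * x2) y = \sum_(p <- L) th x1 p.2 * th x2 p.1.
Proof.
move=> h1 h2 hy hL e; have [r _] := gqgP_pairing_coprod gq.
have hk (k : 'I_(size L)) := hL _ (mem_tnth k (in_tuple L)).
rewrite big_tnth in e; rewrite [RHS]big_tnth.
by apply: (r x1 x2 y _ (fun k => (tnth (in_tuple L) k).1) (fun k => (tnth (in_tuple L) k).2)) => // k; case: (hk k).
Qed.
Lemma rule2 x y1 y2 (L : seq (U * U)) : Upfl x -> Umfl y1 -> Umfl y2 ->
  (forall p, p \in L -> Upfl p.1 /\ Upfl p.2) ->
  Delta U x = \sum_(p <- L) T p.1 p.2 ->
  th x (y1 * y2) = \sum_(p <- L) th p.1 y1 * th p.2 y2.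
Proof.
move=> h1 h2 hy hL e; have [_ r] := gqgP_pairing_coprod gq.
have hk (k : 'I_(size L)) := hL _ (mem_tnth k (in_tuple L)).
rewrite big_tnth in e; rewrite [RHS]big_tnth.
by apply: (r x y1 y2 _ (fun k => (tnth (in_tuple L) k).1) (fun k => (tnth (in_tuple L) k).2)) => // k; case: (hk k).
Qed.

Lemma Delta1 : Delta U 1 = T 1 1.
Proof. by rewrite rmorph1; have [_ -> _] := tensP. Qed.
Lemma th_1_F b y : Umfl y -> th 1 (F b * y) = 0.
Proof.
move=> hy; have hF : Umfl (F b) by apply: Umf; exact: (Gen_subalg (Gen_gen pi F b)).
rewrite (@rule2 1 (F b) y [:: (1, 1)]) ?big_seq1 ?Delta1 //=; last first.
- by move=> p; rewrite inE => /eqP ->; split; apply: Upf; exact: Up1.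
- by apply: Upf; exact: Up1.
by have [_ _ _ h _] := pg; have [k0 _ _ _ _] := cart; rewrite -k0 h mul0r.
Qed.
Lemma th_E_1 b x : Upfl x -> th (E b * x) 1 = 0.
Proof.
move=> hx; have hE : Upfl (E b) by apply: Upf; exact: (Gen_subalg (Gen_gen pi E b)).
rewrite (@rule1 (E b) x 1 [:: (1, 1)]) ?big_seq1 ?Delta1 //=; last first.
- by move=> p; rewrite inE => /eqP ->; split; apply: Umf; exact: Um1.
- by apply: Umf; exact: Um1.
by have [_ _ _ _ h] := pg; have [_ l0 _ _ _] := cart; rewrite -l0 h mul0r.
Qed.
Lemma th_E_F j a y : Umfl y -> th (E j) (F a * y) = (j == a)%:R * th 1 y.
Proof.
move=> hy; have hF : Umfl (F a) by apply: Umf; exact: (Gen_subalg (Gen_gen pi F a)).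
have hE : Upfl (E j) by apply: Upf; exact: (Gen_subalg (Gen_gen pi E j)).
have h1 : Upfl 1 by apply: Upf; exact: Up1.
have hK : Upfl (qk (pi j)) by rewrite -[qk _]mul1r; apply: Upf_K; exact: Up1.
rewrite (@rule2 (E j) (F a) y [:: (E j, 1); (qk (pi j), E j)]) ?big_cons ?big_nil //=.
- have [_ _ h2 h3 _] := pg; by rewrite h2 h3 mul0r !addr0.
- by move=> p; rewrite !inE => /orP[] /eqP ->.
- by have [_ _ -> _] := copP; rewrite addr0.
Qed.
Lemma th_E_Fr j a x : Upfl x -> th (E a * x) (F j) = (a == j)%:R * th x 1.
Proof.
move=> hx; have hF : Umfl (F j) by apply: Umf; exact: (Gen_subalg (Gen_gen pi F j)).
have hE : Upfl (E a) by apply: Upf; exact: (Gen_subalg (Gen_gen pi E a)).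
have h1 : Umfl 1 by apply: Umf; exact: Um1.
rewrite (@rule1 (E a) x (F j) [:: (F j, ql (pi j)); (1, F j)]) ?big_cons ?big_nil //=.
- have [_ _ h2 _ h3] := pg; by rewrite h2 h3 mul0r add0r addr0.
- by move=> p; rewrite !inE => /orP[] /eqP -> //=; split=> //; exact: Umf_qL.
- by have [_ _ _ ->] := copP; rewrite addr0.
Qed.

Definition S2 v := exists a b nu x c, Nm nu x /\ v = F a * (F b * (x * ql c)).
Definition remF (R : seq (U * U)) := forall p, p \in R -> Um U p.1 /\ S2 p.2.

Lemma S2_th v j : S2 v -> Umfl v /\ th (E j) v = 0.
Proof.
move=> [a [b [nu [x [c [hx ->]]]]]]; have ux : Um U x by exact: (Gen_subalg hx).
split; first by rewrite !mulrA; apply: Umf_L; rewrite -mulrA; do 2!apply: Um_F.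
have h2 : Umfl (F b * (x * ql c)) by rewrite mulrA; apply: Umf_L; exact: Um_F.
by rewrite th_E_F // th_1_F ?mulr0 //; exact: Umf_L.
Qed.

(** The coproduct of [y] up to terms whose second factor starts with two letters F, which pair to
    zero with E_j. The coefficient of F_j L is a scalar times the first skew derivative. *)
Definition Cop mu y := exists y1 y2 : I -> U, [/\
  forall j, Nm (mu - pi j) (y1 j), forall j, Nm (mu - pi j) (y2 j),
  forall j, E j * y = y * E j + (y1 j * qk (pi j) + y2 j * ql (pi j)) &
  exists R, remF R /\ Delta U y = T y (ql mu) +
    \sum_j T (- chi (pi j) (mu - pi j) *: y1 j) (F j * ql (mu - pi j)) + \sum_(p <- R) T p.1 p.2].

Lemma Cop_M i nu z : Nm nu z -> Cop nu z -> Cop (pi i + nu) (F i * z).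
Proof.
move=> hz [y1 [y2 [h1 h2 hE [R [hR eD]]]]].
have [c0 cr cl] := chiP; have [_ _ _ ll' kl] := cart.
exists (fun j => F i * y1 j - ((j == i)%:R / chi (pi j) nu) *: z).
exists (fun j => F i * y2 j + ((j == i)%:R * chi nu (pi j)) *: z); split.
- move=> j; apply: GenB; first by apply: Gen_eq (Gen_mul (Gen_gen pi F i) (h1 j)) _; rewrite addrA.
  by case: eqP => [->|_]; [rewrite addrC addrA addNr add0r; exact: GenZ | rewrite mul0r scale0r; exact: Gen0].
- move=> j; apply: GenA; first by apply: Gen_eq (Gen_mul (Gen_gen pi F i) (h2 j)) _; rewrite addrA.
  by case: eqP => [->|_]; [rewrite addrC addrA addNr add0r; exact: GenZ | rewrite mul0r scale0r; exact: Gen0].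
- move=> j; rewrite mulrA gEF mulrDl -[F i * E j * z]mulrA hE.
  have eK := gMK (pi j) hz; have eL := gML (pi j) hz.
  have -> : (ql (pi j) - qk (pi j)) *+ (j == i) * z = (j == i)%:R *: (ql (pi j) * z) - (j == i)%:R *: (qk (pi j) * z).
    by case: (j == i); rewrite ?mulr1n ?mulr0n ?mul0r ?scale1r ?scale0r ?subrr // mulrBl.
  rewrite eK eL !scalerA; set d := (j == i)%:R; generalize ((chi (pi j) nu)^-1) => v.
  by nc_simp K U; ring.
pose dj j := - chi (pi j) (nu - pi j) *: y1 j.
exists ([seq (F i * p.1, ql (pi i) * p.2) | p <- R] ++ [seq (dj j, F i * (F j * (1 * ql (nu - pi j)))) | j <- index_enum I]
        ++ [seq (p.1, F i * p.2) | p <- R]); split.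
- move=> p; rewrite !mem_cat => /or3P[] /mapP[w hw ->] /=.
  + have [u1 [a [b [m [x [c [hx ->]]]]]]] := hR _ hw; split; first exact: Um_F.
    exists a, b, m, ((chi (pi a) (pi i) * chi (pi b) (pi i) * chi m (pi i)) *: x), (pi i + c).
    split; first exact: GenZ.
    have e1 v a' : ql (pi i) * (F a' * v) = chi (pi a') (pi i) *: (F a' * (ql (pi i) * v)).
      by rewrite [LHS]mulrA gLF -scalerAl -mulrA.
    have e2 : ql (pi i) * (x * ql c) = chi m (pi i) *: (x * ql (pi i + c)).
      by rewrite [LHS]mulrA (gML _ hx) -scalerAl -mulrA ll'.
    by rewrite e1 e1 e2; nc_simp K U; ring.
  + split; first by apply: (Gen_subalg (GenZ _ (h1 w))).
    by exists i, w, 0, 1, (nu - pi w); split; first exact: Gen1.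
  + have [u1 [a [b [m [x [c [hx ->]]]]]]] := hR _ hw; split=> //.
    exists i, a, (pi b + m), (F b * x), c; split; first exact: GenM.
    by rewrite !mulrA.
rewrite rmorphM /= eD; have [_ _ _ ->] := copP.
rewrite !big_cat /= !big_map /= mulrDl !mulrDr !mulr_sumr !tM !mul1r ll'.
rewrite (eq_bigr (fun j => chi (pi j) (pi i) *: T (F i * dj j) (F j * ql (pi i + nu - pi j)))); last first.
  by move=> j _; rewrite tM mulrA gLF -scalerAl -mulrA ll' tZr addrA.
rewrite [X in _ + X + _ = _](eq_bigr (fun p => T (F i * p.1) (ql (pi i) * p.2))); last by move=> p _; rewrite tM.
have eb j : T (- chi (pi j) (pi i + nu - pi j) *: (F i * y1 j - ((j == i)%:R / chi (pi j) nu) *: z))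
    (F j * ql (pi i + nu - pi j)) = chi (pi j) (pi i) *: T (F i * dj j) (F j * ql (pi i + nu - pi j))
   + (j == i)%:R *: T z (F i * ql nu).
  have [eji|_] := eqVneq j i; last first.
    rewrite mul0r scale0r subr0 [(false%:R : K) *: _]scale0r addr0 -tZl; congr (T _ _).
    by rewrite /dj -addrA (cr _ (pi i)) -scalerAr !scalerA mulrN.
  rewrite eji mul1r; have -> : pi i + nu - pi i = nu by rewrite addrC addKr.
  rewrite scale1r -tDl; congr (T _ _).
  have ec : chi (pi i) (pi i) * chi (pi i) (nu - pi i) = chi (pi i) nu by rewrite -cr addrC subrK.
  rewrite /dj -scalerAr scalerA mulrN ec.
  by rewrite scalerBr !scalerA mulNr mulfV // scaleN1r opprK.
rewrite [X in _ = _ + X + _](eq_bigr _ (fun j _ => eb j)).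
rewrite big_split /= -scaler_suml (_ : \sum_j (j == i)%:R = 1) ?scale1r; last first.
  by rewrite (bigD1 i) //= eqxx big1 ?addr0 // => j /negbTE ->.
rewrite [X in _ + (_ + X + _) = _](eq_bigr (fun j => T (dj j) (F i * (F j * (1 * ql (nu - pi j)))))); last first.
  by move=> j _; rewrite tM !mul1r.
rewrite [X in _ + (_ + _ + X) = _](eq_bigr (fun p => T p.1 (F i * p.2))); last by move=> p _; rewrite tM mul1r.
set a1 := T _ _; set a2 := \sum_j _; set a3 := \sum_(_ <- R) _; set a4 := T z _; set a5 := \sum_j _; set a6 := \sum_(_ <- R) _.
by rewrite -!addrA; congr (_ + (_ + _)); rewrite addrCA.
Qed.

Lemma Cop_Gen mu y : Nm mu y -> Cop mu y.
Proof.
have [_ l0 _ _ _] := cart.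
elim=> [|a|j a x hx IH|a c x z hx IHx hz IHz].
- exists (fun=> 0), (fun=> 0); split=> [j|j|j|]; try exact: Gen0.
    by rewrite mul1r mulr1 !mul0r !addr0.
  by exists [::]; split=> //; rewrite Delta1 l0 big_nil big1 ?addr0 // => j _; rewrite scaler0 t0l.
- exists (fun=> 0), (fun=> 0); split=> [j|j|j|]; try exact: Gen0.
    by rewrite !mul0r mulr0 !addr0.
  by exists [::]; split=> //; rewrite raddf0 t0l big_nil big1 ?addr0 // => j _; rewrite scaler0 t0l.
- exact: Cop_M.
have [y1 [y2 [h1 h2 hE [R [hR eD]]]]] := IHx; have [z1 [z2 [g1 g2 gE [R' [hR' eD']]]]] := IHz.
exists (fun j => c *: y1 j + z1 j), (fun j => c *: y2 j + z2 j); split.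
- by move=> j; exact: GenD.
- by move=> j; exact: GenD.
- by move=> j; rewrite mulrDr -scalerAr hE gE; nc_simp K U; ring.
exists ([seq (c *: p.1, p.2) | p <- R] ++ R'); split.
- move=> p; rewrite mem_cat => /orP[/mapP[w /hR[u1 u2] ->]|/hR'] //=; split=> //.
  by have [[S0 SD] _ _] := subalg_subalg (range F); rewrite -[_ *: _]addr0; apply: SD.
rewrite linearP /= eD eD' big_cat big_map tDl /=.
rewrite [X in _ = _ + X + _](eq_bigr (fun j => c *: T (- chi (pi j) (a - pi j) *: y1 j) (F j * ql (a - pi j)) +
   T (- chi (pi j) (a - pi j) *: z1 j) (F j * ql (a - pi j)))); last first.
  by move=> j _; rewrite -tDl scalerDr !scalerA [c * _]mulrC.
rewrite [X in _ = _ + (X + _)](eq_bigr (fun p => c *: T p.1 p.2)); last by move=> p _; rewrite tZl.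
rewrite big_split /= -!scaler_sumr !scalerDr.
set a1 := c *: T _ _; set a2 := c *: \sum_j _; set a3 := c *: \sum_(_ <- _) _.
by rewrite addrACA [a1 + a2 + _]addrACA.
Qed.

(** The first rule pairs E_j with the second tensor factor, where only the term with F_j in [Cop]
    survives: left multiplication by E_j is adjoint to the first skew derivative, up to a scalar. *)
Lemma pair_E mu y j : Nm mu y -> exists y1 y2, [/\ Nm (mu - pi j) y1, Nm (mu - pi j) y2,
  E j * y = y * E j + (y1 * qk (pi j) + y2 * ql (pi j)) &
  forall X, Up U X -> th (E j * X) y = th X (- chi (pi j) (mu - pi j) *: y1)].
Proof.
move=> hy; have [y1 [y2 [h1 h2 hE [R [hR eD]]]]] := Cop_Gen hy.
exists (y1 j), (y2 j); split=> // X hX.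
have hE' : Upfl (E j) by apply: Upf; exact: (Gen_subalg (Gen_gen pi E j)).
pose d k := - chi (pi k) (mu - pi k) *: y1 k.
have hd k : Um U (d k) by exact: (Gen_subalg (GenZ _ (h1 k))).
have hFL k : Umfl (F k * ql (mu - pi k)) by apply: Umf_L; exact: (Gen_subalg (Gen_gen pi F k)).
have [_ hKL _ _ hEL] := pg; have [k0 _ _ _ _] := cart.
rewrite (@rule1 (E j) X y ((y, ql mu) :: [seq (d k, F k * ql (mu - pi k)) | k <- index_enum I] ++ R)) //.
- rewrite big_cons big_cat big_map /= hEL mul0r add0r [X in _ + X]big_seq_cond [X in _ + X]big1 ?addr0; last first.
    by move=> p /andP[/hR[_ /(S2_th j)[_ ->]] _]; rewrite mul0r.
  rewrite (bigD1 j) //= th_E_F ?big1 ?addr0 //; last exact: Umf_qL.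
    by rewrite eqxx mul1r -k0 hKL gchi0l mul1r.
  move=> k kj; rewrite th_E_F; last exact: Umf_qL.
  by rewrite eq_sym (negbTE kj) !mul0r.
- exact: Upf.
- exact: (Umf (Gen_subalg hy)).
- move=> p; rewrite inE mem_cat => /or3P[/eqP ->|/mapP[k _ ->]|/hR[u1 /(S2_th j)[u2 _]]] /=; split=> //.
  + exact: (Umf (Gen_subalg hy)).
  + exact: Umf_qL.
  + exact: Umf.
  + exact: Umf.
- by rewrite eD big_cons big_cat big_map /= addrA.
Qed.

Lemma th_1_Nm mu y : Nm mu y -> mu != 0 -> th 1 y = 0.
Proof.
have h1 : Upfl 1 by apply: Upf; exact: Up1.
elim=> [|a _|j a x hx _ _|a c x z hx IHx hz IHz a0]; first by rewrite eqxx.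
- exact: th_0r.
- by apply: th_1_F; exact: (Umf (Gen_subalg hx)).
- by rewrite th_linr ?IHx ?IHz ?mulr0 ?addr0 //; [exact: (Umf (Gen_subalg hx)) | exact: (Umf (Gen_subalg hz))].
Qed.

Lemma th_orth nu x mu y : Np nu x -> Nm mu y -> nu != mu -> th x y = 0.
Proof.
move=> hx; elim: hx mu y => [|a|j a z hz IH|a c z w hz IHz hw IHw] mu y hy ne.
- by apply: (th_1_Nm hy); rewrite eq_sym.
- by apply: th_0l; exact: (Umf (Gen_subalg hy)).
- have [y1 [y2 [h1 _ _ ->]]] := pair_E j hy; last exact: (Gen_subalg hz).
  by apply: (IH _ _ (GenZ _ h1)); apply: contraNneq ne => ->; rewrite addrC subrK.
- rewrite th_linl ?(IHz _ _ hy) ?(IHw _ _ hy) ?mulr0 ?addr0 //.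
  + exact: (Umf (Gen_subalg hy)).
  + exact: (Upf (Gen_subalg hz)).
  + exact: (Upf (Gen_subalg hw)).
Qed.

(** If [y] commutes with every E_j, its skew derivatives vanish, so it pairs to zero with every word
    that begins with some E_j, and with 1 because its degree is not zero. *)
Lemma g_ndF mu y : Nm mu y -> mu != 0 -> (forall j, E j * y = y * E j) -> y = 0.
Proof.
move=> hy mu0 hc; have [_ nd] := gqgP_pairing_nondeg gq; apply: nd; first exact: (Gen_subalg hy).
have hyf := Umf (Gen_subalg hy).
move=> x /(subalg_gsum pi); elim=> [|nu z w hz hw IH]; first exact: th_0l.
have hz' := Upf (Gen_subalg hz).
have hw' : Up U w.
  have [[S0 SD] _ _] := subalg_subalg (range E); elim: hw => // m v v' hv _ IHv.
  by rewrite -[v]scale1r; apply: SD => //; exact: (Gen_subalg hv).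
rewrite -[z]scale1r th_linl ?IH ?mul1r ?addr0 //; last exact: Upf.
elim: hz {hz'} => [|a|j a v hv _|a c v v' hv IHv hv' IHv'].
- exact: th_1_Nm hy mu0.
- exact: th_0l.
- have [y1 [y2 [h1 h2 eE ->]]] := pair_E j hy; last exact: (Gen_subalg hv).
  have [iF _] := g_ind; have e0 : y1 * qk (pi j) + y2 * ql (pi j) = 0.
    by apply: (addrI (y * E j)); rewrite -eE hc addr0.
  have [-> _] := iF j _ _ _ h1 h2 e0; rewrite scaler0 th_0r //; exact: (Upf (Gen_subalg hv)).
- rewrite th_linl ?IHv ?IHv' ?mulr0 ?addr0 //; [exact: (Upf (Gen_subalg hv)) | exact: (Upf (Gen_subalg hv'))].
Qed.

(** The coproduct does not preserve the positive half: the first tensor factors carry torus elements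
    K_a on the right. *)
Definition FP u := exists nu g a, Np nu g /\ u = g * qk a.
Definition S2E v := exists a b y, Up U y /\ v = E a * (E b * y).

Lemma FP_flat u : FP u -> Upfl u.
Proof. by move=> [nu [g [a [hg ->]]]]; apply: Upf_K; exact: (Gen_subalg hg). Qed.
Lemma FP_E i u : FP u -> FP (E i * u).
Proof. by move=> [nu [g [a [hg ->]]]]; exists (pi i + nu), (E i * g), a; split; [exact: GenM | rewrite mulrA]. Qed.
Lemma FP_K b u : FP u -> FP (qk b * u).
Proof.
move=> [nu [g [a [hg ->]]]]; have [_ _ kk' _ _] := cart.
exists nu, (chi b nu *: g), (b + a); split; first exact: GenZ.
by rewrite mulrA (gNK _ hg) -!scalerAl -mulrA kk'.
Qed.

Lemma S2E_th v j : S2E v -> Up U v /\ th v (F j) = 0.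
Proof.
move=> [a [b [y [hy ->]]]]; split; first by do 2!apply: Up_E.
by rewrite th_E_Fr ?th_E_1 ?mulr0 //; apply: Upf => //; exact: Up_E.
Qed.

Definition CopE mu x := exists x1 x2 : I -> U, [/\
  forall j, Np (mu - pi j) (x1 j), forall j, Np (mu - pi j) (x2 j),
  forall j, F j * x = x * F j + (x1 j * qk (pi j) + x2 j * ql (pi j)) &
  exists R : seq (U * U), (forall p, p \in R -> FP p.1 /\ S2E p.2) /\ Delta U x = T x 1 +
    \sum_j T (x1 j * qk (pi j)) (E j) + \sum_(p <- R) T p.1 p.2].

Lemma CopE_M i nu z : Np nu z -> CopE nu z -> CopE (pi i + nu) (E i * z).
Proof.
move=> hz [x1 [x2 [h1 h2 hF [R [hR eD]]]]]; have [c0 cr cl] := chiP.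
exists (fun j => E i * x1 j + ((j == i)%:R * chi (pi j) nu) *: z).
exists (fun j => E i * x2 j - ((j == i)%:R / chi nu (pi j)) *: z); split.
- move=> j; apply: GenA; first by apply: Gen_eq (Gen_mul (Gen_gen pi E i) (h1 j)) _; rewrite addrA.
  by case: eqP => [->|_]; [rewrite addrC addrA addNr add0r; exact: GenZ | rewrite mul0r scale0r; exact: Gen0].
- move=> j; apply: GenB; first by apply: Gen_eq (Gen_mul (Gen_gen pi E i) (h2 j)) _; rewrite addrA.
  by case: eqP => [->|_]; [rewrite addrC addrA addNr add0r; exact: GenZ | rewrite mul0r scale0r; exact: Gen0].
- move=> j; have eK := gNK (pi j) hz; have eL := gNL (pi j) hz.
  have eFE : F j * E i = E i * F j - ((j == i)%:R *: ql (pi j) - (j == i)%:R *: qk (pi j)).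
    rewrite gEF eq_sym; case: eqP => [->|_]; rewrite ?mulr1n ?mulr0n ?scale1r ?scale0r ?subr0 ?addr0 //.
    by rewrite addrK.
  rewrite mulrA eFE mulrBl -[E i * F j * z]mulrA hF mulrBl -!scalerAl eK eL !scalerA.
  set d := (j == i)%:R; generalize ((chi nu (pi j))^-1) => v.
  by nc_simp K U; ring.
exists ([seq (E i * p.1, p.2) | p <- R] ++ [seq (qk (pi i) * (x1 j * qk (pi j)), E i * (E j * 1)) | j <- index_enum I]
        ++ [seq (qk (pi i) * p.1, E i * p.2) | p <- R]); split.
- move=> p; rewrite !mem_cat => /or3P[] /mapP[w hw ->] /=.
  + by have [u1 u2] := hR _ hw; split=> //; exact: FP_E.
  + split; first by apply: FP_K; exists (nu - pi w), (x1 w), (pi w).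
    by exists i, w, 1; split=> //; exact: Up1.
  + have [u1 [a [b [y [hy ->]]]]] := hR _ hw; split; first exact: FP_K.
    by exists i, a, (E b * y); split=> //; exact: Up_E.
rewrite rmorphM /= eD; have [_ _ -> _] := copP.
rewrite !big_cat /= !big_map /= mulrDl !mulrDr !mulr_sumr !tM !mul1r !mulr1.
have eb j : T ((E i * x1 j + ((j == i)%:R * chi (pi j) nu) *: z) * qk (pi j)) (E j) =
   T (E i * (x1 j * qk (pi j))) (E j) + (j == i)%:R *: T (qk (pi i) * z) (E i).
  rewrite mulrDl -mulrA -[X in X = _]scale1r -[T _ _ + _]scale1r.
  have [->|_] := eqVneq j i; last by rewrite !mul0r !scale0r mul0r !addr0.
  by rewrite !mul1r !scale1r (gNK _ hz) addrC -scalerAl tDl tZl addrC.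
rewrite [X in _ = _ + X + _](eq_bigr _ (fun j _ => eb j)) big_split /= -scaler_suml.
rewrite (_ : \sum_j (j == i)%:R = 1) ?scale1r; last first.
  by rewrite (bigD1 i) //= eqxx big1 ?addr0 // => j /negbTE ->.
rewrite [X in _ + X + _ + _ = _](eq_bigr (fun j => T (E i * (x1 j * qk (pi j))) (E j))); last by move=> j _; rewrite tM mul1r.
rewrite [X in _ + X + _ = _](eq_bigr (fun p => T (E i * p.1) p.2)); last by move=> p _; rewrite tM mul1r.
rewrite [X in _ + (_ + X + _) = _](eq_bigr (fun j => T (qk (pi i) * (x1 j * qk (pi j))) (E i * (E j * 1)))); last first.
  by move=> j _; rewrite tM !mulr1.
rewrite [X in _ + (_ + _ + X) = _](eq_bigr (fun p => T (qk (pi i) * p.1) (E i * p.2))); last by move=> p _; rewrite tM.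
set a1 := T _ _; set a2 := \sum_j _; set a3 := \sum_(_ <- R) _; set a4 := T (_ * z) _; set a5 := \sum_j _; set a6 := \sum_(_ <- R) _.
by rewrite -!addrA; congr (_ + (_ + _)); rewrite addrCA.
Qed.

Lemma CopE_Gen mu y : Np mu y -> CopE mu y.
Proof.
elim=> [|a|j a x hx IH|a c x z hx IHx hz IHz].
- exists (fun=> 0), (fun=> 0); split=> [j|j|j|]; try exact: Gen0.
    by rewrite mul1r mulr1 !mul0r !addr0.
  by exists [::]; split=> //; rewrite Delta1 big_nil big1 ?addr0 // => j _; rewrite mul0r t0l.
- exists (fun=> 0), (fun=> 0); split=> [j|j|j|]; try exact: Gen0.
    by rewrite !mul0r mulr0 !addr0.
  by exists [::]; split=> //; rewrite raddf0 t0l big_nil big1 ?addr0 // => j _; rewrite mul0r t0l.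
- exact: CopE_M.
have [y1 [y2 [h1 h2 hE [R [hR eD]]]]] := IHx; have [z1 [z2 [g1 g2 gE [R' [hR' eD']]]]] := IHz.
exists (fun j => c *: y1 j + z1 j), (fun j => c *: y2 j + z2 j); split.
- by move=> j; exact: GenD.
- by move=> j; exact: GenD.
- by move=> j; rewrite mulrDr -scalerAr hE gE; nc_simp K U; ring.
exists ([seq (c *: p.1, p.2) | p <- R] ++ R'); split.
- move=> p; rewrite mem_cat => /orP[/mapP[w /hR[u1 u2] ->]|/hR'] //=; split=> //.
  by case: u1 => [nu [g [b [hg ->]]]]; exists nu, (c *: g), b; split; [exact: GenZ | rewrite scalerAl].
rewrite linearP /= eD eD' big_cat big_map tDl /=.
rewrite [X in _ = _ + X + _](eq_bigr (fun j => c *: T (y1 j * qk (pi j)) (E j) +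
   T (z1 j * qk (pi j)) (E j))); last first.
  by move=> j _; rewrite -tDl mulrDl scalerAl.
rewrite [X in _ = _ + (X + _)](eq_bigr (fun p => c *: T p.1 p.2)); last by move=> p _; rewrite tZl.
rewrite big_split /= -!scaler_sumr !scalerDr.
set a1 := c *: T _ _; set a2 := c *: \sum_j _; set a3 := c *: \sum_(_ <- _) _.
by rewrite addrACA [a1 + a2 + _]addrACA.
Qed.

Lemma pair_F mu x j : Np mu x -> exists x1 x2, [/\ Np (mu - pi j) x1, Np (mu - pi j) x2,
  F j * x = x * F j + (x1 * qk (pi j) + x2 * ql (pi j)) &
  forall Y, Um U Y -> th x (Y * F j) = th (x1 * qk (pi j)) Y].
Proof.
move=> hx; have [x1 [x2 [h1 h2 hF [R [hR eD]]]]] := CopE_Gen hx.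
exists (x1 j), (x2 j); split=> // Y hY.
have hF' : Umfl (F j) by apply: Umf; exact: (Gen_subalg (Gen_gen pi F j)).
have [_ _ hEF hKF _] := pg; have [k0 _ _ _ _] := cart.
rewrite (@rule2 x Y (F j) ((x, 1) :: [seq (x1 k * qk (pi k), E k) | k <- index_enum I] ++ R)) //.
- rewrite big_cons big_cat big_map /= -{1}k0 hKF mulr0 add0r [X in _ + X]big_seq_cond [X in _ + X]big1 ?addr0; last first.
    by move=> p /andP[/hR[_ /(S2E_th j)[_ ->]] _]; rewrite mulr0.
  rewrite (bigD1 j) //= hEF eqxx mulr1 big1 ?addr0 // => k kj.
  by rewrite hEF (negbTE kj) mulr0.
- exact: (Upf (Gen_subalg hx)).
- exact: Umf.
- move=> p; rewrite inE mem_cat => /or3P[/eqP ->|/mapP[k _ ->]|/hR[u1 /(S2E_th j)[u2 _]]] /=; split.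
  + exact: (Upf (Gen_subalg hx)).
  + exact: (Upf Up1).
  + exact: (Upf_K _ (Gen_subalg (h1 k))).
  + exact: (Upf (Gen_subalg (Gen_gen pi E k))).
  + exact: FP_flat.
  + exact: Upf.
- by rewrite eD big_cons big_cat big_map /= addrA.
Qed.

Lemma th_Np_1 mu x : Np mu x -> mu != 0 -> th x 1 = 0.
Proof.
have h1 : Umfl 1 by apply: Umf; exact: Um1.
elim=> [|a _|j a z hz _ _|a c z w hz IHz hw IHw a0]; first by rewrite eqxx.
- exact: th_0l.
- by apply: th_E_1; exact: (Upf (Gen_subalg hz)).
- by rewrite th_linl ?IHz ?IHw ?mulr0 ?addr0 //; [exact: (Upf (Gen_subalg hz)) | exact: (Upf (Gen_subalg hw))].
Qed.

Lemma g_ndE mu x : Np mu x -> mu != 0 -> (forall j, F j * x = x * F j) -> x = 0.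
Proof.
move=> hx mu0 hc; have [nd _] := gqgP_pairing_nondeg gq; apply: nd; first exact: (Gen_subalg hx).
have hxf := Upf (Gen_subalg hx).
move=> y /(subalg_gsum pi); elim=> [|nu z w hz hw IH]; first exact: th_0r.
have hw' : Um U w.
  have [[S0 SD] _ _] := subalg_subalg (range F); elim: hw => // m v v' hv _ IHv.
  by rewrite -[v]scale1r; apply: SD => //; exact: (Gen_subalg hv).
rewrite -[z]scale1r th_linr ?IH ?mul1r ?addr0 //; [|exact: (Umf (Gen_subalg hz))|exact: Umf].
(* Letters F_j are split off on the right, the side on which [pair_F] computes. *)
move: nu z hz {IH}; apply: Gen_rind => [|a|j a v hv _|a c v v' hv hv' IHv IHv'].
- exact: (th_Np_1 hx mu0).
- exact: th_0r.
- have [y1 [y2 [h1 h2 eE ->]]] := pair_F j hx; last exact: (Gen_subalg hv).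
  have [_ iE] := g_ind; have e0 : y1 * qk (pi j) + y2 * ql (pi j) = 0.
    by apply: (addrI (x * F j)); rewrite -eE hc addr0.
  have [-> _] := iE j _ _ _ h1 h2 e0; rewrite mul0r th_0l //; exact: (Umf (Gen_subalg hv)).
- rewrite th_linr ?IHv ?IHv' ?mulr0 ?addr0 //; [exact: (Umf (Gen_subalg hv)) | exact: (Umf (Gen_subalg hv'))].
Qed.

Lemma g_pborel : pborel chi qk ql pi crd E F.
Proof.
have [k0 l0 kk' ll' kl] := cart; have [iF iE] := g_ind.
split=> //.
- exact: g_one.
- exact: gKE.
- exact: gLE.
- exact: gKF.
- exact: gLF.
- exact: gEF.
- exact: g_ndF.
- exact: g_ndE.
Qed.

Lemma g_borel : borel chi qk ql pi crd E F.
Proof.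
split; [exact: g_pborel | exact: g_tri |].
apply: (tspan_of_generation g_pborel) => T0 u [T00 TD [TK TL] TE TF] T1.
have := gqgP_generated gq => hg.
have hu : subalg (range qk `|` range ql `|` range E `|` range F)%classic u by rewrite hg.
suff h : forall v, T0 v -> T0 (u * v) by have := h 1 T1; rewrite mulr1.
move: hu; apply: (subalg_ind (Q := [set u | forall v, T0 v -> T0 (u * v)]%classic)).
- split.
  + split=> [v hv|c x y hx hy v hv]; first by rewrite mul0r.
    by rewrite mulrDl -scalerAl; apply: TD; [exact: hx | exact: hy].
  + by move=> v hv; rewrite mul1r.
  + by move=> x y hx hy v hv; rewrite -mulrA; apply: hx; exact: hy.
- by move=> y [[[[a _ <-]|[a _ <-]]|[j _ <-]]|[j _ <-]] v hv; [exact: TK | exact: TL | exact: TE | exact: TF].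
Qed.

End InitialBorel.

(** * Kostant functions and the initial Hilbert series *)

Module KostantFunctions.
Import finmap.

Lemma card_eq_seq (T : eqType) (X : set T) (L : seq T) : uniq L ->
  (forall g, X g <-> g \in L) -> (X #= `I_(size L))%card.
Proof.
move=> uL hL; apply/card_set_bijP; exists (fun g => index g L); split.
- by move=> g /hL; rewrite -index_mem.
- move=> g g' /set_mem/hL hg /set_mem/hL hg' e.
  by rewrite -(nth_index g hg) e nth_index.
- case: L uL hL => [|g0 L'] uL hL k hk; first by [].
  exists (nth g0 (g0 :: L') k); first by apply/hL; rewrite mem_nth.
  exact: index_uniq.
Qed.

Section Functions.
Variables (A : zmodType) (T : choiceType) (w : T -> A) (adm : T -> pred nat).

(** The recursion of [cnt] for an arbitrary index set and admissibility condition, to be matched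
    with the cardinality of [KF]. *)
Fixpoint cg (N : nat) (idx : seq T) (lam : A) : nat :=
  if idx is t :: l then \sum_(s < N | adm t s) cg N l (lam - w t *+ s) else lam == 0.

Definition KF (idx : seq T) lam : set (T -> nat) := [set g | [/\ forall t, t \notin idx -> g t = 0%N,
  forall t, t \in idx -> adm t (g t) & \sum_(t <- idx) w t *+ g t = lam]]%classic.

Variable ht : A -> int.
Hypothesis htD : forall a b, ht (a + b) = ht a + ht b.

Lemma KF_ht (idx : seq T) lam g : (forall t, t \in idx -> 0 < ht (w t)) -> KF idx lam g -> 0 <= ht lam.
Proof.
move=> pos [_ _ <-]; rewrite big_seq; elim/big_rec: _ => [|t x ti]; first by rewrite (addf0 htD).
by move=> h; rewrite htD (addfMn htD) addr_ge0 // mulrn_wge0 // ltW // pos.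
Qed.

(** Functions are listed by their value at the head of the index list; positivity of [ht] keeps that
    value below [N], so nothing is missed. *)
Lemma KF_list (idx : seq T) N lam : uniq idx -> (forall t, t \in idx -> 0 < ht (w t)) -> ht lam < N%:Z ->
  exists L : seq (T -> nat), [/\ uniq L, forall g, KF idx lam g <-> g \in L & size L = cg N idx lam].
Proof.
elim: idx lam => [|t l IH] lam.
  move=> _ _ _; exists (if lam == 0 then [:: fun=> 0%N] else [::]); split; [by case: ifP| |by rewrite /=; case: ifP].
  move=> g; rewrite /KF /= big_nil; split.
    move=> [h _ <-]; rewrite eqxx inE; apply/eqP/funext => t; exact: h.
  case: eqP => [->|//]; rewrite inE => /eqP ->; by split.
move=> /= /andP[tl ul] pos hN.
have posl t' : t' \in l -> 0 < ht (w t') by move=> h; apply: pos; rewrite inE h orbT.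
have post : 0 < ht (w t) by apply: pos; rewrite mem_head.
pose upd (g : T -> nat) s t' := if t' == t then s else g t'.
suff h N' : (N' <= N)%N -> exists L : seq (T -> nat), [/\ uniq L,
    forall g, KF (t :: l) lam g /\ (g t < N')%N <-> g \in L &
    size L = \sum_(s < N' | adm t s) cg N l (lam - w t *+ s)].
  have [L [L1 L2 L3]] := h N (leqnn N); exists L; split=> // g; split=> [hg|/L2[] //].
  apply/L2; split=> //; rewrite ltnNge; apply/negP => le.
  have [_ _ e] := hg; rewrite big_cons in e.
  have hk : KF l (lam - w t *+ g t) (fun t' => if t' == t then 0%N else g t').
    split.
    - move=> t' nt; case: eqP => // /eqP ne; case: hg => h0 _ _; apply: h0.
      by rewrite inE negb_or ne.
    - move=> t' t'l; case: eqP => [e'|_]; first by rewrite -e' t'l in tl.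
      by case: hg => _ h1 _; apply: h1; rewrite inE t'l orbT.
    - rewrite -e addrC addKr [LHS]big_seq [RHS]big_seq; apply: eq_bigr => t' t'l.
      by case: eqP => // e'; rewrite -e' t'l in tl.
  have := KF_ht posl hk; rewrite (addf_sub htD) subr_ge0 -[_ *+ _]mulr_natr natz.
  by nia.
elim: N' => [|N' IHN] hN'.
  by exists [::]; split=> // [g|]; [split=> // -[] | rewrite big_ord0].
have [L [L1 L2 L3]] := IHN (ltnW hN').
have ev : (\sum_(s < N'.+1 | adm t s) cg N l (lam - w t *+ s)%R =
  \sum_(s < N' | adm t s) cg N l (lam - w t *+ s)%R + (if adm t N' then cg N l (lam - w t *+ N')%R else 0))%N.
  by rewrite big_mkcond big_ord_recr /= -big_mkcond.
have lg (g : T -> nat) : (g t < N'.+1)%N = (g t < N')%N || (g t == N') by rewrite ltnS leq_eqVlt orbC.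
have [ad|nad] := boolP (adm t N'); last first.
  exists L; split=> //; last by rewrite ev (negbTE nad) addn0.
  move=> g; rewrite -L2; split=> -[hg lt]; split=> //; last exact: ltnW.
  move: lt; rewrite lg => /orP[] // /eqP eN; case: hg => _ /(_ t (mem_head _ _)).
  by rewrite eN (negbTE nad).
have hN2 : ht (lam - w t *+ N') < N%:Z.
  by apply: le_lt_trans hN; rewrite (addf_sub htD) gerBl mulrn_wge0 // ltW.
have [L' [M1 M2 M3]] := IH (lam - w t *+ N') ul posl hN2.
have inj : {in L' &, injective (upd^~ N')}.
  move=> g g' /M2[g0 _ _] /M2[g0' _ _] e; apply/funext => t'.
  have [->|ne] := eqVneq t' t; first by rewrite g0 // g0'.
  by have := congr1 (fun f => f t') e; rewrite /upd (negbTE ne).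
exists (L ++ [seq upd g N' | g <- L']); split.
- rewrite cat_uniq L1 map_inj_in_uniq // M1 andbT /=; apply/hasPn => _ /mapP[g _ ->].
  by apply/negP => /L2[_]; rewrite /upd eqxx ltnn.
- move=> g; rewrite mem_cat; split.
    move=> [hg]; rewrite lg => /orP[lt|/eqP eN]; first by rewrite (proj1 (L2 g)) //.
    apply/orP; right; apply/mapP; exists (fun t' => if t' == t then 0%N else g t').
      apply/M2; have [h0 h1 e] := hg; split.
      - move=> t' nt; case: eqP => // /eqP ne; apply: h0; by rewrite inE negb_or ne.
      - move=> t' t'l; case: eqP => [e'|_]; first by rewrite -e' t'l in tl.
        by apply: h1; rewrite inE t'l orbT.
      - rewrite -e big_cons eN addrC addKr [LHS]big_seq [RHS]big_seq; apply: eq_bigr => t' t'l.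
        by case: eqP => // e'; rewrite -e' t'l in tl.
    by apply/funext => t'; rewrite /upd; case: eqP => // ->.
  move=> /orP[/L2[hg lt]|/mapP[g' /M2[h0 h1 e] ->]]; first by split=> //; exact: ltnW.
  split; last by rewrite /upd eqxx.
  split.
  - move=> t'; rewrite inE negb_or /upd => /andP[/negbTE -> /h0].
    by [].
  - move=> t'; rewrite inE /upd; case: eqP => [-> _|_ /=]; [exact: ad | exact: h1].
  - rewrite big_cons {1}/upd eqxx [X in _ + X]big_seq (eq_bigr (fun t' => w t' *+ g' t')).
      by rewrite -big_seq e addrC subrK.
    by move=> t' t'l; rewrite /upd; case: eqP => // e'; rewrite -e' t'l in tl.
- by rewrite size_cat size_map L3 M3 ev ad.
Qed.

Lemma KF_card (idx : seq T) N lam : uniq idx -> (forall t, t \in idx -> 0 < ht (w t)) -> ht lam < N%:Z ->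
  (KF idx lam #= `I_(cg N idx lam))%card.
Proof. by move=> u p h; have [L [L1 L2 <-]] := KF_list u p h; exact: card_eq_seq. Qed.

End Functions.

Lemma cg_cnt (K : fieldType) (A : zmodType) (chi : A -> A -> K) (T : choiceType) (w : T -> A) N idx lam :
  cg w (fun t s => qfact (chi (w t) (w t)) s != 0) N idx lam = cnt chi N (map w idx) lam.
Proof. by elim: idx lam => //= t l IH lam; apply: eq_bigr => s _; exact: IH. Qed.

Lemma fdim_bounded_ex (K : fieldType) (M : lmodType K) (S : M -> Prop) n : subsp S ->
  (forall m (v : 'I_m -> M), (forall l, S (v l)) ->
     (forall c : 'I_m -> K, \sum_l c l *: v l = 0 -> forall l, c l = 0) -> (m <= n)%N) ->
  exists2 m, (m <= n)%N & fdim S m.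
Proof.
move=> Ssub bnd.
pose Q m := `[< exists v : 'I_m -> M, (forall l, S (v l)) /\
  forall c : 'I_m -> K, \sum_l c l *: v l = 0 -> forall l, c l = 0 >].
have exQ : exists m, Q m by exists 0%N; apply/asboolP; exists (fun=> 0); split=> [[]|c _ []].
have bQ m : Q m -> (m <= n)%N by move=> /asboolP[v [v1 v2]]; exact: bnd v1 v2.
case: (ex_maxnP exQ bQ) => m Qm mx; have mn := bQ _ Qm; case/asboolP: Qm => v [v1 v2].
exists m => //; exists 'I_m, v; split; last exact: card_ord.
split=> // x Sx; apply: contrapT => nx; suff : Q m.+1 by move/mx; rewrite ltnn.
apply/asboolP; exists (fun l => if unlift ord_max l is Some l' then v l' else x); split.
  by move=> l; case: unliftP.
move=> c; rewrite big_ord_recr /= unlift_none.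
rewrite (eq_bigr (fun l => c (widen_ord (leqnSn m) l) *: v l)) => [e|l _]; last first.
  have -> : widen_ord (leqnSn m) l = lift ord_max l by apply: val_inj; rewrite /= /bump leqNgt ltn_ord.
  by rewrite liftK.
have c0 : c ord_max = 0.
  apply/eqP; apply/negPn/negP => nz; apply: nx.
  exists (fun l => - (c ord_max)^-1 * c (widen_ord (leqnSn m) l)).
  rewrite (eq_bigr (fun l => - (c ord_max)^-1 *: (c (widen_ord (leqnSn m) l) *: v l))); last first.
    by move=> l _; rewrite scalerA.
  rewrite -scaler_sumr; move/eqP: e; rewrite addr_eq0 => /eqP ->.
  by rewrite scalerN scaleNr opprK scalerA mulVf // scale1r.
rewrite c0 scale0r addr0 in e.
move=> l; case: (unliftP ord_max l) => [l' ->|->] //.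
have := v2 _ e l'; congr (c _ = 0).
by apply: val_inj; rewrite /= /bump leqNgt ltn_ord.
Qed.

(** The Gram matrix of an independent family of [T] against a basis of [S] has independent rows, as
    the radical in [T] is zero; its rank is at most [n]. *)
Lemma fdim_pairing_le (K : fieldType) (M : lmodType K) (S T : M -> Prop) (b : M -> M -> K) n :
  subsp T -> (forall x c y z, S x -> T y -> T z -> b x (c *: y + z) = c * b x y + b x z) ->
  (forall y c x z, T y -> S x -> S z -> b (c *: x + z) y = c * b x y + b z y) -> subsp S ->
  (forall y, T y -> (forall x, S x -> b x y = 0) -> y = 0) ->
  fdim S n -> exists2 m, (m <= n)%N & fdim T m.
Proof.
move=> Tsub bl br [S0 SD] nd /fdim_ord[d [d1 _ d3]].
apply: fdim_bounded_ex => // m v vT vf.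
have [T0 TD] := Tsub.
have b0 x : S x -> b x 0 = 0.
  by move=> Sx; have := bl x (-1) 0 0 Sx T0 T0; rewrite scaler0 addr0 mulN1r addNr.
pose G : 'M[K]_(m, n) := \matrix_(l, k) b (d k) (v l).
suff : row_free G by rewrite /row_free => /eqP <-; exact: rank_leq_col.
apply: inj_row_free => x e; apply/rowP => l; rewrite mxE; apply: (vf (fun l => x 0 l)).
have Ty (r : seq 'I_m) : T (\sum_(l <- r) x 0 l *: v l) by apply: subsp_sum => // l' _; rewrite -[_ *: _]addr0; exact: TD.
apply: nd => // z Sz.
have bk k : b (d k) (\sum_l x 0 l *: v l) = 0.
  have := congr1 (fun y : 'rV_n => y 0 k) e; rewrite !mxE => ek.
  rewrite -[RHS]ek; elim: (index_enum _) => [|l' r IHr]; first by rewrite !big_nil b0.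
  by rewrite !big_cons bl // IHr mxE.
have [c ->] := d3 _ Sz.
suff : S (\sum_k c k *: d k) /\ b (\sum_k c k *: d k) (\sum_l x 0 l *: v l) = 0 by case.
have bz : b 0 (\sum_l x 0 l *: v l) = 0.
  have := br (\sum_l x 0 l *: v l) (-1) 0 0 (Ty (index_enum _)) S0 S0.
  by rewrite scaler0 addr0; set bb := b _ _ => ->; rewrite mulN1r addNr.
elim/big_rec: _ => [|k y _ [IH1 IH2]]; first by [].
by split; [exact: SD | rewrite br // bk mulr0 add0r].
Qed.

Section InitialHilbert.
Variables (K : fieldType) (I : finType) (A : zmodType) (pi : I -> A) (chi : A -> A -> K).
Variable U : gqgData K I A.
Variable crd : I -> A -> int.
Hypothesis crdD : forall i a b, crd i (a + b) = crd i a + crd i b.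
Hypothesis crdpi : forall i j, crd i (pi j) = (i == j)%:Z.
Hypothesis crdE : forall a, a = \sum_i pi i *~ crd i a.
Hypothesis chiP : bihom chi.
Hypothesis gq : is_gqg pi chi U.
Let B := g_borel crdD crdpi crdE chiP gq.
Let H := b_pb B.

(** [theta] vanishes between different degrees, so it is nondegenerate degree by degree, and each
    dimension bounds the other. *)
Lemma Gen_theta lam n : fdim (Gen pi (qE U) lam) n -> fdim (Gen pi (qF U) lam) n.
Proof.
have [nd1 nd2] := gqgP_pairing_nondeg gq.
have uf y : Gen pi (qF U) lam y -> Umflat y by move=> h; apply: (Umf gq); exact: (Gen_subalg h).
have ue x : Gen pi (qE U) lam x -> Upflat x by move=> h; apply: (Upf gq); exact: (Gen_subalg h).
have r x c y z : Gen pi (qE U) lam x -> Gen pi (qF U) lam y -> Gen pi (qF U) lam z ->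
    theta U x (c *: y + z) = c * theta U x y + theta U x z.
  by move=> hx hy hz; apply: (th_linr gq); auto.
have l y c x z : Gen pi (qF U) lam y -> Gen pi (qE U) lam x -> Gen pi (qE U) lam z ->
    theta U (c *: x + z) y = c * theta U x y + theta U z y.
  by move=> hy hx hz; apply: (th_linl gq); auto.
move=> hE; have [|m mn hm] := fdim_pairing_le (Gen_subsp pi (qF U) lam) r l (Gen_subsp pi (qE U) lam) _ hE.
  move=> y hy hz; apply: nd2; first exact: (Gen_subalg hy).
  move=> x /(subalg_gsum pi); elim=> [|nu z w hz' hw IH]; first by apply: (th_0l gq); exact: uf.
  have hw' : Up U w.
    have [[S0 SD] _ _] := subalg_subalg (range (qE U)); elim: hw => // v v' v'' hv _ IHv.
    by rewrite -[v']scale1r; apply: SD => //; exact: (Gen_subalg hv).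
  rewrite -[z]scale1r (th_linl gq) ?IH ?mul1r ?addr0; [|exact: uf|by apply: (Upf gq); exact: (Gen_subalg hz')|exact: (Upf gq)].
  have [e|ne] := eqVneq nu lam; first by apply: hz; rewrite -e.
  exact: (th_orth chiP gq hz' hy ne).
have [|m' mn' hm'] := fdim_pairing_le (b := fun y x => theta U x y) (Gen_subsp pi (qE U) lam)
    (fun x c y z hx hy hz => l x c y z hx hy hz) (fun y c x z hy hx hz => r y c x z hy hx hz) (Gen_subsp pi (qF U) lam) _ hm.
  move=> x hx hz; apply: nd1; first exact: (Gen_subalg hx).
  move=> y /(subalg_gsum pi); elim=> [|nu z w hz' hw IH]; first by apply: (th_0r gq); exact: ue.
  have hw' : Um U w.
    have [[S0 SD] _ _] := subalg_subalg (range (qF U)); elim: hw => // v v' v'' hv _ IHv.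
    by rewrite -[v']scale1r; apply: SD => //; exact: (Gen_subalg hv).
  rewrite -[z]scale1r (th_linr gq) ?IH ?mul1r ?addr0; [|exact: ue|by apply: (Umf gq); exact: (Gen_subalg hz')|exact: (Umf gq)].
  have [e|ne] := eqVneq lam nu; first by apply: hz; rewrite e.
  exact: (th_orth chiP gq hx hz' ne).
have e := fdim_uniq hE hm'; have -> // : n = m by lia.
Qed.

Lemma has_dim_fdim (S : set U) n : has_dim S n -> fdim S n.
Proof.
move=> [e [eS ef]]; exists 'I_n, e; split; last exact: card_ord.
split.
- by move=> j; rewrite eS; apply: lspan_in; exists j.
- by move=> c c0 j; apply: (ef (index_enum 'I_n) c (index_enum_uniq _) c0); rewrite mem_index_enum.
- move=> x; rewrite eS => h; apply: (h [set x | exists c : 'I_n -> K, x = \sum_j c j *: e j]%classic).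
  split; last by move=> _ [j _ <-]; exists (fun k => (k == j)%:R); rewrite (bigD1 j) //= eqxx scale1r big1 ?addr0 // => k /negbTE ->; rewrite scale0r.
  split; first by exists (fun=> 0); rewrite big1 // => j _; rewrite scale0r.
  move=> c x1 x2 [c1 ->] [c2 ->]; exists (fun j => c * c1 j + c2 j).
  by rewrite scaler_sumr -big_split; apply: eq_bigr => j _; rewrite scalerA scalerDl.
Qed.

Lemma nonneg_crd a : nonneg pi a <-> forall j, 0 <= crd j a.
Proof.
split=> [[n ->] j|h].
  rewrite (addf_sum (crdD j)) sumr_ge0 // => i _.
  by rewrite (addfMn (crdD j)) mulrn_wge0 // crdpi.
exists (fun j => `|crd j a|%N); rewrite {1}(crdE a); apply: eq_bigr => j _.
by rewrite -{1}(gez0_abs (h j)) pmulrn.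
Qed.

(** The list repeats each root phi(b) times; that the multiplicities are one is only shown later by
    reflections. Degrees off the positive cone are treated apart, since [is_posroots] is silent
    there. *)
Lemma initial_hil (Rp : set A) : is_posroots pi chi U Rp -> finite_set Rp ->
  (forall b, Rp b -> chi b b != 1) ->
  exists rs : seq A, hil chi pi crd (qF U) rs /\ forall b, b \in rs <-> Rp b.
Proof.
move=> [Rpos [phi [phi0 hdim]]] /finite_setP[n0]; rewrite -[Rp]/(Rp) => hfin neq1.
have fRp : finite_set Rp by apply/finite_setP; exists n0.
pose rl : seq A := finmap.enum_fset (fset_set Rp).
have rlP b : b \in rl <-> Rp b.
  rewrite -[b \in rl]/(b \in fset_set Rp) in_fset_set // ; split=> [/set_mem|/mem_set] //.
pose idx := flatten [seq [seq (b, k) | k <- iota 1 (phi b)] | b <- rl].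
have idxP bk : bk \in idx <-> root_index Rp phi bk.
  split.
    move=> /flatten_mapP[b /rlP hb /mapP[k]]; rewrite mem_iota => hk ->; split=> //=.
  case: bk => b k [/= /rlP hb hk]; apply/flatten_mapP; exists b => //; apply/mapP; exists k => //.
  by rewrite mem_iota add1n ltnS.
have ui : uniq idx.
  rewrite /idx; have : uniq rl by exact: finmap.fset_uniq.
  elim: (rl) => //= b l IH /andP[bl ul]; rewrite cat_uniq IH // andbT map_inj_uniq ?iota_uniq //=; last by move=> x y [].
  apply/hasPn => bk /flatten_mapP[b' b'l /mapP[k _ ->]]; apply/negP => /mapP[k' _ [eb _]].
  by rewrite -eb b'l in bl.
exists (map fst idx).
have mem b : b \in map fst idx <-> Rp b.
  split=> [/mapP[bk /idxP[h _] ->] //|hb].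
  by apply/mapP; exists (b, 1%N) => //; apply/idxP; split=> //=; exact: phi0.
split=> //.
have cone b : b \in map fst idx -> (forall j, 0 <= crd j b) /\ b != 0.
  by move=> /mem/Rpos[/nonneg_crd].
split.
- by move=> b /cone[].
- by move=> b /cone[].
- by move=> b /mem; exact: neq1.
have pos bk : bk \in idx -> 0 < hgt crd bk.1.
  by move=> h; have [c1 c2] := cone bk.1 (map_f fst h); apply: (hgt_gt0 H).
move=> lam N hN; rewrite -cg_cnt.
have hc := KF_card (w := fst) (fun (t : A * nat) s => qfact (chi t.1 t.1) s != 0) (hgtD H) ui pos hN.
have eK : kostant_functions chi Rp phi lam = KF fst (fun (t : A * nat) s => qfact (chi t.1 t.1) s != 0) idx lam.
  rewrite eqEsubset; split=> g.
    move=> [h1 h2 h3 h4]; split.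
    - by move=> t nt; apply: h1 => /idxP; rewrite (negbTE nt).
    - by move=> t /idxP; exact: h3.
    - rewrite -h4 (@fsbigE _ _ _ _ _ idx) // ?[RHS]big_mkcond /=.
      + rewrite [LHS]big_seq [RHS]big_seq; apply: eq_bigr => t /idxP ht; by rewrite mem_set.
      + by move=> t; rewrite /= => /idxP.
      + by move=> t /idxP ->.
  move=> [h1 h2 h3]; split.
  - by move=> t nt; apply: h1; apply/negP => /idxP.
  - apply: (@sub_finite_set _ _ [set` idx]%classic); last exact: finite_seq.
    by move=> t /= nz; apply: contraNT nz => nt; rewrite h1.
  - by move=> t /idxP; exact: h2.
  - rewrite -h3 (@fsbigE _ _ _ _ _ idx) // ?[LHS]big_mkcond /=.
    + rewrite [LHS]big_seq [RHS]big_seq; apply: eq_bigr => t /idxP ht; by rewrite mem_set.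
    + by move=> t; rewrite /= => /idxP.
    + by move=> t /idxP ->.
have [nn|nn] := pselect (nonneg pi lam).
  have [n [/has_dim_fdim hd hk]] := hdim lam nn; rewrite eK in hk.
  have -> : cg fst (fun (t : A * nat) s => qfact (chi t.1 t.1) s != 0) N idx lam = n.
    by apply/card_eq_II; apply: (card_eq_trans _ hk); rewrite card_eq_sym.
  by apply: Gen_theta; apply: fdim_eq hd => x; exact: (UpgrP gq).
rewrite cg_cnt; have [j hj] : exists j, crd j lam < 0.
  apply: contrapT => ne; apply: nn; apply/nonneg_crd => j; rewrite leNgt; apply/negP => lt; apply: ne; by exists j.
rewrite (@cnt_out _ _ chi (crd j) (crdD j) N (map fst idx) lam _ hj).
  by apply: fdim0 => x hx; exact: (Nm_out H hx hj).
by move=> b /cone[].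
Qed.

End InitialHilbert.

End KostantFunctions.
Import KostantFunctions.

(** * The torus algebra U^0 as a ring of functions *)

Section CartanRing.
Variables (K : closedFieldType) (I : finType) (A : zmodType) (pi : I -> A) (chi : A -> A -> K).
Variable U : gqgData K I A.

Definition U0p : {pred U} := [pred u | `[< U0 U u >]].
Lemma U0p_sub : subring_closed U0p.
Proof.
have [[S0 SD] S1 SM] := subalg_subalg [set u : U | exists a b, u = qK U a * qL U b]%classic.
split=> [|x y /asboolP hx /asboolP hy|x y /asboolP hx /asboolP hy]; apply/asboolP.
- exact: S1.
- by rewrite addrC -scaleN1r; apply: SD.
- exact: SM.
Qed.
HB.instance Definition _ := GRing.isSubringClosed.Build U U0p U0p_sub.

Record R0base := MkR0 { r0v : U; r0P : r0v \in U0p }.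
HB.instance Definition _ := [isSub for r0v].
HB.instance Definition _ := [Choice of R0base by <:].
HB.instance Definition _ := [SubChoice_isSubNzRing of R0base by <:].
(** Commutativity of U^0 comes from the Cartan relations, so the ring is indexed by a proof of
    [is_gqg] for the commutative structure to depend on. *)
Definition R0 (h : is_gqg pi chi U) := R0base.
HB.instance Definition _ (h : is_gqg pi chi U) := GRing.NzRing.on (R0 h).

Lemma U0_span (u : U) : is_gqg pi chi U -> U0 U u ->
  exists (s : seq (A * A)) (c : A * A -> K), uniq s /\ u = \sum_(t <- s) c t *: (qK U t.1 * qL U t.2).
Proof.
move=> h /(U0_dec h)[d [s [us /choice[c hc] _ ->]]]; exists s, c; split=> //.
by apply: eq_bigr => t _.
Qed.

Lemma U0_mul (h : is_gqg pi chi U) a b a' b' :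
  qK U a * qL U b * (qK U a' * qL U b') = qK U (a + a') * qL U (b + b').
Proof.
have [_ _ kk ll kl] := gqgP_cartan h.
by rewrite mulrA -[qK U a * qL U b * _]mulrA -kl mulrA kk -mulrA ll.
Qed.

Lemma R0_comm h : commutative (@GRing.mul (R0 h)).
Proof.
move=> x y; apply: val_inj; rewrite /=.
have /asboolP/(U0_span h)[s [c [_ ->]]] := r0P x; have /asboolP/(U0_span h)[s' [c' [_ ->]]] := r0P y.
rewrite mulr_suml mulr_sumr; apply: eq_bigr => t _; rewrite mulr_suml mulr_sumr; apply: eq_bigr => t' _.
rewrite -!scalerAl -!scalerAr !scalerA mulrC; congr (_ *: _).
by rewrite !(U0_mul h) addrC [t.2 + _]addrC.
Qed.
HB.instance Definition _ (h : is_gqg pi chi U) := GRing.PzSemiRing_hasCommutativeMul.Build (R0 h) (@R0_comm h).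

Variable crd : I -> A -> int.
Hypothesis crdD : forall i a b, crd i (a + b) = crd i a + crd i b.
Hypothesis crdpi : forall i j, crd i (pi j) = (i == j)%:Z.
Hypothesis crdE : forall a, a = \sum_i pi i *~ crd i a.
Hypothesis chiP : bihom chi.
Hypothesis gq : is_gqg pi chi U.
Let B := g_borel crdD crdpi crdE chiP gq.
Let H := b_pb B.
Local Notation R := (R0 gq).

Lemma qKL_in a b : qK U a * qL U b \in U0p.
Proof. by apply/asboolP; apply: subalg_gen; exists a, b. Qed.
Definition mon a b : R := MkR0 (qKL_in a b).
Lemma cst_in (c : K) : c *: (1 : U) \in U0p.
Proof.
apply/asboolP; have [[S0 SD] S1 SM] := subalg_subalg [set u : U | exists a b, u = qK U a * qL U b]%classic.
by rewrite -[_ *: _]addr0; apply: SD.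
Qed.
Definition cst c : R := MkR0 (cst_in c).
Lemma cst_is_zmod : zmod_morphism cst.
Proof. by move=> x y; apply: val_inj; rewrite /= scalerBl. Qed.
Lemma cst_is_mon : monoid_morphism cst.
Proof. by split=> [|x y]; apply: val_inj; rewrite /= ?scale1r // -scalerAl mul1r scalerA. Qed.
HB.instance Definition _ := GRing.isZmodMorphism.Build K R cst cst_is_zmod.
HB.instance Definition _ := GRing.isMonoidMorphism.Build K R cst cst_is_mon.

Lemma monM a b a' b' : mon a b * mon a' b' = mon (a + a') (b + b').
Proof. by apply: val_inj; rewrite /= (U0_mul gq). Qed.
Lemma mon0 : mon 0 0 = 1.
Proof. by apply: val_inj; rewrite /=; have [-> -> _ _ _] := gqgP_cartan gq; rewrite mulr1. Qed.

Lemma R_span (u : R) : exists (s : seq (A * A)) (c : A * A -> K), uniq s /\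
  u = \sum_(t <- s) cst (c t) * mon t.1 t.2.
Proof.
have /asboolP/(U0_span gq)[s [c [us e]]] := r0P u; exists s, c; split=> //.
apply: val_inj; rewrite /= e; elim: (s) => [|t l IH]; first by rewrite !big_nil.
by rewrite !big_cons /= IH -scalerAl mul1r.
Qed.

Record chpt := Chpt { ck : A -> K; cl : A -> K; ckP : chrp ck; clP : chrp cl }.

(** Evaluation through the Verma module: a torus element acts on the highest weight vector by a
    scalar, so no choice of an expansion in monomials enters. *)
Definition ev (x : chpt) (u : R) : K := sval (cid (separating_functional (h_one H))) (V B (ck x) (cl x) (r0v u)).

Let sfL := svalP (cid (separating_functional (h_one H))).
Lemma ev_is_zmod x : zmod_morphism (ev x).
Proof.
move=> u v; rewrite /ev /= VB addrC -scaleN1r; have [-> _] := sfL.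
by rewrite mulN1r addrC.
Qed.
HB.instance Definition _ x := GRing.isZmodMorphism.Build R K (ev x) (ev_is_zmod x).

Lemma ev_cmon x c a b : ev x (cst c * mon a b) = c * (ck x a * cl x b).
Proof.
rewrite /ev /= -scalerAl mul1r VZ -[qK U a]mul1r (V_L B (ck x) (clP x)) (V_K B (cl x) (ckP x)).
rewrite (V_Gen B (ckP x) (clP x) (Gen1 pi (qF U))).
have [fl f1] := sfL; rewrite -[_ *: _]addr0 fl -[X in c * sval _ X]addr0 !scalerA -[X in c * sval _ (X + _)]addr0.
rewrite addr0 fl.
have f0 : sval (cid (separating_functional (h_one H))) 0 = 0.
  by have := fl (-1) 0 0; rewrite scaler0 addr0 mulN1r addNr.
by rewrite f0 !addr0 f1 mulr1 [cl x b * _]mulrC.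
Qed.

Lemma ev_span x s (c : A * A -> K) : ev x (\sum_(t <- s) cst (c t) * mon t.1 t.2) =
  \sum_(t <- s) c t * (ck x t.1 * cl x t.2).
Proof. by rewrite raddf_sum; apply: eq_bigr => t _; rewrite /= ev_cmon. Qed.

Lemma ev_is_mon x : monoid_morphism (ev x).
Proof.
split=> [|u v].
  by rewrite -mon0 -[mon 0 0]mul1r -(rmorph1 cst) ev_cmon (chrp0 (ckP x)) (chrp0 (clP x)) !mulr1.
have [s [c [_ ->]]] := R_span u; have [s' [c' [_ ->]]] := R_span v.
rewrite !ev_span mulr_suml mulr_suml raddf_sum; apply: eq_bigr => t _.
rewrite !mulr_sumr raddf_sum; apply: eq_bigr => t' _ /=.
rewrite mulrACA monM -rmorphM /= ev_cmon (proj2 (ckP x)) (proj2 (clP x)).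
by ring.
Qed.
HB.instance Definition _ x := GRing.isMonoidMorphism.Build R K (ev x) (ev_is_mon x).

Lemma ev_cst x c : ev x (cst c) = c.
Proof. by rewrite -[cst c]mulr1 -mon0 ev_cmon (chrp0 (ckP x)) (chrp0 (clP x)) !mulr1. Qed.
Lemma ev_mon x a b : ev x (mon a b) = ck x a * cl x b.
Proof. by rewrite -[mon a b]mul1r -(rmorph1 cst) ev_cmon mul1r. Qed.

(** The difference of two pairs gives a polynomial with integer coefficients, nonzero when the pairs
    are distinct; substituting an integer that is a root of none of them separates the finite
    list. *)
Lemma separating_weight (s : seq (A * A)) : exists th1 th2 : A -> int,
  [/\ forall a b, th1 (a + b) = th1 a + th1 b, forall a b, th2 (a + b) = th2 a + th2 b &
      {in s &, injective (fun t : A * A => th1 t.1 + th2 t.2)}].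
Proof.
pose n := #|I|.
pose P (d : A * A) : {poly int} := \sum_j (crd j d.1 *: 'X^(enum_rank j) + crd j d.2 *: 'X^(n + enum_rank j)).
have P0 d : d != 0 -> P d != 0.
  apply: contraNneq => e; apply/eqP.
  have c1 j : crd j d.1 = 0.
    have := congr1 (fun p : {poly int} => p`_(enum_rank j)) e; rewrite coef0 coef_sum (bigD1 j) //= big1 ?addr0.
      rewrite coefD !coefZ !coefXn eqxx mulr1 (ltn_eqF (leq_trans (ltn_ord _) (leq_addr _ _))).
      by rewrite mulr0 addr0.
    move=> k kj; rewrite coefD !coefZ !coefXn (ltn_eqF (leq_trans (ltn_ord _) (leq_addr _ _))) mulr0 addr0.
    by rewrite (_ : _ == _ = false) ?mulr0 // (inj_eq val_inj) (inj_eq enum_rank_inj) eq_sym; exact: negbTE.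
  have c2 j : crd j d.2 = 0.
    have := congr1 (fun p : {poly int} => p`_(n + enum_rank j)) e; rewrite coef0 coef_sum (bigD1 j) //= big1 ?addr0.
      rewrite coefD !coefZ !coefXn eqxx mulr1 (gtn_eqF (leq_trans (ltn_ord _) (leq_addr _ _))).
      by rewrite mulr0 add0r.
    move=> k kj; rewrite coefD !coefZ !coefXn (gtn_eqF (leq_trans (ltn_ord _) (leq_addr _ _))) mulr0 add0r.
    by rewrite eqn_add2l (_ : _ == _ = false) ?mulr0 // (inj_eq val_inj) (inj_eq enum_rank_inj) eq_sym; exact: negbTE.
  by case: d {e} c1 c2 => a b /= c1 c2; congr (_, _); apply: (crd_inj H) => j; rewrite (crd0 H).
pose Q := \prod_(p <- [seq (t, t') | t <- s, t' <- s] | p.1 - p.2 != 0) P (p.1 - p.2).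
have Q0 : Q != 0 by rewrite /Q prodf_seq_neq0; apply/allP => p _; apply/implyP => /P0.
have [N hN] : exists N : nat, Q.[N%:Z] != 0.
  apply: contrapT => ne; have := @max_poly_roots _ Q [seq k%:Z | k <- iota 0 (size Q)] Q0.
  rewrite size_map size_iota ltnn => h; suff : false by []; apply: h; last by rewrite map_inj_uniq ?iota_uniq // => x y [].
  by apply/allP => _ /mapP[k _ ->]; apply/negPn/negP => nr; apply: ne; exists k.
pose th1 a := \sum_j crd j a * (N%:Z ^+ enum_rank j); pose th2 a := \sum_j crd j a * (N%:Z ^+ (n + enum_rank j)).
have PE d : (P d).[N%:Z] = th1 d.1 + th2 d.2.
  by rewrite /P horner_sum -big_split; apply: eq_bigr => j _; rewrite !hornerE.
have D1 a b : th1 (a + b) = th1 a + th1 b.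
  by rewrite /th1 -big_split; apply: eq_bigr => j _; rewrite crdD mulrDl.
have D2 a b : th2 (a + b) = th2 a + th2 b.
  by rewrite /th2 -big_split; apply: eq_bigr => j _; rewrite crdD mulrDl.
exists th1, th2; split=> // t t' ts ts' /= e.
apply/eqP; rewrite -subr_eq0; apply/negPn/negP => nz.
case/negP: hN; rewrite /Q horner_prod prodf_seq_eq0; apply/hasP; exists (t, t').
  by apply/allpairsP; exists (t, t').
by rewrite nz /= PE /= D1 D2 (addfN D1) (addfN D2) addrACA -opprD e subrr.
Qed.

(* Along a one-parameter subgroup separating the exponents, both elements become
   nonzero Laurent polynomials in one variable. *)
Lemma torus_point (u v : R) : u != 0 -> v != 0 -> exists x, ev x u != 0 /\ ev x v != 0.
Proof.
move=> u0 v0; have [s [c [us eu]]] := R_span u; have [s' [c' [us' ev']]] := R_span v.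
have [th1 [th2 [D1 D2 inj]]] := separating_weight (s ++ s').
pose th (t : A * A) := th1 t.1 + th2 t.2.
pose M0 := (\sum_(t <- s ++ s') absz (th t))%N.
pose e t := absz (th t + M0%:Z).
have eE t : t \in s ++ s' -> (e t)%:Z = th t + M0%:Z.
  move=> ts; rewrite /e gez0_abs //.
  have : (`|th t| <= M0)%N by rewrite /M0 (big_rem t) //= leq_addr.
  by have := lez_abs (- th t); rewrite abszN; lia.
pose p (r : seq (A * A)) (d : A * A -> K) : {poly K} := \sum_(t <- r) d t *: 'X^(e t).
have pn r d w : uniq r -> {subset r <= s ++ s'} -> w = \sum_(t <- r) cst (d t) * mon t.1 t.2 -> w != 0 -> p r d != 0.
  move=> ur sub ew w0; apply: contraNneq w0 => pz; rewrite ew big_seq big1 // => t tr.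
  have := congr1 (fun q : {poly K} => q`_(e t)) pz; rewrite coef0 coef_sum (bigD1_seq t) //= big_seq_cond big1 ?addr0.
    by rewrite coefZ coefXn eqxx mulr1 => ->; rewrite raddf0 mul0r.
  move=> t' /andP[t'r ne]; rewrite coefZ coefXn (_ : _ == _ = false) ?mulr0 //.
  apply/negbTE; apply: contraNneq ne => et; apply/eqP; apply: inj; try exact: sub.
  have := congr1 Posz et; rewrite !eE; try exact: sub.
  by rewrite /th => /addIr ->.
have s1 : {subset s <= s ++ s'} by move=> t; rewrite mem_cat => ->.
have s2 : {subset s' <= s ++ s'} by move=> t; rewrite mem_cat => ->; rewrite orbT.
have [z z0] := generic_point (mulf_neq0 (pn _ _ _ us s1 eu u0) (pn _ _ _ us' s2 ev' v0)).
rewrite hornerM mulf_eq0 negb_or => /andP[g1 g2].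
pose x := Chpt (chrpz D1 z0) (chrpz D2 z0).
have hx r d w : {subset r <= s ++ s'} -> w = \sum_(t <- r) cst (d t) * mon t.1 t.2 -> (p r d).[z] = z ^+ M0 * ev x w.
  move=> sub ->; rewrite ev_span /p horner_sum mulr_sumr big_seq [RHS]big_seq; apply: eq_bigr => t tr.
  rewrite !hornerE exprnP eE; last exact: sub.
  by rewrite /th !expfzDr // -exprnP /x /=; ring.
exists x; split.
  by apply: contraNneq g1 => e0; rewrite (hx _ _ _ s1 eu) e0 mulr0.
by apply: contraNneq g2 => e0; rewrite (hx _ _ _ s2 ev') e0 mulr0.
Qed.

Lemma R_faithful (u : R) : (forall x, ev x u = 0) -> u = 0.
Proof.
move=> h; apply/eqP; apply/negPn/negP => nz; have [x [n0 _]] := torus_point nz nz.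
by rewrite h eqxx in n0.
Qed.

Section Hyperplane.
Variables (b : A) (c : K) (w : A -> int).
Hypothesis c0 : c != 0.
Hypothesis wD : forall a a', w (a + a') = w a + w a'.
Hypothesis wb : w b = 1.

Definition ff : R := mon 0 b - cst c * mon b 0.
Definition onH (x : chpt) := cl x b = c * ck x b.

Lemma ev_ff x : ev x ff = cl x b - c * ck x b.
Proof. by rewrite /ff rmorphB /= rmorphM /= !ev_mon ev_cst (chrp0 (ckP x)) (chrp0 (clP x)) mul1r mulr1. Qed.
Lemma onHP x : onH x <-> ev x ff = 0.
Proof. by rewrite ev_ff; split=> [->|/subr0_eq //]; rewrite subrr. Qed.

(** Since w b = 1, multiplying [cl] by g^w for a suitable g moves the point onto the hyperplane
    without changing values on the kernel of [w]. *)
Lemma onH_proj x : exists y, onH y /\ (ck y = ck x) /\ forall a, w a = 0 -> cl y a = cl x a.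
Proof.
pose g := (cl x b)^-1 * (c * ck x b).
have g0 : g != 0.
  by rewrite !mulf_neq0 ?invr_eq0 //; [case: (clP x) | case: (ckP x)].
exists (Chpt (ckP x) (chrpM (clP x) (chrpz wD g0))); split; last first.
  by split=> // a /= ->; rewrite expr0z mulr1.
by rewrite /onH /= wb expr1z /g mulVKf //; case: (clP x).
Qed.

Lemma ff_pow (n : int) : exists z, mon 0 (b *~ n) = cst (c ^ n) * mon (b *~ n) 0 + z * ff.
Proof.
have pos k : exists z, mon 0 (b *+ k) = cst (c ^+ k) * mon (b *+ k) 0 + z * ff.
  elim: k => [|k [z IH]]; first by exists 0; rewrite mul0r addr0 rmorph1 mul1r.
  exists (mon 0 b * z + cst (c ^+ k) * mon (b *+ k) 0).
  have e1 : mon 0 (b *+ k.+1) = mon 0 b * mon 0 (b *+ k) by rewrite monM addr0 mulrS.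
  have e2 : mon (b *+ k.+1) 0 = mon b 0 * mon (b *+ k) 0 by rewrite monM addr0 mulrS.
  rewrite e1 IH e2 exprS rmorphM /= /ff.
  by ring.
case: n => k; first by have [z h] := pos k; exists z; rewrite -pmulrn.
have [z h] := pos k.+1; rewrite NegzE !mulrNz -!pmulrn.
have ce : cst (c ^ (- (k.+1)%:Z)) * cst (c ^+ k.+1) = 1.
  by rewrite -rmorphM /= -exprnN mulVf ?expf_neq0 // rmorph1.
have m1 : mon 0 (- (b *+ k.+1)) * mon 0 (b *+ k.+1) = 1 by rewrite monM addr0 addNr mon0.
have m2 : mon (- (b *+ k.+1)) 0 * mon (b *+ k.+1) 0 = 1 by rewrite monM addr0 addNr mon0.
exists (- (cst (c ^ (- (k.+1)%:Z)) * mon (- (b *+ k.+1)) 0 * mon 0 (- (b *+ k.+1)) * z)).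
move: ce m1 m2 h; set c' := cst _; set cc := cst _; set l' := mon 0 (- _); set l1 := mon 0 (b *+ _).
set k' := mon (- _) 0; set k1 := mon (b *+ _) 0 => ce m1 m2 h.
have : c' * k' * l' * (l1 - cc * k1 - z * ff) = 0 by rewrite h; ring.
have -> : c' * k' * l' * (l1 - cc * k1 - z * ff) = c' * k' * (l' * l1) - (c' * cc) * (k' * k1) * l' - c' * k' * l' * z * ff by ring.
by rewrite ce m1 m2 => e; rewrite mulNr -[c' * k']mulr1 -[LHS]addr0 -e; ring.
Qed.

(** Modulo [ff] one may replace L_b by c K_b, so the exponents of L can be brought into the kernel
    of [w], where the projection of [onH_proj] changes nothing. *)
Lemma reduce_mod (u : R) : exists u' z, u = u' + z * ff /\
  forall x y, ck y = ck x -> (forall a, w a = 0 -> cl y a = cl x a) -> ev y u' = ev x u'.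
Proof.
have [s [d [_ ->]]] := R_span u; elim: s => [|t s [u' [z [IH1 IH2]]]].
  by exists 0, 0; rewrite big_nil mul0r addr0; split=> // x y _ _; rewrite !rmorph0.
have [z1 h1] := ff_pow (w t.2).
exists (cst (d t) * (mon t.1 (t.2 - b *~ w t.2) * (cst (c ^ w t.2) * mon (b *~ w t.2) 0)) + u'),
  (cst (d t) * mon t.1 (t.2 - b *~ w t.2) * z1 + z); split.
  rewrite big_cons IH1.
  have -> : mon t.1 t.2 = mon t.1 (t.2 - b *~ w t.2) * mon 0 (b *~ w t.2) by rewrite monM addr0 subrK.
  by rewrite h1; ring.
move=> x y ek el; rewrite !rmorphD /= (IH2 x y ek el) !rmorphM /= !ev_mon !ev_cst ek; congr (_ * _ + _).
rewrite (chrp0 (clP x)) (chrp0 (clP y)) el //.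
by rewrite wD (addfN wD) (addf_mulz wD) wb mul1r subrr.
Qed.

(** The reduced form takes the same value at a point and at its projection onto the hyperplane, so
    it vanishes identically. *)
Lemma ff_div (u : R) : (forall x, onH x -> ev x u = 0) -> exists z, u = z * ff.
Proof.
move=> h; have [u' [z [e inv]]] := reduce_mod u.
exists z; suff u0 : u' = 0 by rewrite e u0 add0r.
apply: R_faithful => x; have [y [hy [ek el]]] := onH_proj x.
rewrite -(inv x y ek el); have := h y hy; rewrite e rmorphD rmorphM /=.
by move/onHP: hy => ->; rewrite mulr0 addr0.
Qed.

(** Irreducibility of the hyperplane. Reduced forms turn the question into one on the whole torus,
    which [torus_point] answers. *)
Lemma onH_irr (u v : R) x1 x2 : onH x1 -> onH x2 -> ev x1 u != 0 -> ev x2 v != 0 ->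
  exists y, [/\ onH y, ev y u != 0 & ev y v != 0].
Proof.
move=> h1 h2 n1 n2; have [u' [z [e inv]]] := reduce_mod u; have [v' [z' [e' inv']]] := reduce_mod v.
have red (p p' q : R) y : p = p' + q * ff -> onH y -> ev y p = ev y p'.
  by move=> -> /onHP hy; rewrite rmorphD rmorphM /= hy mulr0 addr0.
have [||x [m1 m2]] := @torus_point u' v'.
- by apply: contraNneq n1 => z0; rewrite (red _ _ _ _ e h1) z0 rmorph0.
- by apply: contraNneq n2 => z0; rewrite (red _ _ _ _ e' h2) z0 rmorph0.
have [y [hy [ek el]]] := onH_proj x; exists y; split=> //.
  by rewrite (red _ _ _ _ e hy) (inv x y ek el).
by rewrite (red _ _ _ _ e' hy) (inv' x y ek el).
Qed.

Lemma ff_neq0 : ff != 0.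
Proof.
apply/eqP => z.
have b0 : b != 0 by apply: contraTneq isT => e; have := wb; rewrite e (addf0 wD).
have : mon 0 b = cst c * mon b 0 by apply/eqP; rewrite -subr_eq0 -/ff z.
move=> /(congr1 r0v) /= e.
have [[_ fr] _] := gqgP_triangular gq.
have := fr [:: (0, b); (b, 0)] (fun t => if t.1 == 0 then 1 else - c).
rewrite /= inE xpair_eqE negb_and [0 == b]eq_sym b0 /= !big_cons big_nil /= eqxx (negbTE b0) addr0 e.
rewrite scale1r -scalerAl mul1r scaleNr subrr => /(_ isT erefl (0, b)).
by rewrite mem_head /= eqxx => /(_ isT)/eqP; rewrite oner_eq0.
Qed.

End Hyperplane.
End CartanRing.

(** * Matrices over a ring of functions with a prime element *)

Section EvalRing.
Variables (K : fieldType) (R : comNzRingType) (X : Type) (ev : X -> {rmorphism R -> K}).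
Variable iota : {rmorphism K -> R}.
Hypothesis ev_iota : forall x c, ev x (iota c) = c.
Hypothesis dom : forall u v : R, u != 0 -> v != 0 -> exists x, ev x u != 0 /\ ev x v != 0.
Variables (H : X -> Prop) (f : R).
Hypothesis f_neq0 : f != 0.
Hypothesis Hf : forall x, H x -> ev x f = 0.
Hypothesis hdiv : forall u, (forall x, H x -> ev x u = 0) -> exists z, u = z * f.
Hypothesis hirr : forall u v x y, H x -> H y -> ev x u != 0 -> ev y v != 0 ->
  exists z, [/\ H z, ev z u != 0 & ev z v != 0].

Local Notation evm x M := (map_mx (ev x) M).

Lemma fcancel u v : f * u = f * v -> u = v.
Proof.
move=> e; apply/eqP; rewrite -subr_eq0; apply/negPn/negP => nz.
have [x [n1 n2]] := dom f_neq0 nz.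
have : ev x (f * (u - v)) = 0 by rewrite mulrBr e subrr rmorph0.
by rewrite rmorphM => /eqP; rewrite mulf_eq0 (negbTE n1) (negbTE n2).
Qed.

(** The product g D vanishes on [H]; as [H] is irreducible and g does not vanish on it, D does, so
    that [f] divides D. Repeat after cancelling [f]. *)
Lemma prime_cancel k z g D x : H x -> ev x g != 0 -> f ^+ k * z = g * D -> exists z', D = f ^+ k * z'.
Proof.
move=> Hx gx; elim: k z D => [|k IH] z D e; first by exists D; rewrite mul1r.
have [D1 e1] : exists D1, D = D1 * f.
  apply: hdiv => y Hy; apply/eqP; apply/negPn/negP => nz.
  have [w [Hw n1 n2]] := hirr Hx Hy gx nz.
  have := congr1 (ev w) e; rewrite exprS -mulrA !rmorphM /= Hf // mul0r => /esym/eqP.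
  by rewrite mulf_eq0 (negbTE n1) (negbTE n2).
have /IH[z' ez] : f ^+ k * z = g * D1.
  by apply: fcancel; rewrite mulrA -exprS e e1; ring.
by exists z'; rewrite e1 ez exprS; ring.
Qed.

(** Constant base changes bring the value at [x0] to a partial identity. The Schur complement [D] of
    the leading block vanishes at the points of [H] where [d] is nonzero, since the rank there is at
    most p; by irreducibility it vanishes on [H], so it is divisible by [f]. *)
Lemma schur p k (S : 'M[R]_(p + k)) x0 : H x0 -> \rank (evm x0 S) = p ->
  (forall x, H x -> (\rank (evm x S) <= p)%N) ->
  exists (P1 P2 : 'M[R]_(p + k)) (d : R) (D' : 'M[R]_k), [/\ ev x0 (\det P1) != 0,
    ev x0 (\det P2) != 0, ev x0 d != 0 & P1 *m S *m P2 = d *: block_mx 1%:M 0 0 (f *: D')].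
Proof.
move=> Hx0 rk le.
set A := evm x0 S in rk; pose C1 := invmx (col_ebase A); pose C2 := invmx (row_ebase A).
have CA : C1 *m A *m C2 = pid_mx p.
  by rewrite -{1}(mulmx_ebase A) rk /C1 /C2 !mulmxA mulVmx ?col_ebase_unit // mul1mx mulmxK ?row_ebase_unit.
pose S' := map_mx iota C1 *m S *m map_mx iota C2.
have evi x m n (C : 'M[K]_(m, n)) : evm x (map_mx iota C) = C.
  by apply/matrixP => i j; rewrite !mxE ev_iota.
have S'0 : evm x0 S' = pid_mx p by rewrite /S' !map_mxM !evi.
pose a := ulsubmx S'; pose b := ursubmx S'; pose c := dlsubmx S'; pose d' := drsubmx S'.
have eS' : S' = block_mx a b c d' by rewrite submxK.
have a0 : evm x0 a = 1%:M.
  rewrite /a map_ulsubmx S'0; apply/matrixP => i j; rewrite !mxE /=.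
  by rewrite ltn_ord andbT.
pose d := \det a; have d0 : ev x0 d = 1 by rewrite /d -det_map_mx a0 det1.
pose L := block_mx (\adj a) 0 (- (c *m \adj a)) d%:M : 'M[R]_(p + k).
pose G := block_mx 1%:M (- (\adj a *m b)) 0 d%:M : 'M[R]_(p + k).
pose D := d *: d' - c *m \adj a *m b.
have eD : L *m S' *m G = d *: block_mx 1%:M 0 0 D.
  rewrite eS' /L /G !mulmx_block !mul0mx !addr0 !mulmx1 !mulmx0 !addr0 mul_adj_mx -/d.
  rewrite !mulNmx -[c *m \adj a *m a]mulmxA mul_adj_mx -/d !mul_scalar_mx !mul_mx_scalar addNr mul0mx add0r.
  rewrite scale_block_mx !scaler0 scalemx1; congr block_mx.
    by rewrite scalerN addrC subrr.
  by rewrite /D [d *: d' - _]addrC.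
have Dz x : H x -> ev x d != 0 -> evm x D = 0.
  move=> Hx dx; apply/eqP; rewrite -mxrank_eq0.
  have r1 : (\rank (evm x (L *m S' *m G)) <= p)%N.
    rewrite !map_mxM !evi; apply: leq_trans (le x Hx).
    apply: leq_trans (mxrankM_maxl _ _) _; apply: leq_trans (mxrankM_maxr _ _) _.
    by apply: leq_trans (mxrankM_maxl _ _) _; exact: mxrankM_maxr.
  rewrite eD map_mxZ in r1; move: r1.
  rewrite mxrank_scale_nz // map_block_mx map_mx1 !map_mx0 rank_diag_block_mx mxrank1.
  by rewrite -{2}[p]addn0 leq_add2l leqn0.
have [D' eD'] : exists D' : 'M[R]_k, D = f *: D'.
  have h i j : exists z, D i j = z * f.
    apply: hdiv => x Hx; apply/eqP; apply/negPn/negP => nz.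
    have d1 : ev x0 d != 0 by rewrite d0 oner_eq0.
    have [y [Hy n1 n2]] := hirr Hx0 Hx d1 nz.
    by have := congr1 (fun M : 'M_k => M i j) (Dz y Hy n1); rewrite [LHS]mxE [RHS]mxE => /eqP; rewrite (negbTE n2).
  have /choice[z hz] ij := h ij.1 ij.2.
  by exists (\matrix_(i, j) z (i, j)); apply/matrixP => i j; rewrite [LHS](hz (i, j)) !mxE mulrC.
exists (L *m map_mx iota C1), (map_mx iota C2 *m G), d, D'; split.
- rewrite -det_map_mx map_mxM evi det_mulmx mulf_neq0 //; last first.
    by have := col_ebase_unit A; rewrite -unitmx_inv unitmxE unitfE.
  by rewrite /L det_map_mx det_lblock rmorphM /= -det_map_mx map_mx_adj a0 adj1 det1 mul1r det_scalar rmorphXn /= d0 expr1n oner_eq0.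
- rewrite -det_map_mx map_mxM evi det_mulmx mulf_neq0 //.
    by have := row_ebase_unit A; rewrite -unitmx_inv unitmxE unitfE.
  by rewrite /G det_map_mx det_ublock rmorphM /= det1 rmorph1 mul1r det_scalar rmorphXn /= d0 expr1n oner_eq0.
- by rewrite d0 oner_eq0.
- by rewrite -eD' -eD /S' !mulmxA.
Qed.

Lemma det_dvd m p k (e : (p + k)%N = m) (S : 'M[R]_m) x0 : H x0 -> \rank (evm x0 S) = p ->
  (forall x, H x -> (\rank (evm x S) <= p)%N) -> exists z, \det S = f ^+ k * z.
Proof.
case: m / e S => S Hx0 rk le; have [P1 [P2 [d [D' [n1 n2 n3 eq]]]]] := schur Hx0 rk le.
have := congr1 (fun M => \det M) eq; rewrite !det_mulmx detZ det_lblock det1 mul1r detZ => ed.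
apply: (@prime_cancel k (d ^+ (p + k) * \det D') (\det P1 * \det P2) (\det S) x0) => //.
  by rewrite rmorphM mulf_neq0.
by rewrite mulrAC ed; ring.
Qed.

(** [x0] is a point of [H] of largest rank; its corank is the exponent of [f] that [schur] extracts
    from the determinant. *)
Lemma generic_corank m (S : 'M[R]_m) x1 : H x1 -> exists x0 k, [/\ H x0,
  (\rank (evm x0 S) + k)%N = m, forall x, H x -> (\rank (evm x S) <= \rank (evm x0 S))%N &
  exists z, \det S = f ^+ k * z].
Proof.
move=> Hx1; pose Q p := `[< exists2 x, H x & \rank (evm x S) = p >].
have ex : exists p, Q p by exists (\rank (evm x1 S)); apply/asboolP; exists x1.
have bd p : Q p -> (p <= m)%N by move=> /asboolP[x _ <-]; exact: rank_leq_row.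
case: (ex_maxnP ex bd) => p /asboolP[x0 Hx0 rk] mx.
have pm : (p <= m)%N by rewrite -rk rank_leq_row.
have le x : H x -> (\rank (evm x S) <= p)%N by move=> Hx; apply: mx; apply/asboolP; exists x.
exists x0, (m - p)%N; rewrite rk subnKC //; split=> //.
exact: (det_dvd (subnKC pm) Hx0 rk le).
Qed.

End EvalRing.

(** * The Shapovalov form at a point *)

Section Shapovalov.
Variables (K : closedFieldType) (A : zmodType) (U : algType K) (I : finType).
Variables (chi : A -> A -> K) (qk ql : A -> U) (pi : I -> A).
Variables (crd : I -> A -> int) (E F : I -> U).
Hypothesis B : borel chi qk ql pi crd E F.
Let H := b_pb B.
Let H' := pborel_swap H.
Local Notation Nm := (Gen pi F).
Local Notation Np := (Gen pi E).
Local Notation psi := (sval (cid (separating_functional (h_one H)))).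

Lemma psi_lin c u v : psi (c *: u + v) = c * psi u + psi v.
Proof. by case: (svalP (cid (separating_functional (h_one H)))) => ->. Qed.
Lemma psi1 : psi 1 = 1.
Proof. by case: (svalP (cid (separating_functional (h_one H)))). Qed.
Lemma psi0 : psi 0 = 0.
Proof. by have := psi_lin (-1) 0 0; rewrite scaler0 addr0 mulN1r addNr. Qed.
Lemma psi_sum (J : Type) (r : seq J) (c : J -> K) (v : J -> U) :
  psi (\sum_(j <- r) c j *: v j) = \sum_(j <- r) c j * psi (v j).
Proof. by elim/big_rec2: _ => [|j x y _ <-]; rewrite ?psi0 ?psi_lin. Qed.
Lemma psi_deg0 y : Nm 0 y -> y = psi y *: 1.
Proof.
by move=> h; have [c ->] := Nm_deg0 H h erefl; rewrite -{2}[c *: 1]addr0 psi_lin psi0 addr0 psi1 mulr1.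
Qed.

Lemma V_NpN kk ll (kkP : chrp kk) (llP : chrp ll) nu x mu y : Np nu x -> Nm mu y -> Nm (mu - nu) (V B kk ll (x * y)).
Proof.
move=> hx hy; elim: hx => [|a|j a z _ IH|a c z w _ IHz _ IHw].
- by rewrite mul1r subr0 (V_Gen _ kkP llP hy).
- by rewrite mul0r V0; exact: Gen0.
- by rewrite -mulrA -(V_V _ kkP llP); apply: Gen_eq (V_Ej _ kkP llP j IH) _; lattice H.
- by rewrite mulrDl -scalerAl V_lin; exact: GenD.
Qed.

Lemma psiV_sum kk ll (J : Type) (r : seq J) (c : J -> K) (u : J -> U) :
  psi (V B kk ll (\sum_(j <- r) c j *: u j)) = \sum_(j <- r) c j * psi (V B kk ll (u j)).
Proof. by rewrite V_sum -psi_sum; congr (psi _); apply: eq_bigr => j _; rewrite VZ. Qed.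

Section Point.
Variables kk ll : A -> K.
Hypothesis kkP : chrp kk.
Hypothesis llP : chrp ll.
Local Notation Vs := (V B).
Local Notation V := (V B kk ll).

Variables (sb : A) (y : U).
Hypothesis y_sing : sing qk ql pi E F kk ll sb y.
Definition sk a := kk a * (chi a sb)^-1.
Definition sl a := ll a * chi sb a.

Lemma V_sing_E nu x v : Np nu x -> nu != 0 -> V (v * (x * y)) = 0.
Proof.
have hy : Nm sb y by case: y_sing.
have sE := proj1 (singP B kkP llP hy) y_sing.
move=> h; elim/(@Gen_rind K A U): h v => [v|a v _|j a z hz _ v _|a c z w _ _ IHz IHw v nz].
- by rewrite eqxx.
- by rewrite mul0r mulr0 V0.
- by rewrite -mulrA mulrA -(V_V _ kkP llP) sE mulr0 V0.
- by rewrite mulrDl mulrDr -scalerAl -scalerAr V_lin IHz // IHw // scaler0 addr0.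
Qed.

(** Right multiplication by a singular vector is a homomorphism from the Verma module with the
    shifted characters [sk], [sl]. *)
Lemma V_shift u : V (u * y) = Vs sk sl u * y.
Proof.
have hy : Nm sb y by case: y_sing.
elim/(V_ind B kk ll): u => [|u v IHu IHv|nu a b rho z x hz hx].
- by rewrite mul0r !V0 mul0r.
- by rewrite mulrDl !VD IHu IHv mulrDl.
rewrite (V_term B sk sl a b hz hx).
case: (eqVneq rho 0) => [e0|nz]; last first.
  have -> : z * (qk a * ql b) * x * y = z * (qk a * ql b) * (x * y) by rewrite -mulrA.
  have -> : veps B rho x = 0 by rewrite /veps (negbTE nz).
  by rewrite mulr0 scale0r mul0r (V_sing_E _ hx nz).
have [c ec] := Nm_deg0 H' hx e0.
have -> : veps B rho x = c.
  by rewrite ec e0 -[c *: 1]addr0 veps_lin veps1 veps0 mulr1 addr0.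
have -> : z * (qk a * ql b) * x * y = c *: (z * (qk a * (ql b * y))).
  by rewrite ec -scalerAr mulr1 -scalerAl !mulrA.
rewrite (GL H b hy) -scalerAr [qk a * _]mulrA (GK H a hy) -!scalerAl -!scalerAr !VZ.
rewrite (V_GenM _ _ _ _ hz) (V_L B kk llP) (V_K B ll kkP) (V_Gen _ kkP llP hy) -?scalerAr !scalerA.
by congr (_ *: _); rewrite /sk /sl; ring.
Qed.

(* The submodule generated by a singular vector lies in the radical, and a
   combination that vanishes in it lies in the radical of the shifted form. *)
Lemma rank_singular lam m m' (X Y : 'I_m -> U) (X' Y' : 'I_m' -> U) :
  y != 0 -> sb != 0 -> (forall j, 0 <= crd j sb) ->
  (forall i, Np lam (X i)) -> fbasis (Nm lam) Y ->
  (forall i, Np (lam - sb) (X' i)) -> (forall i, Nm (lam - sb) (Y' i)) ->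
  (\rank (\matrix_(i, j) psi (V (X i * Y j))) +
   \rank (\matrix_(i, j) psi (Vs sk sl (X' i * Y' j))) <= m)%N.
Proof.
move=> y0 sb0 sbc hX [Y1 Y2 Y3] hX' hY'.
have hy : Nm sb y by case: y_sing.
have hYy k : Nm lam (Y' k * y) by apply: Gen_eq (Gen_mul (hY' k) hy) _; rewrite subrK.
have /choice[n hn] k := Y3 _ (hYy k).
set S := \matrix_(i, j) _; set S' := \matrix_(i, j) _.
pose N : 'M[K]_(m', m) := \matrix_(k, j) n k j.
have SN : S *m N^T = 0.
  apply/matrixP => i k; rewrite !mxE (eq_bigr (fun j => n k j * psi (V (X i * Y j)))).
    have -> : \sum_j n k j * psi (V (X i * Y j)) = psi (V (X i * (Y' k * y))).
      by rewrite hn mulr_sumr -psiV_sum; congr (psi (V _)); apply: eq_bigr => j _; rewrite scalerAr.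
    rewrite mulrA V_shift.
    have z : Nm (- sb) (Vs sk sl (X i * Y' k)).
      have skP : chrp sk by exact: chrpM kkP (chrpV (chrp_chir B sb)).
      have slP : chrp sl by exact: chrpM llP (chrp_chil B sb).
      have h := V_NpN skP slP (hX i) (hY' k).
      by apply: Gen_eq h _; lattice H.
    have [j hj] : exists j, 0 < crd j sb.
      apply: contrapT => ne; case/eqP: sb0; apply: (crd_inj H) => j; rewrite (crd0 H); apply/eqP.
      rewrite eq_le sbc andbT leNgt; apply/negP => lt; apply: ne; by exists j.
    by rewrite (Nm_out H (i := j) z) ?mul0r ?psi0 // (crdN H) oppr_lt0.
  by move=> j _; rewrite !mxE mulrC.
have rN : (\rank S' <= \rank N)%N.
  have sub : (kermx N <= kermx S'^T)%MS.
    apply/rV_subP => v /sub_kermxP vN; apply/sub_kermxP; apply/rowP => i; rewrite !mxE.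
    have vy : (\sum_k v 0 k *: Y' k) * y = 0.
      rewrite mulr_suml (eq_bigr (fun k => \sum_j (v 0 k * n k j) *: Y j)); last first.
        by move=> k _; rewrite -scalerAl hn scaler_sumr; apply: eq_bigr => j _; rewrite scalerA.
      rewrite exchange_big big1 //= => j _; rewrite -scaler_suml.
      have := congr1 (fun w : 'rV_m => w 0 j) vN; rewrite !mxE => e.
      by rewrite (eq_bigr (fun k => v 0 k * N k j)) ?e ?scale0r // => k _; rewrite mxE.
    rewrite (eq_bigr (fun k => v 0 k * psi (Vs sk sl (X' i * Y' k)))); last by move=> k _; rewrite !mxE.
    set Z := \sum_k _ in vy.
    have -> : \sum_k v 0 k * psi (Vs sk sl (X' i * Y' k)) = psi (Vs sk sl (X' i * Z)).
      by rewrite mulr_sumr -psiV_sum; congr (psi (Vs sk sl _)); apply: eq_bigr => k _; rewrite scalerAr.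
    have skP : chrp sk by exact: chrpM kkP (chrpV (chrp_chir B sb)).
    have slP : chrp sl by exact: chrpM llP (chrp_chil B sb).
    have hZ : Nm (lam - sb) Z by apply: Gen_sum => k _; exact: GenZ.
    have h0 := V_NpN skP slP (hX' i) hZ; rewrite subrr in h0.
    have := V_shift (X' i * Z); rewrite -mulrA vy mulr0 V0 (psi_deg0 h0) -scalerAl mul1r => /esym/eqP.
    by rewrite scaler_eq0 (negbTE y0) orbF => /eqP ->; rewrite -[0 *: 1]addr0 psi_lin psi0 mul0r addr0.
  have := mxrankS sub; rewrite !mxrank_ker mxrank_tr; have := rank_leq_row N; have := rank_leq_col S'.
  by move: (\rank N) (\rank S') => a b; lia.
apply: leq_trans (leq_add (leqnn _) rN) _.
by rewrite -(mxrank_tr N); have := mulmx0_rank_max SN.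
Qed.

End Point.

Local Notation VT T := (V B (fun=> 1) (fun a => T ^ hgt crd a)).

Lemma chrp_one : chrp (fun _ : A => 1 : K).
Proof. by split=> [a|a b]; rewrite ?oner_eq0 ?mulr1. Qed.
Lemma chrp_hgt (T : K) : T != 0 -> chrp (fun a => T ^ hgt crd a).
Proof. exact: (chrpz (hgtD H)). Qed.

Lemma VT_step T x j mu y y1 y2 : T != 0 -> der qk ql pi E F j mu y y1 y2 ->
  psi (VT T (x * E j * y)) = psi (VT T (x * y1)) + T * psi (VT T (x * y2)).
Proof.
move=> T0 d; rewrite -mulrA -(V_V B chrp_one (chrp_hgt T0)) (V_der B chrp_one (chrp_hgt T0) d).
by rewrite scale1r (hgt_pi H) expr1z mulrDr -scalerAr [x * y1 + _]addrC V_lin psi_lin addrC.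
Qed.

(** Along the characters (1, T^height) each letter E_j yields the first derivative plus T times the
    second ([VT_step]), so the degree in T is at most the number of letters. *)
Lemma poly_rep nu X : Np nu X -> forall y n, Nm nu y -> hgt crd nu <= n%:Z ->
  exists p : {poly K}, (size p <= n.+1)%N /\ forall T, T != 0 -> psi (VT T (X * y)) = p.[T].
Proof.
move=> h; elim/(@Gen_rind K A U): h => [y n hy _|a y n _ _|j a x hx IH y n hy hn|a c x z _ _ IHx IHz y n hy hn].
- exists (psi y)%:P; split; first by apply: leq_trans (size_polyC_leq1 _) _.
  by move=> T T0; rewrite mul1r (V_Gen B chrp_one (chrp_hgt T0) hy) hornerC.
- by exists 0; rewrite size_poly0; split=> // T T0; rewrite mul0r V0 psi0 horner0.
- have [x0|xn] := eqVneq x 0.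
    by exists 0; rewrite size_poly0; split=> // T T0; rewrite x0 !mul0r V0 psi0 horner0.
  have a0 : 0 <= hgt crd a by rewrite sumr_ge0 // => i _; exact: (Nm_cone H' hx xn).
  rewrite (hgtD H) (hgt_pi H) in hn.
  case: n hn => [|n] hn; first by exfalso; lia.
  have hn' : hgt crd a <= n%:Z by lia.
  have [y1 [y2 d]] := der_ex H j hy; have [h1 h2 _] := d; rewrite addrK in h1 h2.
  have [p1 [s1 e1]] := IH y1 n h1 hn'; have [p2 [s2 e2]] := IH y2 n h2 hn'.
  exists (p1 + p2 * 'X); split.
    apply: leq_trans (size_polyD _ _) _; rewrite geq_max (leq_trans s1) //=.
    by apply: leq_trans (size_mul_leq _ _) _; rewrite size_polyX addn2.
  by move=> T T0; rewrite (VT_step _ T0 d) e1 // e2 // !hornerE mulrC.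
- have [p1 [s1 e1]] := IHx y n hy hn; have [p2 [s2 e2]] := IHz y n hy hn.
  exists (c *: p1 + p2); split.
    apply: leq_trans (size_polyD _ _) _; rewrite geq_max s2 andbT.
    exact: leq_trans (size_scale_leq _ _) s1.
  by move=> T T0; rewrite mulrDl -scalerAl V_lin psi_lin e1 // e2 // !hornerE.
Qed.

(** At T = 0 only first derivatives are left. By [strong_ndF] one of those of [y] is nonzero, and
    induction on it supplies the rest of the element [X]. *)
Lemma poly_nondeg n mu y : hgt crd mu <= n%:Z -> Nm mu y -> y != 0 ->
  exists X (p : {poly K}), [/\ Np mu X, forall T, T != 0 -> psi (VT T (X * y)) = p.[T] & p.[0] != 0].
Proof.
elim: n mu y => [|n IH] mu y hn hy y0; (have [m0|mn] := eqVneq mu 0; [exists 1, (psi y)%:P; split;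
  [by rewrite m0; exact: Gen1|by move=> T T0; rewrite mul1r (V_Gen B chrp_one (chrp_hgt T0) hy) hornerC
  |by rewrite hornerC; apply: contraNneq y0 => e; rewrite m0 in hy; rewrite (psi_deg0 hy) e scale0r] |]).
  by have := hgt_gt0 H (Nm_cone H hy y0) mn; lia.
have [j [y1 [y2 [d n1]]]] : exists j y1 y2, der qk ql pi E F j mu y y1 y2 /\ y1 != 0.
  apply: contrapT => ne; case/eqP: y0; apply: (strong_ndF H hn hy mn) => j y1 y2 d.
  by apply/eqP; apply/negPn/negP => nz; apply: ne; exists j, y1, y2.
have [h1 h2 _] := d.
have hn' : hgt crd (mu - pi j) <= n%:Z by rewrite (hgtB H) (hgt_pi H); lia.
have [X [p1 [hX e1 p10]]] := IH _ _ hn' h1 n1.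
have [p2 [_ e2]] := poly_rep hX h2 hn'.
exists (X * E j), (p1 + p2 * 'X); split.
- have := Gen_mul hX (GenM j (Gen1 pi E)); rewrite mulr1 addr0 => h; apply: Gen_eq h _; by rewrite subrK.
- by move=> T T0; rewrite (VT_step _ T0 d) e1 // e2 // !hornerE mulrC.
- by rewrite !hornerE ?mulr0 ?addr0.
Qed.

Lemma size_det_leq (m n : nat) (Q : 'M[{poly K}]_m) : (forall i j, (size (Q i j) <= n.+1)%N) ->
  (size (\det Q) <= (m * n).+1)%N.
Proof.
move=> hQ; rewrite /determinant; apply: leq_trans (size_sum _ _ _) _; apply/bigmax_leqP => s _.
rewrite -signr_odd size_Msign; apply: leq_trans (size_poly_prod_leq _ _) _.
rewrite leq_subLR (_ : #|_| = m); last by rewrite -[RHS]card_ord; apply: eq_card.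
apply: (@leq_trans (\sum_(i < m) n.+1).+1).
  by rewrite ltnS; apply: leq_sum => i _; exact: hQ.
by rewrite sum_nat_const card_ord; lia.
Qed.

(** A kernel vector of the matrix at T = 0 would give a nonzero [y] contradicting [poly_nondeg]. *)
Lemma shapovalov_poly lam m n (X Y : 'I_m -> U) : fbasis (Np lam) X -> fbasis (Nm lam) Y ->
  hgt crd lam <= n%:Z -> exists p : {poly K}, [/\ (size p <= (m * n).+1)%N, p.[0] != 0 &
    forall T, T != 0 -> \det (\matrix_(i, j) psi (VT T (X i * Y j))) = p.[T]].
Proof.
move=> [X1 X2 X3] [Y1 Y2 Y3] hn.
have /choice[q hq] (ij : 'I_m * 'I_m) := poly_rep (X1 ij.1) (Y1 ij.2) hn.
pose Q : 'M[{poly K}]_m := \matrix_(i, j) q (i, j).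
have hor T : (\det Q).[T] = \det (map_mx (horner_eval T) Q) by rewrite det_map_mx.
exists (\det Q); split.
- by apply: size_det_leq => i j; rewrite mxE; case: (hq (i, j)).
- rewrite hor -det_tr; apply/negP => /det0P[v v0 ev].
  pose y := \sum_j v 0 j *: Y j.
  have hy : Nm lam y by apply: Gen_sum => j _; exact: GenZ.
  have y0 : y != 0.
    apply: contraNneq v0 => e; apply/eqP/rowP => j; rewrite mxE; exact: (Y2 (fun j => v 0 j)).
  have [x [p [hx ep p0]]] := poly_nondeg hn hy y0.
  have [a ea] := X3 _ hx.
  pose P' := \sum_i a i *: \sum_j v 0 j *: Q i j.
  have hP T : T != 0 -> p.[T] = P'.[T].
    move=> T0; rewrite -ep // ea mulr_suml (eq_bigr (fun i => a i *: (X i * y))); last first.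
      by move=> i _; rewrite scalerAl.
    rewrite psiV_sum /P' horner_sum; apply: eq_bigr => i _; rewrite hornerZ; congr (_ * _).
    rewrite /y mulr_sumr (eq_bigr (fun j => v 0 j *: (X i * Y j))); last by move=> j _; rewrite scalerAr.
    rewrite psiV_sum horner_sum; apply: eq_bigr => j _; rewrite hornerZ mxE.
    by have [_ ->] := hq (i, j).
  have eP : p = P'.
    apply/eqP; rewrite -subr_eq0; apply/negPn/negP => /generic_point[T T0].
    by rewrite hornerD hornerN hP // subrr eqxx.
  move: p0; rewrite eP /P' horner_sum big1 ?eqxx // => i _; rewrite hornerZ horner_sum.
  have := congr1 (fun w : 'rV_m => w 0 i) ev; rewrite !mxE => e.
  rewrite (_ : \sum_j _ = 0) ?mulr0 // -[RHS]e; apply: eq_bigr => j _.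
  by rewrite hornerZ !mxE.
- move=> T T0; rewrite hor; congr (\det _); apply/matrixP => i j; rewrite !mxE /horner_eval.
  by have [_ ->] := hq (i, j).
Qed.
End Shapovalov.

(** * Factorisation of the Shapovalov determinant *)

Lemma qfact_prefix (K : fieldType) (x : K) s k : (s <= k)%N -> qfact x k != 0 -> qfact x s != 0.
Proof.
move=> le; rewrite /qfact (@big_cat_nat _ _ _ s.+1) //=.
by rewrite mulf_eq0 negb_or => /andP[].
Qed.

Lemma qfact_root (K : fieldType) (x : K) n k : x != 1 -> x ^+ n = 1 -> (0 < n <= k)%N -> qfact x k = 0.
Proof.
move=> x1 xn /andP[n0 nk]; apply/eqP; rewrite /qfact prodf_seq_eq0; apply/hasP; exists n.
  by rewrite mem_index_iota ltnS n0.
rewrite /qnum big_add1 /= big_mkord; have := subrX1 x n; rewrite xn subrr => /esym/eqP.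
by rewrite mulf_eq0 subr_eq0 (negbTE x1).
Qed.

Lemma rank_minor (K : fieldType) m (M : 'M[K]_m) :
  exists (C : 'M_(\rank M, m)) (D : 'M_(m, \rank M)), C *m M *m D = 1%:M.
Proof.
exists (pinvmx (col_base M)), (pinvmx (row_base M)).
suff h N : N = col_base M *m row_base M -> pinvmx (col_base M) *m N *m pinvmx (row_base M) = 1%:M.
  by apply: h; rewrite mulmx_base.
by move=> ->; rewrite mulmxA mulVpmx ?col_base_full // mul1mx mulmxVp ?row_base_free.
Qed.

Lemma minor_rank (K : fieldType) n m (C : 'M[K]_(n, m)) (M : 'M_m) (D : 'M_(m, n)) :
  \det (C *m M *m D) != 0 -> (n <= \rank M)%N.
Proof.
move=> h; have : C *m M *m D \in unitmx by rewrite unitmxE unitfE.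
by move/mxrank_unit => {1}<-; apply: leq_trans (mxrankM_maxl _ _) (mxrankM_maxr _ _).
Qed.

Lemma size_prod_binom (K : fieldType) (T : eqType) (l : seq T) (e h : T -> nat) (c : T -> K) :
  (forall p, p \in l -> (0 < h p)%N) ->
  size (\prod_(p <- l) ('X^(h p) - (c p)%:P) ^+ e p) = (\sum_(p <- l) e p * h p).+1.
Proof.
elim: l => [|p l IH] hl; first by rewrite !big_nil size_poly1.
have hp := hl p (mem_head _ _).
have m1 : 'X^(h p) - (c p)%:P \is monic by rewrite monicXnsubC.
have n1 := monic_neq0 (monic_exp (e p) m1).
have {}IH : size (\prod_(p <- l) ('X^(h p) - (c p)%:P) ^+ e p) = (\sum_(p <- l) e p * h p).+1.
  by apply: IH => q ql; apply: hl; rewrite inE ql orbT.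
have n2 : \prod_(p <- l) ('X^(h p) - (c p)%:P) ^+ e p != 0 by rewrite -size_poly_gt0 IH.
rewrite !big_cons size_mul // IH addnS /=.
have := size_exp ('X^(h p) - (c p)%:P) (e p); rewrite size_XnsubC //=.
have : (0 < size (('X^(h p) - (c p)%:P) ^+ e p))%N by rewrite size_poly_gt0.
by move: (size _) => a; rewrite [(h p * _)%N]mulnC; lia.
Qed.

Lemma rank_arith (ct k m m' c r0 r1 ry rs : nat) : (r0 + k)%N = m -> (m' <= r1 + c)%N ->
  (r0 <= ry)%N -> (r1 <= rs)%N -> (ry + rs <= m)%N -> (ct + c <= m')%N -> (ct <= k)%N.
Proof. lia. Qed.

Section ShapovalovDet.
Variables (K : closedFieldType) (I : finType) (A : zmodType) (pi : I -> A) (chi : A -> A -> K).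
Variable U : gqgData K I A.
Variable crd : I -> A -> int.
Hypothesis crdD : forall i a b, crd i (a + b) = crd i a + crd i b.
Hypothesis crdpi : forall i j, crd i (pi j) = (i == j)%:Z.
Hypothesis crdE : forall a, a = \sum_i pi i *~ crd i a.
Hypothesis chiP : bihom chi.
Hypothesis gq : is_gqg pi chi U.
Let B := g_borel crdD crdpi crdE chiP gq.
Let H := b_pb B.
Let H' := pborel_swap H.
Local Notation R := (R0 gq).
Local Notation Nm := (Gen pi (qF U)).
Local Notation Np := (Gen pi (qE U)).
Local Notation psi := (sval (cid (separating_functional (h_one H)))).
Local Notation chpt := (chpt K A).
Definition evr (x : chpt) : {rmorphism R -> K} := ev crdD crdpi crdE chiP x.

Lemma ev_ext x y u : (forall a, ck x a = ck y a) -> (forall a, cl x a = cl y a) -> evr x u = evr y u.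
Proof.
move=> e1 e2; have [s [c [_ ->]]] := R_span u; rewrite /evr /= !ev_span.
by apply: eq_bigr => t _; rewrite e1 e2.
Qed.

Definition shp (x : chpt) sb : chpt :=
  Chpt (chrpM (ckP x) (chrpV (chrp_chir B sb))) (chrpM (clP x) (chrp_chil B sb)).
Definition unshp (x : chpt) sb : chpt :=
  Chpt (chrpM (ckP x) (chrp_chir B sb)) (chrpM (clP x) (chrpV (chrp_chil B sb))).
Lemma shpK x sb u : evr (shp (unshp x sb) sb) u = evr x u.
Proof. by apply: ev_ext => a /=; rewrite ?mulfK ?mulfVK //; exact: (chi_nz H). Qed.

Lemma ev_shift sb v : exists v', forall x, evr x v' = evr (shp x sb) v.
Proof.
have [s [c [_ ->]]] := R_span v.
exists (\sum_(t <- s) cst gq (c t * ((chi t.1 sb)^-1 * chi sb t.2)) * mon gq t.1 t.2) => x.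
rewrite /evr /= (ev_span crdD crdpi crdE chiP gq x s (fun t => c t * ((chi t.1 sb)^-1 * chi sb t.2))) ev_span.
by apply: eq_bigr => t _ /=; ring.
Qed.

(** A sum of triangular products of one fixed degree, on which [Sh] can be computed term by term. *)
Inductive dsp (d : A) : U -> Prop :=
| dsp0 : dsp d 0
| dspD mu nu a b z x u : Nm mu z -> Np nu x -> mu - nu = d -> dsp d u ->
    dsp d (z * (qK U a * qL U b) * x + u).

Lemma dsp_add d u v : dsp d u -> dsp d v -> dsp d (u + v).
Proof.
by elim=> [|mu nu a b z x w hz hx e _ IH] hv; rewrite ?add0r // -addrA; apply: dspD hz hx e _; exact: IH.
Qed.
Lemma dspZ d c u : dsp d u -> dsp d (c *: u).
Proof.
elim=> [|mu nu a b z x w hz hx e _ IH]; first by rewrite scaler0; exact: dsp0.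
by rewrite scalerDr !scalerAl; apply: dspD (GenZ c hz) hx e IH.
Qed.
Lemma dsp1 d mu nu a b z x : Nm mu z -> Np nu x -> mu - nu = d -> dsp d (z * (qK U a * qL U b) * x).
Proof. by move=> hz hx e; rewrite -[_ * x]addr0; apply: dspD hz hx e (dsp0 d). Qed.

Lemma dsp_E j d u : dsp d u -> dsp (d - pi j) (qE U j * u).
Proof.
have [_ _ kk ll kl] := gqgP_cartan gq; have [kE lE _ _ _] := gqgP_root gq.
have [chi0 _ _] := chiP.
elim=> [|mu nu a b z x w hz hx e _ IH]; first by rewrite mulr0; exact: dsp0.
have [y1 [y2 [h1 h2 ed]]] := der_ex H j hz.
rewrite mulrDr; apply: dsp_add => //.
have -> : qE U j * (z * (qK U a * qL U b) * x) =
    ((chi a (pi j))^-1 * (chi (- pi j) b)^-1) *: (z * (qK U a * qL U b) * (qE U j * x)) +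
    (y1 * (qK U (pi j + a) * qL U b) * x + y2 * (qK U a * qL U (pi j + b)) * x).
  have eKL : qE U j * (qK U a * qL U b) = ((chi a (pi j))^-1 * (chi (- pi j) b)^-1) *: (qK U a * qL U b * qE U j).
    rewrite -[qK U a * qL U b * _]mulrA lE -scalerAr [qK U a * (qE U j * _)]mulrA kE -!scalerAl !scalerA.
    by rewrite (mulfVK (chi0 _ _)) mulVf ?chi0 // scale1r mulrA.
  rewrite !mulrA ed !mulrDl; congr (_ + _).
    have -> : z * qE U j * qK U a * qL U b * x = z * (qE U j * (qK U a * qL U b)) * x by rewrite !mulrA.
    by rewrite eKL -scalerAr -scalerAl !mulrA.
  congr (_ + _); first by rewrite -kk !mulrA.
  by rewrite -ll -[y2 * _ * qK U a]mulrA -kl !mulrA.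
apply: dsp_add; last apply: dsp_add.
- by apply: dspZ; apply: dsp1 hz (GenM j hx) _; rewrite -e opprD addrA addrAC.
- by apply: dsp1 h1 hx _; rewrite -e addrAC.
- by apply: dsp1 h2 hx _; rewrite -e addrAC.
Qed.

Lemma dsp_mul nu x mu y : Np nu x -> Nm mu y -> dsp (mu - nu) (x * y).
Proof.
move=> hx hy; elim: hx => [|a|j a z _ IH|a c z w _ IHz _ IHw].
- rewrite mul1r; have := dsp1 0 0 hy (Gen1 pi (qE U)) (erefl (mu - 0)).
  by have [-> -> _ _ _] := gqgP_cartan gq; rewrite !mulr1.
- by rewrite mul0r; exact: dsp0.
- by rewrite -mulrA opprD addrA addrAC; exact: dsp_E.
- by rewrite mulrDl -scalerAl; apply: dsp_add => //; exact: dspZ.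
Qed.

Variable Sh : {linear U -> U}.
Hypothesis ShP : is_Sh pi Sh.

(** Both sides kill the triangular products whose positive part has nonzero degree, and in total
    degree zero the others lie in U^0. *)
Lemma psi_Sh (x : chpt) u : dsp 0 u -> psi (V B (ck x) (cl x) (Sh u)) = psi (V B (ck x) (cl x) u).
Proof.
have [Sh1 Sh2 Sh3] := ShP.
elim=> [|mu nu a b z y w hz hy e _ IH]; first by rewrite linear0.
rewrite linearD !VD -[V B _ _ (Sh (z * _ * y))]scale1r (psi_lin B) -[in RHS](scale1r (V B _ _ (_ * y))) (psi_lin B) IH.
congr (_ * _ + _); move/subr0_eq: e => e.
have U0KL : U0 U (qK U a * qL U b) by apply: subalg_gen; exists a, b.
have [n0|nn] := eqVneq nu 0.
  have [c ->] := Nm_deg0 H hz (etrans e n0); have [c' ->] := Nm_deg0 H' hy n0.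
  rewrite Sh2 // -scalerAr -!scalerAl mul1r mulr1.
  have [[S0 SD] _ _] := subalg_subalg [set u : U | exists a b, u = qK U a * qL U b]%classic.
  have Z k v : U0 U v -> U0 U (k *: v) by move=> hv; rewrite -[_ *: _]addr0; apply: SD.
  by apply: (Z); apply: (Z).
have [y0|yn] := eqVneq y 0; first by rewrite y0 mulr0 linear0.
have nu0 : nonneg pi nu by apply/(nonneg_crd crdD crdpi crdE) => j; exact: (Nm_cone H' hy yn).
rewrite (Sh3 nu mu) ?e //.
- have -> := V_term B (ck x) (cl x) a b hz hy.
  have -> : veps B nu y = 0 by rewrite /veps (negbTE nn).
  by rewrite mulr0 scale0r V0.
- by rewrite xpair_eqE negb_and nn.
- by apply/(UmgrP gq); rewrite -e.
- exact/(UpgrP gq).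
Qed.

Lemma Sh_in u : Sh u \in @U0p K I A U.
Proof. by case: ShP => h _ _; apply/asboolP; exact: h. Qed.
Definition shm m (X Y : 'I_m -> U) : 'M[R]_m := \matrix_(i, j) (MkR0 (Sh_in (X i * Y j)) : R).

Lemma ev_shm lam m (X Y : 'I_m -> U) x : (forall i, Np lam (X i)) -> (forall i, Nm lam (Y i)) ->
  map_mx (evr x) (shm X Y) = \matrix_(i, j) psi (V B (ck x) (cl x) (X i * Y j)).
Proof.
move=> hX hY; apply/matrixP => i j; rewrite !mxE /evr /ev /=; apply: psi_Sh.
by have := dsp_mul (hX i) (hY j); rewrite subrr.
Qed.

Definition pt0 : chpt := Chpt (chrp_one K A) (chrp_one K A).

Section RootData.
Variable rs : seq A.
Hypothesis hH : hil chi pi crd (qF U) rs.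
Hypothesis rsu : uniq rs.
Hypothesis wS : forall b, b \in rs -> exists2 w : A -> int, forall a c, w (a + c) = w a + w c & w b = 1.
Hypothesis hPS : forall b t, b \in rs -> (0 < t)%N -> qfact (chi b b) t != 0 ->
  PS chi (qK U) (qL U) pi (qE U) (qF U) b t.
Variable rho : A -> K.
Hypothesis rhoP : is_rho chi pi rho.
Hypothesis dimE : forall lam m, fdim (Nm lam) m -> fdim (Np lam) m.

Local Notation adm := (fun (b : A) s => qfact (chi b b) s != 0).
Local Notation hN a := (absz (hgt crd a)).

Lemma rs_pos b : b \in rs -> 0 < hgt crd b.
Proof. by move=> h; exact: (hgt_gt0 H (hil_cone hH h) (hil_nz hH h)). Qed.

Lemma Lex lam : exists L : seq (A -> nat), [/\ uniq L, forall g, KF id adm rs lam g <-> g \in L &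
  fdim (Nm lam) (size L)].
Proof.
have hl : hgt crd lam < (hN lam).+1%:Z by lia.
have [L [L1 L2 L3]] := KF_list (w := id) (fun (b : A) s => qfact (chi b b) s != 0) (hgtD H) rsu rs_pos hl.
exists L; split=> //; rewrite L3 (cg_cnt chi id) map_id; exact: (hil_dim hH hl).
Qed.
Definition LL lam := sval (cid (Lex lam)).
Lemma LLP lam : [/\ uniq (LL lam), forall g, KF id adm rs lam g <-> g \in LL lam & fdim (Nm lam) (size (LL lam))].
Proof. exact: (svalP (cid (Lex lam))). Qed.
Local Notation mm lam := (size (LL lam)).
Definition cc b s := rho b * chi b b ^- s.
(** Behind [rc], the predicted corank on the hyperplane of slope [c]: the number of p in P_lam such
    that [c] is the slope of some exponent 1 <= s <= p(b). Slopes and not exponents are the index,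
    since exponents may share a slope at roots of unity. *)
Definition occ b c (g : A -> nat) := has (fun s => c == cc b s) (iota 1 (g b)).
Definition rc lam b c := count (occ b c) (LL lam).

Lemma rho_neq0 b : rho b != 0. Proof. by case: rhoP => [[]]. Qed.
Lemma cc_neq0 b s : cc b s != 0.
Proof. by rewrite mulf_neq0 ?rho_neq0 // invr_eq0 expf_neq0 // (chi_nz H). Qed.

Lemma LL_adm lam g b : g \in LL lam -> b \in rs -> qfact (chi b b) (g b) != 0.
Proof. by have [_ h _] := LLP lam; move=> /h[_ h2 _]; exact: h2. Qed.

Lemma cc_inj lam g b s s' : g \in LL lam -> b \in rs -> (0 < s <= g b)%N -> (0 < s' <= g b)%N ->
  cc b s = cc b s' -> s = s'.
Proof.
move=> gL br; wlog le : s s' / (s <= s')%N.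
  move=> h a1 a2 e; case: (leqP s s') => [le|/ltnW le]; first exact: h.
  by apply/esym; apply: h => //; exact: esym.
move=> a1 a2 /(mulfI (rho_neq0 b))/invr_inj e; apply/eqP; rewrite eqn_leq le /=.
rewrite leqNgt; apply/negP => lt; have := LL_adm gL br; apply/negP; rewrite negbK; apply/eqP.
apply: (@qfact_root _ _ (s' - s)%N); first exact: (hil_neq1 hH br); last by lia.
have : chi b b ^+ s * chi b b ^+ (s' - s) = chi b b ^+ s * 1 by rewrite -exprD subnKC // mulr1 e.
by apply: mulfI; rewrite expf_neq0 // (chi_nz H).
Qed.

(** Subtracting s at [b] is injective on the functions with p(b) >= s. No image is counted by the
    second term: otherwise chi(b,b)^(s+s') = 1 with 0 < s + s' <= p(b), against the factorial
    condition. The slope rho(b) chi(b,b)^s is that of the characters shifted by s b. *)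
Lemma count_shift lam b s : b \in rs -> (0 < s)%N ->
  (count (fun g : A -> nat => s <= g b)%N (LL lam) + rc (lam - b *+ s)%R b (rho b * chi b b ^+ s)%R <= mm (lam - b *+ s)%R)%N.
Proof.
move=> br s0; set lam' := lam - _; set c := _ * _.
rewrite -(count_predC (occ b c) (LL lam')) addnC leq_add2l -size_filter -[X in (_ <= X)%N]size_filter.
pose dn (g : A -> nat) b' := if b' == b then (g b - s)%N else g b'.
have [u1 P1 _] := LLP lam; have [u2 P2 _] := LLP lam'.
rewrite -(size_map dn); apply: uniq_leq_size.
  rewrite map_inj_in_uniq ?filter_uniq // => g g'; rewrite !mem_filter => /andP[l1 _] /andP[l2 _] e.
  apply/funext => b'; have := congr1 (fun f => f b') e; rewrite /dn; case: eqP => [->|//].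
  by lia.
move=> g' /mapP[g]; rewrite mem_filter => /andP[sg gL] ->; rewrite mem_filter /=; apply/andP; split.
  apply/hasPn => s'; rewrite mem_iota /dn eqxx => hs'; apply/eqP => /(mulfI (rho_neq0 b)) e.
  have := LL_adm gL br; apply/negP; rewrite negbK; apply/eqP.
  apply: (@qfact_root _ _ (s + s')%N); first exact: (hil_neq1 hH br); last by lia.
  by rewrite exprD e mulVf // expf_neq0 // (chi_nz H).
apply/P2; have [g1 g2 g3] := proj2 (P1 g) gL; split.
- by move=> b' nb; rewrite /dn; case: eqP => [e|_]; [rewrite e br in nb | exact: g1].
- move=> b' b'r; rewrite /dn; case: (eqVneq b' b) => [->|_]; last exact: (g2 b' b'r).
  by apply: qfact_prefix (g2 b br); exact: leq_subr.
- rewrite /lam' -g3 !(bigD1_seq b) //= /dn eqxx mulrnBr // addrAC; congr (_ + _ - _).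
  by apply: eq_bigr => b' /negbTE ->.
Qed.

(** The induction hypothesis on the height. A bound at one point suffices, as it then holds
    generically on the hyperplane; all nonzero slopes are included because shifting leads to slopes
    that need not come from an exponent. *)
Definition Gp lam := forall X Y : 'I_(mm lam) -> U, fbasis (Np lam) X -> fbasis (Nm lam) Y ->
  forall b c, b \in rs -> c != 0 -> exists2 x, onH b c x &
    (mm lam <= \rank (map_mx (evr x) (shm X Y)) + rc lam b c)%N.

Lemma ev_iota x c : evr x (cst gq c) = c.
Proof. exact: ev_cst. Qed.
Lemma edom (u v : R) : u != 0 -> v != 0 -> exists x, evr x u != 0 /\ evr x v != 0.
Proof. exact: torus_point. Qed.
Lemma eHf b c x : onH b c x -> evr x (ff gq b c) = 0.
Proof. by move=> h; apply/(onHP crdD crdpi crdE chiP gq). Qed.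
Lemma ehdiv b c : b \in rs -> c != 0 -> forall u : R, (forall x, onH b c x -> evr x u = 0) -> exists z, u = z * ff gq b c.
Proof. by move=> /wS[w wD wb] c0 u h; exact: (ff_div c0 wD wb h). Qed.
Lemma ehirr b c : b \in rs -> c != 0 -> forall (u v : R) x y, onH b c x -> onH b c y -> evr x u != 0 -> evr y v != 0 ->
  exists z, [/\ onH b c z, evr z u != 0 & evr z v != 0].
Proof. by move=> /wS[w wD wb] c0 u v x y h1 h2 n1 n2; exact: (onH_irr c0 wD wb h1 h2 n1 n2). Qed.
Lemma eff0 b c : b \in rs -> ff gq b c != 0.
Proof. by move=> /wS[w wD wb]; exact: (ff_neq0 gq c wD wb). Qed.
Lemma onH_ex b c : b \in rs -> c != 0 -> exists x : chpt, onH b c x.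
Proof. by move=> /wS[w wD wb] c0; have [y [h _]] := onH_proj c0 wD wb pt0; exists y. Qed.

Lemma corank b c m (S : 'M[R]_m) : b \in rs -> c != 0 -> exists x0 k, [/\ onH b c x0,
  (\rank (map_mx (evr x0) S) + k)%N = m,
  forall x, onH b c x -> (\rank (map_mx (evr x) S) <= \rank (map_mx (evr x0) S))%N &
  exists z, \det S = ff gq b c ^+ k * z].
Proof.
move=> br c0; have [x1 h1] := onH_ex br c0.
exact: (generic_corank (ev := evr) (iota := cst gq) ev_iota edom (eff0 c br) (@eHf b c) (ehdiv br c0) (ehirr br c0) S h1).
Qed.

Lemma basis_ex lam : exists X Y : 'I_(mm lam) -> U, fbasis (Np lam) X /\ fbasis (Nm lam) Y.
Proof.
have [_ _ h] := LLP lam; have [X hX] := fdim_ord (dimE h); have [Y hY] := fdim_ord h.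
by exists X, Y.
Qed.

Lemma evm_const x m n (C : 'M[K]_(m, n)) : map_mx (evr x) (map_mx (cst gq) C) = C.
Proof. by apply/matrixP => i j; rewrite !mxE ev_iota. Qed.

(** At a point where the form of degree lam has generic rank and the shifted form of degree lam - s
    b the rank granted by [Gp], [rank_singular] bounds the sum of both; [count_shift] turns this
    into the claim there, and the generic rank is the largest on the hyperplane. *)
Lemma rank_bound_s lam b s (X Y : 'I_(mm lam) -> U) : b \in rs -> (0 < s)%N -> Gp (lam - b *+ s) ->
  fbasis (Np lam) X -> fbasis (Nm lam) Y -> forall x, onH b (cc b s) x ->
  (\rank (map_mx (evr x) (shm X Y)) + count (fun g : A -> nat => s <= g b)%N (LL lam) <= mm lam)%N.
Proof.
move=> br s0 G hX hY x hx.
have [/hasP[g gL sg]|] := boolP (has (fun g : A -> nat => s <= g b)%N (LL lam)); last first.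
  by rewrite has_count -leqNgt leqn0 => /eqP ->; rewrite addn0 rank_leq_row.
have c0 := cc_neq0 b s.
have [x0 [k [H0 ek mx _]]] := corank (shm X Y) br c0.
suff le : (count (fun g : A -> nat => s <= g b)%N (LL lam) <= k)%N.
  by have := mx x hx; move: (\rank _) ek => r1; move: (\rank _) => r2; lia.
have [X' [Y' [hX' hY']]] := basis_ex (lam - b *+ s).
have q0 : chi b b ^+ s != 0 by rewrite expf_neq0 // (chi_nz H).
have c'0 : rho b * chi b b ^+ s != 0 by rewrite mulf_neq0 ?rho_neq0.
have [x1 H1 r1] := G _ _ hX' hY' b _ br c'0.
have [C [D CD]] := rank_minor (map_mx (evr x0) (shm X Y)).
have [C' [D' CD']] := rank_minor (map_mx (evr x1) (shm X' Y')).
pose u := \det (map_mx (cst gq) C *m shm X Y *m map_mx (cst gq) D).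
pose v := \det (map_mx (cst gq) C' *m shm X' Y' *m map_mx (cst gq) D').
have [v' hv'] := ev_shift (b *+ s) v.
have eu z : evr z u = \det (C *m map_mx (evr z) (shm X Y) *m D).
  by rewrite /u -det_map_mx !map_mxM !evm_const.
have ev' z : evr z v = \det (C' *m map_mx (evr z) (shm X' Y') *m D').
  by rewrite /v -det_map_mx !map_mxM !evm_const.
have n1 : evr x0 u != 0 by rewrite eu CD det1 oner_eq0.
have n2 : evr (unshp x1 (b *+ s)) v' != 0 by rewrite hv' shpK ev' CD' det1 oner_eq0.
have H2 : onH b (cc b s) (unshp x1 (b *+ s)).
  have e1 : chi (b *+ s) b = chi b b ^+ s by exact: (chrpMn _ _ (chrp_chir B b)).
  have e2 : chi b (b *+ s) = chi b b ^+ s by exact: (chrpMn _ _ (chrp_chil B b)).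
  rewrite /onH /= e1 e2 (H1 : cl x1 b = _) /cc.
  by move: (chi b b ^+ s) q0 => q q0; field.
(* Irreducibility lets both minors be nonzero at one point; [v'] is the second minor pulled back
   along the shift of characters. *)
have [y [Hy m1 m2]] := ehirr br c0 H0 H2 n1 n2.
rewrite eu in m1; rewrite hv' ev' in m2.
have ra := minor_rank m1; have rb := minor_rank m2.
have qs : qfact (chi b b) s != 0 := qfact_prefix sg (LL_adm gL br).
have [yv yv0 ys] := hPS br s0 qs rhoP (ckP y) (clP y) Hy.
have sbc j : 0 <= crd j (b *+ s) by rewrite (addfMn (crdD j)) mulrn_wge0 // (hil_cone hH br).
have sb0 : b *+ s != 0.
  apply: contraTneq (rs_pos br) => e; have := addfMn (hgtD H) b s; rewrite e (addf0 (hgtD H)).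
  by move/esym/eqP; rewrite mulrn_eq0 (gtn_eqF s0) /= => /eqP ->.
have rk : (\rank (map_mx (evr y) (shm X Y)) + \rank (map_mx (evr (shp y (b *+ s))) (shm X' Y')) <= mm lam)%N.
  have [hX1 _ _] := hX; have [hY1 _ _] := hY; have [hX'1 _ _] := hX'; have [hY'1 _ _] := hY'.
  rewrite (ev_shm _ hX1 hY1) (ev_shm _ hX'1 hY'1).
  exact: (rank_singular B (ckP y) (clP y) ys yv0 sb0 sbc hX1 hY hX'1 hY'1).
exact: (rank_arith ek r1 ra rb rk (count_shift lam br s0)).
Qed.

Section Step.
Variable lam : A.
Hypothesis IH : forall b s, b \in rs -> (0 < s)%N -> Gp (lam - b *+ s).
Variables X Y : 'I_(mm lam) -> U.
Hypothesis hX : fbasis (Np lam) X.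
Hypothesis hY : fbasis (Nm lam) Y.

Lemma rank_bound b c x : b \in rs -> onH b c x ->
  (\rank (map_mx (evr x) (shm X Y)) + rc lam b c <= mm lam)%N.
Proof.
move=> br hx; have [/hasP[g gL /hasP[s1]]|] := boolP (has (occ b c) (LL lam)); last first.
  by rewrite has_count -leqNgt leqn0 => /eqP e; rewrite /rc e addn0 rank_leq_row.
rewrite mem_iota => s1g ec1.
(* For the least exponent s of slope [c], a function is counted by [rc] exactly when its value at
   [b] is at least s. *)
have ex : exists s, (0 < s)%N && (c == cc b s) by exists s1; rewrite ec1 andbT; lia.
case: (ex_minnP ex) => s /andP[s0 /eqP ec] mn.
have -> : rc lam b c = count (fun g : A -> nat => s <= g b)%N (LL lam).
  apply: eq_in_count => g' _; apply/hasP/idP => [[s']|le].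
    by rewrite mem_iota => h e'; have := mn s'; rewrite e' andbT; lia.
  by exists s; rewrite ?ec // mem_iota; lia.
by apply: rank_bound_s => //; [exact: IH | rewrite -ec].
Qed.

Lemma det_ff b c : b \in rs -> c != 0 -> exists z, \det (shm X Y) = ff gq b c ^+ rc lam b c * z.
Proof.
move=> br c0; have [x0 [k [H0 ek mx [z ez]]]] := corank (shm X Y) br c0.
have := rank_bound br H0; move: (\rank _) ek => r0 ek le.
have lk : (rc lam b c <= k)%N by lia.
by exists (ff gq b c ^+ (k - rc lam b c) * z); rewrite mulrA -exprD subnKC.
Qed.
End Step.

(** For b != b' the value at b' can be changed while that at b is kept: some [th j] vanishes at b
    and not at b' unless b' is an integral multiple of b. Both roots having a functional of value
    one and positive height, that multiple would be b itself. *)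
Lemma hyperplane_sep b c b' c' : b \in rs -> b' \in rs -> c != 0 -> (b, c) != (b', c') ->
  exists x, onH b c x /\ evr x (ff gq b' c') != 0.
Proof.
move=> br br' c0 ne; have [x hx] := onH_ex br c0.
have evf z : evr z (ff gq b' c') = cl z b' - c' * ck z b' by exact: ev_ff.
have [e|nb] := eqVneq b b'.
  exists x; split=> //; rewrite evf -e (hx : cl x b = _) -mulrBl mulf_neq0 ?subr_eq0 //.
    by apply: contraNneq ne => ->; rewrite e.
  by case: (ckP x).
have [w wD wb] := wS br.
pose th j a := crd j a - w a * crd j b.
have thD j a a' : th j (a + a') = th j a + th j a' by rewrite /th crdD wD; ring.
have [j hj] : exists j, th j b' != 0.
  apply: contrapT => nj; case/eqP: nb.
  have eb : b' = b *~ w b'.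
    apply: (crd_inj H) => j; rewrite (addf_mulz (crdD j)); apply/eqP; rewrite -subr_eq0 mulrC.
    by apply/negPn/negP => h; apply: nj; exists j.
  have [w' wD' wb'] := wS br'.
  have e1 : w' b * w b' = 1 by rewrite -(addf_mulz wD') -eb.
  have e2 : hgt crd b' = hgt crd b * w b' by rewrite {1}eb (addf_mulz (hgtD H)).
  have p1 := rs_pos br; have p2 := rs_pos br'.
  have w1 : w b' = 1.
    have wp : 0 < w b' by rewrite e2 pmulr_rgt0 in p2.
    have : (w b' %| 1)%Z by apply/dvdzP; exists (w' b).
    by rewrite dvdz1 => /eqP; lia.
  by rewrite eb w1.
have [n0|n0] := eqVneq (evr x (ff gq b' c')) 0; last by exists x.
have hn : (0 < absz (th j b'))%N by rewrite absz_gt0.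
have [|T T0 hT] := @generic_point K ('X^(absz (th j b')) - 1%:P).
  by rewrite monic_neq0 // monicXnsubC.
have T1 : T ^ th j b' != 1.
  move: hT; rewrite !hornerE subr_eq0; apply: contraNneq; case: (th j b') => k /= e; first by rewrite -e exprnP.
  by apply/eqP; move: e; rewrite NegzE -exprnN => /(congr1 GRing.inv); rewrite invrK invr1.
exists (Chpt (ckP x) (chrpM (clP x) (chrpz (thD j) T0))); split.
  by rewrite /onH /= /th wb mul1r subrr expr0z mulr1.
rewrite evf in n0; move/subr0_eq: n0 => n0; rewrite evf /= -n0 -[X in _ - X]mulr1 -mulrBr.
by rewrite mulf_neq0 ?subr_eq0 //; case: (clP x).
Qed.

Lemma hyperplane_avoid b c (e : A * K -> nat) (l : seq (A * K)) : b \in rs -> c != 0 -> (b, c) \notin l ->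
  (forall p, p \in l -> p.1 \in rs) ->
  exists2 x, onH b c x & evr x (\prod_(p <- l) ff gq p.1 p.2 ^+ e p) != 0.
Proof.
move=> br c0; elim: l => [|p l IHl].
  by move=> _ _; have [x hx] := onH_ex br c0; exists x; rewrite // big_nil rmorph1 oner_eq0.
rewrite inE negb_or => /andP[np nl] hl.
have [|x hx nx] := IHl nl; first by move=> q ql; apply: hl; rewrite inE ql orbT.
have np' : (b, c) != (p.1, p.2) by case: (p) np.
have [y [hy ny]] := hyperplane_sep br (hl p (mem_head _ _)) c0 np'.
have [z [hz n1 n2]] := ehirr br c0 hx hy nx ny.
by exists z => //; rewrite big_cons rmorphM rmorphXn mulf_neq0 // expf_neq0.
Qed.

(** Factors of distinct hyperplanes are coprime: by [hyperplane_avoid] the product found so far does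
    not vanish on the next hyperplane, so [prime_cancel] applies. *)
Lemma ff_prod (D : R) (e : A * K -> nat) (l : seq (A * K)) : uniq l ->
  (forall p, p \in l -> p.1 \in rs /\ p.2 != 0) ->
  (forall p, p \in l -> exists z, D = ff gq p.1 p.2 ^+ e p * z) ->
  exists z, D = (\prod_(p <- l) ff gq p.1 p.2 ^+ e p) * z.
Proof.
elim: l => [|p l IHl] /=; first by exists D; rewrite big_nil mul1r.
move=> /andP[pl ul] hl hd.
have sub q : q \in l -> q \in p :: l by rewrite inE => ->; rewrite orbT.
have [||z ez] := IHl ul; first by move=> q /sub; exact: hl.
  by move=> q /sub; exact: hd.
have [z1 e1] := hd p (mem_head _ _); have [h1 h2] := hl p (mem_head _ _).
have pl' : (p.1, p.2) \notin l by case: (p) pl.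
have [|x hx nx] := hyperplane_avoid e h1 h2 pl'; first by move=> q /sub/hl[].
have eq : ff gq p.1 p.2 ^+ e p * z1 = (\prod_(p <- l) ff gq p.1 p.2 ^+ e p) * z by rewrite -e1.
have [z' ez'] := prime_cancel (ev := evr) edom (eff0 p.2 h1) (@eHf p.1 p.2) (ehdiv h1 h2) (ehirr h1 h2) hx nx eq.
by exists z'; rewrite big_cons ez ez'; ring.
Qed.

(** On the family (1, T^height) the factor L_b - c K_b becomes T^height(b) - c, which is prime to T.
    So the product divides the polynomial [p] itself, not only its multiple by the power of T that
    clears [z]. *)
Lemma degree_bound lam (X Y : 'I_(mm lam) -> U) (e : A * K -> nat) (l : seq (A * K)) z :
  fbasis (Np lam) X -> fbasis (Nm lam) Y -> (forall p, p \in l -> p.1 \in rs /\ p.2 != 0) ->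
  \det (shm X Y) = (\prod_(p <- l) ff gq p.1 p.2 ^+ e p) * z ->
  (\sum_(p <- l) e p * hN p.1 <= mm lam * hN lam)%N.
Proof.
move=> hX hY hl ed; have hn : hgt crd lam <= (hN lam)%:Z by lia.
have [p [sp p0 hp]] := shapovalov_poly B hX hY hn.
have [hX1 _ _] := hX; have [hY1 _ _] := hY.
pose P : {poly K} := \prod_(p <- l) ('X^(hN p.1) - p.2%:P) ^+ e p.
pose xT T (T0 : T != 0) : chpt := Chpt (chrp_one K A) (chrp_hgt B T0).
have pos r : r \in l -> (0 < hN r.1)%N by move=> /hl[/rs_pos h _]; lia.
have [M [Z hZ]] : exists M (Z : {poly K}), forall T (T0 : T != 0), T ^+ M * evr (xT T T0) z = Z.[T].
  have [s [c [_ ->]]] := R_span z.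
  pose M := (\sum_(t <- s) absz (hgt crd t.2))%N.
  exists M, (\sum_(t <- s) c t *: 'X^(absz (hgt crd t.2 + M%:Z))) => T T0.
  rewrite /evr /= ev_span /= mulr_sumr horner_sum big_seq [RHS]big_seq; apply: eq_bigr => t ts.
  have le : (absz (hgt crd t.2) <= M)%N by rewrite /M (big_rem t) //= leq_addr.
  have ge : 0 <= hgt crd t.2 + M%:Z by lia.
  rewrite hornerZ hornerXn.
  have -> : T ^+ absz (hgt crd t.2 + M%:Z) = T ^+ M * T ^ hgt crd t.2.
    by rewrite exprnP gez0_abs // addrC expfzDr.
  by rewrite mul1r mulrCA.
have PT T (T0 : T != 0) : evr (xT T T0) (\prod_(p <- l) ff gq p.1 p.2 ^+ e p) = P.[T].
  rewrite rmorph_prod horner_prod big_seq [RHS]big_seq; apply: eq_bigr => r rl.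
  rewrite rmorphXn horner_exp; congr (_ ^+ _).
  have [/rs_pos h _] := hl r rl.
  by rewrite [LHS]ev_ff /= mulr1 !hornerE [in RHS]exprnP gez0_abs // ltW.
have eq : P * Z = 'X^M * p.
  apply/eqP; rewrite -subr_eq0; apply/negPn/negP => /generic_point[T T0].
  rewrite hornerD hornerN !hornerM hornerXn -(hZ T T0) -(hp T T0) -(PT T T0).
  have := congr1 (evr (xT T T0)) ed; rewrite rmorphM -det_map_mx (ev_shm _ hX1 hY1) /= => ->.
  by rewrite mulrCA subrr eqxx.
have P0 : ~~ root P 0.
  rewrite rootE horner_prod prodf_seq_neq0; apply/allP => r rl /=; rewrite horner_exp expf_neq0 //.
  by rewrite !hornerE expr0n (gtn_eqF (pos r rl)) sub0r oppr_eq0; case: (hl r rl).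
have dv : 'X^M %| Z.
  have : 'X^M %| P * Z by rewrite eq dvdp_mulr.
  by rewrite Gauss_dvdpr // coprimep_expl // coprimep_sym coprimepX.
have [W eW] := dvdpP _ _ dv.
have pW : p = P * W.
  have X0 : 'X^M != 0 :> {poly K} by rewrite expf_neq0 // polyX_eq0.
  by apply: (mulfI X0); rewrite -eq eW mulrA mulrC.
have Pp : P %| p by rewrite pW dvdp_mulIl.
have pn0 : p != 0 by apply: contraNneq p0 => ->; rewrite horner0.
have := leq_trans (dvdp_leq pn0 Pp) sp.
by rewrite /P size_prod_binom.
Qed.

(** An excess on one hyperplane would push the degree of the known factors beyond m height(lam).
    Indeed each p in P_lam contributes height(b) for every b and every s <= p(b), in total
    height(lam), the slopes for one p and b being distinct by [cc_inj]. *)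
Lemma det_ff_max lam (X Y : 'I_(mm lam) -> U) b c e z :
  (forall b s, b \in rs -> (0 < s)%N -> Gp (lam - b *+ s)) -> fbasis (Np lam) X -> fbasis (Nm lam) Y ->
  b \in rs -> c != 0 -> \det (shm X Y) = ff gq b c ^+ e * z -> (e <= rc lam b c)%N.
Proof.
move=> IH hX hY br c0 ez; rewrite leqNgt; apply/negP => lt.
pose lg (g : A -> nat) := [seq (b', cc b' s) | b' <- rs, s <- iota 1 (g b')].
pose PL := undup ((b, c) :: flatten (map lg (LL lam))).
pose e' p := if p == (b, c) then e else rc lam p.1 p.2.
have PLin p : p \in PL -> p.1 \in rs /\ p.2 != 0.
  rewrite mem_undup inE => /orP[/eqP -> //|/flatten_mapP[g gL /allpairsPdep[b' [s [b'r _ ->]]]]] /=.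
  by split=> //; exact: cc_neq0.
have PLd p : p \in PL -> exists z, \det (shm X Y) = ff gq p.1 p.2 ^+ e' p * z.
  move=> /PLin[p1 p2]; rewrite /e'; case: eqP => [->|_]; first by exists z.
  exact: (det_ff IH hX hY p1 p2).
have [z1 ez1] := ff_prod (undup_uniq _) PLin PLd.
have db := degree_bound hX hY PLin ez1.
have bc : (b, c) \in PL by rewrite mem_undup mem_head.
have hb : (0 < hN b)%N by have := rs_pos br; lia.
have s1 : (\sum_(p <- PL) rc lam p.1 p.2 * hN p.1 < \sum_(p <- PL) e' p * hN p.1)%N.
  rewrite !(bigD1_seq (b, c)) ?undup_uniq //= {1}/e' eqxx -addSn leq_add ?ltn_pmul2r //.
  by apply: eq_leq; apply: eq_bigr => p /negbTE np; rewrite /e' np.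
suff h : (mm lam * hN lam <= \sum_(p <- PL) rc lam p.1 p.2 * hN p.1)%N.
  by have := leq_trans s1 db; rewrite ltnNge h.
have -> : (mm lam * hN lam = \sum_(g <- LL lam) hN lam)%N.
  by rewrite big_const_seq count_predT iter_addn_0 mulnC.
have -> : (\sum_(p <- PL) rc lam p.1 p.2 * hN p.1 = \sum_(g <- LL lam) \sum_(p <- PL) occ p.1 p.2 g * hN p.1)%N.
  rewrite exchange_big; apply: eq_bigr => p _ /=; rewrite -big_distrl /=; congr (_ * _)%N.
  by rewrite /rc -sum1_count big_mkcond; apply: eq_bigr => g _; case: occ.
rewrite big_seq [X in (_ <= X)%N]big_seq; apply: leq_sum => g gL.
have iot b' s : s \in iota 1 (g b') -> (0 < s <= g b')%N by rewrite mem_iota add1n ltnS.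
have ulg : uniq (lg g).
  apply: allpairs_uniq_dep => //; first by move=> b' _; exact: iota_uniq.
  move=> p1 p2 /allpairsPdep[b1 [s1' [r1 i1 ->]]] /allpairsPdep[b2 [s2 [r2 i2 ->]]] /= [eb es]; subst b2.
  by rewrite (cc_inj gL r1 (iot _ _ i1) (iot _ _ i2) es).
have [_ P1 _] := LLP lam; have [_ _ g3] := proj2 (P1 g) gL.
have hs l : {subset l <= rs} -> hgt crd (\sum_(b' <- l) b' *+ g b') = Posz (\sum_(b' <- l) g b' * hN b')%N.
  elim: l => [|b1 l IHl] sl; first by rewrite !big_nil (addf0 (hgtD H)).
  rewrite !big_cons (hgtD H) IHl ?(addfMn (hgtD H)); last by move=> b2 h; apply: sl; rewrite inE h orbT.
  have p1 := rs_pos (sl b1 (mem_head _ _)).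
  by rewrite PoszD PoszM gez0_abs ?(ltW p1) // -mulr_natr natz mulrC.
have elam : (hN lam = \sum_(p <- lg g) hN p.1)%N.
  rewrite -g3 (hs rs) // absz_nat /lg big_allpairs_dep; apply: eq_bigr => b' _ /=.
  by rewrite big_const_seq count_predT size_iota iter_addn_0 mulnC.
have pe : perm_eq (lg g) [seq p <- PL | p \in lg g].
  apply: uniq_perm ulg (filter_uniq _ (undup_uniq _)) _ => p; rewrite mem_filter.
  have [pl|//] := boolP (p \in lg g); rewrite mem_undup inE; apply/esym/orP; right.
  by apply/flatten_mapP; exists g.
rewrite elam (perm_big _ pe) big_filter big_mkcond; apply: leq_sum => p _; case: ifP => // pl.
have -> : occ p.1 p.2 g = true.
  move/allpairsPdep: pl => [b' [s [_ is' ->]]] /=; apply/hasP; by exists s.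
by rewrite mul1n.
Qed.

(** The generic corank is an exponent of [ff] in the determinant, and such exponents are at most
    [rc] by [det_ff_max]. *)
Lemma Gp_all n lam : hgt crd lam < n%:Z -> Gp lam.
Proof.
elim: n lam => [|n IHn] lam hn X Y hX hY b c br c0.
  have [x hx] := onH_ex br c0; exists x => //; apply: (@leq_trans 0) => //.
  have [_ P1 _] := LLP lam; case E: (LL lam) => [|g l] //.
  have := KF_ht (w := id) (hgtD H) rs_pos (proj2 (P1 g) _); rewrite E mem_head => /(_ isT).
  by lia.
have IH b' s : b' \in rs -> (0 < s)%N -> Gp (lam - b' *+ s).
  move=> b'r s0; apply: IHn; have := rs_pos b'r.
  rewrite (hgtB H) (addfMn (hgtD H)) -mulr_natr natz => h.
  have : 1 <= hgt crd b' * s%:Z by nia.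
  by lia.
have [x0 [k [H0 ek mx [z ez]]]] := corank (shm X Y) br c0.
have := det_ff_max IH hX hY br c0 ez => le.
by exists x0 => //; rewrite -{1}ek leq_add2l.
Qed.

(** As f^(k+1) does not divide the determinant, the Schur complement f D' has det D' not vanishing
    on the hyperplane. Multiplying by the adjugate of D' makes that block scalar, and det D' on the
    other block yields a common factor [h]. *)
Lemma smith_form m p k (e : (p + k)%N = m) (S : 'M[R]_m) b c x0 : b \in rs -> c != 0 -> onH b c x0 ->
  \rank (map_mx (evr x0) S) = p -> (forall x, onH b c x -> (\rank (map_mx (evr x) S) <= p)%N) ->
  (forall z, \det S <> ff gq b c ^+ k.+1 * z) ->
  exists (P1 P2 : 'M[R]_m) (h : R) y, [/\ onH b c y, evr y h != 0, evr y (\det P1) != 0, evr y (\det P2) != 0 &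
    P1 *m S *m P2 = h *: \matrix_(i, j) ((if (i < p)%N then 1 else ff gq b c) *+ (i == j))].
Proof.
move=> br c0; case: m / e S => S H0 rk le nd; set f := ff gq b c in nd *.
have [P1 [P2 [d [D' [n1 n2 n3 eq]]]]] := schur (ev := evr) (iota := cst gq) ev_iota (ehdiv br c0) (ehirr br c0) H0 rk le.
rewrite -/f in eq.
have [y hy ny] : exists2 y, onH b c y & evr y (\det D') != 0.
  apply: contrapT => ne; have [|z ez] := ehdiv br c0 (u := \det D').
    by move=> x hx; apply/eqP; apply/negPn/negP => nz; apply: ne; exists x.
  have ed := congr1 (fun M => \det M) eq; rewrite !det_mulmx detZ det_lblock det1 mul1r detZ ez in ed.
  have ee : f ^+ k.+1 * (d ^+ (p + k) * z) = (\det P1 * \det P2) * \det S.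
    by rewrite mulrAC ed exprS /f; ring.
  have n12 : evr x0 (\det P1 * \det P2) != 0 by rewrite rmorphM mulf_neq0.
  have [z' ez'] := prime_cancel (ev := evr) edom (eff0 c br) (@eHf b c) (ehdiv br c0) (ehirr br c0) H0 n12 ee.
  exact: nd ez'.
have n123 : evr x0 (\det P1 * \det P2 * d) != 0 by rewrite !rmorphM !mulf_neq0.
have [w [hw]] := ehirr br c0 H0 hy n123 ny.
rewrite !rmorphM !mulf_eq0 !negb_or => /andP[/andP[w1 w2] w3] w4.
have wadj : evr w (\det (\adj D')) != 0.
  have := congr1 (fun M => evr w (\det M)) (mul_adj_mx D'); rewrite /= det_mulmx det_scalar rmorphM rmorphXn /= => ea.
  have : evr w (\det D') ^+ k != 0 by rewrite expf_neq0.
  by rewrite -ea mulf_eq0 negb_or => /andP[].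
exists (block_mx (\det D')%:M 0 0 (\adj D') *m P1), P2, (d * \det D'), w; split=> //.
- by rewrite rmorphM mulf_neq0.
- by rewrite det_mulmx det_lblock det_scalar !rmorphM rmorphXn !mulf_neq0 // expf_neq0.
- rewrite -!mulmxA [P1 *m _]mulmxA eq -scalemxAr mulmx_block !mulmx0 !mul0mx !addr0 !add0r mulmx1 -scalemxAr mul_adj_mx.
  rewrite -scalerA; congr (_ *: _).
  have -> : block_mx (\det D')%:M 0 0 (f *: (\det D')%:M) = \det D' *: block_mx 1%:M 0 0 f%:M :> 'M[R]_(p + k).
    rewrite scale_block_mx !scaler0 scalemx1; congr block_mx.
    by rewrite !scale_scalar_mx mulrC.
  congr (_ *: _); apply/matrixP => i j.
  case: (fintype.split_ordP i) => i' ->; case: (fintype.split_ordP j) => j' ->; rewrite ?block_mxEul ?block_mxEur ?block_mxEdl ?block_mxEdr !mxE /=.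
  + by rewrite eq_lshift ltn_ord.
  + by rewrite eq_lrshift.
  + by rewrite eq_rlshift.
  + by rewrite eq_rshift ltnNge leq_addr.
Qed.

Lemma shapovalov_smith lam (X Y : 'I_(mm lam) -> U) b c : fbasis (Np lam) X -> fbasis (Nm lam) Y ->
  b \in rs -> c != 0 ->
  exists (P1 P2 : 'M[R]_(mm lam)) (h : R) y, [/\ onH b c y, evr y h != 0, evr y (\det P1) != 0, evr y (\det P2) != 0 &
    P1 *m shm X Y *m P2 = h *: \matrix_(i, j) ((if (i < mm lam - rc lam b c)%N then 1 else ff gq b c) *+ (i == j))].
Proof.
move=> hX hY br c0.
have IH b' s : b' \in rs -> (0 < s)%N -> Gp (lam - b' *+ s).
  by move=> _ _; apply: (@Gp_all (absz (hgt crd (lam - b' *+ s))).+1); lia.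
have [x0 [k [H0 ek mx [z ez]]]] := corank (shm X Y) br c0.
have k1 := det_ff_max IH hX hY br c0 ez; have k2 := rank_bound IH hX hY br H0.
have ek' : k = rc lam b c by move: k1 k2 ek; move: (\rank _) => r0; lia.
have ep : \rank (map_mx (evr x0) (shm X Y)) = (mm lam - rc lam b c)%N.
  by move: ek; rewrite ek'; move: (\rank _) => r0; lia.
have em : (mm lam - rc lam b c + rc lam b c)%N = mm lam by rewrite -ep -ek'.
apply: (smith_form em br c0 H0 ep); first by move=> x hx; rewrite -ep; exact: mx.
by move=> z' ez'; have := det_ff_max IH hX hY br c0 ez'; rewrite ltnn.
Qed.
End RootData.
End ShapovalovDet.

(** * Coordinates on the lattice and bases from the pairing *)

(** Integral coordinates are unique because [pi] is free over the reals. *)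
Lemma lattice_crd (R : realType) (V : vectType R) (I : finType) (pi : I -> V) :
  basis_of fullv (codom pi) -> exists crd : I -> rootLattice pi -> int,
  [/\ forall i a b, crd i (a + b) = crd i a + crd i b,
      forall i j, crd i (sroot pi j) = (i == j)%:Z &
      forall a, a = \sum_i sroot pi i *~ crd i a].
Proof.
move=> pb; have fr : free (codom_tuple pi) by exact: (basis_free pb).
have rx (G : I -> V) : \sum_j G j = \sum_(l < #|I|) G (enum_val l).
  by rewrite (reindex _ (onW_bij _ (enum_val_bij I))).
have inj0 (n : I -> int) : \sum_i pi i *~ n i = 0 -> forall i, n i = 0.
  move=> e i; have /freeP fr' := fr.
  have prem : \sum_(k < #|I|) (n (enum_val k))%:~R *: (codom_tuple pi)`_k = 0.
    rewrite -[RHS]e rx; apply: eq_bigr => k _; rewrite scaler_int; congr (_ *~ _); exact: nth_codom.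
  have := fr' _ prem (enum_rank i); rewrite /= enum_rankK => /eqP; by rewrite intr_eq0 => /eqP.
have inj (n n' : I -> int) : \sum_i pi i *~ n i = \sum_i pi i *~ n' i -> forall i, n i = n' i.
  move=> e i; apply/eqP; rewrite -subr_eq0; apply/eqP; apply: (inj0 (fun i => n i - n' i)).
  by under eq_bigr => k _ do rewrite mulrzBr; rewrite sumrB e subrr.
have ex (a : rootLattice pi) : exists n : I -> int, lattice_val a = \sum_i pi i *~ n i.
  by case: a => v h /=; apply/asboolP.
have /choice[n hn] := ex.
exists (fun i a => n a i); split.
- move=> i a b; apply: (inj (n (a + b)) (fun i => n a i + n b i)).
  by under [RHS]eq_bigr => k _ do rewrite mulrzDr; rewrite big_split /= -!hn.
- move=> i j; apply: (inj (n (sroot pi j)) (fun i => (i == j)%:Z)); rewrite -hn /=.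
  by rewrite (bigD1 j) //= eqxx mulr1z big1 ?addr0 // => k /negbTE ->; rewrite mulr0z.
- move=> a; apply: val_inj; rewrite -[LHS]/(lattice_val a) -[RHS]/(lattice_val (\sum_i sroot pi i *~ n a i)).
  have vD : {morph (@lattice_val R V I pi) : x y / x + y >-> x + y} by [].
  have v0 : lattice_val (0 : rootLattice pi) = 0 by [].
  have vn (x : rootLattice pi) (k : nat) : lattice_val (x *+ k) = lattice_val x *+ k.
    by elim: k => [|k IH] //; rewrite !mulrS vD IH.
  have vz (x : rootLattice pi) (k : int) : lattice_val (x *~ k) = lattice_val x *~ k.
    case: k => k; first exact: vn.
    by rewrite NegzE !mulrNz -!pmulrn -vn.
  rewrite hn (big_morph _ vD v0); apply: eq_bigr => i _; by rewrite vz.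
Qed.

Section Bases.
Variables (K : fieldType) (M : lmodType K) (S : M -> Prop) (m : nat) (X : 'I_m -> M).
Hypothesis Ssub : subsp S.
Hypothesis XS : forall i, S (X i).

Lemma free_fbasis : fdim S m -> (forall c : 'I_m -> K, \sum_i c i *: X i = 0 -> forall i, c i = 0) ->
  fbasis S X.
Proof.
move=> /fdim_ord[b [b1 b2 b3]] fX; split=> // x Sx.
have /choice[P hP] i := b3 _ (XS i).
pose Pm := \matrix_(i, k) P i k.
have comb (v : 'rV[K]_m) : \sum_i v 0 i *: X i = \sum_k (v *m Pm) 0 k *: b k.
  rewrite (eq_bigr (fun i => \sum_k (v 0 i * P i k) *: b k)).
    by rewrite exchange_big; apply: eq_bigr => k _; rewrite mxE scaler_suml; apply: eq_bigr => i _; rewrite mxE.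
  by move=> i _; rewrite {1}hP scaler_sumr; apply: eq_bigr => k _; rewrite scalerA.
have fr : row_free Pm.
  apply: inj_row_free => v e; apply/rowP => i; rewrite mxE; apply: (fX (fun i => v 0 i)).
  by rewrite comb e big1 // => k _; rewrite mxE scale0r.
have un : Pm \in unitmx by rewrite -row_free_unit.
have [a ea] := b3 _ Sx.
exists (fun i => ((\row_k a k) *m invmx Pm) 0 i).
by rewrite comb mulmxKV // ea; apply: eq_bigr => k _; rewrite mxE.
Qed.

(** Applied to [theta] on either side, this and the known dimension make [X] and [Y] bases. *)
Lemma pairing_free (phi : 'I_m -> M -> K) :
  (forall j c x y, S x -> S y -> phi j (c *: x + y) = c * phi j x + phi j y) ->
  \det (\matrix_(i, j) phi j (X i)) != 0 ->
  forall c : 'I_m -> K, \sum_i c i *: X i = 0 -> forall i, c i = 0.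
Proof.
have [S0 SD] := Ssub; move=> lin d0 c e i.
have p0 j : phi j 0 = 0 by have := lin j (-1) 0 0 S0 S0; rewrite scaler0 addr0 mulN1r addNr.
have ps j (r : seq 'I_m) : S (\sum_(k <- r) c k *: X k) /\ phi j (\sum_(k <- r) c k *: X k) = \sum_(k <- r) c k * phi j (X k).
  by elim: r => [|k r [IH1 IH2]]; rewrite !(big_nil, big_cons) //; split; rewrite ?lin ?IH2 //; exact: SD.
set Th := \matrix_(i, j) _ in d0.
have un : Th \in unitmx by rewrite unitmxE unitfE.
have z : (\row_k c k) *m Th = 0.
  apply/rowP => j; rewrite !mxE; have [_] := ps j (index_enum _); rewrite e p0 => ez; rewrite [RHS]ez.
  by apply: eq_bigr => k _; rewrite !mxE.
have := congr1 (fun v => (v *m invmx Th) 0 i) z; rewrite /= mulmxK // mul0mx !mxE.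
by [].
Qed.
End Bases.

Lemma sum_delta_mx (W : pzRingType) m (Pr : pred 'I_m) i j :
  (\sum_(x | Pr x) delta_mx x x : 'M[W]_m) i j = ((i == j) && Pr i)%:R.
Proof.
rewrite summxE; have [p|np] := boolP (Pr i).
  rewrite (bigD1 i) //= big1 ?addr0 => [|k /andP[_ ki]]; first by rewrite mxE eqxx andbT eq_sym.
  by rewrite mxE eq_sym (negbTE ki).
rewrite andbF big1 // => k pk; rewrite mxE; case: eqP => // e.
by rewrite e pk in np.
Qed.

(** * From the ring of functions back to the algebra *)

Section Values.
Variables (K : closedFieldType) (I : finType) (A : zmodType) (pi : I -> A) (chi : A -> A -> K).
Variables (U : gqgData K I A) (gq : is_gqg pi chi U).
Local Notation R := (R0 gq).
Local Notation v := (@r0v K I A U : R -> U).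
Lemma valD (x y : R) : v (x + y) = v x + v y. Proof. by []. Qed.
Lemma val00 : v 0 = 0. Proof. by []. Qed.
Lemma valM (x y : R) : v (x * y) = v x * v y. Proof. by []. Qed.
Lemma val01 : v 1 = 1. Proof. by []. Qed.
Lemma val_sign (n : nat) : v ((-1) ^+ n) = (-1) ^+ n.
Proof. by elim: n => [|n IH]; rewrite ?expr0 // !exprS valM IH. Qed.
Definition vmx m (P : 'M[R]_m) : 'M[U]_m := map_mx v P.
Lemma val_det m (P : 'M[R]_m) : \det (vmx P) = v (\det P).
Proof.
rewrite /determinant (big_morph v valD val00); apply: eq_bigr => s _.
rewrite valM val_sign (big_morph v valM val01); congr (_ * _); apply: eq_bigr => i _; by rewrite mxE.
Qed.
Lemma val_mulmx m (P Q : 'M[R]_m) : vmx (P *m Q) = vmx P *m vmx Q.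
Proof.
apply/matrixP => i j; rewrite !mxE (big_morph v valD val00); apply: eq_bigr => k _; by rewrite !mxE.
Qed.
Lemma val_ff b c : v (ff gq b c) = - (c *: qK U b) + qL U b.
Proof.
have [k0 l0 _ _ _] := gqgP_cartan gq.
have -> : v (ff gq b c) = qK U 0 * qL U b - c *: 1 * (qK U b * qL U 0) by [].
by rewrite k0 l0 mul1r mulr1 -scalerAl mul1r addrC.
Qed.
(** Evaluation at a point of the hyperplane kills U^0 f, so a nonzero value certifies that an
    element lies outside. *)
Lemma outside (f : U) (u g : R) (e : R -> K) : v g = f -> (forall z, e (z * g) = 0) -> e u != 0 -> U0_outside f (v u).
Proof.
move=> eg ez nu; split; first by apply/asboolP; exact: (r0P u).
move=> [z hz ezf]; have zin : z \in @U0p K I A U by apply/asboolP.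
case/eqP: nu; have -> : u = (MkR0 zin : R) * g by apply: val_inj; rewrite /= ezf -eg.
exact: ez.
Qed.
End Values.
Local Open Scope classical_set_scope.
Local Open Scope card_scope.
Local Open Scope ring_scope.

Theorem theorem8p6
  (K : closedFieldType) (R : realType) (V : vectType R)
  (I : finType) (I_nonempty : (0 < #|I|)%N)
  (pi : I -> V) (pi_basis : basis_of fullv (codom pi))
  (chi : rootLattice pi -> rootLattice pi -> K) (chi_bihom : bihom chi)
  (U : gqgData K I (rootLattice pi)) (U_gqg : is_gqg (sroot pi) chi U)
  (Rp : set (rootLattice pi)) (Rp_roots : is_posroots (sroot pi) chi U Rp)
  (rho : rootLattice pi -> K) (rho_hat : is_rhohat (sroot pi) chi rho)
  (Sh : {linear U -> U}) (Sh_proj : is_Sh (sroot pi) Sh)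
  (Rp_finite : finite_set Rp)
  (chi_neq1 : forall beta, Rp beta -> chi beta beta != 1)
  (lam : rootLattice pi) (lam_nonneg : nonneg (sroot pi) lam)
  (m : nat) (m_card : PP chi Rp lam #= `I_m) (m_neq0 : m != 0%N)
  (alpha : rootLattice pi) (alpha_root : Rp alpha)
  (t : nat) (t_gt0 : (0 < t)%N)
  (t_separated : exponent_separated chi Rp lam alpha t)
  (r : nat) (r_card : PPge chi Rp lam alpha t #= `I_r)
  (X Y : 'I_m -> U)
  (X_in : forall x, Upgr U lam (X x)) (Y_in : forall y, Umgr U (- lam) (Y y))
  (det_neq0 : \det (\matrix_(x < m, y < m) theta U (X x) (Y y)) != 0) :
  let f : U := - ((rho alpha * chi alpha alpha ^- t) *: qK U alpha)
               + qL U alpha in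
  let S : 'M[U]_m := \matrix_(x < m, y < m) Sh (X x * Y y) in
  exists (h : U) (P1 P2 : 'M[U]_m),
    [/\ U0_outside f h,
        U0_mx P1 /\ U0_mx P2,
        U0_outside f (\det P1) /\ U0_outside f (\det P2) &
        P1 *m S *m P2 =
          h *: (\sum_(x < m | (x < m - r)%N) delta_mx x x
                + f *: \sum_(y < m | (m - r <= y)%N) delta_mx y y)].
Proof.
move=> f S.
have [crd [crdD crdpi crdE]] := lattice_crd pi_basis.
have [rs [hH rsP]] := initial_hil crdD crdpi crdE chi_bihom U_gqg Rp_roots Rp_finite chi_neq1.
have B := g_borel crdD crdpi crdE chi_bihom U_gqg; have H := b_pb B.
have pos b : b \in rs -> 0 < hgt crd b.
  by move=> h; exact: (hgt_gt0 H (hil_cone hH h) (hil_nz hH h)).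
(* For the initial basis every root has positive height, so [positive_roots] yields multiplicity
   one, a functional of value one and singular vectors for all of them. *)
have pr b (br : b \in rs) :=
  positive_roots (hgtD H) B hH (fun b' b'r => lt0r_neq0 (pos b' b'r)) erefl br (pos b br).
have rsu : uniq rs.
  apply: count_mem_uniq => b; case br: (b \in rs); first by have [-> _ _] := pr b br.
  by apply/count_memPn; rewrite br.
have wS b : b \in rs -> exists2 w : rootLattice pi -> int, forall a c, w (a + c) = w a + w c & w b = 1.
  by move=> /pr[].
have hPS b s : b \in rs -> (0 < s)%N -> qfact (chi b b) s != 0 ->
    PS chi (qK U) (qL U) (sroot pi) (qE U) (qF U) b s.
  by move=> /pr[_ _ h]; exact: h.
have rhoP : is_rho chi (sroot pi) rho by case: rho_hat => r0 rD rj; split.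
have dimE l n : fdim (Gen (sroot pi) (qF U) l) n -> fdim (Gen (sroot pi) (qE U) l) n.
  move=> hn; have [nn|nn] := pselect (nonneg (sroot pi) l).
    have [_ [phi [_ hdim]]] := Rp_roots; have [k [/has_dim_fdim hk _]] := hdim l nn.
    have hE : fdim (Gen (sroot pi) (qE U) l) k by apply: fdim_eq hk => x; exact: (UpgrP U_gqg).
    by rewrite (fdim_uniq hn (Gen_theta chi_bihom U_gqg hE)).
  have [j hj] : exists j, crd j l < 0.
    apply: contrapT => ne; apply: nn; apply/(nonneg_crd crdD crdpi crdE) => j.
    by rewrite leNgt; apply/negP => lt; apply: ne; exists j.
  have z0 : fdim (Gen (sroot pi) (qF U) l) 0 by apply: fdim0 => x hx; exact: (Nm_out H hx hj).
  rewrite (fdim_uniq hn z0); apply: fdim0 => x hx; exact: (Nm_out (pborel_swap H) hx hj).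
pose L := @LL K I _ _ _ U crd crdD crdpi crdE chi_bihom U_gqg rs hH rsu lam.
have [u1 P1 d1] : [/\ uniq L, forall g, KF id (fun b s => qfact (chi b b) s != 0) rs lam g <-> g \in L &
    fdim (Gen (sroot pi) (qF U) lam) (size L)].
  exact: (@LLP K I _ _ _ U crd crdD crdpi crdE chi_bihom U_gqg rs hH rsu lam).
have PPL g : PP chi Rp lam g <-> g \in L.
  apply: (iff_trans _ (P1 g)); split=> [[h1 h2 h3 h4]|[h1 h2 h3]]; split.
  - by move=> b nb; apply: h1 => /rsP; rewrite (negbTE nb).
  - by move=> b /rsP; exact: h3.
  - rewrite -h4 (@fsbigE _ _ _ _ _ rs) // ?[RHS]big_mkcond /=.
    + by rewrite [LHS]big_seq [RHS]big_seq; apply: eq_bigr => b /rsP hb; rewrite mem_set.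
    + by move=> b; rewrite /= => /rsP.
    + by move=> b /rsP ->.
  - by move=> b nb; apply: h1; apply/negP => /rsP.
  - apply: (@sub_finite_set _ _ [set` rs]); last exact: finite_seq.
    by move=> b /= nz; apply: contraNT nz => nb; rewrite h1.
  - by move=> b /rsP; exact: h2.
  - rewrite -h3 (@fsbigE _ _ _ _ _ rs) // ?[LHS]big_mkcond /=.
    + by rewrite [LHS]big_seq [RHS]big_seq; apply: eq_bigr => b /rsP hb; rewrite mem_set.
    + by move=> b; rewrite /= => /rsP.
    + by move=> b /rsP ->.
have em : size L = m.
  by apply/card_eq_II; apply: (card_eq_trans _ m_card); rewrite card_eq_sym; exact: (card_eq_seq u1 PPL).
have er0 : count (fun g : rootLattice pi -> nat => t <= g alpha)%N L = r.
  rewrite -size_filter; apply/card_eq_II; apply: (card_eq_trans _ r_card); rewrite card_eq_sym.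
  apply: card_eq_seq; first exact: filter_uniq.
  move=> g; rewrite mem_filter; split=> [[/PPL gL tg]|/andP[tg /PPL gL]]; [by apply/andP | by split].
pose c0 := rho alpha * chi alpha alpha ^- t.
have rho0 : rho alpha != 0 by case: rho_hat.
have er : @rc K I _ _ _ U crd crdD crdpi crdE chi_bihom U_gqg rs hH rsu rho lam alpha c0 = r.
  rewrite /rc -er0; apply: eq_in_count => g gL; apply/hasP/idP => [[s]|tg].
    rewrite mem_iota => hs /eqP; rewrite /cc => /(mulfI rho0)/invr_inj es.
    (* An exponent s <= g(alpha) with the slope of [t] might differ from [t] at roots of unity; this
       is what [exponent_separated] excludes. *)
    have st : s = t; last by rewrite -st; lia.
    by apply: t_separated; [lia | exists g; split; [exact/PPL | rewrite /=; lia] | exact: esym].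
  by exists t; rewrite ?mem_iota //; lia.
have hX1 i : Gen (sroot pi) (qE U) lam (X i) := proj1 (UpgrP U_gqg lam (X i)) (X_in i).
have hY1 j : Gen (sroot pi) (qF U) lam (Y j) := proj1 (UmgrP U_gqg lam (Y j)) (Y_in j).
have uf y : Gen (sroot pi) (qF U) lam y -> Umflat y by move=> h; apply: (Umf U_gqg); exact: (Gen_subalg h).
have ue x : Gen (sroot pi) (qE U) lam x -> Upflat x by move=> h; apply: (Upf U_gqg); exact: (Gen_subalg h).
rewrite em in d1.
have bX : fbasis (Gen (sroot pi) (qE U) lam) X.
  apply: (free_fbasis hX1 (dimE _ _ d1)).
  apply: (pairing_free (Gen_subsp _ _ _) hX1 (phi := fun j x => theta U x (Y j))) => //.
  by move=> j c x y hx hy; apply: (th_linl U_gqg); [exact: uf | exact: ue | exact: ue].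
have dY : \det (\matrix_(i, j) theta U (X j) (Y i)) != 0.
  rewrite -det_tr (_ : _^T = \matrix_(x, y) theta U (X x) (Y y)) //.
  by apply/matrixP => i j; rewrite !mxE.
have bY : fbasis (Gen (sroot pi) (qF U) lam) Y.
  apply: (free_fbasis hY1 d1).
  apply: (pairing_free (Gen_subsp _ _ _) hY1 (phi := fun j y => theta U (X j) y)) => //.
  by move=> j c x y hx hy; apply: (th_linr U_gqg); [exact: ue | exact: uf | exact: uf].
have sm := @shapovalov_smith K I _ _ _ U crd crdD crdpi crdE chi_bihom U_gqg Sh Sh_proj rs hH rsu wS hPS rho rhoP dimE lam.
rewrite -/L em in sm.
have c00 : c0 != 0.
  by have [cn _ _] := chi_bihom; rewrite mulf_neq0 // invr_eq0 expf_neq0 // cn.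
have [Q1 [Q2 [h [y [hy n1 n2 n3 eq]]]]] := sm X Y alpha c0 bX bY (proj2 (rsP alpha) alpha_root) c00.
rewrite er in eq.
have out u : @evr K I _ _ _ U crd crdD crdpi crdE chi_bihom U_gqg y u != 0 -> U0_outside f (r0v u).
  apply: (@outside K I _ _ _ U U_gqg f u (ff U_gqg alpha c0)); first exact: val_ff.
  move=> z; rewrite rmorphM; apply/eqP; rewrite mulf_eq0; apply/orP; right; apply/eqP.
  exact/(onHP crdD crdpi crdE chi_bihom U_gqg).
exists (r0v h), (vmx Q1), (vmx Q2); split.
- exact: out.
- by split=> i j; rewrite mxE; apply/asboolP; exact: r0P.
- by rewrite !val_det; split; exact: out.
have -> : S = vmx (shm U_gqg Sh_proj X Y) by apply/matrixP => i j; rewrite !mxE.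
rewrite -!val_mulmx eq; apply/matrixP => i j.
have -> : vmx (h *: \matrix_(i, j) ((if (i < m - r)%N then 1 else ff U_gqg alpha c0) *+ (i == j))) i j =
    r0v h * r0v ((if (i < m - r)%N then 1 else ff U_gqg alpha c0) *+ (i == j)) by rewrite !mxE.
rewrite [RHS]mxE [X in _ = _ * X]mxE sum_delta_mx [X in _ + X]mxE sum_delta_mx; congr (_ * _).
have vf : r0v (ff U_gqg alpha c0) = f by exact: val_ff.
rewrite [(m - r <= i)%N]leqNgt; case: (i == j); case: (i < m - r)%N.
- by rewrite [RHS](_ : _ = 1 + f * 0) // mulr0 addr0.
- by rewrite [RHS](_ : _ = 0 + f * 1) // add0r mulr1.
- by rewrite [RHS](_ : _ = 0 + f * 0) // mulr0 addr0.
- by rewrite [RHS](_ : _ = 0 + f * 0) // mulr0 addr0.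
Qed.
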